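(* Let $T>0$. Assume that $\sigma$ is positive and bounded, $b$ is continuously differentiable, and $\gamma$ is positive and continuously differentiable. Let $u^{(1)},u^{(2)}\in L^\infty([0,T];BV(\mathbb{R}))$ be two pathwise entropy solutions to $$\mathrm{d}u=\big(-\mathfrak{B}(u)_x+\Sigma(u)_{xx}\big)\,\mathrm{d}t-G(u)_x\circ\mathrm{d}z\quad\text{on }[0,T]\times\mathbb{R}$$ with driving signals $z=z^{(1)},z^{(2)}\in C_0([0,T];\mathbb{R})$, respectively, and initial values $u^1_0,u^2_0\in BV(\mathbb{R})$, respectively. For $j=1,2$ let $m^{(j)}$ and $n^{(j)}$ denote the finite measures on $\mathbb{R}^2\times[0,T]$ corresponding to $u^{(j)}$ in part (c) of the definition of pathwise entropy solution, and let $q^{(j)}=m^{(j)}+n^{(j)}$. Then for all $0\le s\le t\le T$ there exists a constant $C<\infty$, which may depend on $\|u^{(1)}\|_{L^\infty([s,t];BV(\mathbb{R}))}$, $\|u^{(2)}\|_{L^\infty([s,t];BV(\mathbb{R}))}$, $q^{(1)}(\mathbb{R}^2\times[s,t])$ and $q^{(2)}(\mathbb{R}^2\times[s,t])$, such that $$\|u^{(1)}(t,\cdot)-u^{(2)}(t,\cdot)\|_{L^1(\mathbb{R})}\le\|u^{(1)}(s,\cdot)-u^{(2)}(s,\cdot)\|_{L^1(\mathbb{R})}+C\,\|z^{(1)}-z^{(2)}\|^{1/2}_{C([s,t];\mathbb{R})}+C\,\|z^{(1)}-z^{(2)}\|_{C([s,t];\mathbb{R})}.$$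
   Context: The coefficients are measurable functions $b:[0,1]\to\mathbb{R}$ and $\sigma,\gamma:[0,1]\to(0,\infty)$, and $$\mathfrak{B}(r)=\int_0^r b(a)\,\mathrm{d}a,\quad \Sigma(r)=\frac12\int_0^r\sigma^2(a)\,\mathrm{d}a,\quad G(r)=\int_0^r\gamma(a)\,\mathrm{d}a,\quad S(r)=\int_0^r\sigma(a)\,\mathrm{d}a.$$ (Convention: where values of $b,\gamma,\sigma$ at arguments outside $[0,1]$ appear, the coefficients are understood as fixed extensions to $\mathbb{R}$, the same for both solutions, with $b,\gamma$ bounded and continuously differentiable with bounded derivatives, $\gamma>0$, and $\sigma$ measurable, bounded and positive.) $BV(\mathbb{R})$ is the space of $L^\infty(\mathbb{R})$-functions of bounded total variation, and $\|f\|_{BV(\mathbb{R})}$ denotes the total variation of $f$. $C_0([0,T];\mathbb{R})$ is the set of continuous $z:[0,T]\to\mathbb{R}$ with $z_0=0$; $\|z\|_{C([s,t];\mathbb{R})}=\sup_{r\in[s,t]}|z_r|$. For $F:[0,T]\to\mathbb{R}$, $F|_s^t:=F(t)-F(s)$. Subscripts $x$ denote (distributional) derivatives in $x$; $\circ\,\mathrm{d}z$ formally denotes the Stratonovich differential. Define $\overline\chi:\mathbb{R}\times\mathbb{R}\to\mathbb{R}$ by $\overline\chi(\xi,u)=1$ if $0<\xi<u$, $\overline\chi(\xi,u)=-1$ if $u<\xi<0$, and $\overline\chi(\xi,u)=0$ otherwise. For $z\in C_0([0,T];\mathbb{R})$, $\varrho^0\in C^\infty_c(\mathbb{R}^2)$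 and $(\eta,y)\in\mathbb{R}^2$, define the test function $$\varrho(\xi,t,x;\eta,y)=\varrho^0\big(x-y-b(\xi)t-\gamma(\xi)z_t,\ \xi-\eta\big).$$ Definition (pathwise entropy solution). Let $u^0\in L^\infty(\mathbb{R})$ and $z\in C_0([0,T];\mathbb{R})$. A function $u\in L^\infty([0,T]\times\mathbb{R})$ satisfying $\int_{\mathbb{R}}|u(s,x)-u(t,x)|\,\mathrm{d}x<\infty$ for all $0\le s\le t\le T$ and $\lim_{s\to t}\int_{\mathbb{R}}|u(s,x)-u(t,x)|\,\mathrm{d}x=0$ for all $t\in[0,T]$ is a pathwise entropy solution to $\mathrm{d}u=(-\mathfrak{B}(u)_x+\Sigma(u)_{xx})\,\mathrm{d}t-G(u)_x\circ\mathrm{d}z$ with respect to $z$ and with initial condition $u^0$ if $u(0,\cdot)=u^0$ and: (a) $S(u)_x\in L^2([0,T]\times\mathbb{R})$. (b) For all test functions $\varrho$ of the form $\varrho(\xi,t,x;\eta,y)=\varrho^0\big(x-y-b(\xi)t-\gamma(\xi)z_t,\ \xi-\eta\big)$ with $\varrho^0\in C^\infty_c(\mathbb{R}^2)$ and all $(\eta,y)\in\mathbb{R}^2$, $$\int_{\mathbb{R}^2}\overline\chi(\xi,u(t,x))\,\sigma(\xi)\,\varrho_x(\xi,t,x;\eta,y)\,\mathrm{d}x\,\mathrm{d}\xi=-\int_{\mathbb{R}}S(u(t,x))_x\,\varrho(u(t,x),t,x;\eta,y)\,\mathrm{d}x$$ holds for a.e. $t\in[0,T]$. (c) There exists a non-negative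 finite measure $m$ on $\mathbb{R}^2\times[0,T]$ such that for all test functions $\varrho$ of the form $\varrho(\xi,t,x;\eta,y)=\varrho^0\big(x-y-b(\xi)t-\gamma(\xi)z_t,\ \xi-\eta\big)$ with $\varrho^0\in C^\infty_c(\mathbb{R}^2)$, all $(\eta,y)\in\mathbb{R}^2$ and all $0\le s\le t\le T$, $$-\int_{\mathbb{R}^2}\overline\chi(\xi,u(\cdot,x))\,\varrho(\xi,\cdot,x;\eta,y)\,\mathrm{d}\xi\,\mathrm{d}x\Big|_s^t+\frac12\int_s^t\int_{\mathbb{R}^2}\overline\chi(\xi,u(r,x))\,\sigma^2(\xi)\,\varrho_{xx}(\xi,r,x;\eta,y)\,\mathrm{d}\xi\,\mathrm{d}x\,\mathrm{d}r=\int_s^t\int_{\mathbb{R}^2}\partial_\xi\varrho(\xi,r,x;\eta,y)\,(m+n)(\mathrm{d}x,\mathrm{d}\xi,\mathrm{d}r),$$ where $n$ is the non-negative finite measure on $\mathbb{R}^2\times[0,T]$ given by $n(\mathrm{d}x,\mathrm{d}\xi,\mathrm{d}t)=\frac12\big(S(u(t,x))_x\big)^2\,\delta_{u(t,x)}(\mathrm{d}\xi)\,\mathrm{d}x\,\mathrm{d}t$. *)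

(* Defs.v *)
From HB Require Import structures.
From mathcomp Require Import all_boot all_order all_algebra.
From mathcomp Require Import all_classical all_reals all_analysis.

Set Implicit Arguments.
Unset Strict Implicit.
Unset Printing Implicit Defensive.

Import Order.TTheory GRing.Theory Num.Theory.
Import numFieldNormedType.Exports.

Local Open Scope ring_scope.
Local Open Scope classical_set_scope.

Section coefficients_and_signals.
Context {R : realType}.
Implicit Types (T : R) (f z : R -> R).

Local Notation leb := (@lebesgue_measure R).

(* The coefficients b, sigma, gamma live on the whole line: they are fixed
   extensions of the coefficients on [0, 1], with b and gamma bounded_C1. *)
Definition bounded_C1 f : Prop :=
  [/\ forall x, derivable f x 1, continuous (derive1 f), bounded_fun f
    & bounded_fun (derive1 f)].

(* Oriented integral: \int[mu]_(x in `[a, b]) is 0 when b < a. *)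
Definition primitive f (r : R) : R :=
  if 0 <= r then \int[leb]_(a in `[0, r]) f a
  else - \int[leb]_(a in `[r, 0]) f a.

Definition C0 T z : Prop := z 0 = 0 /\ {within `[0, T], continuous z}.

Definition sup_norm_on (s t : R) z : R := sup [set `|z r| | r in `[s, t]].

End coefficients_and_signals.

Section function_spaces.
Context {R : realType}.
Implicit Types (T : R) (f g : R -> R) (u v : R -> R -> R) (phi : R * R -> R).

Local Notation leb := (@lebesgue_measure R).
Local Notation leb2 := (leb \x leb)%E.

Definition Linfty f : Prop :=
  measurable_fun setT f /\ ('N[leb]_+oo[EFin \o f] < +oo)%E.

Definition pointwise_TV g : \bar R :=
  ereal_sup [set total_variation ab.1 ab.2 g | ab in [set ab | ab.1 <= ab.2]].

(* Total variation of the Lebesgue class of f: the least pointwise total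
   variation of a representative. *)
Definition TV f : \bar R :=
  ereal_inf [set pointwise_TV g | g in [set g | ae_eq leb setT f g]].

Definition BV f : Prop := Linfty f /\ (TV f < +oo)%E.

Definition strip T : set (R * R) := `[0, T] `*` [set: R].

Lemma measurable_strip T : measurable (strip T).
Proof. by apply: measurableX => //; exact: measurable_itv. Qed.

(* Functions u of (t, x) are curried, so that u t is the profile at time t. *)
Definition Lp_strip (p : \bar R) T u : Prop :=
  measurable_fun (strip T) (fun q : R * R => u q.1 q.2) /\
  ('N[mrestr leb2 (measurable_strip T)]_p
     [(fun q : R * R => (u q.1 q.2)%:E)] < +oo)%E.

Definition LinftyBV_norm (s t : R) u : \bar R :=
  'N[mrestr leb (measurable_itv `[s, t]%R)]_+oo[(fun r => TV (u r))].

Definition LinftyBV T u : Prop :=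
  [/\ Lp_strip +oo T u,
      {ae leb, forall r, r \in `[0, T]%R -> BV (u r)}
    & (LinftyBV_norm 0 T u < +oo)%E].

Definition d1 phi : R * R -> R :=
  fun p => derive1 (fun a => phi (a, p.2)) p.1.

Definition d2 phi : R * R -> R :=
  fun p => derive1 (fun a => phi (p.1, a)) p.2.

Fixpoint Ck (k : nat) phi : Prop :=
  if k is k'.+1 then
    [/\ continuous phi,
        forall p, derivable (fun a => phi (a, p.2)) p.1 1,
        forall p, derivable (fun a => phi (p.1, a)) p.2 1,
        Ck k' (d1 phi) & Ck k' (d2 phi)]
  else continuous phi.

Definition supp phi : set (R * R) := closure [set p | phi p != 0].

Definition Cc_infty phi : Prop := (forall k, Ck k phi) /\ compact (supp phi).

(* v is the distributional x-derivative of w on ]0, T[ x R; the first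
   coordinate is time. *)
Definition weak_dx T (w v : R -> R -> R) : Prop :=
  forall phi, Cc_infty phi -> supp phi `<=` `]0, T[ `*` [set: R] ->
    \int[leb2]_(p in strip T) (w p.1 p.2 * d2 phi p) =
    - \int[leb2]_(p in strip T) (v p.1 p.2 * phi p).

End function_spaces.

Section pathwise_entropy_solutions.
Context {R : realType}.
Variables (T : R) (b sigma gamma : R -> R).
Implicit Types (z : R -> R) (u v : R -> R -> R).
Implicit Types (m n : {finite_measure set (R * R * R)%type -> \bar R}).

Local Notation leb := (@lebesgue_measure R).
Local Notation leb2 := (leb \x leb)%E.

Definition chi (xi w : R) : R :=
  if 0 < xi < w then 1 else if w < xi < 0 then - 1 else 0.

Definition test z (rho0 : R * R -> R) (xi t x eta y : R) : R :=
  rho0 (x - y - b xi * t - gamma xi * z t, xi - eta).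

Definition test_x z (rho0 : R * R -> R) (xi t x eta y : R) : R :=
  derive1 (fun x' => test z rho0 xi t x' eta y) x.

Definition test_xx z (rho0 : R * R -> R) (xi t x eta y : R) : R :=
  derive1n 2 (fun x' => test z rho0 xi t x' eta y) x.

Definition test_xi z (rho0 : R * R -> R) (xi t x eta y : R) : R :=
  derive1 (fun xi' => test z rho0 xi' t x eta y) xi.

Definition S_of u : R -> R -> R := fun t x => primitive sigma (u t x).

(* v is S(u)_x and belongs to L^2([0, T] x R). *)
Definition is_S_x u v : Prop := Lp_strip 2%:E T v /\ weak_dx T (S_of u) v.

(* In the integrals over R^2 below, p = (x, xi). *)
Definition chain_rule z u v : Prop :=
  forall rho0, Cc_infty rho0 -> forall eta y : R,
  {ae leb, forall t, t \in `[0, T]%R ->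
    \int[leb2]_p (chi p.2 (u t p.1) * sigma p.2
                  * test_x z rho0 p.2 t p.1 eta y) =
    - \int[leb]_x (v t x * test z rho0 (u t x) t x eta y)}.

(* Measures on R^2 x [0, T] are measures on triples ((x, xi), t) that do not
   charge the times outside [0, T]. *)
Definition carried_by_times m : Prop :=
  m (~` ([set: R * R] `*` `[0, T])) = 0%E.

(* n(dx, dxi, dt) = (1/2) (S(u)_x)^2 delta_{u(t,x)}(dxi) dx dt, with
   v = S(u)_x and p = (t, x). *)
Definition parabolic_measure u v n : Prop :=
  forall A : set (R * R * R), measurable A ->
    n A = (\int[leb2]_(p in strip T)
            ((2^-1 * v p.1 p.2 ^+ 2)%:E *
             \d_(u p.1 p.2) [set xi | A (p.2, xi, p.1)]))%E.

Definition kinetic_formulation z u m n : Prop :=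
  forall rho0, Cc_infty rho0 -> forall eta y s t : R,
  0 <= s -> s <= t -> t <= T ->
  let F r := \int[leb2]_p (chi p.2 (u r p.1) * test z rho0 p.2 r p.1 eta y) in
  - (F t - F s)
  + 2^-1 * \int[leb]_(r in `[s, t]) \int[leb2]_p
             (chi p.2 (u r p.1) * sigma p.2 ^+ 2
              * test_xx z rho0 p.2 r p.1 eta y)
  = \int[measure_add m n]_(q in [set: R * R] `*` `[s, t])
      test_xi z rho0 q.1.2 q.2 q.1.1 eta y.

(* Here v stands for S(u)_x; m and n are the entropy and parabolic defect
   measures. *)
Definition entropy_measures z u v m n : Prop :=
  [/\ carried_by_times m, parabolic_measure u v n
    & kinetic_formulation z u m n].

Definition L1_continuous u : Prop :=
  let dist s t := (\int[leb]_x `|u s x - u t x|%:E)%E in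
  (forall s t, 0 <= s -> s <= t -> t <= T -> (dist s t < +oo)%E) /\
  (forall t, t \in `[0, T]%R ->
     dist s t @[s --> within `[0, T] (nbhs t)] --> 0%E).

(* The equation du = (- B(u)_x + Sigma(u)_xx) dt - G(u)_x o dz is formal; its
   solutions only involve b = B', sigma^2 / 2 = Sigma', gamma = G' and S. *)
Definition pathwise_entropy_solution z (u0 : R -> R) u : Prop :=
  [/\ Linfty u0 /\ C0 T z,
      Lp_strip +oo T u,
      L1_continuous u,
      ae_eq leb setT (u 0) u0
    & exists v, [/\ is_S_x u v, chain_rule z u v
        & exists m n, entropy_measures z u v m n]].

End pathwise_entropy_solutions.

(* Main.v *)
Require Import Defs.
From HB Require Import structures.
From mathcomp Require Import all_boot all_order all_algebra.
From mathcomp Require Import all_classical all_reals all_analysis.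
From mathcomp Require Import measurable_realfun ftc ess_sup_inf.
From mathcomp Require Import ring lra.

Set Implicit Arguments.
Unset Strict Implicit.
Unset Printing Implicit Defensive.

Import Order.TTheory GRing.Theory Num.Theory.
Import numFieldNormedType.Exports.

Local Open Scope ring_scope.
Local Open Scope classical_set_scope.

(** The proof is a doubling of the kinetic variable. For a solution [u], let
    [psi xi (u r x) = sg (xi - u r x)]; up to a function of [xi] alone this is
    [-2] times the kinetic function. Along the characteristics
    [f r xi = b xi * r + gamma xi * z r] it solves a linear equation whose
    right-hand side is the [xi]-derivative of the defect measure [q = m + n]
    plus a parabolic term, and for two values [a], [a'] the integral of
    [1 - psi xi a * psi xi a'] over [xi] is [2 * `|a - a'|]. So the evolution of the [L^1]
    distance of two solutions is that of the integral of a product of kinetic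
    functions.

    Each [psi] is mollified at scale [eps] in space, along its own
    characteristics, and at scale [del] in [xi] (definition [Gc]). The mollified
    functions are continuous in time and of finite variation, so their product
    obeys the ordinary product rule ([product_rule]). Three groups of terms
    arise. In the defect terms, an integration by parts in the mollification
    parameters ([pairing_ge]) turns the [xi]-derivative of one test function
    into a nonnegative mass carried by the graph of the other solution, up to
    the difference of the speeds [f'] of the two families of characteristics.
    The parabolic terms give a quadratic form in [sigma ^+ 2] and [1]
    ([parabolic_part]). By the chain rule and Young's inequality, the cross
    term with weights [sigma] and [sigma] is dominated by that nonnegative mass,
    as [q] dominates the parabolic measure ([dissipation_part]). This is
    [mollified_comparison].

    When [del] tends to 0 at fixed [eps], all quadratic parabolic terms have the
    same limit, because [sigma ^+ 2 * 1 = sigma * sigma], and they cancel: at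
    almost every level one is at a Lebesgue point of [sigma] and of its square,
    so bounded measurable [sigma] is enough ([parabolic_cvg],
    [limit_comparison]). What remains is the speed difference, of order
    [dz / eps], where [dz] is the distance of the signals.

    At the end times the mollified functions must be compared with [psi] itself.
    A function of bounded variation oscillates by at most a multiple of
    [H * TV u] in [L^1] under shifts of size [H], even if the shift depends on
    the level ([osc_bound], [osc_bound_TV]), and the two characteristics differ
    by [O(dz)]; hence an error [O(eps + dz)] ([endpoint]). The total error
    [O(eps + dz + dz / eps)] is optimal at [eps = sqrt dz] ([best_scale]).

    The chain rule and the measures in the definition of a solution are those of
    some derivative and some pair of measures; the constant depends on them only
    through the total mass of the defect, which the solution determines
    ([total_mass_unique]). *)

Local Notation L1 mu f := (mu.-integrable setT (EFin \o f)).

(** * Iterated Lebesgue integrals of real-valued functions *)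

(** Compositions of curried functions, in the form that the tactic [meas] below
    recognizes. *)
Lemma measurable_comp2 d1 d2 d3 d4 (X : measurableType d1)
    (Y : measurableType d2) (Z : measurableType d3) (V : measurableType d4)
    (f : Y -> Z -> V) (a : X -> Y) (b : X -> Z) :
  measurable_fun setT (fun p : Y * Z => f p.1 p.2) ->
  measurable_fun setT a -> measurable_fun setT b ->
  measurable_fun setT (fun x => f (a x) (b x)).
Proof.
move=> mf ma mb; apply: (measurableT_comp mf (_ : measurable_fun setT (fun x => (a x, b x)))).
exact: measurable_fun_pair.
Qed.

Lemma measurable_comp3 d1 d2 d3 d4 d5 (X : measurableType d1)
    (Y : measurableType d2) (Z : measurableType d3) (U : measurableType d4)
    (V : measurableType d5) (f : Y -> Z -> U -> V) (a : X -> Y) (b : X -> Z) (c : X -> U) :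
  measurable_fun setT (fun p : Y * Z * U => f p.1.1 p.1.2 p.2) ->
  measurable_fun setT a -> measurable_fun setT b -> measurable_fun setT c ->
  measurable_fun setT (fun x => f (a x) (b x) (c x)).
Proof.
move=> mf ma mb mc.
apply: (measurableT_comp mf (_ : measurable_fun setT (fun x => (a x, b x, c x)))).
by apply: measurable_fun_pair => //; exact: measurable_fun_pair.
Qed.

Lemma measurable_sgr (R : realType) : measurable_fun setT (fun x : R => Num.sg x).
Proof.
apply: nondecreasing_measurable => // x y xy.
case: (sgrP x) => [x0|x0|x0]; case: (sgrP y) => [y0|y0|y0]; lra.
Qed.

Section slices.
Context d d' d'' (X : measurableType d) (Y : measurableType d')
  (Z : measurableType d'').
Implicit Types f : X -> Y -> Z.

Lemma measurable_slice f x : measurable_fun setT (fun p : X * Y => f p.1 p.2) ->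
  measurable_fun setT (f x).
Proof.
move=> mf; apply: (measurableT_comp mf (_ : measurable_fun setT (fun y => (x, y)))).
exact: measurable_fun_pair.
Qed.

Lemma measurable_sliceC f y : measurable_fun setT (fun p : X * Y => f p.1 p.2) ->
  measurable_fun setT (f ^~ y).
Proof.
move=> mf; apply: (measurableT_comp mf (_ : measurable_fun setT (fun x => (x, y)))).
exact: measurable_fun_pair.
Qed.

Lemma measurable_swap f : measurable_fun setT (fun p : X * Y => f p.1 p.2) ->
  measurable_fun setT (fun p : Y * X => f p.2 p.1).
Proof.
move=> mf.
apply: (measurableT_comp mf (_ : measurable_fun setT (fun p : Y * X => (p.2, p.1)))).
exact: measurable_fun_pair.
Qed.

End slices.

(** Structural measurability: variables, arithmetic, and compositions with
    functions whose measurability is a hypothesis. *)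
Ltac meas1 :=
  match goal with
  | |- measurable_fun _ (fun x => x) => exact: measurable_id
  | |- measurable_fun _ (fun x => ?c) => exact: measurable_cst
  | |- measurable_fun _ _ => assumption
  | |- measurable_fun _ (fun x => (_, _)) => apply: measurable_fun_pair
  | |- measurable_fun _ (fun x => x.1) => exact: measurable_fst
  | |- measurable_fun _ (fun x => x.2) => exact: measurable_snd
  | |- measurable_fun _ (fun x => (@?a x).1) =>
      apply: (measurableT_comp measurable_fst)
  | |- measurable_fun _ (fun x => (@?a x).2) =>
      apply: (measurableT_comp measurable_snd)
  | |- measurable_fun _ (fun x => (@?a x + @?b x)%R) => apply: measurable_funD
  | |- measurable_fun _ (fun x => (- @?a x)%R) => apply: measurable_funN
  | |- measurable_fun _ (fun x => (@?a x * @?b x)%R) => apply: measurable_funM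
  | |- measurable_fun _ (fun x => (`| @?a x |)%R) =>
      apply: (measurableT_comp (@normr_measurable _ setT))
  | |- measurable_fun _ (fun x => Num.sg (@?a x)) =>
      apply: (measurableT_comp (@measurable_sgr _))
  | |- measurable_fun _ (fun x => (@?a x ^+ ?n)%R) => apply: measurable_funX
  | |- measurable_fun _ (fun x => (@?a x)%:E) => apply/measurable_EFinP
  | H : measurable_fun setT ?f |- measurable_fun _ (fun x => ?f (@?a x)) =>
      apply: (measurableT_comp H)
  | H : measurable_fun setT (fun p => ?f p.1 p.2)
      |- measurable_fun _ (fun x => ?f (@?a x) (@?b x)) =>
      apply: (measurable_comp2 H)
  | H : measurable_fun setT (fun p => ?f p.1.1 p.1.2 p.2)
      |- measurable_fun _ (fun x => ?f (@?a x) (@?b x) (@?c x)) =>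
      apply: (measurable_comp3 H)
  | H : measurable_fun setT (fun p => ?f p.1 p.2)
      |- measurable_fun _ (?f ?c) => apply: (measurable_slice _ H)
  end.
Ltac meas := repeat meas1.

Section toolkit.
Context {R : realType} d (X : measurableType d).
Variable mu : {measure set X -> \bar R}.
Implicit Types f g : X -> R.

Lemma ae_imp (P Q : X -> Prop) : (forall x, P x -> Q x) ->
  {ae mu, forall x, P x} -> {ae mu, forall x, Q x}.
Proof. by move=> PQ; apply: filterS. Qed.

Lemma ae_and (P Q : X -> Prop) : {ae mu, forall x, P x} ->
  {ae mu, forall x, Q x} -> {ae mu, forall x, P x /\ Q x}.
Proof. by move=> h1 h2; apply: filterS2 h1 h2 => x. Qed.

Lemma ae_all (P : X -> Prop) : (forall x, P x) -> {ae mu, forall x, P x}.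
Proof. by move=> h; exact: aeW. Qed.

Lemma ge0_integralrZl (k : R) f : 0 <= k -> measurable_fun setT f ->
  (forall x, 0 <= f x) ->
  (\int[mu]_x (k * f x)%:E = k%:E * \int[mu]_x (f x)%:E)%E.
Proof.
move=> k0 mf f0; under eq_integral do rewrite EFinM.
by rewrite ge0_integralZl//; [exact/measurable_EFinP|move=> x _; rewrite lee_fin].
Qed.

Lemma le_integralT (f g : X -> \bar R) :
  measurable_fun setT f -> measurable_fun setT g ->
  (forall x, 0 <= f x)%E -> (forall x, f x <= g x)%E ->
  (\int[mu]_x f x <= \int[mu]_x g x)%E.
Proof.
by move=> mf mg f0 fg; apply: ge0_le_integral.
Qed.

Lemma ae_le_integralT (f g : X -> \bar R) :
  measurable_fun setT f -> measurable_fun setT g ->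
  (forall x, 0 <= f x)%E -> (forall x, 0 <= g x)%E ->
  {ae mu, forall x, f x <= g x}%E -> (\int[mu]_x f x <= \int[mu]_x g x)%E.
Proof.
move=> mf mg f0 g0 fg; apply: ae_ge0_le_integral => //.
by apply: filterS fg.
Qed.

Lemma L1P f : measurable_fun setT f ->
  (\int[mu]_x `|f x|%:E < +oo)%E -> L1 mu f.
Proof. by move=> mf fi; apply/integrableP; split => //; apply/measurable_EFinP. Qed.

Lemma L1_measurable f : L1 mu f -> measurable_fun setT f.
Proof. by move/integrableP => -[/measurable_EFinP]. Qed.

Lemma L1_lty f : L1 mu f -> (\int[mu]_x `|f x|%:E < +oo)%E.
Proof. by move/integrableP => -[]. Qed.

Lemma L1_le f g : measurable_fun setT f -> (forall x, `|f x| <= g x) ->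
  L1 mu g -> L1 mu f.
Proof.
move=> mf fg ig; apply: (le_integrable measurableT) ig => //.
- exact/measurable_EFinP.
- by move=> x _ /=; rewrite lee_fin (le_trans (fg x))// ler_norm.
Qed.

Lemma L1_norm f : L1 mu f -> L1 mu (fun x => `|f x|).
Proof. by move=> h; have := integrable_abse h. Qed.

Lemma RintE f : L1 mu f -> (\int[mu]_x f x)%:E = (\int[mu]_x (f x)%:E)%E.
Proof. by move=> h; rewrite /Rintegral fineK//; exact: integrable_fin_num. Qed.

Lemma normr_Rint_le f : measurable_fun setT f ->
  (`|\int[mu]_x f x|%:E <= \int[mu]_x `|f x|%:E)%E.
Proof.
move=> mf; have mf' : measurable_fun setT (EFin \o f) by exact/measurable_EFinP.
apply: le_trans (le_abse_integral mu measurableT mf') => /=.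
by rewrite /Rintegral; case: (\int[mu]_x (f x)%:E)%E => [r||] //=; rewrite normr0 leey.
Qed.

Lemma eq_Rint f g : (forall x, f x = g x) -> \int[mu]_x f x = \int[mu]_x g x.
Proof. by move=> fg; apply: eq_Rintegral => x _; exact: fg. Qed.

Lemma ae_eq_Rint f g : measurable_fun setT f -> measurable_fun setT g ->
  {ae mu, forall x, f x = g x} -> \int[mu]_x f x = \int[mu]_x g x.
Proof.
move=> mf mg fg; congr fine; apply: ae_eq_integral => //.
- exact/measurable_EFinP.
- exact/measurable_EFinP.
- by apply: filterS fg => x /= ->.
Qed.

Lemma Rint_ge0 f : (forall x, 0 <= f x) -> 0 <= \int[mu]_x f x.
Proof. by move=> f0; apply: Rintegral_ge0 => x _; exact: f0. Qed.

Lemma RintD f g : L1 mu f -> L1 mu g ->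
  \int[mu]_x (f x + g x) = \int[mu]_x f x + \int[mu]_x g x.
Proof. exact: RintegralD. Qed.

Lemma RintB f g : L1 mu f -> L1 mu g ->
  \int[mu]_x (f x - g x) = \int[mu]_x f x - \int[mu]_x g x.
Proof. exact: RintegralB. Qed.

Lemma L1D f g : L1 mu f -> L1 mu g -> L1 mu (fun x => f x + g x).
Proof. by move=> h1 h2; have := integrableD measurableT h1 h2. Qed.

Lemma L1B f g : L1 mu f -> L1 mu g -> L1 mu (fun x => f x - g x).
Proof. by move=> h1 h2; have := integrableB measurableT h1 h2. Qed.

Lemma L1Zl c f : L1 mu f -> L1 mu (fun x => c * f x).
Proof. by move=> h; have := integrableZl measurableT c h. Qed.

(** Scalars leave the integral even when it diverges: both sides are then 0. *)
Lemma RintZl c f : measurable_fun setT f ->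
  \int[mu]_x (c * f x) = c * \int[mu]_x f x.
Proof.
move=> mf; have [fi|fi] := pselect (L1 mu f).
  exact: RintegralZl.
have [->|c0] := eqVneq c 0.
  rewrite mul0r; under eq_Rint do rewrite mul0r.
  by rewrite Rintegral_cst// mul0r.
have H0 g : measurable_fun setT g -> ~ L1 mu g -> \int[mu]_x g x = 0.
  move=> mg ng; rewrite /Rintegral; case E: (\int[mu]_x (g x)%:E)%E => [r||]//=.
  exfalso; apply: ng; apply: L1P => //.
  have mg' : measurable_fun setT (EFin \o g) by exact/measurable_EFinP.
  by apply/(abse_integralP mu measurableT mg'); rewrite /= E /= ltry.
rewrite (H0 f)// mulr0 H0//; first exact: measurable_funM.
move=> h; apply: fi; have := L1Zl c^-1 h.
rewrite (_ : (fun x => c^-1 * (c * f x)) = f)//.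
by apply/funext => x; rewrite mulrA mulVf// mul1r.
Qed.

Lemma RintN f : measurable_fun setT f -> \int[mu]_x (- f x) = - \int[mu]_x f x.
Proof.
by move=> mf; rewrite -mulN1r -RintZl//; apply: eq_Rint => x; rewrite mulN1r.
Qed.

Lemma le_Rint f g : L1 mu f -> L1 mu g -> (forall x, f x <= g x) ->
  \int[mu]_x f x <= \int[mu]_x g x.
Proof. by move=> h1 h2 fg; apply: le_Rintegral => // x _; exact: fg. Qed.

Lemma ae_Rint_dominated (f_ : nat -> X -> R) f g :
  (forall n, measurable_fun setT (f_ n)) -> measurable_fun setT f ->
  {ae mu, forall x, f_ n x @[n --> \oo] --> f x} -> L1 mu g ->
  {ae mu, forall x, forall n, `|f_ n x| <= g x} ->
  \int[mu]_x f_ n x @[n --> \oo] --> \int[mu]_x f x.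
Proof.
move=> mf_ mf ff gi fg.
have [||||| h1 _ h2] := @dominated_convergence _ _ _ mu setT measurableT
  (fun n => EFin \o f_ n) (EFin \o f) (EFin \o g).
- by move=> n; exact/measurable_EFinP.
- exact/measurable_EFinP.
- by apply: filterS ff => x fx _; apply: cvg_EFin => //; exact: nearW.
- exact: gi.
- by apply: filterS fg => x h n _; rewrite /= lee_fin.
apply: fine_cvg; rewrite fineK//; exact: integrable_fin_num.
Qed.

Lemma Rint_dominated (f_ : nat -> X -> R) f g :
  (forall n, measurable_fun setT (f_ n)) -> measurable_fun setT f ->
  {ae mu, forall x, f_ n x @[n --> \oo] --> f x} -> L1 mu g ->
  (forall n x, `|f_ n x| <= g x) ->
  \int[mu]_x f_ n x @[n --> \oo] --> \int[mu]_x f x.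
Proof. by move=> mf_ mf ff gi fg; apply: ae_Rint_dominated mf_ mf ff gi (ae_all _) => x n. Qed.

End toolkit.

Section fubini.
Context {R : realType} d d' (X : measurableType d) (Y : measurableType d').
Variable nu : {sigma_finite_measure set Y -> \bar R}.
Implicit Types f : X -> Y -> R.

Lemma measurable_integral f :
  measurable_fun setT (fun p : X * Y => f p.1 p.2) ->
  (forall x y, 0 <= f x y) ->
  measurable_fun setT (fun x => \int[nu]_y (f x y)%:E)%E.
Proof.
move=> mf f0.
have := @measurable_fun_fubini_tonelli_F _ _ X Y R nu (fun p => (f p.1 p.2)%:E).
by rewrite /fubini_F; apply => [|p]; [exact/measurable_EFinP|rewrite lee_fin].
Qed.

Lemma measurable_Rint f :
  measurable_fun setT (fun p : X * Y => f p.1 p.2) ->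
  measurable_fun setT (fun x => \int[nu]_y f x y).
Proof.
move=> mf; apply: (measurableT_comp (@fine_measurable R setT measurableT)).
under eq_fun do rewrite integralE.
apply: emeasurable_funB.
- have mp : measurable_fun setT ((fun p : X * Y => (f p.1 p.2)%:E)^\+)%E.
    by apply: measurable_funepos; exact/measurable_EFinP.
  have := measurable_fun_fubini_tonelli_F (m2 := nu) _ mp (funepos_ge0 _).
  rewrite /fubini_F; apply: eq_measurable_fun => x _.
  by apply: eq_integral => y _; rewrite !funeposE.
- have mp : measurable_fun setT ((fun p : X * Y => (f p.1 p.2)%:E)^\-)%E.
    by apply: measurable_funeneg; exact/measurable_EFinP.
  have := measurable_fun_fubini_tonelli_F (m2 := nu) _ mp (funeneg_ge0 _).
  rewrite /fubini_F; apply: eq_measurable_fun => x _.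
  by apply: eq_integral => y _; rewrite !funenegE.
Qed.

Variable mu : {sigma_finite_measure set X -> \bar R}.

Lemma tonelliE (f : X -> Y -> \bar R) :
  measurable_fun setT (fun p : X * Y => f p.1 p.2) ->
  (forall x y, 0 <= f x y)%E ->
  (\int[mu]_x \int[nu]_y f x y = \int[nu]_y \int[mu]_x f x y)%E.
Proof.
move=> mf f0; have := @fubini_tonelli _ _ X Y R mu nu (fun p => f p.1 p.2).
by apply => [|p].
Qed.

Lemma tonelli f : measurable_fun setT (fun p : X * Y => f p.1 p.2) ->
  (forall x y, 0 <= f x y) ->
  (\int[mu]_x \int[nu]_y (f x y)%:E = \int[nu]_y \int[mu]_x (f x y)%:E)%E.
Proof.
move=> mf f0.
have := @fubini_tonelli _ _ X Y R mu nu (fun p => (f p.1 p.2)%:E).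
by apply => [|p]; [exact/measurable_EFinP|rewrite lee_fin].
Qed.

Lemma L1_prod f : measurable_fun setT (fun p : X * Y => f p.1 p.2) ->
  (\int[mu]_x \int[nu]_y `|f x y|%:E < +oo)%E ->
  (mu \x nu)%E.-integrable setT (EFin \o (fun p => f p.1 p.2)).
Proof. by move=> mf h; apply/integrable12ltyP => //; exact/measurable_EFinP. Qed.

Lemma ae_L1 f : measurable_fun setT (fun p : X * Y => f p.1 p.2) ->
  (\int[mu]_x \int[nu]_y `|f x y|%:E < +oo)%E ->
  {ae mu, forall x, L1 nu (f x)}.
Proof. by move=> mf h; have := ae_integrable1 (L1_prod mf h). Qed.

Lemma L1_Rint f : measurable_fun setT (fun p : X * Y => f p.1 p.2) ->
  (\int[mu]_x \int[nu]_y `|f x y|%:E < +oo)%E ->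
  L1 mu (fun x => \int[nu]_y f x y).
Proof.
move=> mf h; apply: L1P; first exact: measurable_Rint.
apply: le_lt_trans h; apply: le_integralT => //.
- by apply/measurable_EFinP; apply: measurableT_comp => //; exact: measurable_Rint.
- apply: measurable_integral => //.
  exact: (measurableT_comp (@normr_measurable _ setT)).
- by move=> x; apply: normr_Rint_le; exact: measurable_slice.
Qed.

End fubini.

Lemma ge0_integral2rZl {R : realType} d d' (X : measurableType d)
    (Y : measurableType d') (mu : {measure set X -> \bar R})
    (nu : {sigma_finite_measure set Y -> \bar R}) (k : R) (f : X -> Y -> R) :
  0 <= k -> measurable_fun setT (fun p : X * Y => f p.1 p.2) ->
  (forall x y, 0 <= f x y) ->
  (\int[mu]_x \int[nu]_y (k * f x y)%:E =
   k%:E * \int[mu]_x \int[nu]_y (f x y)%:E)%E.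
Proof.
move=> k0 mf f0.
transitivity (\int[mu]_x (k%:E * \int[nu]_y (f x y)%:E))%E.
  apply: eq_integral => x _; apply: ge0_integralrZl => //.
  exact: measurable_slice.
have m1 := measurable_integral nu mf f0.
have p1 x : [set: X] x -> (0 <= \int[nu]_y (f x y)%:E)%E.
  by move=> _; apply: integral_ge0 => y _; rewrite lee_fin.
exact: (ge0_integralZl mu measurableT m1 p1).
Qed.

(** Domination by a tensor product is the integrability criterion used for
    every exchange of integrals below. *)
Lemma tensor_lty {R : realType} d d' (X : measurableType d)
    (Y : measurableType d') (mu : {measure set X -> \bar R})
    (nu : {sigma_finite_measure set Y -> \bar R}) (f : X -> Y -> R)
    (a : X -> R) (b : Y -> R) :
  measurable_fun setT (fun p : X * Y => f p.1 p.2) -> L1 mu a -> L1 nu b ->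
  (forall x y, `|f x y| <= `|a x| * `|b y|) ->
  (\int[mu]_x \int[nu]_y `|f x y|%:E < +oo)%E.
Proof.
move=> mf ia ib fab; have ma := L1_measurable ia; have mb := L1_measurable ib.
apply: (@le_lt_trans _ _ (\int[mu]_x (`|a x| * \int[nu]_y `|b y|)%:E)%E).
  apply: le_integralT.
  - by apply: measurable_integral => //; meas.
  - by meas.
  - by move=> x; apply: integral_ge0.
  move=> x; rewrite EFinM RintE; last exact: L1_norm.
  rewrite -ge0_integralrZl//; last by meas.
  apply: le_integralT; [| |by []|].
  - by have mfx := measurable_slice x mf; meas.
  - by meas.
  - by move=> y; rewrite lee_fin.
rewrite -(RintE (f := fun x => `|a x| * \int[nu]_y `|b y|)) ?ltry//.
under eq_fun do rewrite mulrC.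
exact/L1Zl/L1_norm.
Qed.

Section fubini3.
Context {R : realType} d1 d2 d3 (X : measurableType d1) (Y : measurableType d2)
  (Z : measurableType d3).
Variables (mu : {sigma_finite_measure set X -> \bar R})
  (nu : {sigma_finite_measure set Y -> \bar R})
  (rho : {sigma_finite_measure set Z -> \bar R}).
Variable F : X -> Y -> Z -> R.
Hypothesis mF : measurable_fun setT (fun p : X * Y * Z => F p.1.1 p.1.2 p.2).
Hypothesis F0 : forall x y z, 0 <= F x y z.

Lemma measurable_integral_inner :
  measurable_fun setT (fun p : X * Y => \int[rho]_z (F p.1 p.2 z)%:E)%E.
Proof.
exact: (measurable_integral rho (f := fun (p : X * Y) z => F p.1 p.2 z)).
Qed.

Lemma measurable_integral2 :
  measurable_fun setT (fun x => \int[nu]_y \int[rho]_z (F x y z)%:E)%E.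
Proof.
have := measurable_fun_fubini_tonelli_F (m2 := nu) _ measurable_integral_inner.
by apply => p; apply: integral_ge0 => z _; rewrite lee_fin.
Qed.

Lemma tonelli3 : (\int[mu]_x \int[nu]_y \int[rho]_z (F x y z)%:E =
  \int[rho]_z \int[mu]_x \int[nu]_y (F x y z)%:E)%E.
Proof.
under eq_integral => x _.
  rewrite (tonelli rho nu (f := F x))//; first over.
  by meas.
rewrite (tonelliE rho mu (f := fun x z => \int[nu]_y (F x y z)%:E)%E)//.
- apply: (measurable_integral nu (f := fun (p : X * Z) y => F p.1 y p.2)) => //.
  by meas.
- by move=> x z; apply: integral_ge0 => y _; rewrite lee_fin.
Qed.

End fubini3.

Section fubini_swap.
Context {R : realType} d d' (X : measurableType d) (Y : measurableType d').
Variables (mu : {sigma_finite_measure set X -> \bar R})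
  (nu : {sigma_finite_measure set Y -> \bar R}).
Implicit Types f : X -> Y -> R.

Lemma Rfubini_prod f : measurable_fun setT (fun p : X * Y => f p.1 p.2) ->
  (\int[mu]_x \int[nu]_y `|f x y|%:E < +oo)%E ->
  \int[mu]_x \int[nu]_y f x y = \int[(mu \x nu)%E]_p f p.1 p.2.
Proof.
move=> mf h; have ip := L1_prod mf h; rewrite {3}/Rintegral.
rewrite -(integral12_prod_meas1 ip) /fubini_F /= /Rintegral; congr fine.
apply: ae_eq_integral => //.
- by apply/measurable_EFinP; exact: measurable_Rint.
- exact: measurable_fubini_F ip.
- by apply: filterS (ae_L1 mf h) => x fx _; rewrite -RintE.
Qed.

Lemma Rfubini f : measurable_fun setT (fun p : X * Y => f p.1 p.2) ->
  (\int[mu]_x \int[nu]_y `|f x y|%:E < +oo)%E ->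
  \int[mu]_x \int[nu]_y f x y = \int[nu]_y \int[mu]_x f x y.
Proof.
move=> mf h; rewrite Rfubini_prod//; have ip := L1_prod mf h.
rewrite {1}/Rintegral -(integral21_prod_meas1 ip) /fubini_G /= /Rintegral; congr fine.
apply: ae_eq_integral => //.
- exact: measurable_fubini_G ip.
- by apply/measurable_EFinP; apply: measurable_Rint; exact: measurable_swap.
- by apply: filterS (ae_integrable2 ip) => x fx _; rewrite -RintE.
Qed.

End fubini_swap.
Section lebesgue_affine.
Context {R : realType}.
Local Notation leb := (@lebesgue_measure R).

Lemma measurable_addr (a : R) :
  measurable_fun setT (fun x : R => x + a : measurableTypeR R).
Proof. by apply: measurable_funD. Qed.

Lemma measurable_subl (a : R) :
  measurable_fun setT (fun x : R => a - x : measurableTypeR R).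
Proof. by apply: measurable_funB. Qed.

Lemma leb_addr (a : R) (A : set R) : measurable A ->
  pushforward leb (fun x : R => x + a : measurableTypeR R) A = leb A.
Proof.
move=> mA; apply/esym/lebesgue_measure_unique => //=.
  exact: measurable_addr.
move=> _ _ [[x y] _ <-].
rewrite /pushforward/= (_ : _ @^-1` _ = `](x - a)%R, (y - a)%R]%classic); last first.
  by apply/seteqP; split => r/=; rewrite !in_itv/= ltrBlDr lerBrDr.
rewrite !lebesgue_measure_itv/= !lte_fin ltrD2r.
by case: ifPn => // _; rewrite -!EFinB; congr EFin; ring.
Qed.

Lemma leb_subl (a : R) (A : set R) : measurable A ->
  pushforward leb (fun x : R => a - x : measurableTypeR R) A = leb A.
Proof.
move=> mA; rewrite -(@lebesgue_measureN R A)// /pushforward.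
have mB : measurable (-%R @^-1` A : set R).
  rewrite -[X in measurable X]setTI.
  exact: (@measurable_funN _ _ _ setT id (@measurable_id _ _ _) measurableT A mA).
rewrite -(leb_addr (- a) mB) /pushforward /=; congr (leb _).
by apply/seteqP; split => x /=; rewrite opprD opprK addrC.
Qed.

Section preserving.
Variable phi : measurableTypeR R -> measurableTypeR R.
Hypothesis mphi : measurable_fun setT phi.
Hypothesis lebphi : forall A : set R, measurable A -> pushforward leb phi A = leb A.

(** Translations and reflections preserve Lebesgue measure, hence integrals. *)
Lemma ge0_integral_preserving (f : R -> \bar R) : measurable_fun setT f ->
  (forall x, 0 <= f x)%E -> (\int[leb]_x f (phi x) = \int[leb]_x f x)%E.
Proof.
move=> mf f0.
have := @ge0_integral_pushforward _ _ _ _ R phi mphi leb setT f measurableT mf.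
rewrite preimage_setT => <- //; apply: eq_measure_integral => //= A mA _.
exact: lebphi.
Qed.

Lemma Rint_preserving (f : R -> R) : measurable_fun setT f ->
  \int[leb]_x f (phi x) = \int[leb]_x f x.
Proof.
move=> mf; rewrite /Rintegral [in LHS]integralE [in RHS]integralE.
have mfE : measurable_fun setT (EFin \o f) by exact/measurable_EFinP.
have mp := measurable_funepos mfE; have mn := measurable_funeneg mfE.
rewrite -(ge0_integral_preserving mp); last by move=> ?; exact: funepos_ge0.
rewrite -(ge0_integral_preserving mn); last by move=> ?; exact: funeneg_ge0.
by congr (fine (_ - _))%E; apply: eq_integral => x _; rewrite ?funeposE ?funenegE.
Qed.

Lemma ae_preserving (P : R -> Prop) :
  {ae leb, forall x, P x} -> {ae leb, forall x, P (phi x)}.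
Proof.
move=> [A [mA A0 PA]]; exists (phi @^-1` A); split.
- by rewrite -[X in measurable X]setTI; exact: mphi.
- by have := lebphi mA; rewrite /pushforward A0.
- by move=> x /= Px; apply: PA.
Qed.

End preserving.

Lemma ge0_integral_addr (a : R) (f : R -> \bar R) : measurable_fun setT f ->
  (forall x, 0 <= f x)%E -> (\int[leb]_x f (x + a)%R = \int[leb]_x f x)%E.
Proof.
by move=> mf f0; apply: (ge0_integral_preserving (measurable_addr a) (leb_addr a)).
Qed.

Lemma Rint_addr (a : R) (f : R -> R) : measurable_fun setT f ->
  \int[leb]_x f (x + a) = \int[leb]_x f x.
Proof. by move=> mf; apply: (Rint_preserving (measurable_addr a) (leb_addr a)). Qed.

Lemma ae_addr (a : R) (P : R -> Prop) :
  {ae leb, forall x, P x} -> {ae leb, forall x, P (x + a)}.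
Proof. by apply: (ae_preserving (measurable_addr a) (leb_addr a)). Qed.

Lemma ge0_integral_subl (a : R) (f : R -> \bar R) : measurable_fun setT f ->
  (forall x, 0 <= f x)%E -> (\int[leb]_x f (a - x)%R = \int[leb]_x f x)%E.
Proof.
by move=> mf f0; apply: (ge0_integral_preserving (measurable_subl a) (leb_subl a)).
Qed.

Lemma Rint_subl (a : R) (f : R -> R) : measurable_fun setT f ->
  \int[leb]_x f (a - x) = \int[leb]_x f x.
Proof. by move=> mf; apply: (Rint_preserving (measurable_subl a) (leb_subl a)). Qed.

End lebesgue_affine.

(** * Calculus of compactly supported functions and convolutions *)

Section calculus.
Context {R : realType}.
Local Notation leb := (@lebesgue_measure R).
Implicit Types f g h : R -> R.

(** The derivative is an argument, so that explicit formulas for it propagate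
    through sums, products, compositions and convolutions. *)
Definition C1 f f' : Prop :=
  (forall x : R, is_derive x 1 f (f' x)) /\ continuous f'.

Definition vanishes_off (M : R) f : Prop := forall x, M < `|x| -> f x = 0.

Lemma C1_continuous f f' : C1 f f' -> continuous f.
Proof.
move=> [df _] x; apply: differentiable_continuous; apply/derivable1_diffP.
by have := df x; case.
Qed.

Lemma C1_derive1 f f' : C1 f f' -> derive1 f = f'.
Proof.
by move=> [df _]; apply/funext => x; rewrite derive1E; have := df x; case.
Qed.

Lemma C1_measurable f f' : C1 f f' -> measurable_fun setT f.
Proof. by move/C1_continuous => cf; exact: continuous_measurable_fun. Qed.

Lemma C1_measurable' f f' : C1 f f' -> measurable_fun setT f'.
Proof. by move=> [_ cf]; exact: continuous_measurable_fun. Qed.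

Lemma C1M f f' g g' : C1 f f' -> C1 g g' ->
  C1 (fun x => f x * g x) (fun x => f' x * g x + f x * g' x).
Proof.
move=> F G; have cf := C1_continuous F; have cg := C1_continuous G.
case: F G => [df cf'] [dg cg']; split=> x.
  have := @is_deriveM R _ f g x 1 _ _ (df x) (dg x).
  by rewrite addrC /GRing.scale /= [g x * _]mulrC.
by apply: (@continuousD _ _ _ (fun x => f' x * g x) (fun x => f x * g' x));
  apply: continuousM; [exact: cf'|exact: cg|exact: cf|exact: cg'].
Qed.

Lemma FTC f f' a b : C1 f f' -> a <= b ->
  \int[leb]_(x in `[a, b]) f' x = f b - f a.
Proof.
move=> F; rewrite le_eqVlt => /predU1P[->|ab].
  by rewrite set_itv1 Rintegral_set1 subrr.
have cf := C1_continuous F.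
rewrite /Rintegral (@continuous_FTC2 R f' f a b ab)//.
- by apply: continuous_subspaceT => x; case: F.
- split => [x _||].
  + by case: F => /(_ x) [].
  + exact: cvg_at_right_filter (cf a).
  + exact: cvg_at_left_filter (cf b).
- by move=> x _; rewrite (C1_derive1 F).
Qed.

Lemma vanishes_off_derive f f' M : C1 f f' -> vanishes_off M f ->
  vanishes_off M f'.
Proof.
move=> F sf x Mx; case: F => /(_ x) df _.
have : is_derive x 1 (cst 0 : R -> R) (f' x).
  apply: near_eq_is_derive df; near=> y.
  rewrite /cst sf //; near: y.
  have : continuous (@Num.norm R R) by move=> ?; exact: norm_continuous.
  move=> /(_ x) /cvgrPdist_lt; move: (Mx); rewrite -subr_gt0 => Mx' /(_ _ Mx').
  by apply: filterS => y h; have := ler_norm (`|x| - `|y|); lra.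
by case=> _ <-; rewrite derive_cst.
Unshelve. all: by end_near.
Qed.

Lemma vanishes_off_bounded f M : continuous f -> vanishes_off M f ->
  exists2 A : R, 0 <= A & forall x, `|f x| <= A.
Proof.
move=> cf sf.
have M0 : - `|M| <= `|M| by rewrite (@le_trans _ _ 0)// oppr_le0.
have cnf : {within `[- `|M|, `|M|], continuous (fun x => `|f x|)}.
  apply: continuous_subspaceT => x.
  by apply: (continuous_comp (cf x)); exact: norm_continuous.
have [c _ hc] := EVT_max M0 cnf.
exists `|f c| => // x.
have [Mx|Mx] := ltP M `|x|; first by rewrite sf// normr0.
by apply: hc; rewrite in_itv/= -ler_norml (le_trans Mx)// ler_norm.
Qed.

Lemma Rint_vanishes_off f M N : vanishes_off M f -> M <= N ->
  \int[leb]_x f x = \int[leb]_(x in `[- N, N]) f x.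
Proof.
move=> sf MN; rewrite [RHS]Rintegral_mkcond; apply: eq_Rint => x.
rewrite /patch; case: ifPn => // /negP h; apply: sf; apply: le_lt_trans MN _.
rewrite ltNge; apply/negP => xN; apply: h; rewrite inE/= in_itv/=.
by rewrite -ler_norml.
Qed.

Lemma L1_vanishes_off f M : continuous f -> vanishes_off M f -> L1 leb f.
Proof.
move=> cf sf; pose D : set R := `[- `|M|, `|M|].
have mD : measurable D by exact: measurable_itv.
have iD : leb.-integrable D (EFin \o f).
  by apply: continuous_compact_integrable;
    [exact: segment_compact|exact: continuous_subspaceT].
have -> : f = f \_ D.
  apply/funext => x; rewrite /patch; case: ifPn => // /negP h; apply: sf.
  rewrite (le_lt_trans (ler_norm M))// ltNge.
  by apply/negP => xN; apply: h; rewrite inE /D/= in_itv/= -ler_norml.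
by rewrite -restrict_EFin -integrable_mkcond.
Qed.

Lemma Rint_derive_eq0 f f' M : C1 f f' -> vanishes_off M f ->
  \int[leb]_x f' x = 0.
Proof.
move=> F sf; have sf' := vanishes_off_derive F sf.
have N0 : - (`|M| + 1) <= `|M| + 1 by have := normr_ge0 M; lra.
rewrite (Rint_vanishes_off (N := `|M| + 1) sf'); last by have := ler_norm M; lra.
rewrite (FTC F N0) !sf ?subrr// ?normrN; have := ler_norm (`|M| + 1);
  have := ler_norm M; lra.
Qed.

Lemma IBP f f' g g' M : C1 f f' -> vanishes_off M f -> C1 g g' ->
  \int[leb]_x (f' x * g x) = - \int[leb]_x (f x * g' x).
Proof.
move=> F sf G; have FG := C1M F G; have sf' := vanishes_off_derive F sf.
have := Rint_derive_eq0 FG (M := M); rewrite RintD.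
- by move=> h; apply/eqP; rewrite -addr_eq0 h// => x Mx; rewrite sf ?mul0r.
- apply: (@L1_vanishes_off _ M).
    by move=> x; apply: continuousM; [case: F => _; apply|exact: (C1_continuous G)].
  by move=> x Mx; rewrite sf' ?mul0r.
- apply: (@L1_vanishes_off _ M).
    by move=> x; apply: continuousM; [exact: (C1_continuous F)|case: G => _; apply].
  by move=> x Mx; rewrite sf ?mul0r.
Qed.

(** The sign function jumps by 2, so its distributional derivative at [u] is
    twice a Dirac mass. *)
Lemma Rint_sg_derive f f' M (u : R) : C1 f f' -> vanishes_off M f ->
  \int[leb]_x (Num.sg (x - u) * f' x) = - 2 * f u.
Proof.
move=> F sf; have sf' := vanishes_off_derive F sf.
pose N : R := `|M| + `|u| + 1.
have MN : M < N by have := ler_norm M; have := normr_ge0 u; rewrite /N; lra.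
have [uN1 uN2] : - N <= u /\ u <= N.
  by have := ler_norm u; have := ler_norm (- u); rewrite normrN /N;
    have := normr_ge0 M; lra.
have mf' := C1_measurable' F.
have if' : L1 leb f' by apply: L1_vanishes_off sf'; case: F.
have ifS (D : set R) : measurable D -> L1 leb (f' \_ D).
  move=> mD; apply: (L1_le (mu := leb) (g := fun x => `|f' x|)).
  - by apply/(measurable_restrictT _ _).1 => //; exact: measurable_funTS.
  - by move=> x; rewrite /patch; case: ifPn => // _; rewrite normr0.
  - exact: L1_norm.
rewrite (@ae_eq_Rint _ _ _ leb _ (fun x => (f' \_ `[u, N]) x - (f' \_ `[- N, u]) x)).
- rewrite RintB; try exact: ifS (measurable_itv _).
  rewrite -!Rintegral_mkcond (FTC F uN1) (FTC F uN2).
  rewrite (sf N) ?(sf (- N)) ?normrN; [lra| |];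
    by rewrite (lt_le_trans MN)// ler_norm.
- apply: measurable_funM => //.
  by apply: (measurableT_comp (@measurable_sgr R)); exact: measurable_funB.
- apply: measurable_funB;
    by apply/(measurable_restrictT _ _).1 => //; exact: measurable_funTS.
- exists [set u]; split => //; first exact: lebesgue_measure_set1.
  move=> x /= h; apply: contrapT => /eqP xu; apply: h.
  rewrite /patch !mem_setE/= !in_itv/=.
  have pt0 : point = 0 :> R by [].
  case: (ltgtP x u) xu => [xu _|ux _|-> /eqP//]; rewrite pt0 /=.
    rewrite ltr0_sg ?subr_lt0// andbT sub0r mulN1r.
    case: ifP => // /negP/negP; rewrite -ltNge => xN.
    suff -> : f' x = 0 by rewrite oppr0.
    by apply: sf'; have := ler_norm (- x); rewrite normrN; lra.
  rewrite gtr0_sg ?subr_gt0// andbF subr0 mul1r; case: ifP => // /negP/negP.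
  by rewrite -ltNge => xN; apply: sf'; have := ler_norm x; lra.
Qed.

End calculus.

Section convolution.
Context {R : realType}.
Local Notation leb := (@lebesgue_measure R).
Implicit Types a f g h : R -> R.

Lemma L1_indic_itv (p q : R) : L1 leb (\1_`[p, q] : R -> R).
Proof.
apply: L1P; first exact: measurable_indic.
under eq_integral do rewrite /= ger0_norm//.
rewrite integral_indic// setIT /= lebesgue_measure_itv/=.
by case: ifPn => // _; rewrite -EFinD ltry.
Qed.

Lemma L1_bounded_M a f (A : R) : measurable_fun setT a -> (forall x, `|a x| <= A) ->
  L1 leb f -> L1 leb (fun x => a x * f x).
Proof.
move=> ma aA fi; apply: (L1_le (mu := leb) (g := fun x => A * `|f x|)).
- by apply: measurable_funM => //; exact: L1_measurable fi.
- by move=> x; rewrite normrM ler_wpM2r.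
- exact/L1Zl/L1_norm.
Qed.

(** Convolution with the reflection of [g]: the kernel is centred at [y], as the
    test functions are. *)
Definition conv a g (y : R) : R := \int[leb]_x (a x * g (x - y)).

Lemma L1_shift g (y : R) : L1 leb g -> L1 leb (fun x => g (x - y)).
Proof.
move=> gi; have mg := L1_measurable gi; apply: L1P.
  by apply: (measurableT_comp mg); apply: measurable_funB.
rewrite (ge0_integral_addr (- y) (f := fun x => `|g x|%:E)%R) ?L1_lty//.
by apply/measurable_EFinP; apply: measurableT_comp.
Qed.

(** An integrable envelope, uniform for [y] in a neighbourhood, for passing to
    the limit under the integral sign. *)
Lemma conv_envelope g M (B u v y x : R) : vanishes_off M g ->
  (forall x, `|g x| <= B) -> u < y < v ->
  `|g (x - y)| <= B * \1_`[u - M, v + M] x.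
Proof.
move=> sg gB /andP[uy yv]; rewrite indicE.
have [xM|xM] := leP `|x - y| M; last first.
  by rewrite sg// normr0 mulr_ge0// (le_trans _ (gB 0)).
move: xM; rewrite ler_norml => /andP[h1 h2].
rewrite mem_set ?mulr1//= in_itv/=; apply/andP; split; lra.
Qed.

Lemma conv_continuous a g M (A : R) : measurable_fun setT a -> (forall x, `|a x| <= A) ->
  continuous g -> vanishes_off M g -> continuous (conv a g).
Proof.
move=> ma aA cg sg y; have [B B0 gB] := vanishes_off_bounded cg sg.
have gi := L1_vanishes_off cg sg.
have A0 : 0 <= A by exact: le_trans (aA 0).
apply: (@continuity_under_integral R _ _ leb (fun y x => a x * g (x - y)) setT
  measurableT (y - 1) (y + 1) _ _ (fun x => A * (B * \1_`[y - 1 - M, y + 1 + M] x))).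
- by move=> z _; apply: L1_bounded_M aA _ => //; exact: L1_shift.
- apply: aeW => x _ z _; apply: cvgM; first exact: cvg_cst.
  apply: (@continuous_comp _ _ _ (fun z => x - z) g); last exact: cg.
  by apply: cvgB; [exact: cvg_cst|exact: cvg_id].
- by apply: L1Zl; apply: L1Zl; exact: L1_indic_itv.
- move=> z; rewrite /= in_itv/= => zI; apply: aeW => x _.
  by rewrite normrM ler_pM// (conv_envelope _ sg).
- by rewrite inE /= in_itv/= ltrBlDr ltrDl ltr01.
Qed.

Lemma conv_C1 a g g' M (A : R) : measurable_fun setT a -> (forall x, `|a x| <= A) ->
  C1 g g' -> vanishes_off M g -> C1 (conv a g) (fun y => - conv a g' y).
Proof.
move=> ma aA G sg; have sg' := vanishes_off_derive G sg.
have cg := C1_continuous G; have cg' : continuous g' by case: G.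
have [B B0 gB] := vanishes_off_bounded cg' sg'.
have gi := L1_vanishes_off cg sg.
have A0 : 0 <= A by exact: le_trans (aA 0).
split; last first.
  by move=> y; apply: cvgN; exact: (conv_continuous ma aA cg' sg').
move=> y; pose F := fun (y x : R) => a x * g (x - y).
have dF (z x : R) : is_derive z 1 (F ^~ x) (- (a x * g' (x - z))).
  have d1 : is_derive z 1 (fun z : R => x - z) (-1).
    have := @is_deriveB _ _ _ (cst x) id z 1 0 1
      (is_derive_cst x z 1) (is_derive_id z 1).
    by rewrite sub0r.
  have d2 : is_derive (x - z) 1 g (g' (x - z)) by case: G.
  have d3 := @is_derive1_comp R g (fun z => x - z) z _ _ d2 d1.
  have := @is_deriveZ _ _ _ (g \o (fun z => x - z)) (a x) z 1 _ d3.
  by rewrite /GRing.scale /= mulrN1 mulrN.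
have Iy : `]y - 1, y + 1[ y by rewrite /= in_itv/= ltrBlDr ltrDl ltr01.
have H1 z : `]y - 1, y + 1[ z -> L1 leb (F z).
  by move=> _; apply: L1_bounded_M aA _ => //; exact: L1_shift.
have H2 z x : `]y - 1, y + 1[ z -> [set: R] x -> derivable (F ^~ x) z 1.
  by move=> _ _; case: (dF z x).
pose E (x : R) := A * (B * \1_`[y - 1 - M, y + 1 + M] x).
have E0 x : 0 <= E x by rewrite /E !mulr_ge0// indicE.
have EL : L1 leb E by apply: L1Zl; apply: L1Zl; exact: L1_indic_itv.
have H3 z x : `]y - 1, y + 1[ z -> [set: R] x -> `|partial1of2 F z x| <= E x.
  move=> zI _; rewrite partial1of2E; have [_ ->] := dF z x.
  by rewrite normrN normrM ler_pM// (conv_envelope _ sg').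
have D1 := derivable_under_integral measurableT Iy H1 H2 E0 EL H3.
have D2 := differentiation_under_integral measurableT Iy H1 H2 E0 EL H3.
apply: DeriveDef => //; rewrite -derive1E D2 -RintN.
- apply: eq_Rint => x; rewrite partial1of2E; by have [_ ->] := dF y x.
- apply: measurable_funM => //; apply: (measurableT_comp (C1_measurable' G)).
  exact: measurable_funB.
Qed.

End convolution.

(** * Smooth bumps and mollifiers *)

Section smooth.
Context {R : realType}.
Local Notation leb := (@lebesgue_measure R).
Implicit Types f g h : R -> R.

Fixpoint Cn (k : nat) f : Prop :=
  if k is k'.+1 then exists2 f', C1 f f' & Cn k' f' else continuous f.

Definition smooth f := forall k, Cn k f.

Lemma Cn_continuous k f : Cn k f -> continuous f.
Proof. by case: k => // k [f' /C1_continuous]. Qed.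

Lemma CnS k f : Cn k.+1 f -> Cn k f.
Proof.
elim: k f => [f /Cn_continuous//|k IH f [f' F H]].
by exists f' => //; exact: IH.
Qed.

Lemma smooth_derive1 f : smooth f -> C1 f (derive1 f) /\ smooth (derive1 f).
Proof.
move=> sf; have [f1 F1 _] := sf 1; rewrite (C1_derive1 F1); split => // k.
have [f2 F2 H2] := sf k.+1.
by rewrite -(C1_derive1 F1) (C1_derive1 F2).
Qed.

Lemma C1D f f' g g' : C1 f f' -> C1 g g' ->
  C1 (fun x => f x + g x) (fun x => f' x + g' x).
Proof.
move=> [df cf] [dg cg]; split => x; first exact: is_deriveD (df x) (dg x).
by apply: cvgD; [exact: cf|exact: cg].
Qed.

Lemma C1_affine f f' (p q : R) : C1 f f' ->
  C1 (fun x => f (p * x + q)) (fun x => p * f' (p * x + q)).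
Proof.
move=> [df cf].
have dl (x : R) : is_derive x 1 (fun x : R => p * x + q) p.
  have h := is_deriveD (is_deriveZ p (is_derive_id x 1)) (is_derive_cst q x 1).
  by have {h} : is_derive x 1 _ _ := h; rewrite addr0 /GRing.scale /= mulr1.
split=> x.
  have := @is_derive1_comp R f (fun x : R => p * x + q) x _ _ (df _) (dl x).
  by rewrite mulrC.
apply: cvgM; first exact: cvg_cst.
apply: (@continuous_comp _ _ _ (fun x : R => p * x + q) f'); last exact: cf.
by apply: cvgD; [apply: cvgM; [exact: cvg_cst|exact: cvg_id]|exact: cvg_cst].
Qed.

Lemma CnD k f g : Cn k f -> Cn k g -> Cn k (fun x => f x + g x).
Proof.
elim: k f g => [|k IH] f g /=.
  by move=> cf cg x; apply: cvgD; [exact: cf|exact: cg].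
by move=> [f' F Hf] [g' G Hg]; exists (fun x => f' x + g' x); [exact: C1D|exact: IH].
Qed.

Lemma CnM k f g : Cn k f -> Cn k g -> Cn k (fun x => f x * g x).
Proof.
elim: k f g => [|k IH] f g.
  by move=> cf cg x; apply: cvgM; [exact: cf|exact: cg].
move=> Hf' Hg'; have Hf0 := CnS Hf'; have Hg0 := CnS Hg'.
case: Hf' Hg' => f' F Hf [g' G Hg].
by exists (fun x => f' x * g x + f x * g' x); [exact: C1M|apply: CnD; exact: IH].
Qed.

Lemma Cn_cst k (c : R) : Cn k (fun=> c).
Proof.
elim: k c => [|k IH] c /=; first by move=> x; exact: cvg_cst.
exists (fun=> 0) => //; split => x; [exact: is_derive_cst|exact: cvg_cst].
Qed.

Lemma Cn_id k : Cn k (fun x : R => x).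
Proof.
case: k => [|k] /=; first by move=> x; exact: cvg_id.
exists (fun=> 1); last exact: Cn_cst.
split => x; [exact: is_derive_id|exact: cvg_cst].
Qed.

Lemma Cn_affine k f (p q : R) : Cn k f -> Cn k (fun x => f (p * x + q)).
Proof.
elim: k f => [f cf x|k IH f [f' F H]].
  apply: (@continuous_comp _ _ _ (fun x : R => p * x + q) f); last exact: cf.
  by apply: cvgD; [apply: cvgM; [exact: cvg_cst|exact: cvg_id]|exact: cvg_cst].
exists (fun x => p * f' (p * x + q)); first exact: C1_affine.
by apply: CnM; [exact: Cn_cst|exact: IH].
Qed.

(** The functions x^-k exp(-1/x) on the right half-line, extended by 0, are
    closed under differentiation and continuous at 0: this is why exp(-1/x)
    is smooth across 0. *)
Definition flat (k : nat) (x : R) : R :=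
  if 0 < x then x^-1 ^+ k * expR (- x^-1) else 0.

Lemma flat_ge0 k x : 0 <= flat k x.
Proof.
by rewrite /flat; case: ifPn => // x0; rewrite mulr_ge0 ?expR_ge0// exprn_ge0// invr_ge0 ltW.
Qed.

(** From the bound [y ^ (k + 1) / (k + 1)! <= exp y] at [y = 1 / x]. *)
Lemma flat_le k x : 0 <= x -> flat k x <= k.+1`!%:R * x.
Proof.
rewrite /flat le_eqVlt => /predU1P[<-|x0]; first by rewrite ltxx mulr0.
rewrite x0 expRN; set y := x^-1.
have y0 : 0 < y by rewrite invr_gt0.
have -> : x = y^-1 by rewrite invrK.
have := @expR_ge1Dxn R y k (ltW y0) => h.
have {}h : y ^+ k.+1 <= k.+1`!%:R * expR y.
  rewrite -ler_pdivrMl ?ltr0n ?fact_gt0// mulrC; lra.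
rewrite ler_pdivrMr ?expR_gt0// mulrAC ler_pdivlMr//.
by rewrite -exprSr.
Qed.

Lemma flatS k x : flat k x = flat k.+1 x * x.
Proof.
rewrite /flat; case: ifPn => x0; last by rewrite mul0r.
by rewrite mulrAC exprSr mulfVK// gt_eqF.
Qed.

Lemma flat_derive k (x : R) :
  is_derive x 1 (flat k) (- k%:R * flat k.+1 x + flat k.+2 x).
Proof.
case: (ltgtP x 0) => [x0|x0|->].
- have -> : - k%:R * flat k.+1 x + flat k.+2 x = 0.
    by rewrite /flat ltNge (ltW x0)/= mulr0 addr0.
  apply: near_eq_is_derive (is_derive_cst 0 x 1); near=> y.
  by rewrite /cst /flat ltNge ltW//; near: y; exact: lt_nbhsl.
- have xn0 : x != 0 by rewrite gt_eqF.
  have dV : is_derive x 1 (fun y : R => y^-1) (- x ^- 2).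
    have := @is_deriveV R id x 1 1 xn0 (is_derive_id x 1).
    by rewrite /GRing.scale /= mulr1.
  have dE := @is_derive1_comp R expR (fun y : R => - y^-1) x _ _
    (is_derive_expR _) (is_deriveN dV).
  have d0 : is_derive x 1 (fun y : R => y^-1 ^+ k) (k%:R * x^-1 ^+ k.-1 * - x ^- 2).
    have h := @is_deriveX R _ (fun y : R => y^-1) k x 1 _ dV.
    have -> : (fun y : R => y^-1 ^+ k) = (fun y : R => y^-1) ^+ k; last exact: h.
    apply/funext => y; elim: (k) => [|n IH]; first by rewrite !expr0.
    by rewrite !exprS IH.
  have := @is_deriveM R _ _ _ x 1 _ _ d0 dE.
  set D := (X in is_derive _ _ _ X -> _).
  have -> : - k%:R * flat k.+1 x + flat k.+2 x = D.
    rewrite /D /flat x0 /GRing.scale /= -!exprVn.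
    by case: k {d0 D} => [|k] /=; rewrite ?mul0r ?expr0 !exprS; ring.
  apply: near_eq_is_derive; near=> y.
  rewrite /flat ifT//; near: y; exact: lt_nbhsr.
have -> : - k%:R * flat k.+1 0 + flat k.+2 0 = 0.
  by rewrite /flat ltxx mulr0 addr0.
have H : h^-1 *: (flat k (h *: 1 + 0) - flat k 0) @[h --> (0 : R)^'] --> (0 : R).
  have flat0 : flat k 0 = 0 by rewrite /flat ltxx.
  pose C : R := k.+2`!%:R.
  apply: (@squeeze_cvgr _ _ _ _ (fun=> 0) (fun h : R => C * `|h|)).
  - near=> h; rewrite addr0 flat0 subr0 /GRing.scale /= mulr1.
    have h0 : h != 0 by near: h; exact: nbhs_dnbhs_neq.
    rewrite flatS mulrC mulfK// flat_ge0/=.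
    have [h1|h1] := leP 0 h; first by rewrite ger0_norm// flat_le.
    by rewrite /flat ltNge (ltW h1)/= mulr_ge0// ler0n.
  - exact: cvg_cst.
  - have : C * `|h| @[h --> (0 : R)^'] --> C * `|0 : R|.
      apply: cvgM; first exact: cvg_cst.
      by apply: cvg_norm; exact: cvg_within.
    by rewrite normr0 mulr0.
apply: DeriveDef; first exact: cvgP H.
exact: cvg_lim H.
Unshelve. all: by end_near.
Qed.

Lemma flat_continuous k : continuous (flat k).
Proof.
move=> x; apply: differentiable_continuous; apply/derivable1_diffP.
by case: (flat_derive k x).
Qed.

Lemma flat_smooth k : smooth (flat k).
Proof.
move=> n; elim: n k => [|n IH] k; first exact: flat_continuous.
exists (fun x => - k%:R * flat k.+1 x + flat k.+2 x).
  split => x; first exact: flat_derive.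
  by apply: cvgD; [apply: cvgM; [exact: cvg_cst|]|]; exact: flat_continuous.
by apply: CnD; [apply: CnM; [exact: Cn_cst|]|]; exact: IH.
Qed.

Definition bump (x : R) : R := flat 0 (1 + x) * flat 0 (1 - x).

Lemma bump_smooth : smooth bump.
Proof.
move=> n; apply: CnM.
  have := @Cn_affine n _ 1 1 (flat_smooth 0 n).
  by under eq_fun do rewrite mul1r addrC.
have := @Cn_affine n _ (-1) 1 (flat_smooth 0 n).
by under eq_fun do rewrite mulN1r addrC.
Qed.

Lemma bump_ge0 x : 0 <= bump x.
Proof. by rewrite /bump mulr_ge0 ?flat_ge0. Qed.

Lemma bump_gt0 x : `|x| < 1 -> 0 < bump x.
Proof.
rewrite ltr_norml => /andP[h1 h2].
by rewrite /bump /flat !ifT ?expr0 ?mul1r ?mulr_gt0 ?expR_gt0//; lra.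
Qed.

Lemma bump_vanishes : vanishes_off 1 bump.
Proof.
move=> x; rewrite /bump /flat; case: ifPn => h1; last by rewrite mul0r.
case: ifPn => h2; last by rewrite mulr0.
by rewrite ltNge ler_norml => /negP[]; apply/andP; split; lra.
Qed.

End smooth.

Section mollifiers.
Context {R : realType}.
Local Notation leb := (@lebesgue_measure R).
Implicit Types f g h phi : R -> R.

Lemma smooth_C1 f : smooth f -> C1 f (derive1 f).
Proof. by case/smooth_derive1. Qed.

Lemma smooth_continuous f : smooth f -> continuous f.
Proof. by move/(_ 0). Qed.

Lemma smooth_derive f : smooth f -> smooth (derive1 f).
Proof. by case/smooth_derive1. Qed.

Lemma smooth_scale f (p q : R) : smooth f -> smooth (fun x => p * f (q * x)).
Proof.
move=> sf n; apply: CnM; first exact: Cn_cst.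
by have := @Cn_affine _ n f q 0 (sf n); under eq_fun do rewrite addr0.
Qed.

Lemma C1_scale f f' (q : R) : C1 f f' ->
  C1 (fun x => f (q * x)) (fun x => q * f' (q * x)).
Proof.
move=> /(C1_affine q 0); rewrite (_ : (fun x => f (q * x + 0)) = (fun x => f (q * x))).
  rewrite (_ : (fun x => q * f' (q * x + 0)) = (fun x => q * f' (q * x)))//.
  by apply/funext => x; rewrite addr0.
by apply/funext => x; rewrite addr0.
Qed.

(** Integration by parts against a slowly varying cutoff. *)
Lemma Rint_derive_L1 g g' : C1 g g' -> L1 leb g -> L1 leb g' ->
  \int[leb]_x g' x = 0.
Proof.
move=> G gi gi'.
have [B B0 bB] := vanishes_off_bounded (smooth_continuous bump_smooth) (@bump_vanishes R).
have sb1 := vanishes_off_derive (smooth_C1 bump_smooth) (@bump_vanishes R).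
have [B' B'0 bB'] := vanishes_off_bounded (smooth_continuous (smooth_derive bump_smooth)) sb1.
pose c (n : nat) (x : R) := bump (n.+1%:R^-1 * x).
pose c' (n : nat) (x : R) := n.+1%:R^-1 * derive1 bump (n.+1%:R^-1 * x).
have cC n : C1 (c n) (c' n).
  exact: C1_scale (smooth_C1 (@bump_smooth R)).
have sc n : vanishes_off n.+1%:R (c n).
  move=> x h; apply: bump_vanishes.
  by rewrite normrM ger0_norm ?invr_ge0// mulrC ltr_pdivlMr// mul1r.
have lim1 : \int[leb]_x (c n x * g' x) @[n --> \oo] --> \int[leb]_x (bump 0 * g' x).
  apply: (Rint_dominated (mu := leb) (f_ := fun n x => c n x * g' x)
    (g := fun x => B * `|g' x|)).
  - move=> n; apply: measurable_funM; [exact: C1_measurable (cC n)|exact: C1_measurable' G].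
  - by apply: measurable_funM => //; exact: C1_measurable' G.
  - apply: aeW => x; apply: cvgM; last exact: cvg_cst.
    have h0 : (n.+1%:R^-1 * x) @[n --> \oo] --> (0 : R).
      rewrite -[X in _ --> X](mul0r x); apply: cvgM; last exact: cvg_cst.
      exact: (@cvg_harmonic R).
    exact: (cvg_comp _ (@bump R) h0 (smooth_continuous (@bump_smooth R) (x := 0))).
  - exact/L1Zl/L1_norm.
  - by move=> n x; rewrite normrM ler_wpM2r//; exact: bB.
have lim2 : \int[leb]_x (c n x * g' x) @[n --> \oo] --> (0 : R).
  have E n : \int[leb]_x (c n x * g' x) = - \int[leb]_x (c' n x * g x).
    by rewrite (IBP (cC n) (sc n) G) opprK.
  pose K := \int[leb]_x `|g x|.
  apply: (@squeeze_cvgr _ _ _ _ (fun n => - (n.+1%:R^-1 * (B' * K)))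
    (fun n => n.+1%:R^-1 * (B' * K))).
  - near=> n; rewrite -ler_norml E normrN.
    have mg := L1_measurable gi.
    have mc : measurable_fun setT (fun x => c' n x * g x).
      by apply: measurable_funM => //; exact: C1_measurable' (cC n).
    have i1 : L1 leb (fun x => c' n x * g x).
      apply: (L1_bounded_M (A := n.+1%:R^-1 * B')) => //.
        exact: C1_measurable' (cC n).
      by move=> x; rewrite normrM ger0_norm ?invr_ge0// ler_wpM2l ?invr_ge0//; exact: bB'.
    apply: le_trans (le_normr_Rintegral measurableT i1) _.
    rewrite mulrA /K -RintZl; last by apply: measurableT_comp.
    apply: le_Rint; [exact: L1_norm|exact/L1Zl/L1_norm|] => x.
    rewrite normrM ler_wpM2r// normrM ger0_norm ?invr_ge0// ler_wpM2l ?invr_ge0//; exact: bB'.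
  - rewrite -[X in _ --> X]oppr0; apply: cvgN.
    rewrite -[X in _ --> X](mul0r (B' * K)); apply: cvgM; last exact: cvg_cst.
    exact: (@cvg_harmonic R).
  - rewrite -[X in _ --> X](mul0r (B' * K)); apply: cvgM; last exact: cvg_cst.
    exact: (@cvg_harmonic R).
have b0 : 0 < bump (0 : R) by apply: bump_gt0; rewrite normr0 ltr01.
have : bump 0 * \int[leb]_x g' x = 0.
  rewrite -RintZl; last exact: L1_measurable gi'.
  exact: (cvg_unique _ lim1 lim2).
by move/eqP; rewrite mulf_eq0 gt_eqF//= => /eqP.
Unshelve. all: by end_near.
Qed.

Definition mollifier (e : R) phi : Prop :=
  [/\ smooth phi, forall x, 0 <= phi x, vanishes_off e phi & \int[leb]_x phi x = 1].

Lemma Rint_le_bounded f (M B : R) : continuous f -> vanishes_off M f -> 0 <= M ->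
  (forall x, `|f x| <= B) -> \int[leb]_x `|f x| <= B * (2 * M).
Proof.
move=> cf sf M0 fB.
have sf' : vanishes_off M (fun x => `|f x|) by move=> x Mx; rewrite sf// normr0.
rewrite (Rint_vanishes_off sf' (lexx _)).
have fi : L1 leb (fun x => `|f x|) by apply: L1_norm; exact: L1_vanishes_off cf sf.
have mI : measurable (`[- M, M] : set R) by exact: measurable_itv.
have MM : leb `[- M, M] = (2 * M)%:E.
  rewrite /= lebesgue_measure_itv/= lte_fin; case: ifPn => [_|].
    by rewrite -EFinD; congr EFin; ring.
  by rewrite -leNgt => h; congr EFin; lra.
have <- : fine (leb `[- M, M]) = 2 * M by rewrite MM.
rewrite -Rintegral_cst//; apply: le_Rintegral => //.
- exact: integrableS fi.
- apply: continuous_compact_integrable; first exact: segment_compact.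
  by apply: continuous_subspaceT => x; exact: cvg_cst.
Qed.

(** Rescaled bumps of width [e]: height and total variation are of order
    [1 / e]. *)
Lemma exists_mollifiers : exists2 A : R, 0 < A & forall e : R, 0 < e ->
  exists phi, [/\ mollifier e phi, forall x, phi x <= A / e
    & \int[leb]_x `|derive1 phi x| <= A / e].
Proof.
have sB := @bump_smooth R.
have [B B0 bB] := vanishes_off_bounded (smooth_continuous sB) (@bump_vanishes R).
have sb1 := vanishes_off_derive (smooth_C1 sB) (@bump_vanishes R).
have [B' B'0 bB'] := vanishes_off_bounded (smooth_continuous (smooth_derive sB)) sb1.
pose m : R := expR (- 4).
have m0 : 0 < m by exact: expR_gt0.
have bm (x : R) : `|x| <= 2^-1 -> m <= bump x.
  rewrite ler_norml => /andP[h1 h2].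
  have H (y : R) : 2^-1 <= y -> expR (- 2) <= flat 0 y.
    move=> y2; have y0 : 0 < y by lra.
    rewrite /flat y0 expr0 mul1r ler_expR lerN2.
    by rewrite -[leRHS]invrK lef_pV2 ?posrE//; lra.
  have -> : m = expR (- 2) * expR (- 2) by rewrite -expRD; congr expR; lra.
  by rewrite /bump ler_pM ?expR_ge0//; apply: H; lra.
exists ((B + 2 * B' + 1) / m); first by rewrite divr_gt0//; lra.
move=> e e0; pose be (x : R) := bump (e^-1 * x).
have sbe : smooth be.
  have := @smooth_scale bump 1 e^-1 sB.
  by under eq_fun do rewrite mul1r.
have vbe : vanishes_off e be.
  move=> x h; apply: bump_vanishes.
  by rewrite normrM ger0_norm ?invr_ge0 ?ltW// mulrC ltr_pdivlMr// mul1r.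
have ibe : L1 leb be by exact: L1_vanishes_off (smooth_continuous sbe) vbe.
pose I := \int[leb]_x be x.
have Ime : m * e <= I.
  have MM : leb `[- (e / 2), e / 2] = e%:E.
    rewrite /= lebesgue_measure_itv/= lte_fin; case: ifPn => [_|].
      by rewrite -EFinD; congr EFin; lra.
    by rewrite -leNgt => h; congr EFin; lra.
  have mI : measurable (`[- (e / 2), e / 2] : set R) by exact: measurable_itv.
  have -> : e = fine (leb `[- (e / 2), e / 2]) by rewrite MM.
  rewrite -Rintegral_cst// Rintegral_mkcond.
  apply: le_Rint => //.
    rewrite -restrict_EFin -integrable_mkcond//.
    apply: continuous_compact_integrable; first exact: segment_compact.
    by apply: continuous_subspaceT => x; exact: cvg_cst.
  move=> x; rewrite /patch; case: ifPn => [|_]; last exact: bump_ge0.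
  rewrite inE/= in_itv/= -ler_norml => h; apply: bm.
  by rewrite normrM gtr0_norm ?invr_gt0// ler_pdivrMl.
have I0 : 0 < I by apply: lt_le_trans Ime; rewrite mulr_gt0.
have II : I^-1 <= (m * e)^-1 by rewrite lef_pV2 ?posrE// mulr_gt0.
pose phi (x : R) := I^-1 * bump (e^-1 * x).
have sphi : smooth phi by exact: smooth_scale.
have vphi : vanishes_off e phi by move=> x h; rewrite /phi [bump _]vbe// mulr0.
have phiC : C1 phi (fun x => I^-1 * (e^-1 * derive1 bump (e^-1 * x))).
  have bC := C1_affine e^-1 0 (smooth_C1 sB).
  have cC : C1 (fun=> I^-1) (fun=> 0) by split => x; [exact: is_derive_cst|exact: cvg_cst].
  have := C1M cC bC; rewrite /phi.
  under eq_fun do rewrite addr0.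
  by under [X in C1 _ X]eq_fun do rewrite addr0 mul0r add0r.
exists phi; split.
- split => //.
  + by move=> x; rewrite mulr_ge0 ?bump_ge0// invr_ge0 ltW.
  + by rewrite RintZl ?mulVf ?gt_eqF//; exact: L1_measurable ibe.
- move=> x; apply: (@le_trans _ _ ((m * e)^-1 * B)).
    by rewrite ler_pM ?bump_ge0 ?invr_ge0 ?(ltW I0)// (le_trans (ler_norm _)).
  rewrite invfM mulrC mulrA ler_pM2r ?invr_gt0// ler_pM2r ?invr_gt0//; lra.
- rewrite (C1_derive1 phiC).
  have cphi' : continuous (fun x => I^-1 * (e^-1 * derive1 bump (e^-1 * x))).
    by case: phiC.
  apply: le_trans (Rint_le_bounded cphi' (vanishes_off_derive phiC vphi)
    (ltW e0) (B := (m * e)^-1 * (e^-1 * B')) _) _.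
    have h1 : `|I^-1| = I^-1 by rewrite gtr0_norm ?invr_gt0.
    have h2 : `|e^-1| = e^-1 by rewrite gtr0_norm ?invr_gt0.
    have [I0' e0'] : 0 <= I^-1 /\ 0 <= e^-1 by rewrite !invr_ge0 !ltW.
    by move=> x; rewrite !normrM h1 h2; apply: ler_pM => //;
      [exact: mulr_ge0|exact: ler_wpM2l].
  have -> : (m * e)^-1 * (e^-1 * B') * (2 * e) = 2 * B' / m / e.
    by field; rewrite !gt_eqF.
  by rewrite ler_pM2r ?invr_gt0// ler_pM2r ?invr_gt0//; lra.
Qed.

Lemma tensor_continuous f g : continuous f -> continuous g ->
  continuous (fun p : R * R => f p.1 * g p.2).
Proof.
move=> cf cg p; apply: cvgM.
  by apply: (@continuous_comp _ _ _ fst f); [exact: cvg_fst|exact: cf].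
by apply: (@continuous_comp _ _ _ snd g); [exact: cvg_snd|exact: cg].
Qed.

Lemma tensor_Ck k f g : smooth f -> smooth g -> Ck k (fun p => f p.1 * g p.2).
Proof.
elim: k f g => [|k IH] f g sf sg /=.
  by apply: tensor_continuous; exact: smooth_continuous.
have df (h : R -> R) x : smooth h -> derivable h x 1.
  by move/smooth_C1 => [/(_ x) []].
have E1 : d1 (fun p => f p.1 * g p.2) = (fun p : R * R => derive1 f p.1 * g p.2).
  apply/funext => -[x y]; rewrite /d1/= derive1E [in RHS]derive1E.
  under eq_fun do rewrite mulrC.
  by rewrite (deriveZ (g y) (df _ x sf)) mulrC.
have E2 : d2 (fun p => f p.1 * g p.2) = (fun p : R * R => f p.1 * derive1 g p.2).
  apply/funext => -[x y]; rewrite /d2/= derive1E [in RHS]derive1E.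
  by rewrite (deriveZ (f x) (df _ y sg)).
split.
- by apply: tensor_continuous; exact: smooth_continuous.
- move=> p; apply: (derivableM (df _ _ sf)); exact: derivable_cst.
- move=> p; apply: derivableM (df _ _ sg); exact: derivable_cst.
- by rewrite E1; apply: IH => //; exact: smooth_derive.
- by rewrite E2; apply: IH => //; exact: smooth_derive.
Qed.

Lemma tensor_Cc_infty f g M N : smooth f -> smooth g ->
  vanishes_off M f -> vanishes_off N g -> Cc_infty (fun p => f p.1 * g p.2).
Proof.
move=> sf sg vf vg; split; first by move=> k; exact: tensor_Ck.
pose K := `[- M, M]%classic `*` `[- N, N]%classic : set (R * R).
have cK : compact K by apply: compact_setX; exact: segment_compact.
apply: (subclosed_compact _ cK); first exact: closed_closure.
have clK : closed K by apply: compact_closed => //; exact: norm_hausdorff.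
rewrite (closure_id K).1//.
apply: closure_subset => -[x y] /=.
rewrite mulf_eq0 negb_or => /andP[fx gy]; split; rewrite /= in_itv/= -ler_norml leNgt;
  apply/negP => h.
- by rewrite vf ?eqxx in fx.
- by rewrite vg ?eqxx in gy.
Qed.

End mollifiers.

(** * Oscillation of the level sets of a function of bounded variation *)

Section levels.
Context {R : realType}.
Local Notation leb := (@lebesgue_measure R).

(** [psi xi u] is the kinetic function: twice the indicator of the subgraph of
    [u] is [1 - psi]. *)
Definition psi (xi u : R) : R := Num.sg (xi - u).

Lemma normr_psi xi u : `|psi xi u| <= 1.
Proof. by rewrite /psi normr_sg; case: (_ != 0). Qed.

Lemma ae_neq (a : R) : {ae leb, forall x, x != a}.
Proof.
exists [set a]; split => //; first exact: lebesgue_measure_set1.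
by move=> x /= /negP; rewrite negbK => /eqP.
Qed.

Lemma sg_lt (x a : R) : x < a -> Num.sg (x - a) = -1.
Proof. by move=> h; rewrite ltr0_sg ?subr_lt0. Qed.

Lemma sg_gt (x a : R) : a < x -> Num.sg (x - a) = 1.
Proof. by move=> h; rewrite gtr0_sg ?subr_gt0. Qed.

(** [psi] takes the values 1 and -1, and separates [a] from [b] exactly at the
    levels between them. *)
Lemma psi_jump a b xi : xi != a -> xi != b ->
  [/\ `|psi xi a - psi xi b| = 2 * \1_`[Num.min a b, Num.max a b] xi,
    1 - psi xi a * psi xi b = 2 * \1_`[Num.min a b, Num.max a b] xi &
    psi xi a * psi xi a = 1].
Proof.
rewrite /psi indicE mem_setE in_itv/=.
wlog ab : a b / a <= b => [H|].
  case: (leP a b) => [|/ltW] ab xa xb; first by have := H _ _ ab xa xb; rewrite min_l// max_r.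
  have [] := H _ _ ab xb xa; rewrite min_l// max_r// => h1 h2 _; split.
  - by rewrite distrC h1.
  - by rewrite mulrC.
  - by case: (ltgtP xi a) xa => // h _; rewrite ?(sg_lt h) ?(sg_gt h); lra.
rewrite min_l// max_r//.
have n2 : `|1 - -1| = 2 :> R by rewrite ger0_norm; lra.
have n2' : `|-1 - 1| = 2 :> R by rewrite ler0_norm; lra.
by case: (ltgtP xi a) => // ha _; case: (ltgtP xi b) => // hb _ /=;
  rewrite ?(sg_lt ha) ?(sg_gt ha) ?(sg_lt hb) ?(sg_gt hb) ?subrr ?normr0 ?n2 ?n2';
  split; lra.
Qed.

Lemma measurable_psi : measurable_fun setT (fun p : R * R => psi p.1 p.2).
Proof. by rewrite /psi; meas. Qed.

Lemma integral_indic_between (a b : R) :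
  (\int[leb]_xi (2 * \1_`[Num.min a b, Num.max a b] xi)%:E = (2 * `|a - b|)%:E)%E.
Proof.
rewrite ge0_integralrZl//.
rewrite integral_indic// setIT /= lebesgue_measure_itv/= lte_fin EFinM; congr (_ * _)%E.
case: (ltgtP a b) => ab; rewrite -?EFinB.
- by rewrite ab distrC ger0_norm// subr_ge0 ltW.
- by rewrite ab ger0_norm// subr_ge0 ltW.
- by rewrite ab ltxx subrr normr0.
Qed.

Lemma integral_psi_dist (a b : R) :
  (\int[leb]_xi `|psi xi a - psi xi b|%:E = (2 * `|a - b|)%:E)%E.
Proof.
rewrite -integral_indic_between; apply: ae_eq_integral => //.
- by have mp := measurable_psi; meas.
- by apply/measurable_EFinP/measurable_funM => //; exact: measurable_indic.
- apply: ae_imp (ae_and (ae_neq a) (ae_neq b)) => xi [ha hb] _; by case: (psi_jump ha hb) => ->.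
Qed.

Lemma integral_psi_prod (a b : R) :
  (\int[leb]_xi (1 - psi xi a * psi xi b)%:E = (2 * `|a - b|)%:E)%E.
Proof.
rewrite -integral_indic_between; apply: ae_eq_integral => //.
- by have mp := measurable_psi; meas.
- by apply/measurable_EFinP/measurable_funM => //; exact: measurable_indic.
- apply: ae_imp (ae_and (ae_neq a) (ae_neq b)) => xi [ha hb] _; by case: (psi_jump ha hb) => _ ->.
Qed.

(** The quantitative trace of bounded variation that the doubling of variables
    uses: shifting [u] by an amount that may depend on the level [xi]. *)
Definition osc_bound (u : R -> R) (K : R) : Prop :=
  forall (h : R -> R) (H : R), measurable_fun setT h -> (forall xi, `|h xi| <= H) ->
  (\int[leb]_xi \int[leb]_y `|psi xi (u (y + h xi)%R) - psi xi (u y)|%:E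
    <= (8 * H * K)%:E)%E.

Lemma le_integral_itv (F : R -> R) (c : \bar R) : measurable_fun setT F ->
  (forall y, 0 <= F y) ->
  (forall n : nat, \int[leb]_(y in `[(- n%:R)%R, (n%:R)%R]) (F y)%:E <= c)%E ->
  (\int[leb]_y (F y)%:E <= c)%E.
Proof.
move=> mF F0 h; pose I (n : nat) : set R := `[- n%:R, n%:R]%classic.
have UI : \bigcup_n I n = setT.
  apply/seteqP; split => // y _; exists (Num.truncn `|y|).+1 => //=.
  by rewrite /I /= in_itv/= -ler_norml; apply/ltW/truncnS_gt.
have cv := @ge0_nondecreasing_set_cvg_integral _ (measurableTypeR R) R I (EFin \o F) leb.
rewrite -UI; apply: (cvge_le _ (cv _ _ _ _)).
- by apply: nearW => n; exact: h.
- move=> m n mn; apply/subsetPset => y; rewrite /I /= !in_itv/= => /andP[h1 h2].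
  have : (m%:R : R) <= n%:R by rewrite ler_nat.
  by move=> ?; apply/andP; split; lra.
- by move=> n; exact: measurable_itv.
- by move=> n; apply/measurable_EFinP; exact: measurable_funTS.
- by move=> n y _; rewrite lee_fin.
Qed.

(** A monotone function of total increase [K] increases by [2 * H * K] in total
    over all windows of length [2 * H]: telescope the two shifted integrals. *)
Lemma integral_monotone_increment (V : R -> R) (H K : R) : 0 <= H ->
  {homo V : x y / x <= y} -> (forall a b, a <= b -> V b - V a <= K) ->
  (\int[leb]_y (V (y + H) - V (y - H))%:E <= (2 * H * K)%:E)%E.
Proof.
move=> H0 Vh VK; have mV : measurable_fun setT V by exact: nondecreasing_measurable.
have K0 : 0 <= K by apply: le_trans (VK 0 0 (lexx _)); rewrite subrr.
apply: le_integral_itv.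
- by meas.
- by move=> y; rewrite subr_ge0; apply: Vh; lra.
move=> n; pose N : R := n%:R; have N0 : 0 <= N by rewrite ler0n.
pose c := V (- N - H).
pose A (y : R) := (V y - c) * \1_`[- N + H, N + H] y.
pose B (y : R) := (V y - c) * \1_`[- N - H, N - H] y.
have aux (p q : R) : - N - H <= p -> q <= N + H ->
    L1 leb (fun y => (V y - c) * \1_`[p, q] y).
  move=> hp hq; apply: (L1_le (mu := leb) (g := fun y => K * \1_`[p, q] y)).
  - by apply: measurable_funM; [meas|exact: measurable_indic].
  - move=> y; rewrite indicE mem_setE.
    have [hy|_] := boolP (y \in `[p, q]%R); last by rewrite !mulr0 normr0.
    rewrite !mulr1.
    have cy : - N - H <= y by move: hy; rewrite in_itv/= => /andP[]; lra.
    by rewrite ger0_norm ?subr_ge0 ?Vh// VK.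
  - by apply: L1Zl; exact: L1_indic_itv.
have iA : L1 leb A by apply: aux; lra.
have iB : L1 leb B by apply: aux; lra.
have E y : \1_`[- N, N] y * (V (y + H) - V (y - H)) = A (y + H) - B (y - H).
  rewrite /A /B !indicE !mem_setE !in_itv/= !lerD2r.
  by case: (_ && _); rewrite ?mul1r ?mulr1 ?mul0r ?mulr0; lra.
have iAB : L1 leb (fun y => A (y + H) - B (y - H)).
  by apply: L1B; [have := L1_shift (- H) iA; under eq_fun do rewrite opprK|exact: L1_shift].
rewrite integral_mkcond.
rewrite (_ : (\int[leb]_y _)%E = (\int[leb]_y (A (y + H) - B (y - H)))%:E)%E; last first.
  rewrite RintE//; apply: eq_integral => y _; rewrite -E /patch indicE.
  by case: ifPn => _; rewrite ?mul1r ?mul0r.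
rewrite lee_fin RintB//; last 2 first.
- by have := L1_shift (- H) iA; under eq_fun do rewrite opprK.
- exact: L1_shift.
rewrite (Rint_addr H (L1_measurable iA)) (Rint_addr (- H) (L1_measurable iB)) -RintB//.
have -> : 2 * H * K = \int[leb]_y (K * \1_`[N - H, N + H] y).
  rewrite RintZl; last exact: measurable_indic.
  rewrite /Rintegral integral_indic// setIT /= lebesgue_measure_itv/= lte_fin.
  case: ifPn => [_|]; first by rewrite -EFinB /=; ring.
  by rewrite -leNgt => h /=; rewrite (_ : H = 0) ?mulr0 ?mul0r//; lra.
apply: le_Rint; [exact: L1B|by apply: L1Zl; exact: L1_indic_itv|] => y.
rewrite /A /B !indicE !mem_setE !in_itv/=.
case: (leP (- N - H) y) => h1 /=; last first.
  by rewrite (leNgt (- N + H)) (_ : y < - N + H) ?mulr0 ?subr0 ?mulr_ge0 ?ler0n//; lra.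
case: (leP y (N + H)) => h2; last first.
  by rewrite andbF (leNgt y) (_ : N - H < y) ?andbF ?mulr0 ?subr0 ?mulr_ge0 ?ler0n//; lra.
have p0 : 0 <= V y - c by rewrite subr_ge0 Vh.
have pK : V y - c <= K by exact: VK.
case: (leP y (N - H)) => h3 /=.
  rewrite !mulr1 (le_trans (y := 0)) ?mulr_ge0 ?ler0n// subr_le0.
  by rewrite ler_piMr// lern1 leq_b1.
rewrite (ltW h3) /= mulr0 subr0 mulr1 (le_trans _ pK)//.
by rewrite ler_piMr// lern1 leq_b1.
Qed.

(** The level [xi] can separate [u (y + h xi)] from [u y] only if [xi] lies
    within the increment of [V] over [[y - H, y + H]] of [u y]. These levels no
    longer depend on [h]; integrating over [xi] first leaves four times that
    increment. *)
Lemma osc_bound_of_monotone (u g V : R -> R) (K : R) :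
  measurable_fun setT u -> {ae leb, forall x, u x = g x} ->
  {homo V : x y / x <= y} -> (forall a b, a <= b -> V b - V a <= K) ->
  (forall a b, a <= b -> `|g b - g a| <= V b - V a) -> osc_bound u K.
Proof.
move=> mu ug Vh VK gV h H mh hH; have H0 : 0 <= H by exact: le_trans (hH 0).
have mV : measurable_fun setT V by exact: nondecreasing_measurable.
have mp := measurable_psi.
pose v (y : R) := V (y + H) - V (y - H).
have v0 y : 0 <= v y by rewrite subr_ge0; apply: Vh; lra.
have mv : measurable_fun setT v by rewrite /v; meas.
pose I (xi y : R) : R := \1_(`[0, +oo[%classic : set R) (v y - `|xi - u y|).
have mI : measurable_fun setT (fun p : R * R => I p.1 p.2).
  have m1 : measurable_fun setT (\1_(`[0, +oo[%classic : set R) : R -> R).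
    exact: measurable_indic.
  by rewrite /I; meas.
have I0 xi y : 0 <= I xi y by rewrite /I indicE.
apply: (@le_trans _ _ (\int[leb]_xi \int[leb]_y (2 * I xi y)%:E)%E).
  apply: le_integralT.
  - by apply: measurable_integral => //; meas.
  - by apply: measurable_integral => [|x y]; [meas|rewrite mulr_ge0].
  - by move=> xi; apply: integral_ge0.
  move=> xi; apply: ae_le_integralT => //.
  - by meas.
  - by meas.
  - by move=> y; rewrite lee_fin mulr_ge0.
  apply: ae_imp (ae_and ug (ae_addr (h xi) ug)) => y [h1 h2].
  rewrite lee_fin h1 h2 /I indicE mem_setE in_itv/= andbT subr_ge0 h1.
  have gv : `|g (y + h xi) - g y| <= v y.
    have [hx|hx] := leP 0 (h xi).
      apply: le_trans (gV _ _ _) _; first lra.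
      have hxH := hH xi; rewrite ger0_norm// in hxH.
      have := Vh (y + h xi) (y + H); have := Vh (y - H) y; rewrite /v; lra.
    rewrite distrC; apply: le_trans (gV _ _ _) _; first lra.
    have hxH := hH xi; rewrite ltr0_norm// in hxH.
    have := Vh y (y + H); have := Vh (y - H) (y + h xi); rewrite /v; lra.
  case: (leP `|xi - g y| (v y)) => [_|vx].
    rewrite mulr1; apply: le_trans (ler_normB _ _) _.
    by have := normr_psi xi (g (y + h xi)); have := normr_psi xi (g y); lra.
  rewrite mulr0 /psi; set a := g (y + h xi) in gv *; set b := g y in gv vx *.
  have : v y < `|xi - b| by [].
  case: (ltgtP xi b) => hb; last by rewrite hb subrr normr0; have := v0 y; lra.
    rewrite ltr0_norm ?subr_lt0// (sg_lt hb) => hv.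
    rewrite sg_lt ?subrr ?normr0//.
    by have := ler_norm (b - a); rewrite distrC; lra.
  rewrite gtr0_norm ?subr_gt0// (sg_gt hb) => hv.
  rewrite sg_gt ?subrr ?normr0//.
  by have := ler_norm (a - b); lra.
rewrite (tonelli leb leb (f := fun xi y => 2 * I xi y)); [|by meas|by move=> x y; rewrite mulr_ge0].
have E y : (\int[leb]_xi (2 * I xi y)%:E = (4 * v y)%:E)%E.
  rewrite ge0_integralrZl//; last exact: (measurable_sliceC y mI).
  have I1 xi : I xi y = \1_`[u y - v y, u y + v y] xi.
    rewrite /I !indicE !mem_setE !in_itv/= andbT subr_ge0 ler_norml.
    by rewrite lerBrDl (lerBlDl xi).
  under eq_integral do rewrite I1.
  rewrite integral_indic// setIT /= lebesgue_measure_itv/= lte_fin -!EFinB.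
  case: ifPn => [_|]; first by rewrite -EFinM; congr EFin; lra.
  by rewrite -leNgt => hv; rewrite mule0 (_ : v y = 0) ?mulr0//; have := v0 y; lra.
under eq_integral do rewrite E.
rewrite ge0_integralrZl//.
rewrite (_ : 8 * H * K = 4 * (2 * H * K)); last by ring.
by rewrite EFinM lee_wpmul2l// integral_monotone_increment.
Qed.

End levels.

Section oscillation.
Context {R : realType}.
Local Notation leb := (@lebesgue_measure R).

Lemma integral2_triangle (f g h : R -> R -> R) :
  measurable_fun setT (fun p : R * R => f p.1 p.2) ->
  measurable_fun setT (fun p : R * R => g p.1 p.2) ->
  measurable_fun setT (fun p : R * R => h p.1 p.2) ->
  (forall x y, `|f x y| <= `|g x y| + `|h x y|) ->
  (\int[leb]_x \int[leb]_y `|f x y|%:E <=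
   \int[leb]_x \int[leb]_y `|g x y|%:E + \int[leb]_x \int[leb]_y `|h x y|%:E)%E.
Proof.
move=> mf mg mh fgh.
have mi (k : R -> R -> R) : measurable_fun setT (fun p : R * R => k p.1 p.2) ->
    measurable_fun setT (fun x => \int[leb]_y `|k x y|%:E)%E.
  by move=> mk; apply: measurable_integral => //; meas.
rewrite -ge0_integralD//; last 4 first.
- by move=> x _; apply: integral_ge0.
- exact: mi.
- by move=> x _; apply: integral_ge0.
- exact: mi.
apply: le_integralT; [exact: mi|by apply: emeasurable_funD; exact: mi|by move=> x; apply: integral_ge0|].
move=> x; rewrite -ge0_integralD//; last 2 first.
- by meas.
- by meas.
apply: le_integralT => //; [by meas|by apply: emeasurable_funD; meas|].
by move=> y; rewrite -EFinD lee_fin.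
Qed.

Lemma integral_psi_shift (u u' h : R -> R) : measurable_fun setT u ->
  measurable_fun setT u' -> measurable_fun setT h ->
  (\int[leb]_xi \int[leb]_y
     `|psi xi (u (y + h xi)%R) - psi xi (u' (y + h xi)%R)|%:E =
   2%:E * \int[leb]_y `|u y - u' y|%:E)%E.
Proof.
move=> mu mu' mh; have mp := @measurable_psi R.
under eq_integral => xi _.
  rewrite (ge0_integral_addr (h xi)
    (f := fun y => `|psi xi (u y) - psi xi (u' y)|%:E)); [over|by meas|by []].
rewrite (tonelli leb leb (f := fun xi y => `|psi xi (u y) - psi xi (u' y)|))//; last by meas.
rewrite -ge0_integralrZl//; last by meas.
by apply: eq_integral => y _; rewrite integral_psi_dist.
Qed.

(** Bounded variation enters through [osc_bound] only, and this bound, unlike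
    total variation, passes to limits in L^1 by the triangle inequality. *)
Lemma osc_bound_closed (u : R -> R) (K : R) : measurable_fun setT u ->
  (forall e : R, 0 < e -> exists u', [/\ measurable_fun setT u', osc_bound u' K &
     (\int[leb]_y `|u y - u' y|%:E <= e%:E)%E]) -> osc_bound u K.
Proof.
move=> mu H h B mh hB; have mp := @measurable_psi R.
apply/lee_addgt0Pr => e e0; have e40 : 0 < e / 4 by lra.
have [u' [mu' ou' du']] := H _ e40.
have m0 : measurable_fun setT (fun=> 0 : R) by meas.
have S k : measurable_fun setT k ->
    (\int[leb]_xi \int[leb]_y `|psi xi (u (y + k xi)%R) - psi xi (u' (y + k xi)%R)|%:E
      <= (e / 2)%:E)%E.
  move=> mk; rewrite integral_psi_shift// (_ : e / 2 = 2 * (e / 4)); last by lra.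
  by rewrite EFinM lee_wpmul2l.
apply: le_trans (integral2_triangle (g := fun xi y => psi xi (u' (y + h xi)) - psi xi (u' y))
  (h := fun xi y => `|psi xi (u (y + h xi)) - psi xi (u' (y + h xi))|
    + `|psi xi (u (y + 0)) - psi xi (u' (y + 0))|) _ _ _ _) _.
- by meas.
- by meas.
- by meas.
- move=> xi y; rewrite addr0 [X in _ <= _ + X]ger0_norm ?addr_ge0//.
  rewrite (_ : psi xi (u (y + h xi)) - psi xi (u y) =
    (psi xi (u' (y + h xi)) - psi xi (u' y)) +
    ((psi xi (u (y + h xi)) - psi xi (u' (y + h xi)))
    - (psi xi (u y) - psi xi (u' y)))); last by lra.
  by apply: le_trans (ler_normD _ _) _; rewrite lerD2l; exact: ler_normB.
apply: leeD; first exact: ou'.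
apply: le_trans (integral2_triangle (g := fun xi y => psi xi (u (y + h xi)) - psi xi (u' (y + h xi)))
  (h := fun xi y => psi xi (u (y + 0)) - psi xi (u' (y + 0))) _ _ _ _) _.
- by meas.
- by meas.
- by meas.
- by move=> xi y; rewrite ger0_norm ?addr_ge0.
by rewrite (_ : e = e / 2 + e / 2) ?EFinD; [apply: leeD; exact: S|lra].
Qed.

(** The variation function of [g] from the origin, with its sign. *)
Lemma monotone_of_TV (g : R -> R) (K : R) :
  (forall a b : R, a <= b -> (total_variation a b g <= K%:E)%E) ->
  exists V : R -> R, [/\ {homo V : x y / x <= y},
    forall a b, a <= b -> V b - V a <= K &
    forall a b, a <= b -> `|g b - g a| <= V b - V a].
Proof.
move=> gK.
have fn (a b : R) : a <= b -> total_variation a b g \is a fin_num.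
  move=> ab; rewrite ge0_fin_numE ?total_variation_ge0//.
  by rewrite (le_lt_trans (gK _ _ ab)) ?ltry.
pose t (a b : R) : R := fine (total_variation a b g).
pose V (x : R) : R := if 0 <= x then t 0 x else - t x 0.
have tD (a c b : R) : a <= c -> c <= b -> t a b = t a c + t c b.
  move=> ac cb; rewrite /t (total_variationD _ ac cb) fineD//; exact: fn.
have VE (a b : R) : a <= b -> V b - V a = t a b.
  move=> ab; rewrite /V; case: (leP 0 a) => a0; case: (leP 0 b) => b0.
  - by rewrite (tD 0 a b)//; lra.
  - by exfalso; lra.
  - by rewrite (tD a 0 b)//; lra.
  - by rewrite (tD a b 0)//; lra.
have t0 (a b : R) : a <= b -> 0 <= t a b.
  by move=> ab; rewrite fine_ge0// total_variation_ge0.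
exists V; split.
- by move=> a b ab; rewrite -subr_ge0 VE// t0.
- by move=> a b ab; rewrite VE// -lee_fin fineK ?fn// gK.
- by move=> a b ab; rewrite VE// -lee_fin fineK ?fn// total_variation_ge.
Qed.

(** The total variation of the class of [u] is an infimum over representatives;
    allowing [K + 1] makes a representative available. *)
Lemma osc_bound_TV (u : R -> R) (K : R) : measurable_fun setT u ->
  (Defs.TV u <= K%:E)%E -> osc_bound u (K + 1).
Proof.
move=> mu uK.
have : (Defs.TV u < (K + 1)%:E)%E by rewrite (le_lt_trans uK)// lte_fin ltrDl.
move=> /ereal_inf_lt [_ [g /= ug <-]] gK.
have [V [Vh VK gV]] : exists V : R -> R, [/\ {homo V : x y / x <= y},
    forall a b, a <= b -> V b - V a <= K + 1 &
    forall a b, a <= b -> `|g b - g a| <= V b - V a].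
  apply: monotone_of_TV => a b ab; apply: le_trans (ltW gK).
  by apply: ereal_sup_ubound; exists (a, b).
apply: (osc_bound_of_monotone mu _ Vh VK gV).
by apply: ae_imp ug => x; apply.
Qed.

(** The mollified kinetic function along the characteristic shift [f]. *)
Definition wk (g f u : R -> R) (xi y : R) : R :=
  conv (fun x => psi xi (u x)) g (y + f xi).

Lemma wkE g f u xi y : measurable_fun setT u -> measurable_fun setT g ->
  wk g f u xi y = \int[leb]_a (psi xi (u (a + (y + f xi))) * g a).
Proof.
move=> mu mg; have mp := @measurable_psi R; rewrite /wk /conv.
rewrite -(Rint_addr (y + f xi)); last by meas.
by apply: eq_Rint => a; rewrite addrK.
Qed.

Lemma measurable_wk_gen d (X : measurableType d) (g : R -> R)
    (u : X -> R -> R) (Y XI : X -> R) :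
  measurable_fun setT g ->
  measurable_fun setT (fun p : X * R => u p.1 p.2) ->
  measurable_fun setT Y -> measurable_fun setT XI ->
  measurable_fun setT (fun x => conv (fun a => psi (XI x) (u x a)) g (Y x)).
Proof.
move=> mg mu mY mX; have mp := @measurable_psi R.
apply: (measurable_Rint leb (f := fun x a => psi (XI x) (u x a) * g (a - Y x))).
by meas.
Qed.

Lemma measurable_wk (g f u : R -> R) : measurable_fun setT g ->
  measurable_fun setT f -> measurable_fun setT u ->
  measurable_fun setT (fun p : R * R => wk g f u p.1 p.2).
Proof.
move=> mg mf mu.
by apply: (measurable_wk_gen (u := fun p : R * R => u)) => //; meas.
Qed.

Lemma normr_wk g f u xi y : measurable_fun setT u -> L1 leb g ->
  `|wk g f u xi y| <= \int[leb]_a `|g a|.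
Proof.
move=> mu gi; have mg := L1_measurable gi; rewrite wkE//.
have mp := @measurable_psi R.
have i1 : L1 leb (fun a => psi xi (u (a + (y + f xi))) * g a).
  by apply: (L1_bounded_M (A := 1)) => //; [meas|move=> a; exact: normr_psi].
apply: le_trans (le_normr_Rintegral measurableT i1) _.
apply: le_Rint; [exact: L1_norm|exact: L1_norm|] => a.
by rewrite normrM ler_piMl// normr_psi.
Qed.

(** Mollification at scale [M] displaces the kinetic function in L^1 by at most
    a multiple of [M]; with [\int g = 0] this is a bound on derivatives. *)
Lemma wk_close (g f f' u : R -> R) (M H K : R) : continuous g ->
  vanishes_off M g -> 0 <= M -> measurable_fun setT u -> measurable_fun setT f ->
  measurable_fun setT f' -> osc_bound u K ->
  (forall xi, `|f xi - f' xi| <= H) ->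
  (\int[leb]_xi \int[leb]_y
     `|wk g f u xi y - psi xi (u (y + f' xi)%R) * \int[leb]_a g a|%:E
   <= (8 * (M + H) * K * \int[leb]_a `|g a|)%:E)%E.
Proof.
move=> cg vg M0 mu mf mf' ou fH; have mp := @measurable_psi R.
have gi := L1_vanishes_off cg vg; have mg := L1_measurable gi.
pose D xi y a := psi xi (u (a + (y + f xi))) - psi xi (u (y + f' xi)).
have mD : measurable_fun setT (fun p : R * R * R => D p.1.1 p.1.2 p.2).
  by rewrite /D; meas.
have E xi y : wk g f u xi y - psi xi (u (y + f' xi)) * \int[leb]_a g a
    = \int[leb]_a (D xi y a * g a).
  rewrite wkE// -RintZl// -RintB//.
  - by apply: eq_Rint => a; rewrite /D; ring.
  - by apply: (L1_bounded_M (A := 1)) => //; [meas|move=> a; exact: normr_psi].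
  - exact: L1Zl.
pose F xi y a := `|D xi y a| * `|g a|.
have mF : measurable_fun setT (fun p : R * R * R => F p.1.1 p.1.2 p.2).
  by rewrite /F /D; meas.
have F0 xi y a : 0 <= F xi y a by rewrite mulr_ge0.
apply: (@le_trans _ _ (\int[leb]_xi \int[leb]_y \int[leb]_a (F xi y a)%:E)%E).
  have mW := measurable_wk mg mf mu.
  apply: le_integralT.
  - by apply: measurable_integral => //; meas.
  - exact: (measurable_integral2 leb leb mF F0).
  - by move=> xi; apply: integral_ge0.
  move=> xi; apply: le_integralT => //.
  - by meas.
  - exact: (measurable_slice (f := fun xi y => \int[leb]_a (F xi y a)%:E)%E xi
      (measurable_integral_inner leb mF F0)).
  move=> y; rewrite E; apply: le_trans (normr_Rint_le _ _) _.
    by apply: measurable_funM => //; exact: (measurable_slice (f := fun p : R * R => D p.1 p.2) (xi, y) mD).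
  by under eq_integral do rewrite normrM.
rewrite (tonelli3 leb leb leb mF F0).
have mI1 (a : R) : measurable_fun setT (fun p : R * R => `|D p.1 p.2 a|).
  by rewrite /D; meas.
apply: (@le_trans _ _ (\int[leb]_a (8 * (M + H) * K * `|g a|)%:E)%E).
  apply: le_integralT.
  - apply: (measurable_integral2 leb leb (F := fun a xi y => F xi y a)) => //.
    by rewrite /F /D; meas.
  - by meas.
  - by move=> a; apply: integral_ge0 => xi _; apply: integral_ge0 => y _; rewrite lee_fin.
  move=> a; have [Ma|aM] := ltP M `|a|.
    rewrite vg// normr0 mulr0 integral0_eq// => xi _; rewrite integral0_eq// => y _.
    by rewrite /F vg// normr0 mulr0.
  have -> : (\int[leb]_xi \int[leb]_y (F xi y a)%:E = `|g a|%:E *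
      \int[leb]_xi \int[leb]_y `|psi xi (u (y + (a + (f xi - f' xi)))%R) - psi xi (u y)|%:E)%E.
    transitivity (\int[leb]_xi \int[leb]_y (`|g a| * `|D xi y a|)%:E)%E.
      by apply: eq_integral => xi _; apply: eq_integral => y _; rewrite /F mulrC.
    apply: (etrans (ge0_integral2rZl leb leb (normr_ge0 _) (mI1 a) (fun _ _ => normr_ge0 _))).
    apply: (congr1 (fun c => `|g a|%:E * c)%E); apply: eq_integral => xi _.
    rewrite -(ge0_integral_addr (f' xi) (f := fun y =>
      `|psi xi (u (y + (a + (f xi - f' xi)))) - psi xi (u y)|%:E)); [|by meas|by []].
    apply: eq_integral => y _; rewrite /D.
    by rewrite (_ : a + (y + f xi) = y + f' xi + (a + (f xi - f' xi))); last by lra.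
  rewrite mulrC EFinM lee_wpmul2l//.
  apply: ou; first by meas.
  by move=> xi; apply: le_trans (ler_normD _ _) _; rewrite lerD.
have gi' : L1 leb (fun a => 8 * (M + H) * K * `|g a|) by apply/L1Zl/L1_norm.
by rewrite -RintE// lee_fin RintZl//; meas.
Qed.

End oscillation.

(** * The product rule for continuous functions of finite variation *)

Section product_rule.
Context {R : realType}.

Definition pos_step (z : R) : R := \1_(`]0, +oo[%classic : set R) z.
Definition nneg_step (z : R) : R := \1_(`[0, +oo[%classic : set R) z.

Lemma measurable_pos_step : measurable_fun setT pos_step.
Proof. exact: measurable_indic. Qed.

Lemma measurable_nneg_step : measurable_fun setT nneg_step.
Proof. exact: measurable_indic. Qed.

Lemma pos_stepE z : pos_step z = ((0 < z)%R)%:R.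
Proof. by rewrite /pos_step indicE mem_setE in_itv/= andbT. Qed.

Lemma nneg_stepE z : nneg_step z = ((0 <= z)%R)%:R.
Proof. by rewrite /nneg_step indicE mem_setE in_itv/= andbT. Qed.

Lemma normr_boolr (c : bool) : `|c%:R : R| <= 1.
Proof. by case: c; rewrite ?normr1 ?normr0. Qed.

Section bilinear.
Context d d' (X : measurableType d) (Y : measurableType d').
Variables (mu : {sigma_finite_measure set X -> \bar R})
  (nu : {sigma_finite_measure set Y -> \bar R}).
Variables (a tau : X -> R) (b tau' : Y -> R).
Hypotheses (ia : L1 mu a) (ib : L1 nu b).
Hypotheses (mtau : measurable_fun setT tau) (mtau' : measurable_fun setT tau').

Lemma L1_step (k : X -> R) : measurable_fun setT k -> (forall x, `|k x| <= 1) ->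
  L1 mu (fun x => k x * a x).
Proof.
move=> mk k1; have ma := L1_measurable ia.
apply: (L1_le (mu := mu) (g := fun x => `|a x|)); [by meas| |exact: L1_norm].
by move=> x; rewrite normrM ler_piMl.
Qed.

Lemma double_L1 (k : X -> Y -> R) :
  measurable_fun setT (fun p : X * Y => k p.1 p.2) ->
  (forall x y, `|k x y| <= 1) ->
  (\int[mu]_x \int[nu]_y `|k x y * (a x * b y)|%:E < +oo)%E.
Proof.
move=> mk k1; have ma := L1_measurable ia; have mb := L1_measurable ib.
apply: (tensor_lty _ ia ib); first by meas.
by move=> x y; rewrite !normrM ler_piMl// mulr_ge0.
Qed.

(** Fubini on the two halves of the product, cut along the diagonal of the two
    times. *)
Lemma ibp_bilinear : (\int[mu]_x a x) * (\int[nu]_y b y) =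
  \int[mu]_x (a x * \int[nu]_y (pos_step (tau x - tau' y) * b y)) +
  \int[nu]_y (b y * \int[mu]_x (nneg_step (tau' y - tau x) * a x)).
Proof.
have ma := L1_measurable ia; have mb := L1_measurable ib.
have mp := measurable_pos_step; have mn := measurable_nneg_step.
have mk1 : measurable_fun setT (fun p : X * Y => pos_step (tau p.1 - tau' p.2)) by meas.
have mk2 : measurable_fun setT (fun p : X * Y => nneg_step (tau' p.2 - tau p.1)) by meas.
have k1 x y : `|pos_step (tau x - tau' y)| <= 1 by rewrite pos_stepE normr_boolr.
have k2 x y : `|nneg_step (tau' y - tau x)| <= 1 by rewrite nneg_stepE normr_boolr.
have d1 := double_L1 (k := fun x y => pos_step (tau x - tau' y)) mk1 k1.
have d2 := double_L1 (k := fun x y => nneg_step (tau' y - tau x)) mk2 k2.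
have ib1 x : L1 nu (fun y => pos_step (tau x - tau' y) * b y).
  apply: (L1_le (mu := nu) (g := fun y => `|b y|)); [by meas| |exact: L1_norm].
  by move=> y; rewrite normrM ler_piMl.
have ib2 x : L1 nu (fun y => nneg_step (tau' y - tau x) * b y).
  apply: (L1_le (mu := nu) (g := fun y => `|b y|)); [by meas| |exact: L1_norm].
  by move=> y; rewrite normrM ler_piMl.
have mab : measurable_fun setT (fun p : X * Y => a p.1 * b p.2) by meas.
have -> : \int[nu]_y (b y * \int[mu]_x (nneg_step (tau' y - tau x) * a x)) =
    \int[mu]_x (a x * \int[nu]_y (nneg_step (tau' y - tau x) * b y)).
  transitivity (\int[nu]_y \int[mu]_x (nneg_step (tau' y - tau x) * (a x * b y))).
    apply: eq_Rint => y; rewrite -RintZl; last by meas.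
    by apply: eq_Rint => x; ring.
  rewrite -(Rfubini (f := fun x y => nneg_step (tau' y - tau x) * (a x * b y)))//; last by meas.
  apply: eq_Rint => x; rewrite -RintZl; last by meas.
  by apply: eq_Rint => y; ring.
have H (k : X -> Y -> R) : measurable_fun setT (fun p : X * Y => k p.1 p.2) -> (forall x y, `|k x y| <= 1) ->
    L1 mu (fun x => a x * \int[nu]_y (k x y * b y)).
  move=> mk kk; have := L1_Rint (nu := nu) (f := fun x y => k x y * (a x * b y)) _ (double_L1 mk kk).
  rewrite (_ : (fun x => \int[nu]_y (k x y * (a x * b y))) =
    (fun x => a x * \int[nu]_y (k x y * b y))); first by apply; meas.
  apply/funext => x; have mkx := measurable_slice x mk.
  rewrite -RintZl; last by meas.
  by apply: eq_Rint => y; ring.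
rewrite -RintD; [|exact: (H (fun x y => pos_step (tau x - tau' y)))|
  exact: (H (fun x y => nneg_step (tau' y - tau x)))].
rewrite mulrC -RintZl//; apply: eq_Rint => x; rewrite -mulrDr mulrC -RintD//.
congr (_ * _); apply: eq_Rint => y; rewrite -mulrDl pos_stepE nneg_stepE subr_gt0 subr_ge0.
by rewrite ltNge; case: (_ <= _); rewrite ?add0r ?addr0 mul1r.
Qed.

End bilinear.

Section rule.
Context d1 d2 (X1 : measurableType d1) (X2 : measurableType d2).
Variables (mu1 : {finite_measure set X1 -> \bar R})
  (mu2 : {finite_measure set X2 -> \bar R}) (lam : {finite_measure set R -> \bar R}).
Variables (a1 tau1 : X1 -> R) (a2 tau2 : X2 -> R) (b1 b2 N1 N2 : R -> R) (s t B : R).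
Hypotheses (ia1 : L1 mu1 a1) (ia2 : L1 mu2 a2) (ib1 : L1 lam b1) (ib2 : L1 lam b2).
Hypotheses (mtau1 : measurable_fun setT tau1) (mtau2 : measurable_fun setT tau2).
Hypotheses (mN1 : measurable_fun setT N1) (mN2 : measurable_fun setT N2).
Hypotheses (bN1 : forall r, `|N1 r| <= B) (bN2 : forall r, `|N2 r| <= B).
Hypothesis st : s <= t.
Hypothesis tau1_st : {ae mu1, forall x, s <= tau1 x <= t}.
Hypothesis tau2_st : {ae mu2, forall x, s <= tau2 x <= t}.
Hypothesis lam_st : {ae lam, forall r, s <= r <= t}.

(** [N] grows on [[s, t]] by the density [a] along the times [tau], and by the
    density [b] with respect to [lam]. *)
Definition increments d (X : measurableType d) (mu : {measure set X -> \bar R})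
    (a tau : X -> R) (b N : R -> R) : Prop :=
  forall r0 r, s <= r0 -> r0 <= r -> r <= t -> N r - N r0 =
    \int[mu]_x (\1_`[r0, r] (tau x) * a x) + \int[lam]_x (\1_`[r0, r] x * b x).

Hypothesis (hN1 : increments mu1 a1 tau1 b1 N1) (hN2 : increments mu2 a2 tau2 b2 N2).

Let mp := measurable_pos_step.
Let mn := measurable_nneg_step.

Let mindic (r0 r : R) : measurable_fun setT (\1_`[r0, r] : R -> R).
Proof. exact: measurable_indic. Qed.

(** The increment over the degenerate interval [[r, r]] vanishes, so the total
    mass of the integrator at each time is zero. *)
Lemma increments_step d (X : measurableType d) (mu : {finite_measure set X -> \bar R})
    (a tau : X -> R) (b N : R -> R) r :
  L1 mu a -> L1 lam b -> measurable_fun setT tau ->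
  {ae mu, forall x, s <= tau x <= t} -> increments mu a tau b N -> s <= r <= t ->
  N r - N s = \int[mu]_x (nneg_step (r - tau x) * a x) +
              \int[lam]_x (nneg_step (r - x) * b x) /\
  N r - N s = \int[mu]_x (pos_step (r - tau x) * a x) +
              \int[lam]_x (pos_step (r - x) * b x).
Proof.
move=> ia ib mtau tau_st hN /andP[sr rt].
have ma := L1_measurable ia; have mb := L1_measurable ib.
have mI := mindic s r; have mI' := mindic r r.
have E : N r - N s = \int[mu]_x (nneg_step (r - tau x) * a x) +
              \int[lam]_x (nneg_step (r - x) * b x).
  rewrite (hN _ _ (lexx s) sr rt); congr (_ + _); apply: ae_eq_Rint.
  - by meas.
  - by meas.
  - apply: ae_imp tau_st => x /andP[h1 h2].
    by rewrite indicE mem_setE in_itv/= h1/= nneg_stepE subr_ge0.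
  - by meas.
  - by meas.
  - apply: ae_imp lam_st => x /andP[h1 h2].
    by rewrite indicE mem_setE in_itv/= h1/= nneg_stepE subr_ge0.
split=> //.
have J := hN _ _ sr (lexx r) rt; rewrite subrr in J.
have SP (z : R) : nneg_step z = pos_step z + \1_`[0, 0] z.
  rewrite nneg_stepE pos_stepE indicE mem_setE in_itv/= -eq_le eq_sym.
  by case: (ltgtP 0 z); rewrite ?addr0 ?add0r.
have S0 x : \1_`[r, r] x = \1_`[0, 0] (r - x) :> R.
  rewrite !indicE !mem_setE !in_itv/= -!eq_le.
  by rewrite eq_sym [0 == _]eq_sym subr_eq0 [x == r]eq_sym.
have m00 : measurable_fun setT (\1_`[0, 0] : R -> R) by exact: measurable_indic.
have Lp d' (Z : measurableType d') (nu : {finite_measure set Z -> \bar R}) (c k : Z -> R) :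
    L1 nu c -> measurable_fun setT k -> (forall x, `|k x| <= 1) -> L1 nu (fun x => k x * c x).
  by move=> *; exact: L1_step.
rewrite E -[RHS]addr0 J addrACA -!RintD.
- congr (_ + _); apply: eq_Rint => x; rewrite S0 -mulrDl; congr (_ * _); exact: SP.
- by apply: Lp => //; [meas|move=> x; rewrite pos_stepE normr_boolr].
- by apply: Lp => //; move=> x; rewrite indicE normr_boolr.
- by apply: Lp => //; [meas|move=> x; rewrite pos_stepE normr_boolr].
- by apply: Lp => //; [meas|move=> x; rewrite indicE normr_boolr].
Qed.

(** [N] at the time of a point of [mu] is itself an integral over earlier times:
    iterated integrals of the two densities reduce to integrals of [N]. *)
Lemma half_integral d d' (X : measurableType d) (Y : measurableType d')
    (mu : {finite_measure set X -> \bar R}) (nu : {finite_measure set Y -> \bar R})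
    (a tau : X -> R) (c tau' : Y -> R) (b N k : R -> R) :
  L1 mu a -> measurable_fun setT tau -> {ae mu, forall x, s <= tau x <= t} ->
  L1 nu c -> measurable_fun setT tau' -> L1 lam b ->
  measurable_fun setT N -> (forall r, `|N r| <= B) ->
  measurable_fun setT k -> (forall z, `|k z| <= 1) ->
  (forall r, s <= r <= t -> N r - N s =
     \int[nu]_y (k (r - tau' y) * c y) + \int[lam]_x (k (r - x) * b x)) ->
  \int[mu]_x (a x * \int[nu]_y (k (tau x - tau' y) * c y)) +
  \int[mu]_x (a x * \int[lam]_y (k (tau x - y) * b y)) =
  \int[mu]_x (a x * N (tau x)) - N s * \int[mu]_x a x.
Proof.
move=> ia mtau h ic mtau' ib mN bN mk k1 E.
have ma := L1_measurable ia; have mc := L1_measurable ic; have mb := L1_measurable ib.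
have L (g : X -> R) (A : R) : measurable_fun setT g -> (forall x, `|g x| <= A) ->
    L1 mu (fun x => a x * g x).
  move=> mg gA; apply: (L1_le (mu := mu) (g := fun x => A * `|a x|)); [by meas| |].
    by move=> x; rewrite normrM mulrC ler_wpM2r.
  exact/L1Zl/L1_norm.
have mi1 : measurable_fun setT (fun x => \int[nu]_y (k (tau x - tau' y) * c y)).
  by apply: (measurable_Rint nu (f := fun x y => k (tau x - tau' y) * c y)); meas.
have mi2 : measurable_fun setT (fun x => \int[lam]_y (k (tau x - y) * b y)).
  by apply: (measurable_Rint lam (f := fun x y => k (tau x - y) * b y)); meas.
have bd d0 (Z : measurableType d0) (rho : {finite_measure set Z -> \bar R})
    (c0 k0 : Z -> R) : L1 rho c0 -> measurable_fun setT k0 -> (forall y, `|k0 y| <= 1) ->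
    `|\int[rho]_y (k0 y * c0 y)| <= \int[rho]_y `|c0 y|.
  move=> ic0 mk0 k01; have il := L1_step ic0 mk0 k01.
  apply: le_trans (le_normr_Rintegral measurableT il) _.
  by apply: le_Rint; [exact: L1_norm|exact: L1_norm|move=> y; rewrite normrM ler_piMl].
rewrite -RintD; last 2 first.
- by apply: L => // x; apply: (bd _ _ nu c) => //; meas.
- by apply: L => // x; apply: (bd _ _ lam b) => //; meas.
have mNt : measurable_fun setT (fun x => N (tau x)) by meas.
rewrite -RintZl// -RintB; [|exact: L|exact: L1Zl].
apply: ae_eq_Rint.
- by apply: measurable_funD; apply: measurable_funM.
- by meas.
- by apply: ae_imp h => x hx; rewrite -mulrDr -E//; ring.
Qed.

Lemma regroup8 (p1 q1 p2 q2 p3 q3 p4 q4 : R) :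
  p1 + q1 + (p2 + q2) + (p3 + q3 + (p4 + q4)) =
  (p1 + p2) + (p3 + p4) + (q1 + q3) + (q2 + q4).
Proof. by ring. Qed.

(** Apply [ibp_bilinear] to each of the four pairs of densities. The diagonal is
    attributed to one side only; this is harmless since [N1] and [N2] have no
    jumps, so their increments may be computed with either step function. *)
Theorem product_rule : N1 t * N2 t - N1 s * N2 s =
  (\int[mu1]_x (a1 x * N2 (tau1 x)) + \int[lam]_r (b1 r * N2 r)) +
  (\int[mu2]_x (a2 x * N1 (tau2 x)) + \int[lam]_r (b2 r * N1 r)).
Proof.
have ma1 := L1_measurable ia1; have ma2 := L1_measurable ia2.
have mb1 := L1_measurable ib1; have mb2 := L1_measurable ib2.
have stt : s <= t <= t by rewrite st lexx.
have mid := @measurable_id _ R setT.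
have k1 z : `|pos_step z| <= 1 by rewrite pos_stepE normr_boolr.
have k2 z : `|nneg_step z| <= 1 by rewrite nneg_stepE normr_boolr.
have tot d (X : measurableType d) (mu : {finite_measure set X -> \bar R})
    (a tau : X -> R) (b N : R -> R) : L1 mu a -> L1 lam b -> measurable_fun setT tau ->
    {ae mu, forall x, s <= tau x <= t} -> increments mu a tau b N ->
    N t - N s = \int[mu]_x a x + \int[lam]_x b x.
  move=> ia ib mtau h hN; have ma := L1_measurable ia; have mb := L1_measurable ib.
  have [-> _] := increments_step ia ib mtau h hN stt.
  congr (_ + _); apply: ae_eq_Rint; [by meas|by []| |by meas|by []|].
  - by apply: ae_imp h => x /andP[_ h1]; rewrite nneg_stepE subr_ge0 h1 mul1r.
  - by apply: ae_imp lam_st => x /andP[_ h1]; rewrite nneg_stepE subr_ge0 h1 mul1r.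
have T1 := tot _ _ _ _ _ _ _ ia1 ib1 mtau1 tau1_st hN1.
have T2 := tot _ _ _ _ _ _ _ ia2 ib2 mtau2 tau2_st hN2.
have E1 r (h : s <= r <= t) := (increments_step ia1 ib1 mtau1 tau1_st hN1 h).1.
have E2 r (h : s <= r <= t) := (increments_step ia2 ib2 mtau2 tau2_st hN2 h).2.
have H1 := half_integral ia1 mtau1 tau1_st ia2 mtau2 ib2 mN2 bN2 mp k1 E2.
have H2 := half_integral ib1 mid lam_st ia2 mtau2 ib2 mN2 bN2 mp k1 E2.
have H3 := half_integral ia2 mtau2 tau2_st ia1 mtau1 ib1 mN1 bN1 mn k2 E1.
have H4 := half_integral ib2 mid lam_st ia1 mtau1 ib1 mN1 bN1 mn k2 E1.
have F1 := ibp_bilinear ia1 ia2 mtau1 mtau2.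
have F2 := ibp_bilinear ia1 ib2 mtau1 mid.
have F3 := ibp_bilinear ib1 ia2 mid mtau2.
have F4 := ibp_bilinear ib1 ib2 mid mid.
set A1 := \int[mu1]_x a1 x in T1 F1 F2 H1; set A2 := \int[mu2]_x a2 x in T2 F1 F3 H3.
set B1 := \int[lam]_x b1 x in T1 F3 F4 H2; set B2 := \int[lam]_x b2 x in T2 F2 F4 H4.
have G : (A1 + B1) * (A2 + B2) =
    (\int[mu1]_x (a1 x * N2 (tau1 x)) - N2 s * A1) +
    (\int[lam]_r (b1 r * N2 r) - N2 s * B1) +
    (\int[mu2]_x (a2 x * N1 (tau2 x)) - N1 s * A2) +
    (\int[lam]_r (b2 r * N1 r) - N1 s * B2).
  rewrite -H1 -H2 -H3 -H4 mulrDl !mulrDr F1 F2 F3 F4.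
  exact: regroup8.
have -> : N1 t = N1 s + (A1 + B1) by rewrite -T1; ring.
have -> : N2 t = N2 s + (A2 + B2) by rewrite -T2; ring.
transitivity (N1 s * (A2 + B2) + N2 s * (A1 + B1) + (A1 + B1) * (A2 + B2)).
  by ring.
by rewrite G; ring.
Qed.

End rule.
End product_rule.

(** * Doubly mollified kinetic functions at a fixed time *)

Section leb_fubini.
Context {R : realType}.
Local Notation leb := (@lebesgue_measure R).

Lemma leb_fubini (f : R -> R -> R) :
  measurable_fun setT (fun p : R * R => f p.1 p.2) ->
  (\int[leb]_x \int[leb]_y `|f x y|%:E < +oo)%E ->
  \int[leb]_x \int[leb]_y f x y = \int[leb]_y \int[leb]_x f x y.
Proof. by move=> mf h; apply: (Rfubini (mu := leb) (nu := leb) (f := f)). Qed.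

Lemma leb_fubini_tensor (f : R -> R -> R) (a b : R -> R) :
  measurable_fun setT (fun p : R * R => f p.1 p.2) -> L1 leb a -> L1 leb b ->
  (forall x y, `|f x y| <= `|a x| * `|b y|) ->
  \int[leb]_x \int[leb]_y f x y = \int[leb]_y \int[leb]_x f x y.
Proof. by move=> mf ia ib fab; apply: leb_fubini => //; exact: (tensor_lty (mu := leb) (nu := leb) mf ia ib fab). Qed.

Lemma leb_L1_tensor (f : R -> R -> R) (a b : R -> R) :
  measurable_fun setT (fun p : R * R => f p.1 p.2) -> L1 leb a -> L1 leb b ->
  (forall x y, `|f x y| <= `|a x| * `|b y|) ->
  L1 leb (fun x => \int[leb]_y f x y).
Proof.
move=> mf ia ib fab; apply: (L1_Rint (mu := leb) (nu := leb) mf).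
exact: (tensor_lty (mu := leb) (nu := leb) mf ia ib fab).
Qed.

Lemma slice_lty (f : R -> R -> R) (a : R -> R) (C : R) :
  measurable_fun setT (fun p : R * R => f p.1 p.2) -> L1 leb a ->
  (forall x, \int[leb]_y `|f x y|%:E <= (C * `|a x|)%:E)%E ->
  (\int[leb]_x \int[leb]_y `|f x y|%:E < +oo)%E.
Proof.
move=> mf ia fab; have ma := L1_measurable ia.
apply: (@le_lt_trans _ _ (\int[leb]_x (C * `|a x|)%:E)%E).
  apply: le_integralT; [| |by move=> x; apply: integral_ge0|exact: fab].
    by apply: measurable_integral => //; meas.
  by meas.
by rewrite -(RintE (mu := leb) (f := fun x => C * `|a x|)) ?ltry//; apply/L1Zl/L1_norm.
Qed.

Lemma leb_L1_slice (f : R -> R -> R) (a : R -> R) (C : R) :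
  measurable_fun setT (fun p : R * R => f p.1 p.2) -> L1 leb a ->
  (forall x, \int[leb]_y `|f x y|%:E <= (C * `|a x|)%:E)%E ->
  L1 leb (fun x => \int[leb]_y f x y) /\ L1 leb (fun y => \int[leb]_x f x y).
Proof.
move=> mf ia fab; have h := slice_lty mf ia fab; split.
  exact: (L1_Rint (mu := leb) (nu := leb) mf h).
apply: (L1_Rint (mu := leb) (nu := leb) (f := fun y x => f x y)).
  exact: (measurable_swap mf).
rewrite (tonelli leb leb (f := fun y x => `|f x y|))//.
by have mf' := measurable_swap mf; meas.
Qed.

Lemma L1_subl (g : R -> R) (c : R) : L1 leb g -> L1 leb (fun x => g (c - x)).
Proof.
move=> gi; have mg := L1_measurable gi; apply: L1P; first by meas.
rewrite (ge0_integral_subl c (f := fun x => `|g x|%:E)%R) ?L1_lty//.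
by meas.
Qed.

Lemma C1_comp (g g' h h' : R -> R) : C1 g g' -> C1 h h' ->
  C1 (fun x => g (h x)) (fun x => g' (h x) * h' x).
Proof.
move=> gC hC; have ch := C1_continuous hC; case: gC hC => [dg cg] [dh ch'].
split=> x; first exact: (is_derive1_comp (dg (h x)) (dh x)).
apply: cvgM; last exact: ch'.
by apply: (@continuous_comp _ _ _ h g'); [exact: ch|exact: cg].
Qed.

Lemma C1_subl (g g' : R -> R) (c : R) : C1 g g' ->
  C1 (fun x => g (c - x)) (fun x => - g' (c - x)).
Proof.
move=> gC; have dC : C1 (fun x : R => c - x) (fun=> -1).
  split=> x; last exact: cvg_cst.
  by have := is_deriveB (is_derive_cst c x 1) (is_derive_id x 1); rewrite sub0r.
by have := C1_comp gC dC; under [X in C1 _ X]eq_fun do rewrite mulrN1.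
Qed.

Lemma Rint_comb (F A B : R -> R) (D : R) : (forall x, F x = A x + D * B x) ->
  L1 leb A -> L1 leb B -> \int[leb]_x F x = \int[leb]_x A x + D * \int[leb]_x B x.
Proof.
move=> E iA iB; rewrite -RintZl; last exact: L1_measurable iB.
by rewrite -RintD//; [exact: eq_Rint|exact: L1Zl].
Qed.

Lemma Rint2_comb (F A B : R -> R -> R) (D : R) :
  (forall x y, F x y = A x y + D * B x y) ->
  (forall x, L1 leb (A x)) -> (forall x, L1 leb (B x)) ->
  L1 leb (fun x => \int[leb]_y A x y) -> L1 leb (fun x => \int[leb]_y B x y) ->
  \int[leb]_x \int[leb]_y F x y =
  \int[leb]_x \int[leb]_y A x y + D * \int[leb]_x \int[leb]_y B x y.
Proof.
by move=> E iA iB iiA iiB; apply: Rint_comb => // x; apply: Rint_comb => // y; exact: E.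
Qed.

Lemma eq_le_refl (x y : R) : x = y -> x <= y.
Proof. by move=> ->. Qed.

End leb_fubini.

Section profile.
Context {R : realType}.
Local Notation leb := (@lebesgue_measure R).
Implicit Types (c f g u kap phi : R -> R).

(** The kinetic function of [u], weighted by [c], averaged in space against [g]
    along the characteristics [f] and in the kinetic variable against [kap]. *)
Definition Gc c g kap f u (eta y : R) : R :=
  conv (fun xi => c xi * wk g f u xi y) kap eta.

(** The kinetic average comes first; the spatial one is left. *)
Definition level c kap f u (eta x : R) : R :=
  conv (fun xi => c xi * psi xi (u (x + f xi))) kap eta.

Lemma measurable_Gc d (X : measurableType d) c g kap (f u : X -> R -> R)
    (eta y : X -> R) :
  measurable_fun setT c -> measurable_fun setT g -> measurable_fun setT kap ->
  measurable_fun setT (fun p : X * R => f p.1 p.2) ->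
  measurable_fun setT (fun p : X * R => u p.1 p.2) ->
  measurable_fun setT eta -> measurable_fun setT y ->
  measurable_fun setT (fun x => Gc c g kap (f x) (u x) (eta x) (y x)).
Proof.
move=> mc mg mk mf mu me my.
apply: (measurable_Rint leb
  (f := fun x xi => c xi * wk g (f x) (u x) xi (y x) * kap (xi - eta x))).
have mw : measurable_fun setT (fun p : X * R => wk g (f p.1) (u p.1) p.2 (y p.1)).
  apply: (measurable_wk_gen (u := fun p : X * R => u p.1)) => //; by meas.
by meas.
Qed.

Section one_profile.
Variables (phi phi1 kap kap1 f f' u : R -> R) (eps del Gam : R).
Hypotheses (phiC : C1 phi phi1) (vphi : vanishes_off eps phi).
Hypotheses (kapC : C1 kap kap1) (vkap : vanishes_off del kap).
Hypotheses (kap0 : forall x, 0 <= kap x) (kap_1 : \int[leb]_x kap x = 1).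
Hypotheses (fC : C1 f f') (f'G : forall xi, `|f' xi| <= Gam).
Hypothesis mu : measurable_fun setT u.

Let mpsi := @measurable_psi R.
Let mphi := C1_measurable phiC.
Let mphi1 := C1_measurable' phiC.
Let mkap := C1_measurable kapC.
Let mkap1 := C1_measurable' kapC.
Let mf := C1_measurable fC.
Let mf' := C1_measurable' fC.
Let iphi : L1 leb phi := L1_vanishes_off (C1_continuous phiC) vphi.
Let ikap : L1 leb kap := L1_vanishes_off (C1_continuous kapC) vkap.
Let vphi1 := vanishes_off_derive phiC vphi.
Let vkap1 := vanishes_off_derive kapC vkap.
Let iphi1 : L1 leb phi1 := L1_vanishes_off phiC.2 vphi1.
Let ikap1 : L1 leb kap1 := L1_vanishes_off kapC.2 vkap1.

Lemma Rint_kap eta : \int[leb]_xi kap (xi - eta) = 1.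
Proof. by rewrite (Rint_addr (- eta)). Qed.

Lemma Rint_kapC xi : \int[leb]_eta kap (xi - eta) = 1.
Proof. by rewrite (Rint_subl xi (f := kap)). Qed.

(** Averages against the probability density [kap]. *)
Lemma normr_conv_kap (a : R -> R) (A eta : R) : measurable_fun setT a ->
  (forall x, `|a x| <= A) -> `|conv a kap eta| <= A.
Proof.
move=> ma aA; rewrite /conv.
have i1 : L1 leb (fun x => a x * kap (x - eta)).
  by apply: L1_bounded_M aA _ => //; exact: L1_shift.
apply: le_trans (le_normr_Rintegral measurableT i1) _.
rewrite -[leRHS]mulr1 -(Rint_kap eta) -RintZl; last by meas.
apply: le_Rint; [exact: L1_norm|by apply: L1Zl; exact: L1_shift|] => x.
by rewrite normrM (ger0_norm (kap0 _)) ler_wpM2r.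
Qed.

Section weight.
Variables (c : R -> R) (A : R).
Hypotheses (mc : measurable_fun setT c) (cA : forall xi, `|c xi| <= A).

Let A0 : 0 <= A. Proof. exact: le_trans (cA 0). Qed.

Lemma measurable_level eta : measurable_fun setT (level c kap f u eta).
Proof.
rewrite /level /conv.
by apply: (measurable_Rint leb
  (f := fun x xi : R => c xi * psi xi (u (x + f xi)) * kap (xi - eta))); meas.
Qed.

Lemma normr_level eta x : `|level c kap f u eta x| <= A.
Proof.
apply: normr_conv_kap; first by meas.
by move=> xi; rewrite normrM -[leRHS]mulr1 ler_pM// normr_psi.
Qed.

Lemma normr_Gc g eta y : L1 leb g ->
  `|Gc c g kap f u eta y| <= A * \int[leb]_a `|g a|.
Proof.
move=> ig; have mg := L1_measurable ig; have mw := measurable_wk mg mf mu.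
have mwy := measurable_sliceC (f := fun xi y => wk g f u xi y) y mw.
apply: normr_conv_kap; first by meas.
by move=> xi; rewrite normrM ler_pM// normr_wk.
Qed.

(** Fubini exchanges the two mollifications: as a function of [y] alone, the
    doubly mollified function is a convolution of a bounded function. *)
Lemma GcE g eta y : L1 leb g -> Gc c g kap f u eta y = conv (level c kap f u eta) g y.
Proof.
move=> ig; have mg := L1_measurable ig.
pose F xi a := c xi * psi xi (u (a + f xi)) * kap (xi - eta) * g (a - y).
have mF : measurable_fun setT (fun p : R * R => F p.1 p.2) by rewrite /F; meas.
transitivity (\int[leb]_xi \int[leb]_a F xi a).
  apply: eq_Rint => xi.
  rewrite (_ : _ * _ * _ = c xi * kap (xi - eta) * wk g f u xi y); last by ring.
  rewrite wkE// -(Rint_addr (- y)); last by meas.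
  rewrite -RintZl; last by meas.
  apply: eq_Rint => a; rewrite /F.
  by rewrite (_ : a + - y + (y + f xi) = a + f xi); [ring|lra].
rewrite (leb_fubini_tensor (a := fun xi => A * kap (xi - eta))
  (b := fun a => g (a - y)) mF).
- apply: eq_Rint => a; rewrite mulrC /level /conv -RintZl; last by meas.
  by apply: eq_Rint => xi; rewrite /F; ring.
- by apply: L1Zl; exact: L1_shift.
- exact: L1_shift.
- move=> xi a; rewrite !normrM ler_wpM2r// ler_wpM2r// (ger0_norm A0).
  by rewrite -[leRHS]mulr1 ler_pM// normr_psi.
Qed.

Lemma Gc_C1 g g1 M eta : C1 g g1 -> vanishes_off M g ->
  C1 (Gc c g kap f u eta) (fun y => - Gc c g1 kap f u eta y).
Proof.
move=> gC vg; have ig := L1_vanishes_off (C1_continuous gC) vg.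
have ig1 := L1_vanishes_off gC.2 (vanishes_off_derive gC vg).
rewrite (_ : Gc c g kap f u eta = conv (level c kap f u eta) g); last first.
  by apply/funext => y; exact: GcE.
rewrite (_ : (fun y => _) = (fun y => - conv (level c kap f u eta) g1 y)); last first.
  by apply/funext => y; rewrite GcE.
exact: (conv_C1 (measurable_level eta) (normr_level eta) gC vg).
Qed.

Lemma Gc_L1 g (C : R) : L1 leb g ->
  (\int[leb]_xi \int[leb]_y `|wk g f u xi y|%:E <= C%:E)%E ->
  (\int[leb]_eta \int[leb]_y `|Gc c g kap f u eta y|%:E <= (A * C)%:E)%E.
Proof.
move=> ig wC; have mg := L1_measurable ig; have mw := measurable_wk mg mf mu.
pose F eta y xi := A * kap (xi - eta) * `|wk g f u xi y|.
have F0 eta y xi : 0 <= F eta y xi by rewrite /F !mulr_ge0.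
have mF : measurable_fun setT (fun p : R * R * R => F p.1.1 p.1.2 p.2).
  by rewrite /F; meas.
have mG : measurable_fun setT (fun p : R * R => Gc c g kap f u p.1 p.2).
  by apply: (measurable_Gc (f := fun _ => f) (u := fun _ => u)) => //; meas.
apply: (@le_trans _ _ (\int[leb]_eta \int[leb]_y \int[leb]_xi (F eta y xi)%:E)%E).
  apply: le_integralT.
  - by apply: measurable_integral => //; meas.
  - exact: (measurable_integral2 leb leb mF F0).
  - by move=> eta; apply: integral_ge0.
  move=> eta; apply: le_integralT => //.
  - by have mGe := measurable_slice (f := fun eta y => Gc c g kap f u eta y) eta mG; meas.
  - exact: (measurable_slice (f := fun eta y => \int[leb]_xi (F eta y xi)%:E)%E eta
      (measurable_integral_inner leb mF F0)).
  move=> y; have mwy := measurable_sliceC (f := fun xi y => wk g f u xi y) y mw.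
  apply: le_trans (normr_Rint_le _ _) _; first by meas.
  apply: le_integralT => //; [by meas|by rewrite /F; meas|].
  move=> xi; rewrite lee_fin !normrM (ger0_norm (kap0 _)) /F -mulrA mulrAC -mulrA.
  by rewrite ler_wpM2r// mulr_ge0.
rewrite (tonelli3 leb leb leb mF F0).
apply: (@le_trans _ _ (\int[leb]_xi (A%:E * \int[leb]_y `|wk g f u xi y|%:E))%E).
  apply: le_integralT.
  - by apply: (measurable_integral2 leb leb (F := fun xi eta y => F eta y xi)) => //; rewrite /F; meas.
  - apply: emeasurable_funM; first by meas.
    by apply: measurable_integral => //; meas.
  - by move=> xi; do 2 (apply: integral_ge0 => ? _); rewrite lee_fin.
  move=> xi; have mwx := measurable_slice (f := fun xi y => wk g f u xi y) xi mw.
  pose I := (\int[leb]_y `|wk g f u xi y|%:E)%E.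
  have [Ifin|Iinf] := boolP (I \is a fin_num); last first.
    have : (0 <= I)%E by apply: integral_ge0.
    rewrite -/I; move: Iinf; case: I => //= _ _.
    have [A00|An0] := eqVneq A 0; last by rewrite gt0_muley ?leey// lte_fin lt_neqAle eq_sym An0.
    rewrite integral0_eq ?A00 ?mul0e// => eta _; rewrite integral0_eq// => y _.
    by rewrite /F A00 !mul0r.
  rewrite le_eqVlt; apply/orP; left; apply/eqP.
  transitivity (\int[leb]_eta (A * fine I * kap (xi - eta))%:E)%E.
    apply: eq_integral => eta _; rewrite -/I.
    rewrite (_ : A * fine I * kap (xi - eta) = A * kap (xi - eta) * fine I); last by ring.
    rewrite EFinM fineK// /I -ge0_integralrZl//; [by rewrite mulr_ge0|by meas].
  rewrite ge0_integralrZl//; last 2 first.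
  - by rewrite mulr_ge0// fine_ge0// integral_ge0.
  - by meas.
  rewrite EFinM fineK// (ge0_integral_subl xi (f := fun x => (kap x)%:E)).
  - by rewrite -RintE// kap_1 mule1.
  - by meas.
  - by move=> x; rewrite lee_fin.
rewrite ge0_integralZl//; last 2 first.
- by apply: measurable_integral => //; meas.
- by move=> xi _; apply: integral_ge0.
by rewrite EFinM lee_wpmul2l// lee_fin.
Qed.

End weight.

(** The mollified Dirac mass on the graph of [u]. *)
Definition Uk (eta y : R) : R :=
  \int[leb]_x (phi (x - (y + f (u x))) * kap (u x - eta)).

Lemma integral_shift_norm g (c : R) : L1 leb g ->
  (\int[leb]_x `|g (x - c)|%:E = (\int[leb]_a `|g a|)%:E)%E.
Proof.
move=> ig; have mg := L1_measurable ig; rewrite RintE; last exact: L1_norm.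
by rewrite (ge0_integral_addr (- c) (f := fun x => `|g x|%:E)); [|meas|].
Qed.

(** The derivative in [eta] of the mollified kinetic function: the jump of [psi]
    at [u] produces [Uk], and the dependence of the characteristics on [xi]
    produces the transport term. *)
Lemma conv_wk_kap1 eta y : conv (fun xi => wk phi f u xi y) kap1 eta =
  - 2 * Uk eta y + Gc f' phi1 kap f u eta y.
Proof.
pose F1 xi x := psi xi (u x) * phi (x - (y + f xi)) * kap1 (xi - eta).
pose F2 xi x := f' xi * (psi xi (u x) * phi1 (x - (y + f xi))) * kap (xi - eta).
have mF1 : measurable_fun setT (fun p : R * R => F1 p.1 p.2) by rewrite /F1; meas.
have mF2 : measurable_fun setT (fun p : R * R => F2 p.1 p.2) by rewrite /F2; meas.
have Gam0 : 0 <= Gam by exact: le_trans (f'G 0).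
have b1 xi : (\int[leb]_x `|F1 xi x|%:E <=
    ((\int[leb]_a `|phi a|) * `|kap1 (xi - eta)|)%:E)%E.
  rewrite mulrC EFinM -(integral_shift_norm (y + f xi) iphi) -ge0_integralrZl//; last by meas.
  apply: le_integralT => //; [by rewrite /F1; meas|by meas|].
  move=> x; rewrite lee_fin /F1 !normrM mulrC ler_wpM2l// ler_piMl//.
  exact: normr_psi.
have b2 xi : (\int[leb]_x `|F2 xi x|%:E <=
    ((Gam * \int[leb]_a `|phi1 a|) * `|kap (xi - eta)|)%:E)%E.
  rewrite (_ : _ * _ * _ = Gam * `|kap (xi - eta)| * \int[leb]_a `|phi1 a|); last by ring.
  rewrite EFinM -(integral_shift_norm (y + f xi) iphi1) -ge0_integralrZl//; last 2 first.
  - by rewrite mulr_ge0.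
  - by meas.
  apply: le_integralT => //; [by rewrite /F2; meas|by meas|].
  move=> x; rewrite lee_fin /F2 !normrM mulrAC ler_pM// ?mulr_ge0//.
    by rewrite ler_wpM2r.
  by rewrite ler_piMl// normr_psi.
have ik1 := L1_shift eta ikap1; have ik := L1_shift eta ikap.
have [_ L1F1] := leb_L1_slice mF1 ik1 b1.
have [_ L1F2] := leb_L1_slice mF2 ik b2.
have E1 : conv (fun xi => wk phi f u xi y) kap1 eta = \int[leb]_x \int[leb]_xi F1 xi x.
  rewrite -(leb_fubini mF1 (slice_lty mF1 ik1 b1)); apply: eq_Rint => xi.
  rewrite mulrC /wk /conv -RintZl; last by meas.
  by apply: eq_Rint => x; rewrite /F1; ring.
have E2 : Gc f' phi1 kap f u eta y = \int[leb]_x \int[leb]_xi F2 xi x.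
  rewrite -(leb_fubini mF2 (slice_lty mF2 ik b2)); apply: eq_Rint => xi.
  rewrite (_ : _ * _ * _ = f' xi * kap (xi - eta) * wk phi1 f u xi y); last by ring.
  rewrite /wk /conv -RintZl; last by meas.
  by apply: eq_Rint => x; rewrite /F2; ring.
have [Bp Bp0 bphi] := vanishes_off_bounded (C1_continuous phiC) vphi.
have [Bp1 Bp10 bphi1] := vanishes_off_bounded phiC.2 vphi1.
have step x : \int[leb]_xi F1 xi x = - 2 * (phi (x - (y + f (u x))) * kap (u x - eta)) +
    \int[leb]_xi F2 xi x.
  have hC : C1 (fun xi => phi (x - y - f xi)) (fun xi => phi1 (x - y - f xi) * (- f' xi)).
    apply: (C1_comp phiC); have [df cf] := fC; split=> xi.
      have := is_deriveB (is_derive_cst (x - y) xi 1) (df xi).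
      by rewrite sub0r.
    by apply: cvgN; exact: cf.
  have kC : C1 (fun xi => kap (xi - eta)) (fun xi => kap1 (xi - eta)).
    have := C1_affine 1 (- eta) kapC.
    under eq_fun do rewrite mul1r.
    by under [X in C1 _ X]eq_fun do rewrite !mul1r.
  have vG : vanishes_off (`|eta| + `|del|) (fun xi => phi (x - y - f xi) * kap (xi - eta)).
    move=> xi h; rewrite vkap ?mulr0// (le_lt_trans (ler_norm del))//.
    have h2 := ler_normD (xi - eta) eta; rewrite subrK in h2.
    by rewrite -(ltrD2r `|eta|) addrC (lt_le_trans h h2).
  have J := Rint_sg_derive (u x) (C1M hC kC) vG.
  have := J; rewrite (_ : \int[leb]_x0 _ = \int[leb]_xi F1 xi x - \int[leb]_xi F2 xi x).
    rewrite (_ : x - y - f (u x) = x - (y + f (u x))); last by rewrite opprD addrA.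
    by move=> <-; rewrite subrK.
  rewrite -RintB.
  - apply: eq_Rint => xi; rewrite /F1 /F2 /psi.
    by rewrite opprD addrA; ring.
  - apply: (L1_bounded_M (A := Bp)) => //; first by meas.
    by move=> xi; rewrite normrM -[leRHS]mul1r ler_pM// normr_psi.
  - apply: (L1_bounded_M (A := Gam * Bp1)) => //; first by meas.
    move=> xi; rewrite !normrM ler_pM// ?mulr_ge0//.
    by rewrite -[leRHS]mul1r ler_pM// normr_psi.
rewrite E1 E2; apply/eqP; rewrite -subr_eq -RintB//; apply/eqP.
have mU : measurable_fun setT (fun x : R => phi (x - (y + f (u x))) * kap (u x - eta)) by meas.
rewrite /Uk -RintZl//; apply: eq_Rint => x; rewrite step addrK; ring.
Qed.

Lemma measurable_Uk : measurable_fun setT (fun p : R * R => Uk p.1 p.2).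
Proof.
apply: (measurable_Rint leb (f := fun (p : R * R) (x : R) =>
  phi (x - (p.2 + f (u x))) * kap (u x - p.1))).
by meas.
Qed.

Let W := Gc (fun=> 1) phi kap f u.

Let one_bound : forall xi : R, `|(fun=> 1 : R) xi| <= 1.
Proof. by move=> xi; rewrite normr1. Qed.

Let mone : measurable_fun setT (fun _ : R => 1 : R).
Proof. exact: measurable_cst. Qed.

Lemma W_eta_C1 y : C1 (W ^~ y) (fun eta => 2 * Uk eta y - Gc f' phi1 kap f u eta y).
Proof.
have mw := measurable_sliceC (f := fun xi y => wk phi f u xi y) y (measurable_wk mphi mf mu).
have bw xi : `|wk phi f u xi y| <= \int[leb]_a `|phi a| by exact: normr_wk.
have := conv_C1 mw bw kapC vkap.
rewrite (_ : conv _ kap = W ^~ y); last first.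
  by apply/funext => eta; apply: eq_Rint => xi; rewrite mul1r.
rewrite (_ : (fun y0 => - _) = (fun eta => 2 * Uk eta y - Gc f' phi1 kap f u eta y))//.
by apply/funext => eta; rewrite conv_wk_kap1; ring.
Qed.

Lemma normr_Uk eta y : `|2 * Uk eta y| <=
  (\int[leb]_a `|phi a|) * (\int[leb]_a `|kap1 a|) + Gam * \int[leb]_a `|phi1 a|.
Proof.
have mw := measurable_sliceC (f := fun xi y => wk phi f u xi y) y (measurable_wk mphi mf mu).
have -> : 2 * Uk eta y = Gc f' phi1 kap f u eta y - conv (fun xi => wk phi f u xi y) kap1 eta.
  by rewrite conv_wk_kap1; ring.
apply: le_trans (ler_normB _ _) _; rewrite addrC lerD//; last exact: normr_Gc.
have ik1 := L1_shift eta ikap1.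
have iw : L1 leb (fun xi => wk phi f u xi y * kap1 (xi - eta)).
  by apply: (L1_bounded_M (A := \int[leb]_a `|phi a|)) => // xi; exact: normr_wk.
apply: le_trans (le_normr_Rintegral measurableT iw) _.
rewrite -(Rint_addr (- eta) (f := fun a => `|kap1 a|)); last by meas.
rewrite -RintZl; last by meas.
apply: le_Rint; [exact: L1_norm|by apply: L1Zl; exact: L1_norm|] => xi.
by rewrite normrM ler_wpM2r// normr_wk.
Qed.

Lemma normr_W eta y : `|W eta y| <= \int[leb]_a `|phi a|.
Proof. by have := normr_Gc mone one_bound eta y iphi; rewrite mul1r. Qed.

Lemma measurable_Gcp c g : measurable_fun setT c -> measurable_fun setT g ->
  measurable_fun setT (fun p : R * R => Gc c g kap f u p.1 p.2).
Proof.
move=> mc mg.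
by apply: (measurable_Gc (f := fun _ => f) (u := fun _ => u)) => //; meas.
Qed.

Lemma measurable_W : measurable_fun setT (fun p : R * R => W p.1 p.2).
Proof. exact: measurable_Gcp. Qed.

(** The pairing of the [xi]-derivative of one test function with the other
    mollified solution, after integration by parts in [eta] and [y]: the
    derivatives of the two characteristics appear through their difference. *)
Lemma pairing (X xi0 D : R) :
  \int[leb]_eta \int[leb]_y
    ((phi (X - y) * kap1 (xi0 - eta) - D * phi1 (X - y) * kap (xi0 - eta)) * W eta y) =
  \int[leb]_eta \int[leb]_y (phi (X - y) * kap (xi0 - eta) *
    (2 * Uk eta y + (D * Gc (fun=> 1) phi1 kap f u eta y - Gc f' phi1 kap f u eta y))).
Proof.
have mW := measurable_W; have mU := measurable_Uk.
have mG1 := measurable_Gcp mone mphi1; have mGf := measurable_Gcp mf' mphi1.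
have ip := L1_subl X iphi; have ip1 := L1_subl X iphi1.
have ik := L1_subl xi0 ikap; have ik1 := L1_subl xi0 ikap1.
have key (a b : R -> R) (Z : R -> R -> R) (C : R) : L1 leb a -> L1 leb b ->
    measurable_fun setT (fun p : R * R => Z p.1 p.2) ->
    (forall eta y, `|Z eta y| <= C) ->
    [/\ \int[leb]_eta \int[leb]_y (b y * a eta * Z eta y) =
          \int[leb]_y (b y * \int[leb]_eta (a eta * Z eta y)),
        \int[leb]_eta \int[leb]_y (b y * a eta * Z eta y) =
          \int[leb]_eta (a eta * \int[leb]_y (b y * Z eta y)),
        forall eta, L1 leb (fun y => b y * a eta * Z eta y) &
        L1 leb (fun eta => \int[leb]_y (b y * a eta * Z eta y))].
  move=> ia ib mZ ZC; have ma := L1_measurable ia; have mb := L1_measurable ib.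
  have mF : measurable_fun setT (fun p : R * R => b p.2 * a p.1 * Z p.1 p.2) by meas.
  have C0 : 0 <= C by exact: le_trans (ZC 0 0).
  have dom eta y : `|b y * a eta * Z eta y| <= `|C * a eta| * `|b y|.
    rewrite !normrM (ger0_norm C0) mulrC -mulrA (mulrC `|b y|) ler_wpM2r ?mulr_ge0//.
  split.
  - rewrite (leb_fubini_tensor (a := fun eta => C * a eta) mF (L1Zl C ia) ib dom).
    apply: eq_Rint => y; have mZy := measurable_sliceC (f := Z) y mZ.
    rewrite -RintZl; last by meas.
    by apply: eq_Rint => eta; ring.
  - apply: eq_Rint => eta; have mZe := measurable_slice (f := Z) eta mZ.
    rewrite -RintZl; last by meas.
    by apply: eq_Rint => y; ring.
  - move=> eta; have mZe := measurable_slice (f := Z) eta mZ.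
    apply: (L1_le (mu := leb) (g := fun y => `|C * a eta| * `|b y|)) => //; first by meas.
    by apply/L1Zl/L1_norm.
  - exact: (leb_L1_tensor (a := fun eta => C * a eta) mF (L1Zl C ia) ib dom).
pose C1' := \int[leb]_a `|phi1 a|.
have bG1 eta y : `|Gc (fun=> 1) phi1 kap f u eta y| <= C1'.
  by have := normr_Gc mone one_bound eta y iphi1; rewrite mul1r.
have bGf eta y : `|Gc f' phi1 kap f u eta y| <= Gam * C1' by exact: normr_Gc.
pose Z1 eta y := 2 * Uk eta y - Gc f' phi1 kap f u eta y.
have mZ1 : measurable_fun setT (fun p : R * R => Z1 p.1 p.2) by rewrite /Z1; meas.
have bZ1 eta y := le_trans (ler_normB (2 * Uk eta y) (Gc f' phi1 kap f u eta y))
  (lerD (normr_Uk eta y) (bGf eta y)).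
have [e1 _ s1 L1a] := key _ _ _ _ ik1 ip mW normr_W.
have [_ e2 s2 L1b] := key _ _ _ _ ik ip1 mW normr_W.
have [e3 _ s3 L1c] := key _ _ Z1 _ ik ip mZ1 bZ1.
have [_ e4 s4 L1d] := key _ _ _ _ ik ip mG1 bG1.
have T1 : \int[leb]_eta \int[leb]_y (phi (X - y) * kap1 (xi0 - eta) * W eta y) =
    \int[leb]_eta \int[leb]_y (phi (X - y) * kap (xi0 - eta) * Z1 eta y).
  rewrite e1 e3; apply: eq_Rint => y; congr (_ * _).
  have vk : vanishes_off (`|xi0| + `|del|) (fun eta => kap (xi0 - eta)).
    move=> eta h; apply: vkap; apply: (le_lt_trans (ler_norm del)).
    have h2 := ler_normB (xi0 - eta) xi0; rewrite -addrA addrCA subrr addr0 normrN in h2.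
    by rewrite -(ltrD2r `|xi0|) addrC (lt_le_trans h h2).
  have := IBP (C1_subl xi0 kapC) vk (W_eta_C1 y).
  have mWy := measurable_sliceC (f := W) y mW.
  under eq_Rint do rewrite mulNr.
  rewrite RintN; last by meas.
  by move/oppr_inj.
have T2 : \int[leb]_eta \int[leb]_y (phi1 (X - y) * kap (xi0 - eta) * W eta y) =
    - \int[leb]_eta \int[leb]_y (phi (X - y) * kap (xi0 - eta) * Gc (fun=> 1) phi1 kap f u eta y).
  pose J (eta : R) : R := \int[leb]_y (phi (X - y) * Gc (fun=> 1) phi1 kap f u eta y).
  have mJ : measurable_fun setT J.
    by apply: (measurable_Rint leb (f := fun eta y : R => phi (X - y) * Gc (fun=> 1) phi1 kap f u eta y)); meas.
  apply: (etrans e2); apply: (etrans _ (congr1 -%R (esym e4))).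
  apply: (etrans _ (RintN leb (f := fun eta => kap (xi0 - eta) * J eta) _)); last by meas.
  apply: eq_Rint => eta; rewrite -mulrN; congr (_ * _).
  have vp : vanishes_off (`|X| + `|eps|) (fun y => phi (X - y)).
    move=> y h; apply: vphi; apply: (le_lt_trans (ler_norm eps)).
    have h2 := ler_normB (X - y) X; rewrite -addrA addrCA subrr addr0 normrN in h2.
    by rewrite -(ltrD2r `|X|) addrC (lt_le_trans h h2).
  have mWe := measurable_slice (f := W) eta mW.
  have mGe := measurable_slice (f := fun eta y => Gc (fun=> 1) phi1 kap f u eta y) eta mG1.
  have e5 := IBP (C1_subl X phiC) vp (Gc_C1 mone one_bound eta phiC vphi).
  have e6 : \int[leb]_y (- phi1 (X - y) * W eta y) = - \int[leb]_y (phi1 (X - y) * W eta y).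
    apply: (etrans _ (RintN leb (f := fun y => phi1 (X - y) * W eta y) _)); last first.
      by apply: measurable_funM; [meas|exact: mWe].
    by apply: eq_Rint => y; rewrite mulNr.
  have e7 : \int[leb]_y (phi (X - y) * - Gc (fun=> 1) phi1 kap f u eta y) =
      - \int[leb]_y (phi (X - y) * Gc (fun=> 1) phi1 kap f u eta y).
    apply: (etrans _ (RintN leb (f := fun y => phi (X - y) * Gc (fun=> 1) phi1 kap f u eta y) _)); last first.
      by apply: measurable_funM; [meas|exact: mGe].
    by apply: eq_Rint => y; rewrite mulrN.
  have := etrans (esym e6) (etrans e5 (congr1 -%R e7)).
  by move=> h; apply: oppr_inj; exact: h.
have E1 eta y : (phi (X - y) * kap1 (xi0 - eta) - D * phi1 (X - y) * kap (xi0 - eta)) * W eta y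
    = phi (X - y) * kap1 (xi0 - eta) * W eta y
      + (- D) * (phi1 (X - y) * kap (xi0 - eta) * W eta y) by ring.
have E2 eta y : phi (X - y) * kap (xi0 - eta) *
      (2 * Uk eta y + (D * Gc (fun=> 1) phi1 kap f u eta y - Gc f' phi1 kap f u eta y))
    = phi (X - y) * kap (xi0 - eta) * Z1 eta y
      + D * (phi (X - y) * kap (xi0 - eta) * Gc (fun=> 1) phi1 kap f u eta y).
  by rewrite /Z1; ring.
have R1 := Rint2_comb E1 s1 s2 L1a L1b.
have R2 := Rint2_comb E2 s3 s4 L1c L1d.
apply: (etrans R1); apply: (etrans _ (esym R2)).
exact: (congr2 (fun a b => a + b) T1 (etrans (congr1 ( *%R (- D)) T2) (mulrNN _ _))).
Qed.

Hypotheses (phi0 : forall x, 0 <= phi x) (phi_1 : \int[leb]_x phi x = 1).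

(** Average of [c] against the autocorrelation of [kap]. *)
Definition dav (k c : R -> R) (xi : R) : R :=
  \int[leb]_eta (conv c k eta * k (xi - eta)).

(** The transport term of [pairing] is a difference of speeds averaged twice
    against [kap]; bounding one mollified factor by the [L^1] norm of [phi1]
    leaves the average of [`|D - f' xi|]. *)
Lemma pairing_ge (X xi0 D : R) :
  2 * (\int[leb]_eta \int[leb]_y (phi (X - y) * kap (xi0 - eta) * Uk eta y)) -
  (\int[leb]_a `|phi1 a|) * dav kap (fun xi => `|D - f' xi|) xi0 <=
  \int[leb]_eta \int[leb]_y
    ((phi (X - y) * kap1 (xi0 - eta) - D * phi1 (X - y) * kap (xi0 - eta)) * W eta y).
Proof.
rewrite pairing.
have mU := measurable_Uk.
have mG1 := measurable_Gcp mone mphi1; have mGf := measurable_Gcp mf' mphi1.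
have ip := L1_subl X iphi; have ik := L1_subl xi0 ikap.
have mp := L1_measurable ip; have mk := L1_measurable ik.
pose C1' := \int[leb]_a `|phi1 a|.
pose B eta y := D * Gc (fun=> 1) phi1 kap f u eta y - Gc f' phi1 kap f u eta y.
pose g xi := `|D - f' xi|.
have mg : measurable_fun setT g by rewrite /g; meas.
have gB xi : `|g xi| <= `|D| + Gam.
  by rewrite /g normr_id; apply: le_trans (ler_normB _ _) _; rewrite lerD2l.
have Bg eta y : `|B eta y| <= C1' * conv g kap eta.
  have mw := measurable_sliceC (f := fun xi y => wk phi1 f u xi y) y (measurable_wk mphi1 mf mu).
  have ike := L1_shift eta ikap.
  have iA : L1 leb (fun xi => 1 * wk phi1 f u xi y * kap (xi - eta)).
    apply: (L1_bounded_M (A := C1')) => //; first by meas.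
    by move=> xi; rewrite mul1r; exact: normr_wk.
  have iB : L1 leb (fun xi => f' xi * wk phi1 f u xi y * kap (xi - eta)).
    apply: (L1_bounded_M (A := Gam * C1')) => //; first by meas.
    by move=> xi; rewrite normrM ler_pM// normr_wk.
  have -> : B eta y = \int[leb]_xi ((D - f' xi) * wk phi1 f u xi y * kap (xi - eta)).
    rewrite /B /Gc /conv -RintZl; last exact: L1_measurable iA.
    rewrite -RintB//; last exact: L1Zl.
    by apply: eq_Rint => xi; ring.
  have iF : L1 leb (fun xi => (D - f' xi) * wk phi1 f u xi y * kap (xi - eta)).
    apply: (L1_bounded_M (A := (`|D| + Gam) * C1')) => //; first by meas.
    move=> xi; rewrite normrM ler_pM// ?normr_wk//.
    by have := gB xi; rewrite /g normr_id.
  apply: le_trans (le_normr_Rintegral measurableT iF) _.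
  have ig : L1 leb (fun xi => g xi * kap (xi - eta)) by exact: (L1_bounded_M mg gB).
  rewrite /conv -RintZl; last exact: L1_measurable ig.
  apply: le_Rint; [exact: L1_norm|exact: L1Zl|] => xi.
  rewrite !normrM (ger0_norm (kap0 _)) mulrA ler_wpM2r// mulrC ler_wpM2r//.
  exact: normr_wk.
have mB : measurable_fun setT (fun p : R * R => B p.1 p.2) by rewrite /B; meas.
have mcg : measurable_fun setT (conv g kap).
  by rewrite /conv; apply: (measurable_Rint leb (f := fun y x : R => g x * kap (x - y))); meas.
have bcg eta : `|conv g kap eta| <= `|D| + Gam by exact: normr_conv_kap.
have Gam0 : 0 <= `|D| + Gam by exact: le_trans (gB 0).
have C10 : 0 <= C1' by apply: Rint_ge0.
pose CU := (\int[leb]_a `|phi a|) * (\int[leb]_a `|kap1 a|) + Gam * C1'.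
have tens (Z : R -> R -> R) (C : R) : measurable_fun setT (fun p : R * R => Z p.1 p.2) ->
    (forall eta y, `|Z eta y| <= C) ->
    (forall eta, L1 leb (fun y => phi (X - y) * kap (xi0 - eta) * Z eta y)) /\
    L1 leb (fun eta => \int[leb]_y (phi (X - y) * kap (xi0 - eta) * Z eta y)).
  move=> mZ ZC; have C0 : 0 <= C by exact: le_trans (ZC 0 0).
  have mF : measurable_fun setT (fun p : R * R => phi (X - p.2) * kap (xi0 - p.1) * Z p.1 p.2) by meas.
  have dom eta y : `|phi (X - y) * kap (xi0 - eta) * Z eta y| <=
      `|C * kap (xi0 - eta)| * `|phi (X - y)|.
    rewrite !normrM (ger0_norm C0) mulrC -mulrA (mulrC `|phi _|) ler_wpM2r ?mulr_ge0//.
  split; last exact: (leb_L1_tensor mF (L1Zl C ik) ip dom).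
  move=> eta; have mZe := measurable_slice (f := Z) eta mZ.
  apply: (L1_le (mu := leb) (g := fun y => `|C * kap (xi0 - eta)| * `|phi (X - y)|)) => //; first by meas.
  by apply/L1Zl/L1_norm.
have m2U : measurable_fun setT (fun p : R * R => 2 * Uk p.1 p.2) by meas.
have [s1 i1] := tens (fun eta y => 2 * Uk eta y) CU m2U normr_Uk.
have BC eta y : `|B eta y| <= C1' * (`|D| + Gam).
  apply: le_trans (Bg eta y) _; rewrite ler_wpM2l//.
  exact: le_trans (ler_norm _) (bcg eta).
have [s2 i2] := tens B _ mB BC.
have E eta y : phi (X - y) * kap (xi0 - eta) * (2 * Uk eta y + B eta y) =
  phi (X - y) * kap (xi0 - eta) * (2 * Uk eta y) +
  1 * (phi (X - y) * kap (xi0 - eta) * B eta y) by ring.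
have R0 := Rint2_comb E s1 s2 i1 i2.
apply: (@le_trans _ _ (\int[leb]_eta \int[leb]_y (phi (X - y) * kap (xi0 - eta) * (2 * Uk eta y)) +
  1 * \int[leb]_eta \int[leb]_y (phi (X - y) * kap (xi0 - eta) * B eta y))); last first.
  by apply: eq_le_refl; exact: (esym R0).
rewrite mul1r; apply: lerD.
  rewrite -RintZl; last first.
    by apply: (measurable_Rint leb (f := fun eta y : R => phi (X - y) * kap (xi0 - eta) * Uk eta y)); meas.
  rewrite le_eqVlt; apply/orP; left; apply/eqP; apply: eq_Rint => eta.
  have mUe := measurable_slice (f := Uk) eta mU.
  rewrite -RintZl; last by meas.
  by apply: eq_Rint => y; ring.
have negb (v w : R) : `|v| <= w -> - w <= v by rewrite ler_norml => /andP[].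
apply: negb.
apply: le_trans (le_normr_Rintegral measurableT i2) _.
rewrite /dav -RintZl; last by meas.
apply: le_Rint; [exact: L1_norm| |].
  apply: L1Zl; apply: (L1_bounded_M mcg bcg); exact: ik.
move=> eta; apply: le_trans (le_normr_Rintegral measurableT (s2 eta)) _.
rewrite -[leRHS]mulr1 -phi_1 -(Rint_subl X mphi) -RintZl//.
apply: le_Rint; [exact: L1_norm|exact: L1Zl|] => y.
rewrite !normrM (ger0_norm (phi0 _)) (ger0_norm (kap0 _)) mulrAC mulrC.
rewrite (_ : C1' * (_ * _) * _ = phi (X - y) * (kap (xi0 - eta) * (C1' * conv g kap eta))); last by ring.
rewrite mulrCA.
by rewrite ler_wpM2l// ler_wpM2l.
Qed.

End one_profile.
End profile.

(** * Removing the mollification of the kinetic variable *)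

Section autocorrelation.
Context {R : realType}.
Local Notation leb := (@lebesgue_measure R).
Implicit Types (a c k : R -> R).

Section one_kernel.
Variables (k : R -> R) (del : R).
Hypothesis mk : mollifier del k.

Let ck : continuous k. Proof. by case: mk => /smooth_continuous. Qed.
Let C1k : C1 k (derive1 k). Proof. by case: mk => /smooth_C1. Qed.
Let mek := C1_measurable C1k.
Let k0 x : 0 <= k x. Proof. by case: mk. Qed.
Let vk : vanishes_off del k. Proof. by case: mk. Qed.
Let k1 : \int[leb]_x k x = 1. Proof. by case: mk. Qed.
Let ik : L1 leb k := L1_vanishes_off ck vk.

Lemma measurable_conv c : measurable_fun setT c -> measurable_fun setT (conv c k).
Proof.
by move=> mc; apply: (measurable_Rint leb (f := fun eta x : R => c x * k (x - eta))); meas.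
Qed.

Lemma normr_dav c (C xi : R) : measurable_fun setT c -> (forall x, `|c x| <= C) ->
  `|dav k c xi| <= C.
Proof.
move=> mc cC; have mcc := measurable_conv mc.
have bc eta := normr_conv_kap C1k vk k0 k1 eta mc cC.
have i1 : L1 leb (fun eta => conv c k eta * k (xi - eta)).
  by apply: (L1_bounded_M mcc bc); exact: L1_subl.
apply: le_trans (le_normr_Rintegral measurableT i1) _.
rewrite -[leRHS]mulr1 -(Rint_kapC C1k k1 xi) -RintZl; last by meas.
apply: le_Rint; [exact: L1_norm|by apply: L1Zl; exact: L1_subl|] => eta.
by rewrite normrM (ger0_norm (k0 _)) ler_wpM2r.
Qed.

(** Mollification is moved from [a] to [c], so that only [c] is approximated. *)
Lemma conv_conv a c (C : R) : L1 leb a -> measurable_fun setT c ->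
  (forall x, `|c x| <= C) ->
  \int[leb]_eta (conv a k eta * conv c k eta) = \int[leb]_xi (a xi * dav k c xi).
Proof.
move=> ia mc cC; have ma := L1_measurable ia; have mcc := measurable_conv mc.
have bc eta := normr_conv_kap C1k vk k0 k1 eta mc cC.
have C0 : 0 <= C by exact: le_trans (cC 0).
pose F xi eta := a xi * (conv c k eta * k (xi - eta)).
have mF : measurable_fun setT (fun p : R * R => F p.1 p.2) by rewrite /F; meas.
transitivity (\int[leb]_eta \int[leb]_xi F xi eta).
  apply: eq_Rint => eta; rewrite mulrC /conv -RintZl; last by meas.
  by apply: eq_Rint => xi; rewrite /F /conv; ring.
rewrite -(leb_fubini (f := F))//.
  apply: eq_Rint => xi; rewrite -RintZl//.
  by apply: measurable_funM; [exact: mcc|meas].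
apply: (slice_lty (C := C) mF ia) => xi.
have iks := L1_subl xi ik; have miks := L1_measurable iks.
have -> : C * `|a xi| = \int[leb]_eta (`|a xi| * C * k (xi - eta)).
  by rewrite RintZl// (Rint_kapC C1k k1 xi) mulr1 mulrC.
rewrite RintE; last exact: L1Zl.
apply: le_integralT => //; [|by meas|].
  by apply/measurable_EFinP; apply: measurableT_comp => //; exact: (measurable_slice (f := F) xi mF).
move=> eta; rewrite lee_fin /F !normrM -mulrA ler_wpM2l// (ger0_norm (k0 _)).
by rewrite ler_wpM2r.
Qed.

(** The autocorrelation of [k] lives on a window of width comparable to [del] and
    is at most of order [1 / del]: it is dominated by the averages of the
    Lebesgue differentiation theorem. *)
Lemma dav_dist c (C A xi : R) : 0 < del -> (forall x, k x <= A / del) ->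
  measurable_fun setT c -> (forall x, `|c x| <= C) ->
  `|dav k c xi - c xi| <= (6 * A) * fine (davg c xi (3 * del)).
Proof.
move=> d0 kA mc cC; have mcc := measurable_conv mc.
have bc eta := normr_conv_kap C1k vk k0 k1 eta mc cC.
have C0 : 0 <= C by exact: le_trans (cC 0).
pose B : set R := ball xi (3 * del).
pose h x := \1_B x * `|c x - c xi|.
have mB : measurable B by exact: measurable_ball.
have mI : measurable_fun setT (\1_B : R -> R) by exact: measurable_indic.
have mh : measurable_fun setT h by rewrite /h; meas.
have lB : leb B = (6 * del)%:E.
  rewrite /B lebesgue_measure_ball ?mulr_ge0 ?ltW//; congr _%:E; ring.
have iB : L1 leb (\1_B : R -> R).
  apply: L1P => //; under eq_integral do rewrite /= ger0_norm//.
  by have := ltry (6 * del); rewrite -lB integral_indic// setIT.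
have ih : L1 leb h.
  apply: (L1_le (mu := leb) (g := fun x => (2 * C) * \1_B x)) => //; last exact: L1Zl.
  move=> x; rewrite /h normrM normr_id mulrC ger0_norm// ler_wpM2r//.
  by apply: le_trans (ler_normB _ _) _; rewrite mulr2n mulrDl mul1r lerD.
have EI : (A / del) * \int[leb]_x h x = (6 * A) * fine (davg c xi (3 * del)).
  have -> : davg c xi (3 * del) = ((6 * del)^-1 * \int[leb]_x h x)%:E.
    rewrite /davg /iavg -/B lB [RHS]EFinM (RintE ih); congr (_ * _)%E.
      by rewrite inver gt_eqF// mulr_gt0.
    rewrite [LHS]integral_mkcond; apply: eq_integral => x _.
    rewrite patchE /h indicE; case: (x \in B) => /=; rewrite ?mul1r ?mul0r//.
  have d1 : del != 0 by rewrite gt_eqF.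
  by rewrite /=; field.
rewrite -EI; set I := (X in _ <= X).
have iks := L1_subl xi ik; have miks := L1_measurable iks.
have ic : L1 leb (fun eta => conv c k eta * k (xi - eta)) by exact: (L1_bounded_M mcc bc).
have -> : dav k c xi - c xi = \int[leb]_eta ((conv c k eta - c xi) * k (xi - eta)).
  rewrite -[X in _ - X = _]mulr1 -(Rint_kapC C1k k1 xi) -RintZl// -RintB//; last exact: L1Zl.
  by apply: eq_Rint => eta; rewrite mulrBl.
have icc : L1 leb (fun eta => (conv c k eta - c xi) * k (xi - eta)).
  under eq_fun do rewrite mulrBl.
  by apply: L1B => //; exact: L1Zl.
apply: le_trans (le_normr_Rintegral measurableT icc) _.
rewrite -[leRHS]mulr1 -(Rint_kapC C1k k1 xi) -RintZl//.
apply: le_Rint; [exact: L1_norm|exact: L1Zl|] => eta.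
rewrite normrM (ger0_norm (k0 _)).
have [far|near] := ltP del `|xi - eta|; first by rewrite vk// !mulr0.
rewrite ler_wpM2r//.
have ike := L1_shift eta ik; have mike := L1_measurable ike.
have ice : L1 leb (fun x => c x * k (x - eta)) by exact: L1_bounded_M.
have -> : conv c k eta - c xi = \int[leb]_x ((c x - c xi) * k (x - eta)).
  rewrite -[X in _ - X = _]mulr1 -(Rint_kap C1k k1 eta) -RintZl// -RintB//; last exact: L1Zl.
  by apply: eq_Rint => x; rewrite mulrBl.
have icce : L1 leb (fun x => (c x - c xi) * k (x - eta)).
  under eq_fun do rewrite mulrBl.
  by apply: L1B => //; exact: L1Zl.
apply: le_trans (le_normr_Rintegral measurableT icce) _.
rewrite /I -RintZl//; apply: le_Rint; [exact: L1_norm|exact: L1Zl|] => x.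
rewrite normrM (ger0_norm (k0 _)) /h indicE.
have [xB|xB] := boolP (x \in B); first by rewrite mul1r mulrC ler_wpM2r.
rewrite mul0r mulr0 vk ?mulr0//.
move: xB; rewrite notin_setE /B /ball/= => /negP; rewrite -leNgt => xB.
have := ler_normD (xi - eta) (eta - x); rewrite addrA subrK (distrC eta) => tri.
have := le_trans xB tri; lra.
Qed.

End one_kernel.

Section kernels.
Variables (k : nat -> R -> R) (del : nat -> R) (A : R).
Hypotheses (mk : forall n, mollifier (del n) (k n)) (d0 : forall n, 0 < del n).
Hypotheses (kA : forall n x, k n x <= A / del n) (dl : del n @[n --> \oo] --> 0).

Lemma dav_cvg c (C xi : R) : measurable_fun setT c -> (forall x, `|c x| <= C) ->
  lebesgue_pt c xi -> dav (k n) c xi @[n --> \oo] --> c xi.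
Proof.
move=> mc cC lc.
have d3 : 3 * del n @[n --> \oo] --> 0^'+.
  have h : 3 * del n @[n --> \oo] --> (0 : R).
    by rewrite -[X in _ --> X](mulr0 (3 : R)); apply: cvgMr.
  move=> S [e /= e0 eS]; suff : \forall n \near \oo, S (3 * del n) by [].
  near=> n.
  have p : 0 < 3 * del n by rewrite mulr_gt0.
  apply: (eS _ _ p) => /=.
  by near: n; move/cvgrPdist_lt : h => /(_ e e0).
have h1 : davg c xi (3 * del n) @[n --> \oo] --> 0%E by exact: (cvg_comp _ _ d3 lc).
have h2 : (6 * A) * fine (davg c xi (3 * del n)) @[n --> \oo] --> (0 : R).
  rewrite -[X in _ --> X](mulr0 (6 * A)); apply: cvgMr; exact: (fine_cvg h1).
apply/cvgrPdist_lt => e e0; near=> n.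
rewrite distrC; apply: le_lt_trans (dav_dist (mk n) xi (d0 n) (kA n) mc cC) _.
apply: le_lt_trans (ler_norm _) _; rewrite -[X in `|X|]subr0 distrC.
by near: n; move/cvgrPdist_lt : h2 => /(_ e e0).
Unshelve. all: by end_near. Qed.

Lemma ae_dav_cvg c (C : R) : measurable_fun setT c -> (forall x, `|c x| <= C) ->
  {ae leb, forall xi, dav (k n) c xi @[n --> \oo] --> c xi}.
Proof.
move=> mc cC; have lc : locally_integrable setT c.
  split => //; first exact: openT.
  move=> K _ cK.
  have mK : measurable K by apply: compact_measurable.
  apply: (@le_lt_trans _ _ (\int[leb]_(x in K) C%:E)%E).
    apply: ge0_le_integral => //.
    - by apply/measurable_EFinP; apply: measurableT_comp => //; exact: measurable_funTS.
    - by move=> x _; rewrite lee_fin.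
  have h := compact_finite_measure cK.
  rewrite integral_cst//; apply: lte_mul_pinfty => //.
  by rewrite lee_fin (le_trans _ (cC 0)).
apply: ae_imp (lebesgue_differentiation lc) => xi; exact: dav_cvg mc cC.
Qed.

(** [c] is merely bounded and measurable: convergence holds at its Lebesgue
    points, and [a] provides the domination. *)
Lemma lim_conv_conv (a c : R -> R -> R) (C : R) :
  measurable_fun setT (fun p : R * R => a p.1 p.2) ->
  measurable_fun setT (fun p : R * R => c p.1 p.2) ->
  (\int[leb]_xi \int[leb]_y `|a xi y|%:E < +oo)%E ->
  (forall xi y, `|c xi y| <= C) ->
  \int[leb]_y \int[leb]_eta (conv (a ^~ y) (k n) eta * conv (c ^~ y) (k n) eta)
    @[n --> \oo] --> \int[leb]_y \int[leb]_xi (a xi y * c xi y).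
Proof.
move=> ma mc ia cC.
have C0 : 0 <= C by exact: le_trans (cC 0 0).
have ma' : measurable_fun setT (fun p : R * R => a p.2 p.1) by exact: (measurable_swap (f := a) ma).
have mc' : measurable_fun setT (fun p : R * R => c p.2 p.1) by exact: (measurable_swap (f := c) mc).
have iay : (\int[leb]_y \int[leb]_xi `|a xi y|%:E < +oo)%E.
  by rewrite (tonelli leb leb (f := fun y xi : R => `|a xi y|))//; meas.
have [N [mN N0 Na]] := ae_L1 (mu := leb) (nu := leb) (f := fun y xi => a xi y) ma' iay.
have La y : ~ N y -> L1 leb (a ^~ y).
  by move=> Ny; apply: contrapT => h; apply: Ny; apply: Na.
have mcy y : measurable_fun setT (c ^~ y) := measurable_sliceC (f := c) y mc.
have mk' n : measurable_fun setT (k n).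
  by have [sk _ _ _] := mk n; exact: (C1_measurable (smooth_C1 sk)).
have mdav n y : measurable_fun setT (fun xi => dav (k n) (c ^~ y) xi).
  have mk0 := mk' n; have mcc := measurable_conv (mk n) (mcy y).
  apply: (measurable_Rint leb (f := fun xi eta : R => conv (c ^~ y) (k n) eta * k n (xi - eta))).
  by meas.
have mconv (b : R -> R -> R) n : measurable_fun setT (fun p : R * R => b p.1 p.2) ->
    measurable_fun setT (fun p : R * R => conv (b ^~ p.1) (k n) p.2).
  move=> mb; have mk0 := mk' n.
  by apply: (measurable_Rint leb (f := fun (p : R * R) (x : R) => b x p.1 * k n (x - p.2))); meas.
have mn y n : ~ N y -> `|\int[leb]_eta (conv (a ^~ y) (k n) eta * conv (c ^~ y) (k n) eta)| <=
    C * \int[leb]_xi `|a xi y|.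
  move=> Ny; have i := La y Ny.
  rewrite (conv_conv (mk n) i (mcy y) (fun x => cC x y)).
  have iad : L1 leb (fun xi => a xi y * dav (k n) (c ^~ y) xi).
    under eq_fun do rewrite mulrC.
    exact: (L1_bounded_M (mdav n y) (fun x => normr_dav (mk n) x (mcy y) (fun x => cC x y)) i).
  apply: le_trans (le_normr_Rintegral measurableT iad) _.
  have may := measurable_sliceC (f := a) y ma.
  rewrite -RintZl; last by meas.
  apply: le_Rint; [exact: L1_norm|by apply/L1Zl/L1_norm|] => xi.
  rewrite normrM mulrC ler_wpM2r//.
  by apply: (normr_dav (mk n) xi (mcy y)) => x; exact: cC.
(* Slices with a non-integrable [a ^~ y] form a null set, discarded by an indicator. *)
pose g y := C * \int[leb]_xi `|a xi y|.
pose Z y : R := \1_(~` N) y.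
have mZ : measurable_fun setT Z by apply: measurable_indic; exact: measurableC.
pose F n y := \int[leb]_eta (conv (a ^~ y) (k n) eta * conv (c ^~ y) (k n) eta).
pose F0 y := \int[leb]_xi (a xi y * c xi y).
have mF n : measurable_fun setT (F n).
  have m1 := mconv a n ma; have m2 := mconv c n mc.
  by apply: (measurable_Rint leb (f := fun y eta : R => conv (a ^~ y) (k n) eta * conv (c ^~ y) (k n) eta)); exact: measurable_funM m1 m2.
have mF0 : measurable_fun setT F0.
  by apply: (measurable_Rint leb (f := fun y xi : R => a xi y * c xi y)); meas.
have aeN : {ae leb, forall y, ~ N y} by exists N; split => // y /= /contrapT.
have ZE y : ~ N y -> Z y = 1 by move=> Ny; rewrite /Z indicE mem_set.
have eF (G : R -> R) : measurable_fun setT G -> \int[leb]_y G y = \int[leb]_y (Z y * G y).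
  move=> mG; apply: ae_eq_Rint => //; first exact: measurable_funM.
  by apply: ae_imp aeN => y /ZE ->; rewrite mul1r.
have ig : L1 leb g.
  apply: L1Zl; apply: (L1_Rint (mu := leb) (nu := leb) (f := fun y xi : R => `|a xi y|)); first by meas.
  by under eq_integral do under eq_integral do rewrite normr_id.
rewrite (eF _ mF0) (_ : (fun n => _) = (fun n => \int[leb]_y (Z y * F n y))); last first.
  by apply/funext => n; exact: (eF _ (mF n)).
apply: (Rint_dominated (mu := leb) (g := g)) => //.
- by move=> n; apply: measurable_funM mZ (mF n).
- exact: measurable_funM mZ mF0.
- apply: ae_imp aeN => y Ny; rewrite ZE// mul1r; under eq_fun do rewrite mul1r.
  have i := La y Ny.
  rewrite /F (_ : (fun n => _) = (fun n => \int[leb]_xi (a xi y * dav (k n) (c ^~ y) xi))); last first.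
    by apply/funext => n; exact: (conv_conv (mk n) i (mcy y) (fun x => cC x y)).
  apply: (Rint_dominated (mu := leb) (g := fun xi => C * `|a xi y|)).
  + by move=> n; apply: measurable_funM; [exact: L1_measurable i|exact: mdav].
  + by apply: measurable_funM; [exact: L1_measurable i|exact: mcy].
  + apply: ae_imp (ae_dav_cvg (mcy y) (fun x => cC x y)) => xi h.
    by apply: cvgMr; exact: h.
  + by apply/L1Zl/L1_norm.
  + move=> n xi; rewrite normrM mulrC ler_wpM2r//.
    by apply: (normr_dav (mk n) xi (mcy y)) => x; exact: cC.
- move=> n y; have [Ny|Ny] := pselect (N y).
    rewrite /Z indicE memNset/=; last by move=> /(_ Ny).
    by rewrite mul0r normr0 mulr_ge0//; apply: Rint_ge0.
  by rewrite ZE// mul1r; exact: mn.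
Qed.

End kernels.
End autocorrelation.

(** * Parabolic terms at a fixed time *)

Lemma integral2_prod_le {R : realType} d d' (X : measurableType d)
    (Y : measurableType d') (mu : {measure set X -> \bar R})
    (nu : {sigma_finite_measure set Y -> \bar R}) (a b : X -> Y -> R) (B C : R) :
  measurable_fun setT (fun p : X * Y => a p.1 p.2) ->
  measurable_fun setT (fun p : X * Y => b p.1 p.2) ->
  0 <= B -> (forall x y, `|b x y| <= B) ->
  (\int[mu]_x \int[nu]_y `|a x y|%:E <= C%:E)%E ->
  (\int[mu]_x \int[nu]_y `|a x y * b x y|%:E <= (B * C)%:E)%E.
Proof.
move=> ma mb B0 bB aC; rewrite EFinM.
apply: (@le_trans _ _ (B%:E * \int[mu]_x \int[nu]_y `|a x y|%:E)%E); last first.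
  by rewrite lee_wpmul2l.
have mn : measurable_fun setT (fun p : X * Y => `|a p.1 p.2|) by meas.
rewrite -(ge0_integral2rZl mu nu (f := fun x y => `|a x y|))//.
apply: le_integralT.
- by apply: measurable_integral => //; meas.
- by apply: measurable_integral => [|? ?]; [meas|rewrite mulr_ge0].
- by move=> x; apply: integral_ge0.
move=> x; have max := measurable_slice (f := a) x ma; have mbx := measurable_slice (f := b) x mb.
apply: le_integralT => //; [by meas|by meas|] => y.
by rewrite lee_fin normrM mulrC ler_wpM2r.
Qed.

(** Integration by parts in the second variable, on almost every slice. *)
Lemma integral2_ibp {R : realType} (leb := @lebesgue_measure R) (a a' b b' : R -> R -> R) :
  measurable_fun setT (fun p : R * R => a p.1 p.2) ->
  measurable_fun setT (fun p : R * R => a' p.1 p.2) ->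
  measurable_fun setT (fun p : R * R => b p.1 p.2) ->
  measurable_fun setT (fun p : R * R => b' p.1 p.2) ->
  (forall eta, C1 (a eta) (fun y => - a' eta y)) ->
  (forall eta, C1 (b eta) (fun y => - b' eta y)) ->
  (\int[leb]_eta \int[leb]_y `|a' eta y * b eta y|%:E < +oo)%E ->
  (\int[leb]_eta \int[leb]_y `|a eta y * b' eta y|%:E < +oo)%E ->
  (\int[leb]_eta \int[leb]_y `|a eta y * b eta y|%:E < +oo)%E ->
  \int[leb]_eta \int[leb]_y (a' eta y * b eta y) =
  - \int[leb]_eta \int[leb]_y (a eta y * b' eta y).
Proof.
move=> ma ma' mb mb' aC bC lt1 lt2 lt3.
pose P1 eta y := a' eta y * b eta y; pose P2 eta y := a eta y * b' eta y.
pose P3 eta y := a eta y * b eta y.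
have mP1 : measurable_fun setT (fun p : R * R => P1 p.1 p.2) by rewrite /P1; meas.
have mP2 : measurable_fun setT (fun p : R * R => P2 p.1 p.2) by rewrite /P2; meas.
have mP3 : measurable_fun setT (fun p : R * R => P3 p.1 p.2) by rewrite /P3; meas.
have h1 := ae_L1 (mu := leb) (nu := leb) (f := P1) mP1 lt1.
have h2 := ae_L1 (mu := leb) (nu := leb) (f := P2) mP2 lt2.
have h3 := ae_L1 (mu := leb) (nu := leb) (f := P3) mP3 lt3.
have mQ1 : measurable_fun setT (fun eta => \int[leb]_y P1 eta y).
  exact: (measurable_Rint leb (f := P1)).
have mQ2 : measurable_fun setT (fun eta => \int[leb]_y P2 eta y).
  exact: (measurable_Rint leb (f := P2)).
apply: (etrans _ (RintN leb (f := fun eta => \int[leb]_y P2 eta y) mQ2)).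
apply: ae_eq_Rint; [exact: mQ1|exact: measurable_funN|].
apply: ae_imp (ae_and h1 (ae_and h2 h3)) => eta [l1 [l2 l3]].
have E (y : R) : - a' eta y * b eta y + a eta y * - b' eta y = - (P1 eta y + P2 eta y).
  by rewrite mulNr mulrN opprD.
have l12 : L1 leb (fun y => P1 eta y + P2 eta y) by exact: L1D.
have lN : L1 leb (fun y => - a' eta y * b eta y + a eta y * - b' eta y).
  by have := L1Zl (-1) l12; under eq_fun do rewrite mulN1r -E.
have := Rint_derive_L1 (C1M (aC eta) (bC eta)) l3 lN.
under eq_Rint do rewrite E.
rewrite RintN; last exact: L1_measurable l12.
by rewrite RintD// => /eqP; rewrite oppr_eq0 addr_eq0 => /eqP.
Qed.

Section parabolic.
Context {R : realType}.
Local Notation leb := (@lebesgue_measure R).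
Implicit Types (c f g u v kap phi : R -> R).

(** Functions of mean zero see only the oscillation of the profile. *)
Lemma Gc_mean0 c g kap f f' u (A M del K : R) : mollifier del kap -> C1 f f' ->
  measurable_fun setT u -> measurable_fun setT c -> (forall xi, `|c xi| <= A) ->
  continuous g -> vanishes_off M g -> 0 <= M -> \int[leb]_a g a = 0 -> osc_bound u K ->
  (\int[leb]_eta \int[leb]_y `|Gc c g kap f u eta y|%:E <=
    (A * (8 * M * K * \int[leb]_a `|g a|))%:E)%E.
Proof.
move=> [sk k0 vk k1] fC mu mc cA cg vg M0 g0 osc.
have mf := C1_measurable fC.
apply: (Gc_L1 (smooth_C1 sk) vk k0 k1 fC mu mc cA (L1_vanishes_off cg vg)).
have h0 : forall xi : R, `|f xi - f xi| <= 0 by move=> xi; rewrite subrr normr0.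
have := wk_close cg vg M0 mu mf mf osc h0; rewrite g0 addr0.
by under eq_integral do under eq_integral do rewrite mulr0 subr0.
Qed.

Section two_profiles.
Variables (phi kap : R -> R) (eps del : R).
Hypotheses (mphi : mollifier eps phi) (mkap : mollifier del kap) (eps0 : 0 <= eps).
Variables (f1 f1' f2 f2' u1 u2 c1 c2 : R -> R) (A1 A2 K1 : R).
Hypotheses (f1C : C1 f1 f1') (f2C : C1 f2 f2').
Hypotheses (mu1 : measurable_fun setT u1) (mu2 : measurable_fun setT u2).
Hypotheses (mc1 : measurable_fun setT c1) (c1A : forall xi, `|c1 xi| <= A1).
Hypotheses (mc2 : measurable_fun setT c2) (c2A : forall xi, `|c2 xi| <= A2).
Hypothesis osc1 : osc_bound u1 K1.

Let phi1 := derive1 phi.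
Let phi2 := derive1 phi1.
Let sphi : smooth phi. Proof. by case: mphi. Qed.
Let sphi1 : smooth phi1 := smooth_derive sphi.
Let sphi2 : smooth phi2 := smooth_derive sphi1.
Let vphi : vanishes_off eps phi. Proof. by case: mphi. Qed.
Let vphi1 : vanishes_off eps phi1 := vanishes_off_derive (smooth_C1 sphi) vphi.
Let vphi2 : vanishes_off eps phi2 := vanishes_off_derive (smooth_C1 sphi1) vphi1.

Local Notation G c g f u := (Gc c g kap f u).

Let bG c g f f' u (A : R) : C1 f f' -> measurable_fun setT u -> measurable_fun setT c ->
  (forall xi, `|c xi| <= A) -> L1 leb g -> 
  forall eta y, `|G c g f u eta y| <= A * \int[leb]_a `|g a|.
Proof.
move=> fC mu mc cA ig eta y; have [sk k0 vk k1] := mkap.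
exact: (normr_Gc (smooth_C1 sk) vk k0 k1 fC mu mc cA).
Qed.

Let mG c g f f' u : C1 f f' -> measurable_fun setT u -> measurable_fun setT c ->
  measurable_fun setT g -> measurable_fun setT (fun p : R * R => G c g f u p.1 p.2).
Proof.
move=> fC mu mc mg; have [sk k0 vk k1] := mkap.
exact: (measurable_Gcp (smooth_C1 sk) fC mu).
Qed.

Lemma Gc_prod_lty g h : continuous g -> vanishes_off eps g -> \int[leb]_a g a = 0 ->
  L1 leb h ->
  (\int[leb]_eta \int[leb]_y `|G c1 g f1 u1 eta y * G c2 h f2 u2 eta y|%:E <=
    ((A2 * \int[leb]_a `|h a|) * (A1 * (8 * eps * K1 * \int[leb]_a `|g a|)))%:E)%E.
Proof.
move=> cg vg g0 ih; have ig := L1_vanishes_off cg vg.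
have mg := L1_measurable ig; have mh := L1_measurable ih.
have m1 := mG f1C mu1 mc1 mg; have m2 := mG f2C mu2 mc2 mh.
have A20 : 0 <= A2 by exact: le_trans (c2A 0).
have B0 : 0 <= A2 * \int[leb]_a `|h a| by rewrite mulr_ge0//; exact: Rint_ge0.
have bb := bG f2C mu2 mc2 c2A ih.
apply: (integral2_prod_le (mu := leb) (nu := leb) (a := G c1 g f1 u1) (b := G c2 h f2 u2) m1 m2 B0 bb).
exact: (Gc_mean0 mkap f1C mu1 mc1 c1A cg vg eps0 g0 osc1).
Qed.

(** One spatial derivative is moved to the other profile. The oscillation bound
    makes all products integrable, since the derivatives of [phi] have mean
    zero. *)
Lemma Gc_ibp :
  \int[leb]_eta \int[leb]_y (G c1 phi2 f1 u1 eta y * G c2 phi f2 u2 eta y) =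
  - \int[leb]_eta \int[leb]_y (G c1 phi1 f1 u1 eta y * G c2 phi1 f2 u2 eta y).
Proof.
have cphi1 := smooth_continuous sphi1; have cphi2 := smooth_continuous sphi2.
have iphi : L1 leb phi := L1_vanishes_off (smooth_continuous sphi) vphi.
have iphi1 : L1 leb phi1 := L1_vanishes_off cphi1 vphi1.
have iphi2 : L1 leb phi2 := L1_vanishes_off cphi2 vphi2.
have i1 : \int[leb]_a phi1 a = 0 := Rint_derive_eq0 (smooth_C1 sphi) vphi.
have i2 : \int[leb]_a phi2 a = 0 := Rint_derive_eq0 (smooth_C1 sphi1) vphi1.
have lt1 := le_lt_trans (Gc_prod_lty cphi2 vphi2 i2 iphi) (ltry _).
have lt2 := le_lt_trans (Gc_prod_lty cphi1 vphi1 i1 iphi1) (ltry _).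
have lt3 := le_lt_trans (Gc_prod_lty cphi1 vphi1 i1 iphi) (ltry _).
have mg12 := mG f1C mu1 mc1 (L1_measurable iphi2).
have mg11 := mG f1C mu1 mc1 (L1_measurable iphi1).
have mg20 := mG f2C mu2 mc2 (L1_measurable iphi).
have mg21 := mG f2C mu2 mc2 (L1_measurable iphi1).
have [sk k0 vk k1] := mkap.
have Ca eta := Gc_C1 (smooth_C1 sk) vk k0 k1 f1C mu1 mc1 c1A eta (smooth_C1 sphi1) vphi1.
have Cb eta := Gc_C1 (smooth_C1 sk) vk k0 k1 f2C mu2 mc2 c2A eta (smooth_C1 sphi) vphi.
have h := @integral2_ibp R (G c1 phi1 f1 u1) (G c1 phi2 f1 u1) (G c2 phi f2 u2) (G c2 phi1 f2 u2).
have h1 := h mg11 mg12.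
have h2 := h1 mg20 mg21.
have h3 := h2 Ca Cb.
have h4 := h3 lt1 lt2 lt3.
exact: h4.
Qed.

End two_profiles.

(** Cauchy--Schwarz in the form used for the dissipation: the square of
    [v1 x - v2 x'] is integrated against the product of the two weights. *)
Lemma weighted_young (r1 r2 v1 v2 : R -> R) :
  (forall x, 0 <= r1 x) -> (forall x, 0 <= r2 x) ->
  L1 leb r1 -> L1 leb r2 ->
  L1 leb (fun x => v1 x * r1 x) -> L1 leb (fun x => v2 x * r2 x) ->
  L1 leb (fun x => v1 x ^+ 2 * r1 x) -> L1 leb (fun x => v2 x ^+ 2 * r2 x) ->
  2 * (\int[leb]_x (v1 x * r1 x) * \int[leb]_x (v2 x * r2 x)) <=
  (\int[leb]_x (v1 x ^+ 2 * r1 x)) * (\int[leb]_x r2 x) +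
  (\int[leb]_x (v2 x ^+ 2 * r2 x)) * (\int[leb]_x r1 x).
Proof.
move=> r10 r20 i1 i2 iv1 iv2 iq1 iq2.
set V1 := \int[leb]_x (v1 x * r1 x); set V2 := \int[leb]_x (v2 x * r2 x).
set Q1 := \int[leb]_x (v1 x ^+ 2 * r1 x); set Q2 := \int[leb]_x (v2 x ^+ 2 * r2 x).
set U1 := \int[leb]_x r1 x; set U2 := \int[leb]_x r2 x.
have step (a : R) : 0 <= Q1 - 2 * a * V1 + a ^+ 2 * U1.
  have h : 0 <= \int[leb]_x ((v1 x - a) ^+ 2 * r1 x) by apply: Rint_ge0 => x; rewrite mulr_ge0// sqr_ge0.
  suff <- : \int[leb]_x ((v1 x - a) ^+ 2 * r1 x) = Q1 - 2 * a * V1 + a ^+ 2 * U1 by [].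
  rewrite /U1 -RintZl; last exact: L1_measurable i1.
  rewrite /V1 -RintZl; last exact: L1_measurable iv1.
  rewrite /Q1 -RintB//; last exact: L1Zl.
  rewrite -RintD; [|by apply: L1B => //; exact: L1Zl|exact: L1Zl].
  by apply: eq_Rint => x; ring.
have h : 0 <= \int[leb]_x ((Q1 - 2 * v2 x * V1 + v2 x ^+ 2 * U1) * r2 x).
  by apply: Rint_ge0 => x; rewrite mulr_ge0.
have E : \int[leb]_x ((Q1 - 2 * v2 x * V1 + v2 x ^+ 2 * U1) * r2 x) =
    Q1 * U2 - (2 * V1) * V2 + U1 * Q2.
  rewrite /U2 -RintZl; last exact: L1_measurable i2.
  rewrite /V2 -RintZl; last exact: L1_measurable iv2.
  rewrite /Q2 -(RintZl leb U1 (L1_measurable iq2)).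
  rewrite -RintB; [|exact: L1Zl|exact: L1Zl].
  rewrite -RintD; [|by apply: L1B; exact: L1Zl|exact: L1Zl].
  by apply: eq_Rint => x; ring.
move: h; rewrite E; move: V1 V2 Q1 Q2 U1 U2 {step E} => V1 V2 Q1 Q2 U1 U2; lra.
Qed.

End parabolic.

(** * The mollified comparison of two kinetic solutions *)

Lemma L1_finite {R : realType} d (X : measurableType d)
    (mu : {finite_measure set X -> \bar R}) (f : X -> R) (C : R) :
  measurable_fun setT f -> (forall x, `|f x| <= C) -> L1 mu f.
Proof.
move=> mf fC; apply: L1P => //.
apply: (@le_lt_trans _ _ (\int[mu]_x C%:E)%E).
  by apply: le_integralT => //; meas.
have C0 : 0 <= C by exact: le_trans (fC point).
rewrite integral_cst//; apply: lte_mul_pinfty => //.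
by rewrite ltey_eq fin_num_measure.
Qed.

Lemma Rfubini_L1 {R : realType} d d' (X : measurableType d) (Y : measurableType d')
    (mu : {sigma_finite_measure set X -> \bar R})
    (nu : {sigma_finite_measure set Y -> \bar R}) (f : X -> Y -> R) :
  measurable_fun setT (fun p : X * Y => f p.1 p.2) ->
  (\int[mu]_x \int[nu]_y `|f x y|%:E < +oo)%E ->
  L1 nu (fun y => \int[mu]_x f x y) /\
  \int[nu]_y \int[mu]_x f x y = \int[mu]_x \int[nu]_y f x y.
Proof.
move=> mf h; split; last by rewrite (Rfubini mf h).
have mf' := measurable_swap mf.
apply: (L1_Rint (mu := nu) (nu := mu) (f := fun y x => f x y) mf').
have mn : measurable_fun setT (fun p : X * Y => `|f p.1 p.2|) by meas.
by rewrite -(tonelli nu mu (f := fun x y => `|f x y|) mn).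
Qed.

Lemma Rfubini_L1_opp {R : realType} d d' (X : measurableType d) (Y : measurableType d')
    (mu : {sigma_finite_measure set X -> \bar R})
    (nu : {sigma_finite_measure set Y -> \bar R}) (f g : X -> Y -> R) :
  measurable_fun setT (fun p : X * Y => f p.1 p.2) ->
  measurable_fun setT (fun p : X * Y => g p.1 p.2) ->
  (\int[mu]_x \int[nu]_y `|f x y|%:E < +oo)%E ->
  (\int[mu]_x \int[nu]_y `|g x y|%:E < +oo)%E ->
  {ae mu, forall x, L1 nu (f x) -> L1 nu (g x) ->
    \int[nu]_y f x y = - \int[nu]_y g x y} ->
  L1 nu (fun y => \int[mu]_x f x y) /\
  \int[nu]_y \int[mu]_x f x y = - \int[mu]_x \int[nu]_y g x y.
Proof.
move=> mf mg hf hg fg; have [i1 ->] := Rfubini_L1 mf hf; split => //.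
have mF := measurable_Rint nu mf; have mG := measurable_Rint nu mg.
rewrite -RintN//; apply: ae_eq_Rint => //; first exact: measurable_funN.
apply: ae_imp (ae_and fg (ae_and (ae_L1 mf hf) (ae_L1 mg hg))) => x [h [l1 l2]].
exact: h.
Qed.

Lemma eq_le_refl_e {R : realType} (x y : \bar R) : x = y -> (x <= y)%E.
Proof. by move=> ->. Qed.

Lemma Rint2_le_pos {R : realType} d d' (X : measurableType d) (Y : measurableType d')
    (mu : {sigma_finite_measure set X -> \bar R})
    (nu : {sigma_finite_measure set Y -> \bar R}) (f : X -> Y -> R) :
  measurable_fun setT (fun p : X * Y => f p.1 p.2) ->
  (\int[mu]_x \int[nu]_y `|f x y|%:E < +oo)%E ->
  ((\int[mu]_x \int[nu]_y f x y)%:E <= \int[mu]_x \int[nu]_y (Num.max 0 (f x y))%:E)%E.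
Proof.
move=> mf h; rewrite (Rfubini_prod mf h); have i := L1_prod mf h.
pose g (p : X * Y) := Num.max 0 (f p.1 p.2).
have mg : measurable_fun setT g by apply: measurable_maxr; [exact: measurable_cst|exact: mf].
have j : L1 (mu \x nu)%E g.
  apply: (L1_le (mu := (mu \x nu)%E) (g := fun p => `|f p.1 p.2|) mg); last exact: L1_norm.
  by move=> p; rewrite ger0_norm ?le_max ?lexx// ge_max normr_ge0 ler_norm.
have m1 : measurable_fun setT (fun p : X * Y => (g p)%:E) by exact/measurable_EFinP.
have m0 (p : X * Y) : (0 <= (g p)%:E)%E by rewrite lee_fin le_max lexx.
apply: (le_trans _ (eq_le_refl_e (@fubini_tonelli1 _ _ _ _ R mu nu _ m1 m0))).
rewrite -(RintE j) lee_fin.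
by apply: (le_Rint (mu := (mu \x nu)%E) i j) => p; rewrite /g le_max lexx orbT.
Qed.

(** An inequality known, for each [y], for almost every [x], can be integrated. *)
Lemma Rint2_le_ae {R : realType} d d' (X : measurableType d) (Y : measurableType d')
    (mu : {sigma_finite_measure set X -> \bar R})
    (nu : {sigma_finite_measure set Y -> \bar R}) (f g : X -> Y -> R) :
  measurable_fun setT (fun p : X * Y => f p.1 p.2) ->
  measurable_fun setT (fun p : X * Y => g p.1 p.2) ->
  (\int[mu]_x \int[nu]_y `|f x y|%:E < +oo)%E -> (forall x y, 0 <= g x y) ->
  (forall y, {ae mu, forall x, f x y <= g x y}) ->
  ((\int[mu]_x \int[nu]_y f x y)%:E <= \int[mu]_x \int[nu]_y (g x y)%:E)%E.
Proof.
move=> mf mg h g0 fg; apply: (le_trans (Rint2_le_pos mf h)).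
pose fp x y := Num.max 0 (f x y).
have mfp : measurable_fun setT (fun p : X * Y => fp p.1 p.2).
  by apply: measurable_maxr; [exact: measurable_cst|exact: mf].
have fp0 x y : 0 <= fp x y by rewrite le_max lexx.
rewrite (tonelli nu mu mfp fp0) (tonelli nu mu mg g0).
have mg' := measurable_swap mg; have mfp' := measurable_swap mfp.
apply: le_integralT.
- exact: (measurable_integral mu (f := fun y x => fp x y)).
- exact: (measurable_integral mu (f := fun y x => g x y)).
- by move=> y; apply: integral_ge0 => x _; rewrite lee_fin.
move=> y; apply: ae_le_integralT.
- by apply/measurable_EFinP; exact: (measurable_sliceC (f := fp) y mfp).
- by apply/measurable_EFinP; exact: (measurable_sliceC (f := g) y mg).
- by move=> x; rewrite lee_fin.
- by move=> x; rewrite lee_fin.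
by apply: ae_imp (fg y) => x h'; rewrite lee_fin ge_max g0.
Qed.

Lemma ge0_integral2D {R : realType} d d' (X : measurableType d) (Y : measurableType d')
    (mu : {measure set X -> \bar R})
    (nu : {sigma_finite_measure set Y -> \bar R}) (f g : X -> Y -> R) :
  measurable_fun setT (fun p : X * Y => f p.1 p.2) ->
  measurable_fun setT (fun p : X * Y => g p.1 p.2) ->
  (forall x y, 0 <= f x y) -> (forall x y, 0 <= g x y) ->
  (\int[mu]_x \int[nu]_y (f x y + g x y)%:E =
   \int[mu]_x \int[nu]_y (f x y)%:E + \int[mu]_x \int[nu]_y (g x y)%:E)%E.
Proof.
move=> mf mg f0 g0.
have i0 (h : X -> Y -> R) : (forall x y, 0 <= h x y) ->
    forall x, [set: X] x -> (0 <= \int[nu]_y (h x y)%:E)%E.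
  by move=> h0 x _; apply: integral_ge0 => y _; rewrite lee_fin.
rewrite -(ge0_integralD _ measurableT (i0 f f0) (measurable_integral nu mf f0) (i0 g g0)
  (measurable_integral nu mg g0)).
apply: eq_integral => x _.
have mfx := measurable_slice x mf; have mgx := measurable_slice x mg.
by rewrite -ge0_integralD//; [move=> y _; rewrite lee_fin|meas|move=> y _; rewrite lee_fin|meas].
Qed.

Lemma Rint_comb4 {R : realType} d (X : measurableType d) (mu : {measure set X -> \bar R})
    (F A B C D : X -> R) (a b c e : R) :
  (forall x, F x = - a * A x - b * B x - c * C x - e * D x) ->
  L1 mu A -> L1 mu B -> L1 mu C -> L1 mu D ->
  \int[mu]_x F x = - a * (\int[mu]_x A x) - b * (\int[mu]_x B x) -
    c * (\int[mu]_x C x) - e * \int[mu]_x D x.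
Proof.
move=> E iA iB iC iD.
rewrite -(RintZl mu (- a) (L1_measurable iA)) -(RintZl mu b (L1_measurable iB)).
rewrite -(RintZl mu c (L1_measurable iC)) -(RintZl mu e (L1_measurable iD)).
have [jA jB] := (L1Zl (- a) iA, L1Zl b iB); have [jC jD] := (L1Zl c iC, L1Zl e iD).
rewrite -(RintB jA jB) -(RintB (L1B jA jB) jC) -(RintB (L1B (L1B jA jB) jC) jD).
exact: eq_Rint.
Qed.

Lemma comparison_algebra {R : realType} (x A1 A2 B1 B2 M1 M2 S1 S2 f e1 e2 g : R) :
  x = - 2 * A1 - 2 * A2 - 2^-1 * B1 - 2^-1 * B2 -> B1 = - e1 -> B2 = - e2 ->
  2 * M1 - f * S1 <= A1 -> 2 * M2 - f * S2 <= A2 -> g <= 4 * (M1 + M2) ->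
  x <= 2 * f * (S1 + S2) + 2^-1 * (e1 + e2 - 2 * g).
Proof.
move=> -> -> -> h1 h2 h3.
have -> : 2 * f * (S1 + S2) = 2 * (f * S1) + 2 * (f * S2) by ring.
by move: (f * S1) (f * S2) h1 h2 => a b; lra.
Qed.

Section plane.
Context {R : realType}.
Local Notation leb := (@lebesgue_measure R).

(** Lebesgue measure on the plane, under a name that carries its sigma-finite
    structure. *)
Definition plane := (leb \x leb)%E.

Let plane0 : plane set0 = 0%E. Proof. exact: (measure0 (leb \x leb)%E). Qed.
Let plane_ge0 A : (0 <= plane A)%E. Proof. exact: (measure_ge0 (leb \x leb)%E). Qed.
Let plane_sigma_additive : semi_sigma_additive plane.
Proof. exact: (@measure_semi_sigma_additive _ _ _ (leb \x leb)%E). Qed.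
HB.instance Definition _ := isMeasure.Build _ _ _ plane plane0 plane_ge0 plane_sigma_additive.

Lemma plane_sigma_finite : sigma_finite setT plane.
Proof.
pose I (n : nat) : set R := `[- n%:R, n%:R]%classic.
exists (fun n => I n `*` I n).
  apply/esym/seteqP; split => // -[x y] _.
  exists (Num.truncn (Num.max `|x| `|y|)).+1 => //; split; rewrite /I set_itvE /= -ler_norml.
    by apply/ltW; apply: le_lt_trans (truncnS_gt _); rewrite le_max lexx.
  by apply/ltW; apply: le_lt_trans (truncnS_gt _); rewrite le_max lexx orbT.
move=> n; split; first by apply: measurableX; exact: measurable_itv.
have l : (leb (I n) < +oo)%E.
  by rewrite lebesgue_measure_itv/=; case: ifPn => _; rewrite -?EFinD ltry.
rewrite /plane product_measure1E; [|exact: measurable_itv|exact: measurable_itv].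
by apply: lte_mul_pinfty => //; rewrite ge0_fin_numE.
Qed.

HB.instance Definition _ := Measure_isSigmaFinite.Build _ _ _ plane plane_sigma_finite.

Lemma plane_integral (F : R * R -> R) : measurable_fun setT F ->
  (forall p, 0 <= F p) ->
  (\int[plane]_p (F p)%:E = \int[leb]_eta \int[leb]_y (F (eta, y))%:E)%E.
Proof.
move=> mF F0; have m1 : measurable_fun setT (fun p : R * R => (F p)%:E) by meas.
have m0 (p : R * R) : (0 <= (F p)%:E)%E by rewrite lee_fin.
exact: (@fubini_tonelli1 _ _ _ _ R leb leb _ m1 m0).
Qed.

Lemma plane_Rint (F : R * R -> R) : measurable_fun setT F ->
  (\int[plane]_p `|F p|%:E < +oo)%E ->
  \int[plane]_p F p = \int[leb]_eta \int[leb]_y F (eta, y).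
Proof.
move=> mF h; apply/esym.
have mn : measurable_fun setT (fun p : R * R => `|F p|) by meas.
have e := plane_integral mn (fun p => normr_ge0 _).
have mF' : measurable_fun setT (fun p : R * R => F (p.1, p.2)).
  by rewrite (_ : (fun p => _) = F)//; apply/funext => -[].
rewrite e in h; have := Rfubini_prod (mu := leb) (nu := leb) (f := fun a b => F (a, b)) mF' h.
by move=> ->; apply: eq_Rint => -[].
Qed.

End plane.
Section comparison.
Context {R : realType}.
Local Notation leb := (@lebesgue_measure R).
Implicit Types (c f g u v kap phi : R -> R).

Lemma integral_tensor_subl (g h : R -> R) (X xi : R) : L1 leb g -> L1 leb h ->
  (\int[leb]_eta \int[leb]_y `|g (X - y) * h (xi - eta)|%:E =
   ((\int[leb]_a `|g a|) * \int[leb]_a `|h a|)%:E)%E.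
Proof.
move=> ig ih; have mg := L1_measurable ig; have mh := L1_measurable ih.
have ng : 0 <= \int[leb]_a `|g a| by exact: Rint_ge0.
transitivity (\int[leb]_eta ((\int[leb]_a `|g a|) * `|h (xi - eta)|)%:E)%E.
  apply: eq_integral => eta _.
  rewrite mulrC -(Rint_subl X (f := fun a => `|g a|)); last by meas.
  rewrite EFinM RintE; last by apply: L1_norm; exact: L1_subl.
  rewrite -ge0_integralrZl//; last by meas.
  by apply: eq_integral => y _; rewrite normrM mulrC.
rewrite ge0_integralrZl//; last by meas.
rewrite EFinM -(Rint_subl xi (f := fun a => `|h a|)); last by meas.
by rewrite (RintE (L1_norm (L1_subl xi ih))).
Qed.

(** The test functions transported along the characteristics, and their
    derivative with respect to the kinetic variable. *)
Definition rho phi kap f (x xi : R) (p : R * R) : R :=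
  phi (x - (p.2 + f xi)) * kap (xi - p.1).

Definition rho_xi phi kap f f' (x xi : R) (p : R * R) : R :=
  phi (x - (p.2 + f xi)) * derive1 kap (xi - p.1) -
  f' xi * derive1 phi (x - (p.2 + f xi)) * kap (xi - p.1).

Variables (lam : {finite_measure set R -> \bar R}) (s t F Gam A : R) (sigma : R -> R).
Hypotheses (msigma : measurable_fun setT sigma) (sigmaA : forall xi, `|sigma xi| <= A).

(** What the comparison uses of a pathwise entropy solution [ku] on [[s, t]]:
    [kf r xi] is the position at time [r] of the characteristic of [xi], [kv]
    is the derivative of the parabolic flux, and [kq] the total defect measure
    on triples (space, kinetic variable, time). *)
Record kinetic := Kinetic {
  ku : R -> R -> R; kv : R -> R -> R; kf : R -> R -> R; kf' : R -> R -> R;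
  kq : {finite_measure set (R * R * R)%type -> \bar R}; kK : R;
  ku_meas : measurable_fun setT (fun p : R * R => ku p.1 p.2);
  kv_meas : measurable_fun setT (fun p : R * R => kv p.1 p.2);
  kf_meas : measurable_fun setT (fun p : R * R => kf p.1 p.2);
  kf'_meas : measurable_fun setT (fun p : R * R => kf' p.1 p.2);
  kf_C1 : forall r, C1 (kf r) (kf' r);
  kf_bound : forall r xi, `|kf r xi| <= F;
  kf'_bound : forall r xi, `|kf' r xi| <= Gam;
  kq_time : {ae kq, forall w, s <= w.2 <= t};
  ku_osc : {ae lam, forall r, osc_bound (ku r) kK};
  ku_osc_s : osc_bound (ku s) kK;
  ku_osc_t : osc_bound (ku t) kK;
  ku_st : (\int[leb]_x `|ku s x - ku t x|%:E < +oo)%E;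
  kv_L2 : (\int[lam]_r \int[leb]_x (kv r x ^+ 2)%:E < +oo)%E;
  kq_dissipation : forall G : R * R * R -> R, measurable_fun setT G ->
    (forall w, 0 <= G w) ->
    (\int[lam]_r \int[leb]_x (2^-1 * kv r x ^+ 2 * G (x, ku r x, r))%:E
     <= \int[kq]_w (G w)%:E)%E;
  k_chain : forall phi kap eps del, mollifier eps phi -> mollifier del kap ->
    forall p, {ae lam, forall r,
      Gc sigma (derive1 phi) kap (kf r) (ku r) p.1 p.2 =
      2 * \int[leb]_x (kv r x * rho phi kap (kf r) x (ku r x) p)};
  k_increments : forall phi kap eps del, mollifier eps phi -> mollifier del kap ->
    forall p, increments lam s t kq
      (fun w => 2 * rho_xi phi kap (kf w.2) (kf' w.2) w.1.1 w.1.2 p) snd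
      (fun r => 2^-1 * Gc (fun xi => sigma xi ^+ 2) (derive1 (derive1 phi)) kap
                          (kf r) (ku r) p.1 p.2)
      (fun r => Gc (fun=> 1) phi kap (kf r) (ku r) p.1 p.2)
}.

Section mollified.
Variables (phi kap : R -> R) (eps del : R).
Hypotheses (mphi : mollifier eps phi) (mkap : mollifier del kap) (eps0 : 0 <= eps).

Let phi1 := derive1 phi.
Let phi2 := derive1 phi1.
Let sphi : smooth phi. Proof. by case: mphi. Qed.
Let sphi1 : smooth phi1 := smooth_derive sphi.
Let sphi2 : smooth phi2 := smooth_derive sphi1.
Let phi0 x : 0 <= phi x. Proof. by case: mphi. Qed.
Let phi_1 : \int[leb]_x phi x = 1. Proof. by case: mphi. Qed.
Let vphi : vanishes_off eps phi. Proof. by case: mphi. Qed.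
Let vphi1 : vanishes_off eps phi1 := vanishes_off_derive (smooth_C1 sphi) vphi.
Let vphi2 : vanishes_off eps phi2 := vanishes_off_derive (smooth_C1 sphi1) vphi1.
Let iphi : L1 leb phi := L1_vanishes_off (smooth_continuous sphi) vphi.
Let iphi1 : L1 leb phi1 := L1_vanishes_off (smooth_continuous sphi1) vphi1.
Let iphi2 : L1 leb phi2 := L1_vanishes_off (smooth_continuous sphi2) vphi2.
Let mmphi := L1_measurable iphi.
Let mmphi1 := L1_measurable iphi1.
Let mmphi2 := L1_measurable iphi2.
Let int_phi1 : \int[leb]_a phi1 a = 0 := Rint_derive_eq0 (smooth_C1 sphi) vphi.
Let int_phi2 : \int[leb]_a phi2 a = 0 := Rint_derive_eq0 (smooth_C1 sphi1) vphi1.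

Let skap : smooth kap. Proof. by case: mkap. Qed.
Let Ckap : C1 kap (derive1 kap) := smooth_C1 skap.
Let kap0 x : 0 <= kap x. Proof. by case: mkap. Qed.
Let kap_1 : \int[leb]_x kap x = 1. Proof. by case: mkap. Qed.
Let vkap : vanishes_off del kap. Proof. by case: mkap. Qed.
Let ikap : L1 leb kap := L1_vanishes_off (smooth_continuous skap) vkap.
Let ikap1 : L1 leb (derive1 kap) :=
  L1_vanishes_off Ckap.2 (vanishes_off_derive Ckap vkap).
Let mmkap := L1_measurable ikap.
Let mmkap1 := L1_measurable ikap1.

Definition GG c g (X : kinetic) (r : R) (p : R * R) : R :=
  Gc c g kap (kf X r) (ku X r) p.1 p.2.

Lemma measurable_GG c g X : measurable_fun setT c -> measurable_fun setT g ->
  measurable_fun setT (fun z : R * (R * R) => GG c g X z.1 z.2).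
Proof.
move=> mc mg; have mf := kf_meas X; have mu := ku_meas X.
apply: (measurable_Gc (f := fun z : R * (R * R) => kf X z.1)
  (u := fun z : R * (R * R) => ku X z.1) (eta := fun z : R * (R * R) => z.2.1)
  (y := fun z : R * (R * R) => z.2.2)) => //; by meas.
Qed.

Lemma normr_GG c g X (B : R) : measurable_fun setT c -> (forall xi, `|c xi| <= B) ->
  L1 leb g -> forall r p, `|GG c g X r p| <= B * \int[leb]_a `|g a|.
Proof.
move=> mc cB ig r p.
apply: (normr_Gc Ckap vkap kap0 kap_1 (kf_C1 X r) _ mc cB) => //.
exact: (measurable_slice r (ku_meas X)).
Qed.

Lemma GGE c g X r eta y : GG c g X r (eta, y) = Gc c g kap (kf X r) (ku X r) eta y.
Proof. by []. Qed.

Opaque GG.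

Lemma GG_lty c g X (B : R) : measurable_fun setT c -> (forall xi, `|c xi| <= B) ->
  continuous g -> vanishes_off eps g -> \int[leb]_a g a = 0 ->
  exists C : R, (\int[lam]_r \int[plane]_p `|GG c g X r p|%:E <= C%:E)%E.
Proof.
move=> mc cB cg vg g0; have ig := L1_vanishes_off cg vg.
have mG := measurable_GG X mc (L1_measurable ig).
pose C := B * (8 * eps * kK X * \int[leb]_a `|g a|).
have iC : L1 lam (fun _ : R => `|C|) by apply: (@L1_finite _ _ _ lam _ `|C|) => // x; rewrite normr_id.
exists (\int[lam]_r `|C|); rewrite RintE//.
apply: ae_le_integralT.
- by apply: (measurable_integral plane (f := fun (r : R) (p : R * R) => `|GG c g X r p|)) => //; meas.
- exact: measurable_cst.
- by move=> r; apply: integral_ge0.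
- by move=> r; rewrite lee_fin.
apply: ae_imp (ku_osc X) => r osc.
have mGr := measurable_slice (f := GG c g X) r mG.
rewrite (plane_integral (F := fun p => `|GG c g X r p|))//; last by meas.
under eq_integral do under eq_integral do rewrite GGE.
have mur := measurable_slice r (ku_meas X).
have := Gc_mean0 mkap (kf_C1 X r) mur mc cB cg vg eps0 g0 osc.
by move=> h; apply: (le_trans h); rewrite lee_fin; exact: ler_norm.
Qed.

Lemma GG_prod_lty c g h c' X Y (B B' : R) :
  measurable_fun setT c -> (forall xi, `|c xi| <= B) ->
  measurable_fun setT c' -> (forall xi, `|c' xi| <= B') ->
  continuous g -> vanishes_off eps g -> \int[leb]_a g a = 0 -> L1 leb h ->
  (\int[lam]_r \int[plane]_p `|GG c g X r p * GG c' h Y r p|%:E < +oo)%E.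
Proof.
move=> mc cB mc' cB' cg vg g0 ih.
have [C GC] := GG_lty X mc cB cg vg g0.
have mG := measurable_GG X mc (L1_measurable (L1_vanishes_off cg vg)).
have mH := measurable_GG Y mc' (L1_measurable ih).
have bH := normr_GG Y mc' cB' ih.
have b0 := le_trans (normr_ge0 _) (bH 0 (0, 0)).
have := integral2_prod_le (mu := lam) (nu := plane) (a := GG c g X) (b := GG c' h Y) mG mH b0 bH GC.
by move=> h'; exact: (le_lt_trans h' (ltry _)).
Qed.

Let one_bound (xi : R) : `|1 : R| <= 1. Proof. by rewrite normr1. Qed.
Let mone : measurable_fun setT (fun _ : R => 1 : R). Proof. exact: measurable_cst. Qed.
Let sigma2 (xi : R) := sigma xi ^+ 2.
Let msigma2 : measurable_fun setT sigma2. Proof. by rewrite /sigma2; meas. Qed.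
Let sigma2A xi : `|sigma2 xi| <= A ^+ 2.
Proof. by rewrite /sigma2 normrX ler_pXn2r// ?nnegrE// (le_trans _ (sigmaA 0)). Qed.

(** The second derivative of one profile is shared with the other, for every
    parameter [p]; Fubini in [p] and time. *)
Lemma parabolic_part X Y :
  L1 plane (fun p => \int[lam]_r (GG sigma2 phi2 X r p * GG (fun=> 1) phi Y r p)) /\
  \int[plane]_p \int[lam]_r (GG sigma2 phi2 X r p * GG (fun=> 1) phi Y r p) =
  - \int[lam]_r \int[plane]_p (GG sigma2 phi1 X r p * GG (fun=> 1) phi1 Y r p).
Proof.
have m2 := measurable_GG X msigma2 mmphi2; have m0 := measurable_GG Y mone mmphi.
have m1 := measurable_GG X msigma2 mmphi1; have m1' := measurable_GG Y mone mmphi1.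
have lt1 := GG_prod_lty X Y msigma2 sigma2A mone one_bound
  (smooth_continuous sphi2) vphi2 int_phi2 iphi.
have lt2 := GG_prod_lty X Y msigma2 sigma2A mone one_bound
  (smooth_continuous sphi1) vphi1 int_phi1 iphi1.
pose P2 r p := GG sigma2 phi2 X r p * GG (fun=> 1) phi Y r p.
pose P1 r p := GG sigma2 phi1 X r p * GG (fun=> 1) phi1 Y r p.
have mP2 : measurable_fun setT (fun z : R * (R * R) => P2 z.1 z.2).
  by apply: measurable_funM; [exact: m2|exact: m0].
have mP1 : measurable_fun setT (fun z : R * (R * R) => P1 z.1 z.2).
  by apply: measurable_funM; [exact: m1|exact: m1'].
apply: (Rfubini_L1_opp (mu := lam) (nu := plane) (f := P2) (g := P1) mP2 mP1 lt1 lt2).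
apply: ae_imp (ku_osc X) => r osc l2 l1.
have mP2r := measurable_slice (f := P2) r mP2; have mP1r := measurable_slice (f := P1) r mP1.
rewrite (plane_Rint (F := P2 r) mP2r (L1_lty l2)) (plane_Rint (F := P1 r) mP1r (L1_lty l1)).
have muX := measurable_slice r (ku_meas X); have muY := measurable_slice r (ku_meas Y).
have ibp := Gc_ibp mphi mkap eps0 (kf_C1 X r) (kf_C1 Y r) muX muY msigma2 sigma2A mone one_bound osc.
apply: (etrans _ (etrans ibp _)).
  by apply: eq_Rint => eta; apply: eq_Rint => y; rewrite /P2 !GGE.
by congr (- _); apply: eq_Rint => eta; apply: eq_Rint => y; rewrite /P1 !GGE.
Qed.

Definition thX (X : kinetic) (w : R * R * R) (p : R * R) : R :=
  rho_xi phi kap (kf X w.2) (kf' X w.2) w.1.1 w.1.2 p.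
Definition rhX (X : kinetic) (w : R * R * R) (p : R * R) : R :=
  rho phi kap (kf X w.2) w.1.1 w.1.2 p.
Definition UX (X : kinetic) (r : R) (p : R * R) : R :=
  Uk phi kap (kf X r) (ku X r) p.1 p.2.
Definition massX (X Y : kinetic) (w : R * R * R) : R :=
  \int[plane]_p (rhX X w p * UX Y w.2 p).
Definition speed_gap (X Y : kinetic) (w : R * R * R) : R :=
  dav kap (fun xi => `|kf' X w.2 w.1.2 - kf' Y w.2 xi|) w.1.2.

Lemma measurable_thX X :
  measurable_fun setT (fun z : (R * R * R) * (R * R) => thX X z.1 z.2).
Proof.
by have mf := kf_meas X; have mf' := kf'_meas X; rewrite /thX /rho_xi; meas.
Qed.

Lemma measurable_rhX X :
  measurable_fun setT (fun z : (R * R * R) * (R * R) => rhX X z.1 z.2).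
Proof. by have mf := kf_meas X; rewrite /rhX /rho; meas. Qed.

Lemma measurable_UX X : measurable_fun setT (fun z : R * (R * R) => UX X z.1 z.2).
Proof.
have mf := kf_meas X; have mu := ku_meas X.
apply: (measurable_Rint leb (f := fun (z : R * (R * R)) (x : R) =>
  phi (x - (z.2.2 + kf X z.1 (ku X z.1 x))) * kap (ku X z.1 x - z.2.1))).
by meas.
Qed.

Let CU := (\int[leb]_a `|phi a|) * (\int[leb]_a `|derive1 kap a|) + Gam * \int[leb]_a `|phi1 a|.

Lemma UX_ge0 X r p : 0 <= UX X r p.
Proof. by apply: Rint_ge0 => x; rewrite mulr_ge0. Qed.

Lemma normr_UX X r p : `|UX X r p| <= CU.
Proof.
have muX := measurable_slice r (ku_meas X).
have := normr_Uk (smooth_C1 sphi) vphi Ckap vkap kap0 kap_1 (kf_C1 X r)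
  (kf'_bound X r) muX p.1 p.2.
rewrite normrM ger0_norm// -/(UX X r p) => h.
by apply: le_trans h; rewrite mulr2n mulrDl mul1r lerDl.
Qed.

Lemma rhX_ge0 X w p : 0 <= rhX X w p.
Proof. by rewrite mulr_ge0. Qed.

Lemma rhX_lty X w : (\int[plane]_p `|rhX X w p|%:E <= 1%:E)%E.
Proof.
have m := measurable_slice w (measurable_rhX X).
rewrite (plane_integral (F := fun p => `|rhX X w p|))//; last by meas.
have := integral_tensor_subl (w.1.1 - kf X w.2 w.1.2) w.1.2 iphi ikap.
have -> : \int[leb]_a `|phi a| = 1.
  by rewrite -phi_1; apply: eq_Rint => a; rewrite ger0_norm.
have -> : \int[leb]_a `|kap a| = 1.
  by rewrite -kap_1; apply: eq_Rint => a; rewrite ger0_norm.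
rewrite mulr1 => <-; apply: eq_le_refl_e.
apply: eq_integral => eta _; apply: eq_integral => y _.
by rewrite /rhX /rho/= opprD addrA addrAC.
Qed.

Lemma thX_lty X : exists C : R, forall w, (\int[plane]_p `|thX X w p|%:E <= C%:E)%E.
Proof.
have iG : L1 leb (fun a => Gam * phi1 a) by exact: L1Zl.
exists ((\int[leb]_a `|phi a|) * (\int[leb]_a `|derive1 kap a|) +
  (\int[leb]_a `|Gam * phi1 a|) * (\int[leb]_a `|kap a|)) => w.
have m := measurable_slice w (measurable_thX X).
rewrite (plane_integral (F := fun p => `|thX X w p|))//; last by meas.
pose X0 := w.1.1 - kf X w.2 w.1.2.
rewrite EFinD -(integral_tensor_subl X0 w.1.2 iphi ikap1) -(integral_tensor_subl X0 w.1.2 iG ikap).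
apply: (integral2_triangle (f := fun eta y => thX X w (eta, y))
  (g := fun eta y => phi (X0 - y) * derive1 kap (w.1.2 - eta))
  (h := fun eta y => Gam * phi1 (X0 - y) * kap (w.1.2 - eta))).
- by rewrite (_ : (fun p : R * R => _) = thX X w)//; apply/funext => -[].
- by meas.
- by meas.
move=> eta y; rewrite /thX /rho_xi/= (_ : _ - (y + _) = X0 - y); last by rewrite /X0 opprD addrA addrAC.
apply: le_trans (ler_normB _ _) _; rewrite lerD2l !normrM -/phi1.
rewrite ler_wpM2r// ler_wpM2r//.
by apply: le_trans (kf'_bound X _ _) _; exact: ler_norm.
Qed.

Lemma normr_speed_gap X Y w : `|speed_gap X Y w| <= Gam + Gam.
Proof.
have mf := measurable_slice w.2 (kf'_meas Y).
apply: (normr_dav mkap); first by meas.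
move=> xi; rewrite normr_id; apply: le_trans (ler_normB _ _) _.
by apply: lerD; exact: kf'_bound.
Qed.

Lemma measurable_speed_gap X Y : measurable_fun setT (speed_gap X Y).
Proof.
have mX := kf'_meas X; have mY := kf'_meas Y.
pose cv (w : R * R * R) (eta : R) := \int[leb]_xi (`|kf' X w.2 w.1.2 - kf' Y w.2 xi| * kap (xi - eta)).
have mcv : measurable_fun setT (fun z : (R * R * R) * R => cv z.1 z.2).
  apply: (measurable_Rint leb (f := fun (z : (R * R * R) * R) (xi : R) =>
    `|kf' X z.1.2 z.1.1.2 - kf' Y z.1.2 xi| * kap (xi - z.2))).
  by meas.
apply: (measurable_Rint leb (f := fun (w : R * R * R) (eta : R) => cv w eta * kap (w.1.2 - eta))).
by meas.
Qed.

Lemma rhXE X w eta y : rhX X w (eta, y) =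
  phi (w.1.1 - (y + kf X w.2 w.1.2)) * kap (w.1.2 - eta).
Proof. by []. Qed.

Lemma thXE X w eta y : thX X w (eta, y) =
  phi (w.1.1 - (y + kf X w.2 w.1.2)) * derive1 kap (w.1.2 - eta) -
  kf' X w.2 w.1.2 * phi1 (w.1.1 - (y + kf X w.2 w.1.2)) * kap (w.1.2 - eta).
Proof. by []. Qed.

Lemma UXE X r eta y : UX X r (eta, y) = Uk phi kap (kf X r) (ku X r) eta y.
Proof. by []. Qed.

Lemma UX_weight X r p : UX X r p = \int[leb]_x rhX X (x, ku X r x, r) p.
Proof. by []. Qed.

Lemma chain_weight X p : {ae lam, forall r, GG sigma phi1 X r p =
  2 * \int[leb]_x (kv X r x * rhX X (x, ku X r x, r) p)}.
Proof. exact: (k_chain X mphi mkap p). Qed.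

Lemma rhX_bounded : exists2 B : R, 0 <= B & forall X w p,
  `|rhX X w p| <= B * \1_`[- (`|p.2| + eps + F), `|p.2| + eps + F] w.1.1.
Proof.
have [B B0 bphi] := vanishes_off_bounded (smooth_continuous sphi) vphi.
have [B' B'0 bkap] := vanishes_off_bounded (smooth_continuous skap) vkap.
exists (B * B') => [|X w p]; first by rewrite mulr_ge0.
rewrite indicE mem_setE in_itv/= -ler_norml /rhX /rho.
have [h|h] := leP `|w.1.1| (`|p.2| + eps + F).
  by rewrite mulr1n mulr1 normrM ler_pM.
rewrite mulr0n mulr0 vphi ?mul0r ?normr0//.
have h1 := kf_bound X w.2 w.1.2.
have h2 : `|w.1.1| <= `|w.1.1 - (p.2 + kf X w.2 w.1.2)| + (`|p.2| + `|kf X w.2 w.1.2|).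
  apply: le_trans (lerD (lexx _) (ler_normD _ _)).
  by rewrite -{1}(subrK (p.2 + kf X w.2 w.1.2) w.1.1) ler_normD.
by rewrite -(ltrD2r (`|p.2| + F)); apply: (lt_le_trans _ (le_trans h2 _)); [rewrite addrCA addrA|rewrite !lerD2l].
Qed.

Opaque thX rhX UX.
Lemma normr_massX X Y w : `|massX X Y w| <= CU.
Proof.
have mr := measurable_slice w (measurable_rhX X); have mU := measurable_slice w.2 (measurable_UX Y).
have CU0 : 0 <= CU by exact: le_trans (normr_UX Y 0 (0, 0)).
rewrite -lee_fin; apply: le_trans (normr_Rint_le plane _) _; first by meas.
apply: (@le_trans _ _ (\int[plane]_p (CU * `|rhX X w p|)%:E)%E).
  apply: le_integralT => //; [by meas|by meas|] => p.
  by rewrite lee_fin normrM mulrC ler_wpM2r// normr_UX.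
rewrite ge0_integralrZl//; last by meas.
by rewrite -[leRHS]mule1; apply: lee_wpmul2l; [rewrite lee_fin|exact: rhX_lty].
Qed.

Lemma measurable_massX X Y : measurable_fun setT (massX X Y).
Proof.
have mr := measurable_rhX X; have mU := measurable_UX Y.
by apply: (measurable_Rint plane (f := fun (w : R * R * R) p => rhX X w p * UX Y w.2 p)); meas.
Qed.

Lemma massX_ge0 X Y w : 0 <= massX X Y w.
Proof.
by apply: Rint_ge0 => p; apply: mulr_ge0; [exact: rhX_ge0|exact: UX_ge0].
Qed.

Lemma massX_L1 X Y w : (\int[plane]_p `|rhX X w p * UX Y w.2 p|%:E < +oo)%E.
Proof.
have mr := measurable_slice w (measurable_rhX X); have mU := measurable_slice w.2 (measurable_UX Y).
have CU0 : 0 <= CU by exact: le_trans (normr_UX Y 0 (0, 0)).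
apply: (@le_lt_trans _ _ (\int[plane]_p (CU * `|rhX X w p|)%:E)%E).
  apply: le_integralT => //; [by meas|by meas|] => p.
  by rewrite lee_fin normrM mulrC ler_wpM2r// normr_UX.
rewrite ge0_integralrZl//; last by meas.
by apply: lte_mul_pinfty => //; rewrite ?lee_fin//; exact: le_lt_trans (rhX_lty X w) (ltry _).
Qed.

(** The pairing of the defect measure of [X] with the mollified [Y], bounded
    below by the dissipation term and the difference of the speeds. *)
Lemma defect_pointwise X Y w :
  2 * massX X Y w - (\int[leb]_a `|phi1 a|) * speed_gap X Y w <=
  \int[plane]_p (thX X w p * GG (fun=> 1) phi Y w.2 p).
Proof.
have mr := measurable_slice w (measurable_rhX X); have mU := measurable_slice w.2 (measurable_UX Y).
have mt := measurable_slice w (measurable_thX X).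
have mG := measurable_slice w.2 (measurable_GG Y mone mmphi).
have bG := normr_GG Y mone one_bound iphi.
have [C thC] := thX_lty X.
have lt : (\int[plane]_p `|thX X w p * GG (fun=> 1) phi Y w.2 p|%:E < +oo)%E.
  apply: (@le_lt_trans _ _ (\int[plane]_p ((1 * \int[leb]_a `|phi a|) * `|thX X w p|)%:E)%E).
    apply: le_integralT => //; [by meas|by meas|] => p.
    by rewrite lee_fin normrM mulrC ler_wpM2r.
  have B0 : 0 <= 1 * \int[leb]_a `|phi a| by exact: le_trans (bG 0 (0, 0)).
  rewrite ge0_integralrZl//; last by meas.
  by apply: lte_mul_pinfty => //; rewrite ?lee_fin//; exact: le_lt_trans (thC w) (ltry _).
have mrU : measurable_fun setT (fun p => rhX X w p * UX Y w.2 p) by meas.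
have mtG : measurable_fun setT (fun p => thX X w p * GG (fun=> 1) phi Y w.2 p) by meas.
rewrite /massX (plane_Rint mrU (massX_L1 X Y w)) (plane_Rint mtG lt).
pose x0 := w.1.1 - kf X w.2 w.1.2.
have muY := measurable_slice w.2 (ku_meas Y).
have H := pairing_ge (smooth_C1 sphi) vphi Ckap vkap kap0 kap_1 (kf_C1 Y w.2)
  (kf'_bound Y w.2) muY phi0 phi_1 x0 w.1.2 (kf' X w.2 w.1.2).
have E1 y : w.1.1 - (y + kf X w.2 w.1.2) = x0 - y by rewrite /x0 opprD addrA addrAC.
have E2 : \int[leb]_eta \int[leb]_y (rhX X w (eta, y) * UX Y w.2 (eta, y)) =
  \int[leb]_eta \int[leb]_y (phi (x0 - y) * kap (w.1.2 - eta) * Uk phi kap (kf Y w.2) (ku Y w.2) eta y).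
  by apply: eq_Rint => eta; apply: eq_Rint => y; rewrite rhXE UXE E1.
have E3 : \int[leb]_eta \int[leb]_y (thX X w (eta, y) * GG (fun=> 1) phi Y w.2 (eta, y)) =
  \int[leb]_eta \int[leb]_y
    ((phi (x0 - y) * derive1 kap (w.1.2 - eta) - kf' X w.2 w.1.2 * phi1 (x0 - y) * kap (w.1.2 - eta)) *
     Gc (fun=> 1) phi kap (kf Y w.2) (ku Y w.2) eta y).
  by apply: eq_Rint => eta; apply: eq_Rint => y; rewrite thXE GGE E1.
apply: le_trans (le_trans H (eq_le_refl (esym E3))).
exact: (eq_le_refl (congr1 (fun z => 2 * z - (\int[leb]_a `|phi1 a|) * speed_gap X Y w) E2)).
Qed.

Lemma massXE X Y w : massX X Y w = \int[plane]_p (rhX X w p * UX Y w.2 p).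
Proof. by []. Qed.

Opaque massX speed_gap.

Lemma defect_part X Y :
  L1 plane (fun p => \int[kq X]_w (thX X w p * GG (fun=> 1) phi Y w.2 p)) /\
  2 * (\int[kq X]_w massX X Y w) - (\int[leb]_a `|phi1 a|) * \int[kq X]_w speed_gap X Y w <=
  \int[plane]_p \int[kq X]_w (thX X w p * GG (fun=> 1) phi Y w.2 p).
Proof.
have mt := measurable_thX X; have mG := measurable_GG Y mone mmphi.
have bG := normr_GG Y mone one_bound iphi.
have B0 : 0 <= 1 * \int[leb]_a `|phi a| by exact: le_trans (bG 0 (0, 0)).
have [C thC] := thX_lty X.
pose P w p := thX X w p * GG (fun=> 1) phi Y w.2 p.
have mP : measurable_fun setT (fun z : (R * R * R) * (R * R) => P z.1 z.2) by rewrite /P; meas.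
have C0 : 0 <= C by rewrite -lee_fin; apply: le_trans (thC point); exact: integral_ge0.
have hC : (\int[kq X]_w \int[plane]_p `|thX X w p|%:E <=
    (\int[kq X]_w C)%:E)%E.
  rewrite RintE; last by apply: (@L1_finite _ _ _ (kq X) _ `|C|) => // x; rewrite ger0_norm.
  apply: le_integralT => //; first by apply: (measurable_integral plane (f := fun w p => `|thX X w p|)) => //; meas.
  by move=> w; apply: integral_ge0.
have mGw : measurable_fun setT (fun z : (R * R * R) * (R * R) => GG (fun=> 1) phi Y z.1.2 z.2) by meas.
have lt := le_lt_trans (integral2_prod_le (mu := kq X) (nu := plane) (a := thX X)
  (b := fun w p => GG (fun=> 1) phi Y w.2 p) mt mGw B0 (fun w p => bG w.2 p) hC) (ltry _).
have [L1P EP] := Rfubini_L1 (mu := kq X) (nu := plane) (f := P) mP lt.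
split; first exact: L1P.
apply: (le_trans _ (eq_le_refl (esym EP))).
have iP := L1_Rint (mu := kq X) (nu := plane) (f := P) mP lt.
have iM := @L1_finite _ _ _ (kq X) _ _ (measurable_massX X Y) (normr_massX X Y).
have iS := @L1_finite _ _ _ (kq X) _ _ (measurable_speed_gap X Y) (normr_speed_gap X Y).
rewrite -(RintZl (kq X) 2 (measurable_massX X Y)) -(RintZl (kq X) _ (measurable_speed_gap X Y)).
rewrite -RintB; [|exact: L1Zl|exact: L1Zl].
apply: le_Rint; [by apply: L1B; exact: L1Zl|exact: iP|] => w.
exact: defect_pointwise.
Qed.

Lemma measurable_weight X : measurable_fun setT
  (fun z : R * (R * R) * R => rhX X (z.2, ku X z.1.1 z.2, z.1.1) z.1.2).
Proof. by have mr := measurable_rhX X; have mu := ku_meas X; meas. Qed.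

Lemma L1_weight X r p : L1 leb (fun x => rhX X (x, ku X r x, r) p).
Proof.
have [B B0 rB] := rhX_bounded.
have mw := measurable_slice (f := fun (q : R * (R * R)) (x : R) => rhX X (x, ku X q.1 x, q.1) q.2) (r, p) (measurable_weight X).
apply: (L1_le (mu := leb) _ (fun x => rB X (x, ku X r x, r) p)); first exact: mw.
by apply: L1Zl; exact: L1_indic_itv.
Qed.

Lemma L1_square_weight X r p : L1 leb (fun x => kv X r x ^+ 2) ->
  L1 leb (fun x => kv X r x ^+ 2 * rhX X (x, ku X r x, r) p) /\
  L1 leb (fun x => kv X r x * rhX X (x, ku X r x, r) p).
Proof.
move=> iv; have [B B0 rB] := rhX_bounded.
have mw := measurable_slice (f := fun (q : R * (R * R)) (x : R) => rhX X (x, ku X q.1 x, q.1) q.2) (r, p) (measurable_weight X).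
have mv := measurable_slice r (kv_meas X).
have rB' x : `|rhX X (x, ku X r x, r) p| <= B.
  apply: le_trans (rB _ _ _) _; rewrite -[leRHS]mulr1 ler_wpM2l// indicE.
have i2 : L1 leb (fun x => kv X r x ^+ 2 * rhX X (x, ku X r x, r) p).
  under eq_fun do rewrite mulrC.
  exact: (L1_bounded_M mw rB' iv).
split => //.
apply: (L1_le (mu := leb) (g := fun x => rhX X (x, ku X r x, r) p +
  kv X r x ^+ 2 * rhX X (x, ku X r x, r) p)).
- exact: measurable_funM.
- move=> x; have r0 := rhX_ge0 X (x, ku X r x, r) p.
  rewrite normrM (ger0_norm r0) -{2}[rhX _ _ _]mul1r -mulrDl ler_wpM2r//.
  by rewrite -[kv X r x ^+ 2]real_normK ?num_real//; move: `|_| => a; nra.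
- by apply: L1D => //; exact: L1_weight.
Qed.

Definition QX (X : kinetic) (r : R) (p : R * R) : R :=
  \int[leb]_x (kv X r x ^+ 2 * rhX X (x, ku X r x, r) p).

Lemma QX_ge0 X r p : 0 <= QX X r p.
Proof. by apply: Rint_ge0 => x; rewrite mulr_ge0 ?sqr_ge0 ?rhX_ge0. Qed.

Lemma measurable_QX X : measurable_fun setT (fun z : R * (R * R) => QX X z.1 z.2).
Proof.
have mw := measurable_weight X; have mv := kv_meas X.
apply: (measurable_Rint leb (f := fun (z : R * (R * R)) (x : R) =>
  kv X z.1 x ^+ 2 * rhX X (x, ku X z.1 x, z.1) z.2)).
apply: measurable_funM; first by meas.
apply: (measurableT_comp mw (_ : measurable_fun setT
  (fun q : R * (R * R) * R => ((q.1.1, q.1.2), q.2)))); by meas.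
Qed.

Lemma square_weight_E X r p : QX X r p = \int[leb]_x (kv X r x ^+ 2 * rhX X (x, ku X r x, r) p).
Proof. by []. Qed.

Opaque QX.

Lemma square_L1 X : {ae lam, forall r, L1 leb (fun x => kv X r x ^+ 2)}.
Proof.
have mv := kv_meas X.
apply: (ae_L1 (mu := lam) (nu := leb) (f := fun r x => kv X r x ^+ 2)); first by meas.
under eq_integral do under eq_integral do rewrite ger0_norm ?sqr_ge0//.
exact: kv_L2.
Qed.

(** By the chain rule both factors are integrals of the parabolic derivative
    against the mass on the graph. *)
Lemma young_pointwise X Y r p :
  L1 leb (fun x => kv X r x ^+ 2) -> L1 leb (fun x => kv Y r x ^+ 2) ->
  GG sigma phi1 X r p = 2 * (\int[leb]_x (kv X r x * rhX X (x, ku X r x, r) p)) ->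
  GG sigma phi1 Y r p = 2 * (\int[leb]_x (kv Y r x * rhX Y (x, ku Y r x, r) p)) ->
  GG sigma phi1 X r p * GG sigma phi1 Y r p <=
  2 * (QX X r p * UX Y r p + QX Y r p * UX X r p).
Proof.
move=> iX iY -> ->.
have [i1 i2] := L1_square_weight p iX; have [j1 j2] := L1_square_weight p iY.
have := weighted_young (fun x => rhX_ge0 X (x, ku X r x, r) p)
  (fun x => rhX_ge0 Y (x, ku Y r x, r) p) (L1_weight X r p) (L1_weight Y r p) i2 j2 i1 j1.
rewrite -!UX_weight !square_weight_E.
move: (\int[leb]_x (kv X r x * _)) (\int[leb]_x (kv Y r x * _)) => a b.
by move=> h; rewrite mulrACA -mulrA ler_pM2l.
Qed.

(** [QX] is the density of the parabolic dissipation, and the defect measure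
    dominates the latter. *)
Lemma dissipation_one X Y :
  (\int[lam]_r \int[plane]_p (QX X r p * UX Y r p)%:E <=
   (2 * \int[kq X]_w massX X Y w)%:E)%E.
Proof.
have mU := measurable_UX Y; have mw := measurable_weight X; have mv := kv_meas X.
have mu := ku_meas X; have mM := measurable_massX X Y; have mQ := measurable_QX X.
have M0 := massX_ge0 X Y; have U0 := UX_ge0 Y.
have iM := @L1_finite _ _ _ (kq X) _ _ (measurable_massX X Y) (normr_massX X Y).
pose H (r x : R) : R := 2^-1 * kv X r x ^+ 2 * massX X Y (x, ku X r x, r).
have mH : measurable_fun setT (fun z : R * R => H z.1 z.2) by rewrite /H; meas.
have H0 r x : 0 <= H r x by apply: mulr_ge0 => //; apply: mulr_ge0; rewrite ?sqr_ge0 ?invr_ge0.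
apply: (@le_trans _ _ (\int[lam]_r \int[leb]_x (2 * H r x)%:E)%E); last first.
  rewrite (ge0_integral2rZl lam leb (f := H))// EFinM RintE//.
  apply: lee_wpmul2l; first by rewrite lee_fin.
  exact: (kq_dissipation X mM M0).
have mQU : measurable_fun setT (fun z : R * (R * R) => QX X z.1 z.2 * UX Y z.1 z.2) by meas.
have QU0 r p : 0 <= QX X r p * UX Y r p by rewrite mulr_ge0// QX_ge0.
apply: ae_le_integralT.
- exact: (measurable_integral plane (f := fun r p => QX X r p * UX Y r p)).
- by apply: (measurable_integral leb (f := fun r x => 2 * H r x)) => [|r x]; [meas|rewrite mulr_ge0].
- by move=> r; apply: integral_ge0 => p _; rewrite lee_fin.
- by move=> r; apply: integral_ge0 => x _; rewrite lee_fin mulr_ge0.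
apply: ae_imp (square_L1 X) => r iv; apply: eq_le_refl_e.
have mwr : measurable_fun setT (fun z : (R * R) * R => rhX X (z.2, ku X r z.2, r) z.1).
  apply: (measurableT_comp mw (_ : measurable_fun setT
    (fun q : (R * R) * R => ((r, q.1), q.2)))); by meas.
have mvr := measurable_slice r mv; have mUr := measurable_slice r mU.
pose K p x := kv X r x ^+ 2 * (rhX X (x, ku X r x, r) p * UX Y r p).
have mK : measurable_fun setT (fun z : (R * R) * R => K z.1 z.2).
  apply: measurable_funM; first by meas.
  apply: measurable_funM; first exact: mwr.
  by meas.
have K0 p x : 0 <= K p x by rewrite mulr_ge0 ?sqr_ge0// mulr_ge0 ?rhX_ge0.
transitivity (\int[plane]_p \int[leb]_x (K p x)%:E)%E.
  apply: eq_integral => p _; have [i2 _] := L1_square_weight p iv.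
  rewrite mulrC EFinM square_weight_E (RintE i2) -ge0_integralrZl//.
  - by apply: eq_integral => x _; rewrite /K; congr (_%:E); ring.
  - exact: L1_measurable i2.
  - by move=> x; rewrite mulr_ge0 ?sqr_ge0 ?rhX_ge0.
rewrite (tonelli leb plane (f := K))//; apply: eq_integral => x _.
have mp := measurable_slice (x, ku X r x, r) (measurable_rhX X).
rewrite /K ge0_integralrZl ?sqr_ge0//.
- have l : L1 plane (fun p => rhX X (x, ku X r x, r) p * UX Y r p).
    by apply: L1P; [meas|exact: (massX_L1 X Y (x, ku X r x, r))].
  have E : (massX X Y (x, ku X r x, r))%:E = (\int[plane]_p (rhX X (x, ku X r x, r) p * UX Y r p)%:E)%E.
    by rewrite massXE -(RintE l).
  by rewrite -E -EFinM /H; congr (_%:E); rewrite !mulrA divff// mul1r.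
- by meas.
- by move=> p; rewrite mulr_ge0 ?rhX_ge0.
Qed.

Lemma dissipation_part X Y :
  \int[lam]_r \int[plane]_p (GG sigma phi1 X r p * GG sigma phi1 Y r p) <=
  4 * (\int[kq X]_w massX X Y w + \int[kq Y]_w massX Y X w).
Proof.
have mX := measurable_GG X msigma mmphi1; have mY := measurable_GG Y msigma mmphi1.
have lt1 := GG_prod_lty X Y msigma sigmaA msigma sigmaA
  (smooth_continuous sphi1) vphi1 int_phi1 iphi1.
pose a r p := QX X r p * UX Y r p; pose b r p := QX Y r p * UX X r p.
have ma : measurable_fun setT (fun z : R * (R * R) => a z.1 z.2).
  exact: measurable_funM (measurable_QX X) (measurable_UX Y).
have mb : measurable_fun setT (fun z : R * (R * R) => b z.1 z.2).
  exact: measurable_funM (measurable_QX Y) (measurable_UX X).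
have a0 r p : 0 <= a r p := mulr_ge0 (QX_ge0 X r p) (UX_ge0 Y r p).
have b0 r p : 0 <= b r p := mulr_ge0 (QX_ge0 Y r p) (UX_ge0 X r p).
have mab : measurable_fun setT (fun z : R * (R * R) => a z.1 z.2 + b z.1 z.2).
  exact: measurable_funD ma mb.
have mab2 : measurable_fun setT (fun z : R * (R * R) => 2 * (a z.1 z.2 + b z.1 z.2)).
  exact: measurable_funM (measurable_cst _) mab.
have ab0 r p : 0 <= a r p + b r p := addr_ge0 (a0 r p) (b0 r p).
have ab20 r p : 0 <= 2 * (a r p + b r p) := mulr_ge0 (ler0n _ 2) (ab0 r p).
rewrite -lee_fin.
apply: (le_trans (Rint2_le_ae (mu := lam) (nu := plane)
  (f := fun r p => GG sigma phi1 X r p * GG sigma phi1 Y r p)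
  (g := fun r p => 2 * (a r p + b r p)) (measurable_funM mX mY) mab2 lt1 ab20 _)).
  move=> p; apply: ae_imp (ae_and (ae_and (square_L1 X) (square_L1 Y))
    (ae_and (chain_weight X p) (chain_weight Y p))) => r [[iX iY] [cX cY]].
  exact: young_pointwise.
rewrite (ge0_integral2rZl lam plane (f := fun r p => a r p + b r p) (ler0n _ 2) mab ab0).
rewrite (ge0_integral2D lam plane ma mb a0 b0).
have alg (x y : R) : 4 * (x + y) = 2 * (2 * x + 2 * y) by ring.
rewrite alg [leRHS]EFinM; apply: lee_wpmul2l; first by rewrite lee_fin.
by rewrite [leRHS]EFinD; apply: leeD; exact: dissipation_one.
Qed.

Lemma GG_increments X p : increments lam s t (kq X)
  (fun w => 2 * thX X w p) snd (fun r => 2^-1 * GG sigma2 phi2 X r p)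
  (fun r => GG (fun=> 1) phi X r p).
Proof. exact: (k_increments X mphi mkap p). Qed.

Lemma normr_thX X p : exists C : R, forall w, `|2 * thX X w p| <= C.
Proof.
have [B B0 bphi] := vanishes_off_bounded (smooth_continuous sphi) vphi.
have [B1 B10 bphi1] := vanishes_off_bounded (smooth_continuous sphi1) vphi1.
have [C C0 bkap] := vanishes_off_bounded (smooth_continuous skap) vkap.
have [C1 C10 bkap1] := vanishes_off_bounded Ckap.2 (vanishes_off_derive Ckap vkap).
have Gam0 : 0 <= Gam by exact: le_trans (kf'_bound X 0 0).
exists (2 * (B * C1 + Gam * B1 * C)) => w; case: p => eta y.
rewrite normrM ger0_norm// ler_pM2l// thXE; apply: le_trans (ler_normB _ _) _.
rewrite !normrM; apply: lerD; first exact: ler_pM.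
by apply: ler_pM => //; apply: ler_pM => //; exact: kf'_bound.
Qed.

Hypothesis st : s <= t.
Hypothesis lam_st : {ae lam, forall r, s <= r <= t}.

(** The product rule at a fixed mollification parameter. *)
Lemma mollified_product X Y p :
  GG (fun=> 1) phi X s p * GG (fun=> 1) phi Y s p -
  GG (fun=> 1) phi X t p * GG (fun=> 1) phi Y t p =
  - 2 * (\int[kq X]_w (thX X w p * GG (fun=> 1) phi Y w.2 p)) -
  2 * (\int[kq Y]_w (thX Y w p * GG (fun=> 1) phi X w.2 p)) -
  2^-1 * (\int[lam]_r (GG sigma2 phi2 X r p * GG (fun=> 1) phi Y r p)) -
  2^-1 * \int[lam]_r (GG sigma2 phi2 Y r p * GG (fun=> 1) phi X r p).
Proof.
have L1th Z : L1 (kq Z) (fun w => 2 * thX Z w p).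
  have [C thC] := normr_thX Z p.
  have mt : measurable_fun setT (fun w => 2 * thX Z w p).
    exact: measurable_funM (measurable_cst _) (measurable_sliceC (f := thX Z) p (measurable_thX Z)).
  exact: (@L1_finite _ _ _ (kq Z) _ _ mt thC).
have mD Z : measurable_fun setT (fun r => GG sigma2 phi2 Z r p).
  exact: (measurable_sliceC (f := GG sigma2 phi2 Z) p (measurable_GG Z msigma2 mmphi2)).
have mN Z : measurable_fun setT (fun r => GG (fun=> 1) phi Z r p).
  exact: (measurable_sliceC (f := GG (fun=> 1) phi Z) p (measurable_GG Z mone mmphi)).
have L1D2 Z : L1 lam (fun r => 2^-1 * GG sigma2 phi2 Z r p).
  apply: L1Zl.
  exact: (@L1_finite _ _ _ lam _ _ (mD Z) (fun r => normr_GG Z msigma2 sigma2A iphi2 r p)).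
have mt Z : measurable_fun setT (fun w => thX Z w p).
  exact: (measurable_sliceC (f := thX Z) p (measurable_thX Z)).
have bN Z r := normr_GG Z mone one_bound iphi r p.
have pr := product_rule (L1th X) (L1th Y) (L1D2 X) (L1D2 Y) measurable_snd measurable_snd
  (mN X) (mN Y) (bN X) (bN Y) st (kq_time X) (kq_time Y) lam_st
  (GG_increments X p) (GG_increments Y p).
have E1 Z Z' : \int[kq Z]_w (2 * thX Z w p * GG (fun=> 1) phi Z' w.2 p) =
    2 * \int[kq Z]_w (thX Z w p * GG (fun=> 1) phi Z' w.2 p).
  rewrite -RintZl; first by apply: eq_Rint => w; rewrite mulrA.
  apply: measurable_funM; [exact: mt|].
  exact: (measurableT_comp (mN Z') measurable_snd).
have E2 Z Z' : \int[lam]_r (2^-1 * GG sigma2 phi2 Z r p * GG (fun=> 1) phi Z' r p) =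
    2^-1 * \int[lam]_r (GG sigma2 phi2 Z r p * GG (fun=> 1) phi Z' r p).
  rewrite -RintZl; first by apply: eq_Rint => w; rewrite mulrA.
  exact: measurable_funM (mD Z) (mN Z').
have alg (a b c d a' b' c' d' x y : R) : y - x = a + c + (b + d) ->
    a = 2 * a' -> b = 2 * b' -> c = 2^-1 * c' -> d = 2^-1 * d' ->
    x - y = - 2 * a' - 2 * b' - 2^-1 * c' - 2^-1 * d'.
  by move=> h e1 e2 e3 e4; rewrite -opprB h e1 e2 e3 e4; ring.
exact: (alg _ _ _ _ _ _ _ _ _ _ pr (E1 X Y) (E1 Y X) (E2 X Y) (E2 Y X)).
Qed.

(** The masses produced by the defect terms absorb the cross term of the chain
    rule. If [sigma] were constant the parabolic terms would cancel; in general
    they do so only in the limit. *)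
Lemma mollified_comparison X Y :
  \int[plane]_p (GG (fun=> 1) phi X s p * GG (fun=> 1) phi Y s p -
                 GG (fun=> 1) phi X t p * GG (fun=> 1) phi Y t p) <=
  2 * (\int[leb]_a `|phi1 a|) *
    (\int[kq X]_w speed_gap X Y w + \int[kq Y]_w speed_gap Y X w) +
  2^-1 * (\int[lam]_r \int[plane]_p (GG sigma2 phi1 X r p * GG (fun=> 1) phi1 Y r p) +
          \int[lam]_r \int[plane]_p (GG sigma2 phi1 Y r p * GG (fun=> 1) phi1 X r p) -
          2 * \int[lam]_r \int[plane]_p (GG sigma phi1 X r p * GG sigma phi1 Y r p)).
Proof.
have [iA1 lA1] := defect_part X Y; have [iA2 lA2] := defect_part Y X.
have [iB1 EB1] := parabolic_part X Y; have [iB2 EB2] := parabolic_part Y X.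
have dis := dissipation_part X Y.
have E : \int[plane]_p (GG (fun=> 1) phi X s p * GG (fun=> 1) phi Y s p -
                 GG (fun=> 1) phi X t p * GG (fun=> 1) phi Y t p) =
  - 2 * (\int[plane]_p \int[kq X]_w (thX X w p * GG (fun=> 1) phi Y w.2 p)) -
  2 * (\int[plane]_p \int[kq Y]_w (thX Y w p * GG (fun=> 1) phi X w.2 p)) -
  2^-1 * (\int[plane]_p \int[lam]_r (GG sigma2 phi2 X r p * GG (fun=> 1) phi Y r p)) -
  2^-1 * \int[plane]_p \int[lam]_r (GG sigma2 phi2 Y r p * GG (fun=> 1) phi X r p).
  pose A1 p := \int[kq X]_w (thX X w p * GG (fun=> 1) phi Y w.2 p).
  pose A2 p := \int[kq Y]_w (thX Y w p * GG (fun=> 1) phi X w.2 p).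
  pose B1 p := \int[lam]_r (GG sigma2 phi2 X r p * GG (fun=> 1) phi Y r p).
  pose B2 p := \int[lam]_r (GG sigma2 phi2 Y r p * GG (fun=> 1) phi X r p).
  pose F0 p := GG (fun=> 1) phi X s p * GG (fun=> 1) phi Y s p -
    GG (fun=> 1) phi X t p * GG (fun=> 1) phi Y t p.
  have e := @Rint_comb4 _ _ _ plane F0 A1 A2 B1 B2 2 2 2^-1 2^-1 (mollified_product X Y).
  exact: (e iA1 iA2 iB1 iB2).
exact: (comparison_algebra E EB1 EB2 lA1 lA2 dis).
Qed.

End mollified.
End comparison.

(** * Letting the kinetic mollifier concentrate *)

Lemma product_increment {R : comRingType} (a b c d : R) :
  a * c - b * d = (a - b) * c + (c - d) * b.
Proof. by ring. Qed.

(** The three parabolic terms have a common limit and enter with total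
    weight 0. *)
Lemma comparison_limit {R : realType} (N_ a1 a2 e1 e2 e3 : nat -> R) (N l1 l2 E c : R) :
  N_ n @[n --> \oo] --> N -> a1 n @[n --> \oo] --> l1 -> a2 n @[n --> \oo] --> l2 ->
  e1 n @[n --> \oo] --> E -> e2 n @[n --> \oo] --> E -> e3 n @[n --> \oo] --> E ->
  (forall n, N_ n <= c * (a1 n + a2 n) + 2^-1 * (e1 n + e2 n - 2 * e3 n)) ->
  N <= c * (l1 + l2).
Proof.
move=> cN c1 c2 ce1 ce2 ce3 le.
have cR : (c * (a1 n + a2 n) + 2^-1 * (e1 n + e2 n - 2 * e3 n)) @[n --> \oo] -->
    c * (l1 + l2) + 2^-1 * (E + E - 2 * E).
  apply: cvgD; apply: cvgMr; first exact: cvgD.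
  by apply: cvgB; [exact: cvgD|exact: cvgMr].
have -> : c * (l1 + l2) = c * (l1 + l2) + 2^-1 * (E + E - 2 * E) by ring.
apply: (ler_cvg_to cN cR); exact: nearW.
Qed.

Section kernel_limits.
Context {R : realType}.
Local Notation leb := (@lebesgue_measure R).

Lemma integral_conv_le (k : R -> R) (del : R) (a : R -> R) : mollifier del k ->
  measurable_fun setT a ->
  (\int[leb]_eta `|conv a k eta|%:E <= \int[leb]_xi `|a xi|%:E)%E.
Proof.
move=> mk ma; have [sk k0 vk k1] := mk.
have mmk := C1_measurable (smooth_C1 sk); have mc := measurable_conv mk ma.
have ik := L1_vanishes_off (smooth_continuous sk) vk.
pose K xi eta := `|a xi| * k (xi - eta).
have K0 xi eta : 0 <= K xi eta by rewrite mulr_ge0.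
have mK : measurable_fun setT (fun p : R * R => K p.1 p.2) by rewrite /K; meas.
apply: (@le_trans _ _ (\int[leb]_eta \int[leb]_xi (K xi eta)%:E)%E).
  apply: le_integralT => //.
  - by meas.
  - exact: (measurable_integral leb (f := fun eta xi => K xi eta) (measurable_swap mK)).
  move=> eta; apply: le_trans (normr_Rint_le _ _) _; first by meas.
  apply: le_integralT => //; [by meas|by rewrite /K; meas|].
  by move=> xi; rewrite lee_fin normrM (ger0_norm (k0 _)).
rewrite -(tonelli leb leb mK K0); apply: eq_le_refl_e.
apply: eq_integral => xi _; rewrite /K ge0_integralrZl//; last by meas.
have iks := L1_subl xi ik.
by rewrite -(RintE iks) (Rint_subl xi (f := k))// k1 mule1.
Qed.

Section kernels.
Variables (k : nat -> R -> R) (del : nat -> R) (A : R).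
Hypotheses (mk : forall n, mollifier (del n) (k n)) (d0 : forall n, 0 < del n).
Hypotheses (kA : forall n x, k n x <= A / del n) (dl : del n @[n --> \oo] --> 0).

Section pair.
Variables (a c : R -> R -> R) (B C : R).
Hypotheses (ma : measurable_fun setT (fun p : R * R => a p.1 p.2)).
Hypotheses (mc : measurable_fun setT (fun p : R * R => c p.1 p.2)).
Hypotheses (ia : (\int[leb]_xi \int[leb]_y `|a xi y|%:E <= B%:E)%E).
Hypothesis cC : forall xi y, `|c xi y| <= C.

Let F n (p : R * R) := conv (a ^~ p.2) (k n) p.1 * conv (c ^~ p.2) (k n) p.1.

Let measurable_conv2 (b : R -> R -> R) n : measurable_fun setT (fun p : R * R => b p.1 p.2) ->
  measurable_fun setT (fun p : R * R => conv (b ^~ p.2) (k n) p.1).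
Proof.
move=> mb; have [sk _ _ _] := mk n; have mk0 := C1_measurable (smooth_C1 sk).
by apply: (measurable_Rint leb (f := fun (p : R * R) (x : R) => b x p.2 * k n (x - p.1))); meas.
Qed.

Let normr_conv2 n p : `|conv (c ^~ p.2) (k n) p.1| <= C.
Proof.
have [sk k0 vk k1] := mk n.
apply: (normr_conv_kap (smooth_C1 sk) vk k0 k1); last by move=> x; exact: cC.
exact: (measurable_sliceC (f := c) p.2 mc).
Qed.

Lemma measurable_conv_pair n : measurable_fun setT (F n).
Proof. by apply: measurable_funM; exact: measurable_conv2. Qed.

Lemma integral_conv_pair n : (\int[plane]_p `|F n p|%:E <= (C * B)%:E)%E.
Proof.
have m1 := measurable_conv2 n ma; have m2 := measurable_conv2 n mc.
have C0 : 0 <= C by exact: le_trans (cC 0 0).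
have mF := measurable_conv_pair n.
rewrite (plane_integral (F := fun p => `|F n p|))//; last by meas.
apply: (integral2_prod_le (mu := leb) (nu := leb)
  (a := fun eta y => conv (a ^~ y) (k n) eta) (b := fun eta y => conv (c ^~ y) (k n) eta)
  m1 m2 C0 (fun eta y => normr_conv2 n (eta, y))).
apply: le_trans ia.
have mn : measurable_fun setT (fun p : R * R => `|conv (a ^~ p.2) (k n) p.1|) by meas.
have mna : measurable_fun setT (fun p : R * R => `|a p.1 p.2|) by meas.
rewrite (tonelli leb leb (f := fun eta y => `|conv (a ^~ y) (k n) eta|))//.
rewrite (tonelli leb leb (f := fun eta y => `|a eta y|))//.
apply: le_integralT.
- exact: (measurable_integral leb (f := fun y eta => `|conv (a ^~ y) (k n) eta|) (measurable_swap (f := fun eta y => `|conv (a ^~ y) (k n) eta|) mn)).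
- exact: (measurable_integral leb (f := fun y eta => `|a eta y|) (measurable_swap (f := fun eta y => `|a eta y|) mna)).
- by move=> y; apply: integral_ge0.
move=> y; apply: (integral_conv_le (mk n)).
exact: (measurable_sliceC (f := a) y ma).
Qed.

Lemma integral_pair : (\int[leb]_xi \int[leb]_y `|a xi y * c xi y|%:E < +oo)%E.
Proof.
have C0 : 0 <= C by exact: le_trans (cC 0 0).
exact: (le_lt_trans (integral2_prod_le (mu := leb) (nu := leb) ma mc C0 cC ia) (ltry _)).
Qed.

Lemma L1_pair : L1 plane (fun p => a p.1 p.2 * c p.1 p.2).
Proof.
have mac : measurable_fun setT (fun p : R * R => a p.1 p.2 * c p.1 p.2) by meas.
have mn : measurable_fun setT (fun p : R * R => `|a p.1 p.2 * c p.1 p.2|) by meas.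
have e := plane_integral mn (fun p => normr_ge0 _).
apply: L1P; first exact: mac.
by apply: le_lt_trans integral_pair; exact: eq_le_refl_e.
Qed.

(** For fixed [y] this is the convergence of autocorrelation averages; the
    integral in [y] is over the whole line. *)
Lemma conv_pair_cvg :
  \int[plane]_p F n p @[n --> \oo] --> \int[plane]_p (a p.1 p.2 * c p.1 p.2).
Proof.
have iab := le_lt_trans ia (ltry _).
have mac : measurable_fun setT (fun p : R * R => a p.1 p.2 * c p.1 p.2) by meas.
have iac := integral_pair; have iP := L1_lty L1_pair.
rewrite (plane_Rint mac iP) (leb_fubini (f := fun xi y => a xi y * c xi y) mac iac).
rewrite (_ : (fun n => _) = (fun n => \int[leb]_y \int[leb]_eta
    (conv (a ^~ y) (k n) eta * conv (c ^~ y) (k n) eta))).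
  exact: (lim_conv_conv mk d0 kA dl ma mc iab cC).
apply/funext => n; have mF := measurable_conv_pair n.
have iF := le_lt_trans (integral_conv_pair n) (ltry _).
rewrite (plane_Rint mF iF).
have mnF : measurable_fun setT (fun p : R * R => `|F n p|) by meas.
have e' := plane_integral mnF (fun p => normr_ge0 _).
have iF' : (\int[leb]_eta \int[leb]_y `|F n (eta, y)|%:E < +oo)%E.
  apply: le_lt_trans iF; exact: eq_le_refl_e.
apply: (leb_fubini (f := fun eta y => F n (eta, y))) => //.
Qed.

End pair.

Variables (lam : {finite_measure set R -> \bar R}) (s t F Gam S : R) (sigma : R -> R).
Hypotheses (msigma : measurable_fun setT sigma) (sigmaS : forall xi, `|sigma xi| <= S).
Variables (phi : R -> R) (eps : R).
Hypotheses (mphi : mollifier eps phi) (eps0 : 0 <= eps).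
Implicit Types X Y : kinetic lam s t F Gam sigma.

Let phi1 := derive1 phi.
Let sphi : smooth phi. Proof. by case: mphi. Qed.
Let sphi1 : smooth phi1 := smooth_derive sphi.
Let vphi : vanishes_off eps phi. Proof. by case: mphi. Qed.
Let vphi1 : vanishes_off eps phi1 := vanishes_off_derive (smooth_C1 sphi) vphi.
Let iphi : L1 leb phi := L1_vanishes_off (smooth_continuous sphi) vphi.
Let iphi1 : L1 leb phi1 := L1_vanishes_off (smooth_continuous sphi1) vphi1.
Let mmphi := L1_measurable iphi.
Let mmphi1 := L1_measurable iphi1.
Let int_phi1 : \int[leb]_a phi1 a = 0 := Rint_derive_eq0 (smooth_C1 sphi) vphi.

Definition wX (g : R -> R) X (r xi y : R) : R := wk g (kf X r) (ku X r) xi y.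

Lemma GG_conv n c g X r p :
  GG (k n) c g X r p = conv (fun xi => c xi * wX g X r xi p.2) (k n) p.1.
Proof. by []. Qed.

Lemma measurable_wX g X r : measurable_fun setT g ->
  measurable_fun setT (fun p : R * R => wX g X r p.1 p.2).
Proof.
move=> mg; apply: (measurable_wk mg); first exact: (measurable_slice r (kf_meas X)).
exact: (measurable_slice r (ku_meas X)).
Qed.

Lemma normr_wX g X r xi y : L1 leb g -> `|wX g X r xi y| <= \int[leb]_a `|g a|.
Proof. by move=> ig; apply: normr_wk => //; exact: (measurable_slice r (ku_meas X)). Qed.

Lemma wX_mean0 X r : osc_bound (ku X r) (kK X) ->
  (\int[leb]_xi \int[leb]_y `|wX phi1 X r xi y|%:E <=
    (8 * eps * kK X * \int[leb]_a `|phi1 a|)%:E)%E.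
Proof.
move=> osc; have mf := measurable_slice r (kf_meas X); have mu := measurable_slice r (ku_meas X).
have h0 : forall xi : R, `|kf X r xi - kf X r xi| <= 0 by move=> xi; rewrite subrr normr0.
have := wk_close (smooth_continuous sphi1) vphi1 eps0 mu mf mf osc h0; rewrite int_phi1 addr0.
by under eq_integral do under eq_integral do rewrite mulr0 subr0.
Qed.

Lemma measurable_wX3 g X : measurable_fun setT g ->
  measurable_fun setT (fun z : R * (R * R) => wX g X z.1 z.2.1 z.2.2).
Proof.
move=> mg; have mf := kf_meas X; have mu := ku_meas X.
apply: (measurable_wk_gen (u := fun z : R * (R * R) => ku X z.1)
  (Y := fun z : R * (R * R) => z.2.2 + kf X z.1 z.2.1)
  (XI := fun z : R * (R * R) => z.2.1) mg); by meas.
Qed.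

Opaque wX.

(** The quadratic parabolic terms have the same limit whatever the splitting
    [c * c'] of [sigma ^+ 2]. *)
Lemma parabolic_cvg X Y (c c' : R -> R) (B B' : R) :
  measurable_fun setT c -> (forall xi, `|c xi| <= B) ->
  measurable_fun setT c' -> (forall xi, `|c' xi| <= B') ->
  (forall xi, c xi * c' xi = sigma xi ^+ 2) ->
  \int[lam]_r \int[plane]_p (GG (k n) c phi1 X r p * GG (k n) c' phi1 Y r p)
    @[n --> \oo] -->
  \int[lam]_r \int[plane]_p
    (sigma p.1 ^+ 2 * wX phi1 X r p.1 p.2 * wX phi1 Y r p.1 p.2).
Proof.
move=> mc cB mc' cB' cc'.
have B0 : 0 <= B by exact: le_trans (cB 0).
pose J := \int[leb]_a `|phi1 a|.
have J0 : 0 <= J by exact: Rint_ge0.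
pose M := (B' * J) * (B * (8 * eps * kK X * J)).
pose a r xi y := c xi * wX phi1 X r xi y; pose b r xi y := c' xi * wX phi1 Y r xi y.
have ma r : measurable_fun setT (fun p : R * R => a r p.1 p.2).
  by have mw := measurable_wX X r mmphi1; rewrite /a; meas.
have mb r : measurable_fun setT (fun p : R * R => b r p.1 p.2).
  by have mw := measurable_wX Y r mmphi1; rewrite /b; meas.
have bB r xi y : `|b r xi y| <= B' * J.
  by rewrite /b normrM ler_pM//; exact: normr_wX.
have ia r : osc_bound (ku X r) (kK X) ->
    (\int[leb]_xi \int[leb]_y `|a r xi y|%:E <= (B * (8 * eps * kK X * J))%:E)%E.
  move=> osc; have mw := measurable_wX X r mmphi1.
  have mc2 : measurable_fun setT (fun p : R * R => c p.1) by meas.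
  have := integral2_prod_le (mu := leb) (nu := leb) (a := wX phi1 X r)
    (b := fun xi _ => c xi) mw mc2 B0 (fun xi _ => cB xi) (wX_mean0 osc).
  by under eq_integral do under eq_integral do rewrite mulrC.
have E n r : \int[plane]_p (GG (k n) c phi1 X r p * GG (k n) c' phi1 Y r p) =
    \int[plane]_p (conv (a r ^~ p.2) (k n) p.1 * conv (b r ^~ p.2) (k n) p.1).
  by apply: eq_Rint => p; rewrite !GG_conv.
have Elim r : \int[plane]_p (sigma p.1 ^+ 2 * wX phi1 X r p.1 p.2 * wX phi1 Y r p.1 p.2) =
    \int[plane]_p (a r p.1 p.2 * b r p.1 p.2).
  by apply: eq_Rint => p; rewrite /a /b -cc' -mulrA mulrACA.
apply: (@ae_Rint_dominated _ _ _ lam _ _ (fun=> M)).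
- move=> n.
  have m1 := measurable_GG (mk n) X mc mmphi1; have m2 := measurable_GG (mk n) Y mc' mmphi1.
  exact: (measurable_Rint plane (f := fun r p => GG (k n) c phi1 X r p * GG (k n) c' phi1 Y r p)
    (measurable_funM m1 m2)).
- have mX := measurable_wX3 X mmphi1; have mY := measurable_wX3 Y mmphi1.
  have ms : measurable_fun setT (fun z : R * (R * R) => sigma z.2.1 ^+ 2) by meas.
  exact: (measurable_Rint plane (f := fun r p => sigma p.1 ^+ 2 * wX phi1 X r p.1 p.2 * wX phi1 Y r p.1 p.2)
    (measurable_funM (measurable_funM ms mX) mY)).
- apply: ae_imp (ku_osc X) => r osc.
  rewrite Elim (_ : (fun n => _) = (fun n =>
    \int[plane]_p (conv (a r ^~ p.2) (k n) p.1 * conv (b r ^~ p.2) (k n) p.1))); last first.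
    by apply/funext => n; exact: E.
  exact: (conv_pair_cvg (ma r) (mb r) (ia r osc) (bB r)).
- by apply: (@L1_finite _ _ _ lam _ `|M|) => // x.
- apply: ae_imp (ku_osc X) => r osc n; rewrite E.
  have mF := measurable_conv_pair (ma r) (mb r) n.
  rewrite -lee_fin; apply: le_trans (normr_Rint_le plane mF) _.
  exact: (integral_conv_pair (ma r) (mb r) (ia r osc) (bB r) n).
Qed.

Lemma speed_gapE n X Y w : speed_gap (k n) X Y w =
  dav (k n) (fun xi => `|kf' X w.2 w.1.2 - kf' Y w.2 xi|) w.1.2.
Proof. by []. Qed.

(** The averaged difference of the speeds converges to the difference at the
    same [xi], which is controlled by the distance of the two signals. *)
Lemma speed_gap_cvg X Y (H : R) :
  (forall r xi, s <= r <= t -> `|kf' X r xi - kf' Y r xi| <= H) ->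
  exists2 L : R, \int[kq X]_w speed_gap (k n) X Y w @[n --> \oo] --> L &
    L <= \int[kq X]_w H.
Proof.
move=> hH; pose g (w : R * R * R) := `|kf' X w.2 w.1.2 - kf' Y w.2 w.1.2|.
have mX := kf'_meas X; have mY := kf'_meas Y.
have mg : measurable_fun setT g by rewrite /g; meas.
have gB w : `|g w| <= Gam + Gam.
  rewrite /g normr_id; apply: le_trans (ler_normB _ _) _.
  by apply: lerD; exact: kf'_bound.
exists (\int[kq X]_w g w); last first.
  have ig := @L1_finite _ _ _ (kq X) _ _ mg gB.
  have iH : L1 (kq X) (fun=> H).
    by apply: (@L1_finite _ _ _ (kq X) _ `|H|) => // x; exact: measurable_cst.
  rewrite -lee_fin (RintE ig) (RintE iH).
  have H0 : {ae kq X, forall w, (`|H| = H)%R}.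
    apply: ae_imp (kq_time X) => w hw; apply: ger0_norm.
    exact: le_trans (hH w.2 w.1.2 hw).
  have -> : (\int[kq X]_w H%:E = \int[kq X]_w (`|H|)%:E)%E.
    apply: ae_eq_integral => //.
    by apply: ae_imp H0 => w -> _.
  apply: ae_le_integralT; [by meas|exact: measurable_cst|by move=> w; rewrite lee_fin /g|by move=> w; rewrite lee_fin|].
  apply: ae_imp (kq_time X) => w hw; rewrite lee_fin.
  by apply: le_trans (ler_norm H); exact: hH.
apply: (Rint_dominated (mu := kq X) (g := fun=> Gam + Gam)).
- by move=> n; exact: (measurable_speed_gap (mk n)).
- exact: mg.
- apply: ae_all => w.
  rewrite (_ : (fun n => _) = (fun n =>
    dav (k n) (fun xi => `|kf' X w.2 w.1.2 - kf' Y w.2 xi|) w.1.2)); last first.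
    by apply/funext => n; exact: speed_gapE.
  have cY : continuous (kf' Y w.2) := (kf_C1 Y w.2).2.
  have cc : continuous (fun xi => `|kf' X w.2 w.1.2 - kf' Y w.2 xi|).
    move=> xi; apply: cvg_norm; apply: cvgB; [exact: cvg_cst|exact: cY].
  have mc : measurable_fun setT (fun xi => `|kf' X w.2 w.1.2 - kf' Y w.2 xi|).
    exact: continuous_measurable_fun cc.
  apply: (dav_cvg mk d0 kA dl (C := Gam + Gam) mc).
    move=> xi; rewrite normr_id; apply: le_trans (ler_normB _ _) _.
    by apply: lerD; exact: kf'_bound.
  apply: (@continuous_lebesgue_pt R _ w.1.2 setT); [by split; [exact: openT|]|exact: measurableT|exact: mc|exact: cc].
- by apply: (@L1_finite _ _ _ (kq X) _ `|Gam + Gam|) => //; exact: measurable_cst.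
- by move=> n w; exact: (normr_speed_gap (mk n)).
Qed.

(** Two profiles close in [L^1] have close kinetic functions, whatever their
    (bounded) characteristics. *)
Lemma wX_st X : 0 <= F -> exists B : R,
  (\int[leb]_xi \int[leb]_y `|wX phi X s xi y - wX phi X t xi y|%:E <= B%:E)%E.
Proof.
move=> F0.
have mzero : measurable_fun setT (fun _ : R => 0 : R) by exact: measurable_cst.
have [mus mut] := (measurable_slice s (ku_meas X), measurable_slice t (ku_meas X)).
have [mws mwt] := (measurable_wX X s mmphi, measurable_wX X t mmphi).
have phi_1 : \int[leb]_x phi x = 1 by case: mphi.
have close r : osc_bound (ku X r) (kK X) ->
    exists C : R, (\int[leb]_xi \int[leb]_y `|wX phi X r xi y - psi xi (ku X r y)|%:E <= C%:E)%E.
  move=> osc; have mf := measurable_slice r (kf_meas X); have mu := measurable_slice r (ku_meas X).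
  have hF : forall xi : R, `|kf X r xi - 0| <= F by move=> xi; rewrite subr0; exact: kf_bound.
  have := wk_close (smooth_continuous sphi) vphi eps0 mu mf mzero osc hF; rewrite phi_1.
  by under eq_integral do under eq_integral do rewrite mulr1 addr0; eexists; eassumption.
have [Cs hs] := close s (ku_osc_s X); have [Ct ht] := close t (ku_osc_t X).
have hst : exists C : R, (\int[leb]_xi \int[leb]_y `|psi xi (ku X s y) - psi xi (ku X t y)|%:E <= C%:E)%E.
  have := integral_psi_shift mus mut mzero.
  under eq_integral do under eq_integral do rewrite addr0.
  move=> ->; have := ku_st X; case: (\int[leb]_x _)%E => [r _|//|_].
    by exists (2 * r); rewrite EFinM.
  by exists 0; rewrite gt0_muleNy ?leNye// lte_fin.
have [C hC] := hst.
have mp := @measurable_psi R.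
exists (Cs + (C + Ct)).
have m1 : measurable_fun setT (fun p : R * R => wX phi X s p.1 p.2 - psi p.1 (ku X s p.2)) by meas.
have m2 : measurable_fun setT (fun p : R * R => psi p.1 (ku X s p.2) - psi p.1 (ku X t p.2)) by meas.
have m3 : measurable_fun setT (fun p : R * R => wX phi X t p.1 p.2 - psi p.1 (ku X t p.2)) by meas.
have m4 : measurable_fun setT (fun p : R * R => psi p.1 (ku X s p.2) - wX phi X t p.1 p.2) by meas.
have m5 : measurable_fun setT (fun p : R * R => wX phi X s p.1 p.2 - wX phi X t p.1 p.2) by meas.
rewrite !EFinD; apply: (le_trans (integral2_triangle
  (f := fun xi y => wX phi X s xi y - wX phi X t xi y)
  (g := fun xi y => wX phi X s xi y - psi xi (ku X s y))
  (h := fun xi y => psi xi (ku X s y) - wX phi X t xi y) m5 m1 m4 _)).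
  by move=> xi y; apply: le_trans (ler_normD _ _); rewrite addrA subrK.
apply: leeD => //; apply: (le_trans (integral2_triangle
  (f := fun xi y => psi xi (ku X s y) - wX phi X t xi y)
  (g := fun xi y => psi xi (ku X s y) - psi xi (ku X t y))
  (h := fun xi y => wX phi X t xi y - psi xi (ku X t y)) m4 m2 m3 _)).
  move=> xi y; rewrite (distrC (wX _ _ _ _ _)); apply: le_trans (ler_normD _ _).
  by rewrite addrA subrK.
exact: leeD.
Qed.

(** The products themselves are not integrable over the plane; their increments
    are, by [wX_st], since solutions are [L^1]-close at different times. *)
Lemma product_increment_cvg X Y : 0 <= F ->
  \int[plane]_p (GG (k n) (fun=> 1) phi X s p * GG (k n) (fun=> 1) phi Y s p -
                 GG (k n) (fun=> 1) phi X t p * GG (k n) (fun=> 1) phi Y t p)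
    @[n --> \oo] -->
  \int[plane]_p (wX phi X s p.1 p.2 * wX phi Y s p.1 p.2 -
                 wX phi X t p.1 p.2 * wX phi Y t p.1 p.2).
Proof.
move=> F0; have [B1 iB1] := wX_st X F0; have [B2 iB2] := wX_st Y F0.
have [mXs mXt] := (measurable_wX X s mmphi, measurable_wX X t mmphi).
have [mYs mYt] := (measurable_wX Y s mmphi, measurable_wX Y t mmphi).
pose a1 xi y := wX phi X s xi y - wX phi X t xi y.
pose a2 xi y := wX phi Y s xi y - wX phi Y t xi y.
have ma1 : measurable_fun setT (fun p : R * R => a1 p.1 p.2) by rewrite /a1; meas.
have ma2 : measurable_fun setT (fun p : R * R => a2 p.1 p.2) by rewrite /a2; meas.
have bY xi y := normr_wX Y s xi y iphi; have bX xi y := normr_wX X t xi y iphi.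
have c1 := conv_pair_cvg ma1 mYs iB1 bY; have c2 := conv_pair_cvg ma2 mXt iB2 bX.
have h1 n := le_lt_trans (integral_conv_pair ma1 mYs iB1 bY n) (ltry _).
have h2 n := le_lt_trans (integral_conv_pair ma2 mXt iB2 bX n) (ltry _).
have l1 n : L1 plane (fun p => conv (a1 ^~ p.2) (k n) p.1 * conv (wX phi Y s ^~ p.2) (k n) p.1).
  by apply: L1P; [exact: (measurable_conv_pair ma1 mYs n)|exact: h1].
have l2 n : L1 plane (fun p => conv (a2 ^~ p.2) (k n) p.1 * conv (wX phi X t ^~ p.2) (k n) p.1).
  by apply: L1P; [exact: (measurable_conv_pair ma2 mXt n)|exact: h2].
have convB n (u v : R -> R) eta : L1 leb (fun x => u x * k n (x - eta)) ->
    L1 leb (fun x => v x * k n (x - eta)) ->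
    conv (fun x => u x - v x) (k n) eta = conv u (k n) eta - conv v (k n) eta.
  by move=> iu iv; rewrite /conv -RintB//; apply: eq_Rint => x; rewrite mulrBl.
have lk n X' r p : L1 leb (fun x => wX phi X' r x p.2 * k n (x - p.1)).
  have [sk k0 vk k1] := mk n.
  have ik := L1_vanishes_off (smooth_continuous sk) vk.
  have mw := measurable_sliceC (f := wX phi X' r) p.2 (measurable_wX X' r mmphi).
  exact: (L1_bounded_M mw (fun x => normr_wX X' r x p.2 iphi) (L1_shift p.1 ik)).
rewrite (_ : (fun n => _) = (fun n =>
  \int[plane]_p (conv (a1 ^~ p.2) (k n) p.1 * conv (wX phi Y s ^~ p.2) (k n) p.1) +
  \int[plane]_p (conv (a2 ^~ p.2) (k n) p.1 * conv (wX phi X t ^~ p.2) (k n) p.1))); last first.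
  apply/funext => n; rewrite -(RintD (l1 n) (l2 n)); apply: eq_Rint => p.
  rewrite /a1 /a2 !convB//.
  rewrite !GG_conv.
  have E r X' : conv (fun xi => 1 * wX phi X' r xi p.2) (k n) p.1 = conv (wX phi X' r ^~ p.2) (k n) p.1.
    by apply: eq_Rint => xi; rewrite mul1r.
  by rewrite !E; exact: product_increment.
have lL1 : L1 plane (fun p : R * R => a1 p.1 p.2 * wX phi Y s p.1 p.2).
  exact: (L1_pair ma1 mYs iB1 bY).
have lL2 : L1 plane (fun p : R * R => a2 p.1 p.2 * wX phi X t p.1 p.2).
  exact: (L1_pair ma2 mXt iB2 bX).
rewrite (_ : \int[plane]_p _ = \int[plane]_p (a1 p.1 p.2 * wX phi Y s p.1 p.2) +
  \int[plane]_p (a2 p.1 p.2 * wX phi X t p.1 p.2)); last first.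
  by rewrite -(RintD lL1 lL2); apply: eq_Rint => p; exact: product_increment.
exact: cvgD c1 c2.
Qed.

Hypothesis st : s <= t.
Hypothesis lam_st : {ae lam, forall r, s <= r <= t}.

Lemma limit_comparison X Y (H : R) : 0 <= F ->
  (forall r xi, s <= r <= t -> `|kf' X r xi - kf' Y r xi| <= H) ->
  \int[plane]_p (wX phi X s p.1 p.2 * wX phi Y s p.1 p.2 -
                 wX phi X t p.1 p.2 * wX phi Y t p.1 p.2) <=
  2 * (\int[leb]_a `|phi1 a|) * ((\int[kq X]_w H) + \int[kq Y]_w H).
Proof.
move=> F0 hH.
have [L1 cL1 L1H] := speed_gap_cvg hH.
have hH' r xi : s <= r <= t -> `|kf' Y r xi - kf' X r xi| <= H.
  by move=> h; rewrite distrC; exact: hH.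
have [L2 cL2 L2H] := speed_gap_cvg hH'.
have cN := product_increment_cvg (X := X) (Y := Y) F0.
have one_bound (xi : R) : `|1 : R| <= 1 by rewrite normr1.
have mone : measurable_fun setT (fun _ : R => 1 : R) by exact: measurable_cst.
have msigma2 : measurable_fun setT (fun xi => sigma xi ^+ 2) by meas.
have S0 : 0 <= S by exact: le_trans (sigmaS 0).
have sigma2S xi : `|sigma xi ^+ 2| <= S ^+ 2 by rewrite normrX ler_pXn2r.
have cE1 := parabolic_cvg (X := X) (Y := Y) msigma2 sigma2S mone one_bound (fun xi => mulr1 _).
have cE2 := parabolic_cvg (X := Y) (Y := X) msigma2 sigma2S mone one_bound (fun xi => mulr1 _).
have cE3 := parabolic_cvg (X := X) (Y := Y) msigma sigmaS msigma sigmaS (fun xi => esym (expr2 _)).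
have E21 : \int[lam]_r \int[plane]_p
    (sigma p.1 ^+ 2 * wX phi1 Y r p.1 p.2 * wX phi1 X r p.1 p.2) =
  \int[lam]_r \int[plane]_p
    (sigma p.1 ^+ 2 * wX phi1 X r p.1 p.2 * wX phi1 Y r p.1 p.2).
  by apply: eq_Rint => r; apply: eq_Rint => p; exact: mulrAC.
rewrite E21 in cE2.
pose J := \int[leb]_a `|phi1 a|.
have J0 : 0 <= J by exact: Rint_ge0.
have le n := mollified_comparison msigma sigmaS mphi (mk n) eps0 st lam_st X Y.
apply: le_trans (comparison_limit cN cL1 cL2 cE1 cE2 cE3 le) _.
exact: (ler_wpM2l (mulr_ge0 (ler0n _ 2) J0) (lerD L1H L2H)).
Qed.

End kernels.
End kernel_limits.

(** * The comparison estimate for kinetic solutions *)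

Lemma endpoint_algebra {R : realType} (I Is It Ds Dt e B : R) :
  I = It - Is -> `|It - 2 * Dt| <= e -> `|Is - 2 * Ds| <= e -> I <= 2 * B ->
  Dt <= Ds + e + B.
Proof. move=> -> h1 h2 h3; move: h1 h2; rewrite !ler_norml => /andP[h1 h1'] /andP[h2 h2']; lra. Qed.

Lemma one_sub_sub {R : comRingType} (a b : R) : a - b = (1 - b) - (1 - a).
Proof. by ring. Qed.

Section kinetic_comparison.
Context {R : realType}.
Local Notation leb := (@lebesgue_measure R).
Variables (lam : {finite_measure set R -> \bar R}) (s t F Gam S : R) (sigma : R -> R).
Hypotheses (msigma : measurable_fun setT sigma) (sigmaS : forall xi, `|sigma xi| <= S).
Implicit Types X Y : kinetic lam s t F Gam sigma.

Section endpoint.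
Variables (phi : R -> R) (eps : R).
Hypotheses (mphi : mollifier eps phi) (eps0 : 0 <= eps).

Let sphi : smooth phi. Proof. by case: mphi. Qed.
Let vphi : vanishes_off eps phi. Proof. by case: mphi. Qed.
Let iphi : L1 leb phi := L1_vanishes_off (smooth_continuous sphi) vphi.
Let mmphi := L1_measurable iphi.
Let phi_1 : \int[leb]_x phi x = 1. Proof. by case: mphi. Qed.
Let nphi_1 : \int[leb]_x `|phi x| = 1.
Proof. by case: mphi => _ p0 _ <-; apply: eq_Rint => x; rewrite ger0_norm. Qed.

Let Psi (Z : kinetic lam s t F Gam sigma) f r (p : R * R) : R := psi p.1 (ku Z r (p.2 + f p.1)).

Let measurable_Psi Z (f : R -> R) r : measurable_fun setT f -> measurable_fun setT (Psi Z f r).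
Proof.
by move=> mf; have mp := @measurable_psi R; have mu := measurable_slice r (ku_meas Z); rewrite /Psi; meas.
Qed.

Lemma wX_Psi Z (f : R -> R) r (H : R) : measurable_fun setT f ->
  osc_bound (ku Z r) (kK Z) -> (forall xi, `|kf Z r xi - f xi| <= H) ->
  (\int[plane]_p `|wX phi Z r p.1 p.2 - Psi Z f r p|%:E <= (8 * (eps + H) * kK Z)%:E)%E.
Proof.
move=> mf osc hH; have mw := measurable_wX Z r mmphi; have mP := measurable_Psi Z r mf.
rewrite (plane_integral (F := fun p => `|wX phi Z r p.1 p.2 - Psi Z f r p|))//; last by meas.
have mkf := measurable_slice r (kf_meas Z); have mu := measurable_slice r (ku_meas Z).
have := wk_close (smooth_continuous sphi) vphi eps0 mu mkf mf osc hH.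
rewrite phi_1 nphi_1 mulr1.
by under eq_integral do under eq_integral do rewrite mulr1.
Qed.

Lemma Psi_dist X Y (f : R -> R) r (D : R) : measurable_fun setT f ->
  (\int[leb]_x `|ku X r x - ku Y r x|%:E = D%:E)%E ->
  L1 plane (fun p => 1 - Psi X f r p * Psi Y f r p) /\
  \int[plane]_p (1 - Psi X f r p * Psi Y f r p) = 2 * D.
Proof.
move=> mf hD; have mX := measurable_Psi X r mf; have mY := measurable_Psi Y r mf.
have mp := @measurable_psi R.
have muX := measurable_slice r (ku_meas X); have muY := measurable_slice r (ku_meas Y).
have psi1 (xi a b : R) : 0 <= 1 - psi xi a * psi xi b.
  rewrite subr_ge0; apply: le_trans (ler_norm _) _; rewrite normrM -[leRHS]mulr1.
  by apply: ler_pM => //; exact: normr_psi.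
have m : measurable_fun setT (fun p => 1 - Psi X f r p * Psi Y f r p) by meas.
have E : (\int[plane]_p (1 - Psi X f r p * Psi Y f r p)%:E = (2 * D)%:E)%E.
  rewrite (plane_integral m (fun p => psi1 _ _ _)).
  transitivity (\int[leb]_xi \int[leb]_y (1 - psi xi (ku X r y) * psi xi (ku Y r y))%:E)%E.
    apply: eq_integral => xi _.
    rewrite -(ge0_integral_addr (f xi) (f := fun y => (1 - psi xi (ku X r y) * psi xi (ku Y r y))%:E))//.
      by meas.
    by move=> y; rewrite lee_fin.
  rewrite (tonelli leb leb (f := fun xi y => 1 - psi xi (ku X r y) * psi xi (ku Y r y)))//; last by meas.
  rewrite EFinM -hD -ge0_integralrZl//; last by meas.
  by apply: eq_integral => y _; exact: integral_psi_prod.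
have l : L1 plane (fun p => 1 - Psi X f r p * Psi Y f r p).
  apply: L1P; first exact: m.
  apply: (@le_lt_trans _ _ (2 * D)%:E); last exact: ltry.
  rewrite -E; apply: eq_le_refl_e; apply: eq_integral => p _.
  by rewrite ger0_norm//; exact: psi1.
by split => //; apply: EFin_inj; rewrite (RintE l).
Qed.

(** At a fixed time the mollified kinetic functions recover the [L^1] distance,
    up to the oscillation over the mollification and characteristic scales. *)
Lemma endpoint X Y r (D H : R) :
  osc_bound (ku X r) (kK X) -> osc_bound (ku Y r) (kK Y) ->
  (forall xi, `|kf Y r xi - kf X r xi| <= H) ->
  (\int[leb]_x `|ku X r x - ku Y r x|%:E = D%:E)%E ->
  L1 plane (fun p => 1 - wX phi X r p.1 p.2 * wX phi Y r p.1 p.2) /\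
  `|\int[plane]_p (1 - wX phi X r p.1 p.2 * wX phi Y r p.1 p.2) - 2 * D| <=
    8 * (eps * kK X + (eps + H) * kK Y).
Proof.
move=> oX oY hH hD; have mf := measurable_slice r (kf_meas X).
have mX := measurable_Psi X r mf; have mY := measurable_Psi Y r mf.
have [lP EP] := Psi_dist mf hD.
have h0 : forall xi : R, `|kf X r xi - kf X r xi| <= 0 by move=> xi; rewrite subrr normr0.
have cX := wX_Psi mf oX h0; have cY := wX_Psi mf oY hH; rewrite addr0 in cX.
have [mwX mwY] := (measurable_wX X r mmphi, measurable_wX Y r mmphi).
pose a p := wX phi X r p.1 p.2; pose b p := wX phi Y r p.1 p.2.
pose P p := Psi X (kf X r) r p; pose Q p := Psi Y (kf X r) r p.
have ma : measurable_fun setT a by exact: mwX.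
have mb : measurable_fun setT b by exact: mwY.
have mP : measurable_fun setT P by exact: mX.
have mQ : measurable_fun setT Q by exact: mY.
have b1 p : `|b p| <= 1 by rewrite -nphi_1; exact: normr_wX.
have P1 p : `|P p| <= 1 by exact: normr_psi.
have lX : L1 plane (fun p => a p - P p).
  by apply: L1P; [exact: measurable_funB ma mP|exact: le_lt_trans cX (ltry _)].
have lY : L1 plane (fun p => b p - Q p).
  by apply: L1P; [exact: measurable_funB mb mQ|exact: le_lt_trans cY (ltry _)].
have l1 : L1 plane (fun p => (a p - P p) * b p).
  apply: (L1_le (mu := plane) (g := fun p => `|a p - P p|)); last exact: L1_norm.
  - exact: measurable_funM (measurable_funB ma mP) mb.
  - by move=> p; rewrite normrM ler_piMr.
have l2 : L1 plane (fun p => P p * (b p - Q p)).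
  apply: (L1_le (mu := plane) (g := fun p => `|b p - Q p|)); last exact: L1_norm.
  - exact: measurable_funM mP (measurable_funB mb mQ).
  - by move=> p; rewrite normrM ler_piMl.
have split_ab p : 1 - a p * b p = (1 - P p * Q p) - ((a p - P p) * b p + P p * (b p - Q p)).
  by move: (a p) (b p) (P p) (Q p) => a' b' P' Q'; ring.
have lE := L1D l1 l2.
have lab : L1 plane (fun p => 1 - a p * b p).
  by under eq_fun do rewrite split_ab; exact: L1B.
split; first exact: lab.
have -> : \int[plane]_p (1 - wX phi X r p.1 p.2 * wX phi Y r p.1 p.2) =
    2 * D - \int[plane]_p ((a p - P p) * b p + P p * (b p - Q p)).
  rewrite -EP -(RintB lP lE); apply: eq_Rint => p; exact: split_ab.
rewrite addrAC subrr sub0r normrN (RintD l1 l2); apply: le_trans (ler_normD _ _) _.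
rewrite mulrDr; apply: lerD; rewrite -lee_fin.
- apply: le_trans (normr_Rint_le plane (L1_measurable l1)) _.
  rewrite mulrA; apply: le_trans cX; apply: le_integralT => //.
  + by apply/measurable_EFinP; exact: (L1_measurable (L1_norm l1)).
  + by apply/measurable_EFinP; exact: (L1_measurable (L1_norm lX)).
  by move=> p; rewrite lee_fin normrM ler_piMr.
- apply: le_trans (normr_Rint_le plane (L1_measurable l2)) _.
  rewrite mulrA; apply: le_trans cY; apply: le_integralT => //.
  + by apply/measurable_EFinP; exact: (L1_measurable (L1_norm l2)).
  + by apply/measurable_EFinP; exact: (L1_measurable (L1_norm lY)).
  by move=> p; rewrite lee_fin normrM ler_piMl.
Qed.

End endpoint.
Hypothesis st : s <= t.
Hypothesis lam_st : {ae lam, forall r, s <= r <= t}.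

(** The inequality in the limit of a concentrating kinetic mollifier, with the
    boundary terms replaced by the [L^1] distances at [s] and [t]. *)
Lemma comparison_at_scale X Y (Ds Dt H H' A eps : R) : 0 <= F -> 0 < eps ->
  (forall r xi, s <= r <= t -> `|kf Y r xi - kf X r xi| <= H) ->
  (forall r xi, s <= r <= t -> `|kf' X r xi - kf' Y r xi| <= H') ->
  (\int[leb]_x `|ku X s x - ku Y s x|%:E = Ds%:E)%E ->
  (\int[leb]_x `|ku X t x - ku Y t x|%:E = Dt%:E)%E ->
  (exists2 phi, mollifier eps phi & \int[leb]_x `|derive1 phi x| <= A / eps) ->
  Dt <= Ds + 8 * (eps * kK X + (eps + H) * kK Y) +
    A / eps * ((\int[kq X]_w H') + \int[kq Y]_w H').
Proof.
move=> F0 e0 hH hH' hs ht [phi mphi phiA].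
have eps0 := ltW e0.
have H'0 : 0 <= H' by apply: le_trans (hH' s 0 _); rewrite ?lexx.
have [A' A'0 hk] := @exists_mollifiers R.
pose del (n : nat) : R := n.+1%:R^-1.
have d0 n : 0 < del n by rewrite invr_gt0.
have [k mk] := choice (fun n => hk (del n) (d0 n)).
have mk1 n : mollifier (del n) (k n) by have [] := mk n.
have kA n x : k n x <= A' / del n by have [_ h _] := mk n.
have dl : del n @[n --> \oo] --> (0 : R) by exact: cvg_harmonic.
have ss : s <= s <= t by rewrite lexx.
have tt : s <= t <= t by rewrite lexx st.
have [ls Is] := endpoint mphi eps0 (ku_osc_s X) (ku_osc_s Y) (fun xi => hH s xi ss) hs.
have [lt It] := endpoint mphi eps0 (ku_osc_t X) (ku_osc_t Y) (fun xi => hH t xi tt) ht.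
have lim := limit_comparison mk1 d0 kA dl msigma sigmaS mphi eps0 st lam_st F0 hH'.
have E : \int[plane]_p (wX phi X s p.1 p.2 * wX phi Y s p.1 p.2 -
                 wX phi X t p.1 p.2 * wX phi Y t p.1 p.2) =
   \int[plane]_p (1 - wX phi X t p.1 p.2 * wX phi Y t p.1 p.2) -
   \int[plane]_p (1 - wX phi X s p.1 p.2 * wX phi Y s p.1 p.2).
  rewrite -(RintB lt ls); apply: eq_Rint => p; exact: one_sub_sub.
rewrite -mulrA in lim; have := endpoint_algebra E It Is lim.
have Q0 : 0 <= (\int[kq X]_w H') + \int[kq Y]_w H'.
  by apply: addr_ge0; exact: Rint_ge0.
move=> h; apply: le_trans h _; rewrite lerD2l.
exact: ler_wpM2r Q0 _ _ phiA.
Qed.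

End kinetic_comparison.

(** * Restriction to a time window *)

Section restriction.
Context {R : realType} d (X : measurableType d) (mu : {measure set X -> \bar R}).
Variables (D : set X) (mD : measurable D).
Local Notation res := (mrestr mu mD).

Lemma ae_mrestr_in : {ae res, forall x, D x}.
Proof.
exists (~` D); split; [exact: measurableC| |by []].
by rewrite /mrestr setICl measure0.
Qed.

Lemma ae_mrestr (P : X -> Prop) : {ae mu, forall x, D x -> P x} -> {ae res, forall x, P x}.
Proof.
move=> [N [mN N0 NP]]; exists (N `|` ~` D); split.
- by apply: measurableU => //; exact: measurableC.
- rewrite /mrestr; apply/eqP; rewrite -measure_le0 -N0.
  apply: le_measure; rewrite ?inE//.
    by apply: measurableI => //; apply: measurableU => //; exact: measurableC.
  by rewrite setIUl setICl setU0; exact: subIsetl.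
- move=> x nP; have [Dx|nD] := pselect (D x); last by right.
  by left; apply: NP => h; apply: nP; exact: h.
Qed.

Lemma ge0_integral_mrestr (f : X -> \bar R) : measurable_fun setT f ->
  (forall x, 0 <= f x)%E -> (\int[res]_x f x = \int[mu]_(x in D) f x)%E.
Proof.
move=> mf f0.
transitivity (\int[res]_(x in D) f x)%E.
  rewrite [RHS]integral_mkcond; apply: ae_eq_integral => //.
    by apply/(measurable_restrictT _ _).1 => //; exact: measurable_funTS.
  by apply: ae_imp ae_mrestr_in => x Dx _; rewrite patchE mem_set.
apply: eq_measure_integral => A mA AD.
by change (mu (A `&` D) = mu A); rewrite setIidl.
Qed.

Lemma Rint_mrestr (f : X -> R) : measurable_fun setT f ->
  \int[res]_x f x = \int[mu]_(x in D) f x.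
Proof.
move=> mf.
transitivity (\int[res]_(x in D) f x).
  rewrite [RHS]Rintegral_mkcond; apply: ae_eq_Rint => //.
    by apply/(measurable_restrictT _ _).1 => //; exact: measurable_funTS.
  by apply: ae_imp ae_mrestr_in => x Dx; rewrite patchE mem_set.
congr fine; apply: eq_measure_integral => A mA AD.
by change (mu (A `&` D) = mu A); rewrite setIidl.
Qed.

Hypothesis Dfin : (mu D < +oo)%E.

Lemma ae_mfrestr_in : {ae mfrestr mD Dfin, forall x, D x}.
Proof. exact: ae_mrestr_in. Qed.

Lemma ae_mfrestr (P : X -> Prop) : {ae mu, forall x, D x -> P x} ->
  {ae mfrestr mD Dfin, forall x, P x}.
Proof. exact: ae_mrestr. Qed.

Lemma ge0_integral_mfrestr (f : X -> \bar R) : measurable_fun setT f ->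
  (forall x, 0 <= f x)%E -> (\int[mfrestr mD Dfin]_x f x = \int[mu]_(x in D) f x)%E.
Proof. exact: ge0_integral_mrestr. Qed.

Lemma Rint_mfrestr (f : X -> R) : measurable_fun setT f ->
  \int[mfrestr mD Dfin]_x f x = \int[mu]_(x in D) f x.
Proof. exact: Rint_mrestr. Qed.

End restriction.

Section window.
Context {R : realType} (s t : R).
Local Notation leb := (@lebesgue_measure R).

Lemma lebesgue_itv_fin : (leb `[s, t]%classic < +oo)%E.
Proof. by rewrite lebesgue_measure_itv/=; case: ifPn => _; rewrite -?EFinD ltry. Qed.

Let res := mfrestr (f := leb) (measurable_itv `[s, t]%R) lebesgue_itv_fin.
Let idm : measurable_fun setT (fun x : measurableTypeR R => (x : R)).
Proof. exact: measurable_id. Qed.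

(** Lebesgue measure on [[s, t]], as a finite measure on the time axis. *)
Definition window : set R -> \bar R := pushforward res (fun x : measurableTypeR R => (x : R)).

Let window0 : window set0 = 0%E. Proof. exact: measure0. Qed.
Let window_ge0 A : (0 <= window A)%E. Proof. exact: (measure_ge0 res). Qed.
Let window_sigma_additive : semi_sigma_additive window.
Proof. exact: (@measure_semi_sigma_additive _ _ _ res). Qed.
HB.instance Definition _ := isMeasure.Build _ _ _ window window0 window_ge0 window_sigma_additive.
Let window_fin : fin_num_fun window.
Proof. by move=> A mA; exact: (fin_num_measure res). Qed.
HB.instance Definition _ := Measure_isFinite.Build _ _ _ window window_fin.

Lemma ae_window_in : {ae window, forall r, s <= r <= t}.
Proof.
have [N [mN N0 NP]] := ae_mfrestr_in (mu := leb) (measurable_itv `[s, t]%R) lebesgue_itv_fin.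
by exists N; split => // x h; apply: NP => /= h'; apply: h; move: h'; rewrite in_itv.
Qed.

Lemma ae_window (P : R -> Prop) : {ae leb, forall r, r \in `[s, t]%R -> P r} ->
  {ae window, forall r, P r}.
Proof.
move=> h; have [N [mN N0 NP]] := ae_mfrestr (mu := leb) (P := P) (measurable_itv `[s, t]%R)
  lebesgue_itv_fin h.
by exists N.
Qed.

(** Properties holding at almost every time hold somewhere in every
    non-degenerate interval. *)
Lemma ae_window_exists (P : R -> Prop) (p q : R) : {ae window, forall r, P r} ->
  s <= p -> p < q -> q <= t -> exists2 r, p <= r <= q & P r.
Proof.
move=> [N [mN N0 NP]] sp pq qt; apply: contrapT => H.
have sub : `[p, q]%classic `<=` N `&` `[s, t]%classic.
  move=> x /=; rewrite !in_itv/= => /andP[px xq]; split.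
    by apply: NP => /= Px; apply: H; exists x; rewrite ?px.
  by rewrite (le_trans sp px) (le_trans xq qt).
have : (leb `[p, q]%classic <= leb (N `&` `[s, t]%classic))%E.
  apply: le_measure; rewrite ?inE//.
  by apply: measurableI => //; exact: measurable_itv.
rewrite lebesgue_measure_itv/= lte_fin pq.
have -> : leb (N `&` `[s, t]%classic) = 0%E by exact: N0.
by rewrite -EFinD lee_fin leNgt subr_gt0 pq.
Qed.

Lemma ge0_integral_window (f : R -> \bar R) : measurable_fun setT f ->
  (forall x, 0 <= f x)%E -> (\int[window]_x f x = \int[leb]_(x in `[s, t]%classic) f x)%E.
Proof.
move=> mf f0.
have e := @ge0_integral_pushforward _ _ _ _ R _ idm res setT f measurableT mf (fun x _ => f0 x).
have e2 := ge0_integral_mfrestr (mu := leb) (measurable_itv `[s, t]%R) lebesgue_itv_fin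
  (f := f) mf f0.
apply: (etrans _ e2); apply: (etrans _ (etrans e _)).
  by apply: eq_measure_integral => A mA _.
by rewrite preimage_setT.
Qed.

Lemma Rint_window (f : R -> R) : measurable_fun setT f ->
  \int[window]_x f x = \int[leb]_(x in `[s, t]%classic) f x.
Proof.
move=> mf; have mf' : measurable_fun setT (EFin \o f) by exact/measurable_EFinP.
rewrite -(Rint_mfrestr (mu := leb) (measurable_itv `[s, t]%R) lebesgue_itv_fin (f := f) mf).
rewrite /Rintegral; congr fine; rewrite integralE [RHS]integralE; congr (_ - _)%E.
- have mp := measurable_funepos mf'.
  rewrite (ge0_integral_window mp) ?funepos_ge0//.
  by rewrite (ge0_integral_mfrestr (mu := leb) _ _ mp) ?funepos_ge0.
- have mp := measurable_funeneg mf'.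
  rewrite (ge0_integral_window mp) ?funeneg_ge0//.
  by rewrite (ge0_integral_mfrestr (mu := leb) _ _ mp) ?funeneg_ge0.
Qed.

End window.

(** The layer-cake formula reduces integrals against a measure to its values
    on sets. *)
Section layer_cake.
Context {R : realType} d d1 d2 (Z : measurableType d) (X : measurableType d1)
  (Y : measurableType d2).
Local Notation leb := (@lebesgue_measure R).
Variables (mu : {finite_measure set Z -> \bar R}).
Variables (nu1 : {sigma_finite_measure set X -> \bar R})
  (nu2 : {sigma_finite_measure set Y -> \bar R}).
Variables (w : X -> Y -> R) (phi : X -> Y -> Z).
Hypotheses (mw : measurable_fun setT (fun p : X * Y => w p.1 p.2)) (w0 : forall x y, 0 <= w x y).
Hypothesis mphi : measurable_fun setT (fun p : X * Y => phi p.1 p.2).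
Hypothesis density_le : forall A, measurable A ->
  (\int[nu1]_x \int[nu2]_y (w x y * \1_A (phi x y))%:E <= mu A)%E.

Let layer (g c : R) : R := \1_`[0, g[ c.

Let layerE g : 0 <= g -> (\int[leb]_c (layer g c)%:E = g%:E)%E.
Proof.
move=> g0; rewrite integral_indic ?setIT//.
rewrite /= lebesgue_measure_itv/= lte_fin; case: ltP => h; first by rewrite -EFinD subr0.
by congr (_%:E); apply/eqP; rewrite eq_le g0 h.
Qed.

Lemma density_integral_le (G : Z -> R) : measurable_fun setT G -> (forall z, 0 <= G z) ->
  (\int[nu1]_x \int[nu2]_y (w x y * G (phi x y))%:E <= \int[mu]_z (G z)%:E)%E.
Proof.
move=> mG G0; have mp := @measurable_pos_step R; have mn := @measurable_nneg_step R.
have layer_steps g c : layer g c = nneg_step c * pos_step (g - c).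
  rewrite /layer indicE mem_setE in_itv/= nneg_stepE pos_stepE subr_gt0.
  by case: (0 <= c); case: (c < g); rewrite ?mul0r ?mulr0 ?mul1r.
have l0 g c : 0 <= layer g c by rewrite /layer.
pose K x y c := w x y * layer (G (phi x y)) c.
have mL : measurable_fun setT (fun p : Z * R => layer (G p.1) p.2).
  rewrite (_ : (fun p => _) = (fun p : Z * R => nneg_step p.2 * pos_step (G p.1 - p.2))); first by meas.
  by apply/funext => p; exact: layer_steps.
have mK : measurable_fun setT (fun p : X * Y * R => K p.1.1 p.1.2 p.2).
  rewrite (_ : (fun p => _) = (fun p : X * Y * R =>
    w p.1.1 p.1.2 * (nneg_step p.2 * pos_step (G (phi p.1.1 p.1.2) - p.2)))); first by meas.
  by apply/funext => p; rewrite /K layer_steps.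
have K0 x y c : 0 <= K x y c by rewrite mulr_ge0.
have -> : (\int[nu1]_x \int[nu2]_y (w x y * G (phi x y))%:E =
    \int[nu1]_x \int[nu2]_y \int[leb]_c (K x y c)%:E)%E.
  apply: eq_integral => x _; apply: eq_integral => y _.
  rewrite EFinM -(layerE (G0 _)) -ge0_integralrZl//.
  exact: measurable_indic.
have -> : (\int[mu]_z (G z)%:E = \int[mu]_z \int[leb]_c (layer (G z) c)%:E)%E.
  by apply: eq_integral => z _; rewrite layerE.
rewrite (tonelli3 nu1 nu2 leb mK K0) (tonelli leb mu (f := fun z c => layer (G z) c))//.
apply: le_integralT.
- exact: (measurable_integral2 nu1 nu2 (F := fun c x y => K x y c)
    (measurable_comp3 (f := K) mK (measurableT_comp measurable_snd measurable_fst) measurable_snd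
      (measurableT_comp measurable_fst measurable_fst)) (fun c x y => K0 x y c)).
- exact: (measurable_integral mu (f := fun c z => layer (G z) c)
    (measurable_swap (f := fun z c => layer (G z) c) mL)).
- by move=> c; apply: integral_ge0 => x _; apply: integral_ge0 => y _; rewrite lee_fin.
move=> c; pose A := [set z | layer (G z) c = 1].
have mA : measurable A.
  rewrite -[A]setTI; have := measurable_sliceC (f := fun z c => layer (G z) c) c mL.
  by move=> /(_ measurableT [set 1]); apply; exact: measurable_set1.
have LA z : layer (G z) c = \1_A z.
  rewrite indicE; have [/set_mem//|] := boolP (z \in A).
  by rewrite notin_setE /A/= /layer indicE; case: (c \in _).
have -> : (\int[mu]_z (layer (G z) c)%:E = mu A)%E.
  by under eq_integral do rewrite LA; rewrite integral_indic// setIT.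
by apply: le_trans (density_le mA); rewrite /K; under eq_integral do under eq_integral do rewrite LA.
Qed.

End layer_cake.

(** * From pathwise entropy solutions to kinetic solutions *)

Section test_functions.
Context {R : realType}.
Local Notation leb := (@lebesgue_measure R).
Variables (b gamma z : R -> R).
Hypotheses (bC : C1 b (derive1 b)) (gammaC : C1 gamma (derive1 gamma)).

(** The position at time [r] of the characteristic of [xi] starting at 0, and its
    derivative in [xi]. *)
Definition char (r xi : R) : R := b xi * r + gamma xi * z r.
Definition char' (r xi : R) : R := derive1 b xi * r + derive1 gamma xi * z r.

Lemma C1_mulr (g g' : R -> R) (c : R) : C1 g g' -> C1 (fun x => g x * c) (fun x => g' x * c).
Proof.
move=> gC; have cC : C1 (fun _ : R => c) (fun=> 0).
  by split=> x; [exact: is_derive_cst|exact: cvg_cst].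
by have := C1M gC cC; under [X in C1 _ X]eq_fun do rewrite mulr0 addr0.
Qed.

Lemma C1_shift (g g' : R -> R) (c : R) : C1 g g' -> C1 (fun x => g (x - c)) (fun x => g' (x - c)).
Proof.
move=> gC; have := C1_affine 1 (- c) gC.
under eq_fun do rewrite mul1r.
by under [X in C1 _ X]eq_fun do rewrite !mul1r.
Qed.

Lemma char_C1 r : C1 (char r) (char' r).
Proof. by apply: C1D; exact: C1_mulr. Qed.

Section tensor.
Variables (phi kap : R -> R).
Hypotheses (sphi : smooth phi) (skap : smooth kap).

Let rho0 (p : R * R) := phi p.1 * kap p.2.

Lemma test_rho xi r x eta y :
  test b gamma z rho0 xi r x eta y = rho phi kap (char r) x xi (eta, y).
Proof. by rewrite /test /rho0 /rho /char/= !opprD !addrA. Qed.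

Lemma rho_C1_x (g g' : R -> R) f xi p : C1 g g' ->
  C1 (fun x => rho g kap f x xi p) (fun x => rho g' kap f x xi p).
Proof. by move=> gC; apply: C1_mulr; exact: C1_shift. Qed.

Lemma test_x_rho xi r x eta y :
  test_x b gamma z rho0 xi r x eta y = rho (derive1 phi) kap (char r) x xi (eta, y).
Proof.
rewrite /test_x; under eq_fun do rewrite test_rho.
by rewrite (C1_derive1 (rho_C1_x (char r) xi (eta, y) (smooth_C1 sphi))).
Qed.

Lemma test_xx_rho xi r x eta y :
  test_xx b gamma z rho0 xi r x eta y = rho (derive1 (derive1 phi)) kap (char r) x xi (eta, y).
Proof.
rewrite /test_xx /derive1n /=; under eq_fun do rewrite test_rho.
rewrite (C1_derive1 (rho_C1_x (char r) xi (eta, y) (smooth_C1 sphi))).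
by rewrite (C1_derive1 (rho_C1_x (char r) xi (eta, y) (smooth_C1 (smooth_derive sphi)))).
Qed.

Lemma test_xi_rho xi r x eta y :
  test_xi b gamma z rho0 xi r x eta y =
  rho_xi phi kap (char r) (char' r) x xi (eta, y).
Proof.
rewrite /test_xi; under eq_fun do rewrite test_rho.
have h1 : C1 (fun xi => phi (x - (y + char r xi)))
    (fun xi => derive1 phi (x - (y + char r xi)) * - char' r xi).
  apply: (C1_comp (smooth_C1 sphi)); have [dc cc] := char_C1 r; split=> a.
    have := is_deriveB (is_derive_cst (x - y) a 1) (dc a); rewrite sub0r.
    by rewrite (_ : (fun a => _) = (cst (x - y) - char r))//; apply/funext => a'; rewrite opprD addrA.
  by apply: cvgN; exact: cc.
have h2 := C1_shift eta (smooth_C1 skap).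
have -> : (fun xi => rho phi kap (char r) x xi (eta, y)) =
  (fun xi => phi (x - (y + char r xi)) * kap (xi - eta)) by [].
rewrite (C1_derive1 (C1M h1 h2)) /rho_xi/=.
ring.
Qed.

End tensor.
End test_functions.

Section kinetic_function.
Context {R : realType}.
Local Notation leb := (@lebesgue_measure R).

Lemma ae_chi_psi (w : R) : {ae leb, forall xi, chi xi w = 2^-1 * (Num.sg xi - psi xi w)}.
Proof.
apply: ae_imp (ae_and (ae_neq 0) (ae_neq w)) => xi [x0 xw]; rewrite /chi /psi.
case: (ltgtP xi 0) x0 => // h _; case: (ltgtP xi w) xw => // h' _.
- by rewrite sg_lt// ltr0_sg//= subrr mulr0.
- by rewrite sg_gt// ltr0_sg//=; lra.
- by rewrite sg_lt// gtr0_sg//=; lra.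
- by rewrite sg_gt// gtr0_sg//= subrr mulr0.
Qed.

Lemma measurable_chi : measurable_fun setT (fun p : R * R => chi p.1 p.2).
Proof.
rewrite (_ : (fun p => _) = (fun p : R * R =>
  pos_step p.1 * pos_step (p.2 - p.1) - pos_step (p.1 - p.2) * pos_step (- p.1))).
  by have mp := @measurable_pos_step R; meas.
apply/funext => -[xi w]; rewrite /chi !pos_stepE/= !subr_gt0 oppr_gt0.
by case: (ltgtP xi 0) => h; case: (ltgtP xi w) => h'; rewrite /= ?mulr1n ?mulr0n ?mulr0 ?mul0r ?mulr1 ?sub0r ?subr0 ?oppr0//; lra.
Qed.

(** The integral of [chi] against a transported test function, in terms of the
    mollified kinetic function: [sgr xi - psi] is twice [chi]. *)
Lemma chi_integral (c phi kap f u : R -> R) (C M N eta y : R) :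
  measurable_fun setT c -> (forall xi, `|c xi| <= C) ->
  continuous phi -> vanishes_off M phi -> continuous kap -> vanishes_off N kap ->
  measurable_fun setT f -> measurable_fun setT u ->
  \int[(leb \x leb)%E]_p (chi p.2 (u p.1) * c p.2 * rho phi kap f p.1 p.2 (eta, y)) =
  2^-1 * ((\int[leb]_a phi a) * (\int[leb]_xi (Num.sg xi * c xi * kap (xi - eta))) -
          Gc c phi kap f u eta y).
Proof.
move=> mc cC cphi vphi ckap vkap mf mu.
have iphi := L1_vanishes_off cphi vphi; have ikap := L1_vanishes_off ckap vkap.
have mphi := L1_measurable iphi; have mkap := L1_measurable ikap.
have mp := @measurable_psi R; have mchi := measurable_chi.
have msg := @measurable_sgr R.
have C0 : 0 <= C by exact: le_trans (cC 0).
have ik := L1_shift eta ikap.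
pose r x xi := phi (x - (y + f xi)) * kap (xi - eta).
have mr : measurable_fun setT (fun p : R * R => r p.1 p.2) by rewrite /r; meas.
pose K1 x xi := chi xi (u x) * c xi * r x xi.
pose K2 x xi := 2^-1 * (Num.sg xi - psi xi (u x)) * c xi * r x xi.
have mK1 : measurable_fun setT (fun p : R * R => K1 p.1 p.2) by rewrite /K1; meas.
have mK2 : measurable_fun setT (fun p : R * R => K2 p.1 p.2) by rewrite /K2; meas.
have nr xi : (\int[leb]_x `|r x xi|%:E = ((\int[leb]_a `|phi a|) * `|kap (xi - eta)|)%:E)%E.
  rewrite mulrC EFinM -(integral_shift_norm (y + f xi) iphi) -ge0_integralrZl//; last by meas.
  by apply: eq_integral => x _; rewrite /r normrM mulrC.
have lty (K : R -> R -> R) (A : R) : 0 <= A -> measurable_fun setT (fun p : R * R => K p.1 p.2) ->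
    (forall x xi, `|K x xi| <= A * `|r x xi|) -> (\int[leb]_xi \int[leb]_x `|K x xi|%:E < +oo)%E.
  move=> A0 mK KA; have mK' := measurable_swap mK.
  apply: (slice_lty (f := fun xi x => K x xi) (C := A * \int[leb]_a `|phi a|) mK' ik) => xi.
  apply: (@le_trans _ _ (\int[leb]_x (A * `|r x xi|)%:E)%E).
    have mKx := measurable_sliceC (f := K) xi mK; have mrx := measurable_sliceC (f := r) xi mr.
    by apply: le_integralT => //; [by meas|by meas|move=> x; rewrite lee_fin].
  have mrx := measurable_sliceC (f := r) xi mr.
  by rewrite ge0_integralrZl//; [rewrite nr -EFinM mulrA|by meas].
have b1 x xi : `|K1 x xi| <= C * `|r x xi|.
  rewrite /K1 normrM ler_wpM2r// normrM -[leRHS]mul1r ler_pM// /chi.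
  by case: ifP => _; [rewrite normr1|case: ifP => _; rewrite ?normrN ?normr1 ?normr0].
have b2 x xi : `|K2 x xi| <= C * `|r x xi|.
  rewrite /K2 normrM ler_wpM2r// normrM -[leRHS]mul1r ler_pM//.
  rewrite normrM ger0_norm ?invr_ge0// mulrC ler_pdivrMr// mul1r.
  apply: le_trans (ler_normB _ _) _; rewrite mulr2n lerD ?normr_psi//.
  by rewrite normr_sg; case: (_ != 0).
have l1 := lty K1 C C0 mK1 b1; have l2 := lty K2 C C0 mK2 b2.
have E0 : \int[(leb \x leb)%E]_p (chi p.2 (u p.1) * c p.2 * rho phi kap f p.1 p.2 (eta, y)) =
    \int[leb]_x \int[leb]_xi K1 x xi.
  have l1' : (\int[leb]_x \int[leb]_xi `|K1 x xi|%:E < +oo)%E.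
    have mabs : measurable_fun setT (fun p : R * R => `|K1 p.1 p.2|).
      exact: measurableT_comp mK1.
    apply: le_lt_trans l1; apply: eq_le_refl_e.
    exact: (tonelli leb leb (f := fun x xi => `|K1 x xi|) mabs (fun _ _ => normr_ge0 _)).
  exact: (esym (Rfubini_prod (mu := leb) (nu := leb) (f := K1) mK1 l1')).
have E1 : \int[leb]_x \int[leb]_xi K1 x xi = \int[leb]_x \int[leb]_xi K2 x xi.
  apply: eq_Rint => x; apply: ae_eq_Rint.
  - exact: (measurable_slice (f := K1) x mK1).
  - exact: (measurable_slice (f := K2) x mK2).
  by apply: ae_imp (ae_chi_psi (u x)) => xi h; rewrite /K1 h.
have mK2' := measurable_swap (f := K2) mK2.
have E2 : \int[leb]_x \int[leb]_xi K2 x xi = \int[leb]_xi \int[leb]_x K2 x xi.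
  exact: (esym (leb_fubini (f := fun xi x => K2 x xi) mK2' l2)).
apply: (etrans E0); apply: (etrans E1); apply: (etrans E2).
clear E0 E1 E2 l1 l2 b1 b2 lty nr mK1 mK2 mK2' K1.
have ip xi := L1_shift (y + f xi) iphi.
have ipsi xi : L1 leb (fun x => psi xi (u x) * phi (x - (y + f xi))).
  by apply: (L1_bounded_M (A := 1)) => //; [meas|move=> x; exact: normr_psi].
have Ein xi : \int[leb]_x K2 x xi = 2^-1 * ((\int[leb]_a phi a) * (Num.sg xi * c xi * kap (xi - eta)) -
    c xi * wk phi f u xi y * kap (xi - eta)).
  have E x : K2 x xi = (2^-1 * c xi * kap (xi - eta)) *
      (Num.sg xi * phi (x - (y + f xi)) - psi xi (u x) * phi (x - (y + f xi))).
    by rewrite /K2 /r; ring.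
  under eq_Rint do rewrite E.
  rewrite RintZl; last by apply: measurable_funB; [apply: measurable_funM => //; exact: L1_measurable (ip xi)|exact: L1_measurable (ipsi xi)].
  rewrite (RintB (L1Zl (Num.sg xi) (ip xi)) (ipsi xi)) RintZl; last exact: L1_measurable (ip xi).
  rewrite -(Rint_addr (y + f xi) (f := fun x => phi (x - (y + f xi)))); last by meas.
  under eq_Rint do rewrite addrK.
  rewrite /wk /conv; ring.
transitivity (\int[leb]_xi (2^-1 * ((\int[leb]_a phi a) * (Num.sg xi * c xi * kap (xi - eta)) -
    c xi * wk phi f u xi y * kap (xi - eta)))); first by apply: eq_Rint => xi; exact: Ein.
have msk : measurable_fun setT (fun xi : R => Num.sg xi * c xi) by meas.
have isk : L1 leb (fun xi : R => Num.sg xi * c xi * kap (xi - eta)).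
  apply: (L1_bounded_M msk (A := C)) => // xi; rewrite normrM -[leRHS]mul1r ler_pM//.
  by rewrite normr_sg; case: (_ != 0).
have mw := measurable_sliceC (f := fun xi y => wk phi f u xi y) y (measurable_wk mphi mf mu).
have mcw : measurable_fun setT (fun xi : R => c xi * wk phi f u xi y) by meas.
have iG : L1 leb (fun xi : R => c xi * wk phi f u xi y * kap (xi - eta)).
  apply: (L1_bounded_M mcw (A := C * \int[leb]_a `|phi a|)) => // xi.
  by rewrite normrM ler_pM// normr_wk.
rewrite RintZl; last by apply: measurable_funB; [apply: measurable_funM => //; exact: L1_measurable isk|exact: L1_measurable iG].
by rewrite (RintB (L1Zl _ isk) iG) (RintZl leb _ (L1_measurable isk)).
Qed.

End kinetic_function.

Lemma increment_algebra {R : realType} (F1 F0 D J Sg g1 g0 i1 i2 : R) :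
  - (F1 - F0) + 2^-1 * D = J -> F1 = 2^-1 * (Sg - g1) -> F0 = 2^-1 * (Sg - g0) ->
  D = - i1 -> J = 2^-1 * i2 -> g1 - g0 = i2 + i1.
Proof. by move=> h e1 e2 e3 e4; lra. Qed.

(** Monotonicity of the integral does not require measurability of the larger
    function, the integral being a supremum over simple functions. *)
Lemma le_integral_pointwise {R : realType} d (X : measurableType d)
    (mu : {measure set X -> \bar R}) (f g : X -> \bar R) :
  (forall x, 0 <= f x)%E -> (forall x, f x <= g x)%E ->
  (\int[mu]_x f x <= \int[mu]_x g x)%E.
Proof.
move=> f0 fg; rewrite !ge0_integralTE//; last by move=> x; exact: le_trans (fg x).
by apply: le_ereal_sup => _ [h hf <-]; exists h => // x; exact: le_trans (hf x) (fg x).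
Qed.

Section solution.
Context {R : realType}.
Local Notation leb := (@lebesgue_measure R).
Variables (T : R) (b sigma gamma : R -> R) (s t : R).
Hypotheses (s_ge0 : 0 <= s) (lt_st : s < t) (t_leT : t <= T).
Variables (A Bb Bb' Bg Bg' Z : R).
Hypotheses (msigma : measurable_fun setT sigma) (sigmaA : forall xi, `|sigma xi| <= A).
Hypotheses (bC : C1 b (derive1 b)) (gammaC : C1 gamma (derive1 gamma)).
Hypotheses (b_le : forall xi, `|b xi| <= Bb) (b'_le : forall xi, `|derive1 b xi| <= Bb').
Hypotheses (g_le : forall xi, `|gamma xi| <= Bg) (g'_le : forall xi, `|derive1 gamma xi| <= Bg').

Let T_ge0 : 0 <= T. Proof. by rewrite (le_trans s_ge0)// (le_trans (ltW lt_st)). Qed.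

(** Times are clamped to [[0, T]], where the solution and the signal live. *)
Definition clamp (r : R) : R := Num.min (Num.max 0 r) T.

Lemma clamp_in r : 0 <= clamp r <= T.
Proof. by rewrite /clamp le_min le_max lexx T_ge0/= ge_min lexx orbT. Qed.

Lemma clamp_id r : 0 <= r <= T -> clamp r = r.
Proof. by move=> /andP[r0 rT]; rewrite /clamp max_r// min_l. Qed.

Lemma measurable_clamp : measurable_fun setT clamp.
Proof. by apply: measurable_minr; [apply: measurable_maxr|]. Qed.

Lemma window_sub r : s <= r <= t -> 0 <= r <= T.
Proof. by move=> /andP[sr rt]; rewrite (le_trans s_ge0 sr) (le_trans rt t_leT). Qed.

Lemma measurable_clamped (f : R -> R -> R) :
  measurable_fun (strip T) (fun q : R * R => f q.1 q.2) ->
  measurable_fun setT (fun q : R * R => f (clamp q.1) q.2).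
Proof.
move=> mf; have mc := measurable_clamp.
apply: (measurable_comp (F := strip T) (f := fun q : R * R => f q.1 q.2)
  (g := fun q : R * R => (clamp q.1, q.2)) _ _ mf).
- exact: measurable_strip.
- by move=> _ [q _ <-]; split => //=; rewrite in_itv/= clamp_in.
- by apply: measurable_fun_pair; meas.
Qed.

Section one_solution.
Variables (z : R -> R) (u v : R -> R -> R).
Variables (m n : {finite_measure set (R * R * R)%type -> \bar R}).
Hypotheses (mz : measurable_fun `[0, T]%classic z) (z_le : forall r, 0 <= r <= T -> `|z r| <= Z).
Hypothesis mu : measurable_fun (strip T) (fun q : R * R => u q.1 q.2).
Hypothesis v2 : Lp_strip 2%:E T v.
Hypothesis u_L1 : L1_continuous T u.
Hypothesis chain : chain_rule T b sigma gamma z u v.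
Hypothesis par : parabolic_measure T u v n.
Hypothesis kin : kinetic_formulation T b sigma gamma z u m n.

Definition uc (r x : R) : R := u (clamp r) x.
Definition vc (r x : R) : R := v (clamp r) x.
Definition zc (r : R) : R := z (clamp r).
Definition fc (r xi : R) : R := char b gamma z (clamp r) xi.
Definition fc' (r xi : R) : R := char' b gamma z (clamp r) xi.

Lemma measurable_zc : measurable_fun setT zc.
Proof.
apply: (measurable_comp (F := `[0, T]%classic) (f := z) (g := clamp) _ _ mz).
- exact: measurable_itv.
- by move=> _ [r _ <-] /=; rewrite in_itv/= clamp_in.
- exact: measurable_clamp.
Qed.

Lemma measurable_uc : measurable_fun setT (fun q : R * R => uc q.1 q.2).
Proof. exact: measurable_clamped. Qed.

Lemma measurable_vc : measurable_fun setT (fun q : R * R => vc q.1 q.2).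
Proof. by apply: measurable_clamped; case: v2. Qed.

Lemma measurable_fc : measurable_fun setT (fun q : R * R => fc q.1 q.2).
Proof.
have mb := C1_measurable bC; have mg := C1_measurable gammaC.
have mc := measurable_clamp; have mzc := measurable_zc.
suff : measurable_fun setT (fun q : R * R => b q.2 * clamp q.1 + gamma q.2 * zc q.1) by [].
by meas.
Qed.

Lemma measurable_fc' : measurable_fun setT (fun q : R * R => fc' q.1 q.2).
Proof.
have mb := C1_measurable' bC; have mg := C1_measurable' gammaC.
have mc := measurable_clamp; have mzc := measurable_zc.
suff : measurable_fun setT (fun q : R * R =>
  derive1 b q.2 * clamp q.1 + derive1 gamma q.2 * zc q.1) by [].
by meas.
Qed.

Let bound_char (p q P Q r : R) : `|p| <= P -> `|q| <= Q ->
  `|p * clamp r + q * z (clamp r)| <= P * T + Q * Z.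
Proof.
move=> hp hq; have /andP[c0 cT] := clamp_in r.
apply: le_trans (ler_normD _ _) _; rewrite !normrM; apply: lerD; apply: ler_pM => //.
  by rewrite ger0_norm.
by apply: z_le; exact: clamp_in.
Qed.

Lemma fc_bound r xi : `|fc r xi| <= Bb * T + Bg * Z.
Proof. exact: bound_char. Qed.

Lemma fc'_bound r xi : `|fc' r xi| <= Bb' * T + Bg' * Z.
Proof. exact: bound_char. Qed.

Definition slab : set (R * R * R) := [set: R * R] `*` `[s, t]%classic.

Lemma measurable_slab (p q : R) : measurable ([set: R * R] `*` `[p, q]%classic : set (R * R * R)).
Proof. by apply: measurableX => //; exact: measurable_itv. Qed.

Lemma slab_fin : (measure_add m n slab < +oo)%E.
Proof.
have ms : measurable slab := measurable_slab s t.
rewrite measure_addE; apply: lte_add_pinfty; rewrite ltey_eq fin_num_measure//.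
Qed.

(** The defect measure restricted to the times in [[s, t]]. *)
Definition qslab := mfrestr (f := measure_add m n) (measurable_slab s t) slab_fin.

Lemma qslab_time : {ae qslab, forall w, s <= w.2 <= t}.
Proof.
have := ae_mfrestr_in (mu := measure_add m n) (measurable_slab s t) slab_fin.
by apply: ae_imp => w [_ /=]; rewrite in_itv.
Qed.

Lemma qslab_total : qslab setT = measure_add m n slab.
Proof. by rewrite /qslab /mfrestr /mrestr setTI. Qed.

Lemma uc_st : (\int[leb]_x `|uc s x - uc t x|%:E < +oo)%E.
Proof.
rewrite /uc !clamp_id ?lexx ?(ltW lt_st) ?s_ge0 ?t_leT//.
- by apply: u_L1.1 => //; exact: ltW.
- by rewrite (le_trans s_ge0 (ltW lt_st)).
- by rewrite (le_trans (ltW lt_st) t_leT).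
Qed.

Lemma uc_chain phi kap eps del p : mollifier eps phi -> mollifier del kap ->
  {ae window s t, forall r, Gc sigma (derive1 phi) kap (fc r) (uc r) p.1 p.2 =
    2 * \int[leb]_x (vc r x * rho phi kap (fc r) x (uc r x) p)}.
Proof.
case: p => eta y [sphi _ vphi _] [skap _ vkap _] /=.
have := chain (tensor_Cc_infty sphi skap vphi vkap) eta y.
move=> h; apply: ae_window; apply: ae_imp h => r h rst.
have r0T : 0 <= r <= T by apply: window_sub; move: rst; rewrite in_itv.
have {h} := h r0T; rewrite /uc /vc /fc clamp_id//.
have mur : measurable_fun setT (u r).
  by have := measurable_slice r measurable_uc; rewrite /uc clamp_id.
have mf := C1_measurable (char_C1 z bC gammaC r).
have cphi1 := smooth_continuous (smooth_derive sphi).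
have vphi1 := vanishes_off_derive (smooth_C1 sphi) vphi.
have := chi_integral eta y msigma sigmaA cphi1 vphi1 (smooth_continuous skap) vkap mf mur.
rewrite (Rint_derive_eq0 (smooth_C1 sphi) vphi) mul0r sub0r => E1.
set I := (X in X = _ -> _); have -> : I = 2^-1 * - Gc sigma (derive1 phi) kap (char b gamma z r) (u r) eta y.
  by rewrite -E1; apply: eq_Rint => q; rewrite test_x_rho.
set J := \int[leb]_x (v r x * test _ _ _ _ _ _ _ _ _).
have -> : J = \int[leb]_x (v r x * rho phi kap (char b gamma z r) x (u r x) (eta, y)).
  by apply: eq_Rint => x; rewrite test_rho.
move: (\int[leb]_x _) => j; lra.
Qed.

Let one_bound (xi : R) : `|1 : R| <= 1. Proof. by rewrite normr1. Qed.
Let mone : measurable_fun setT (fun _ : R => 1 : R). Proof. exact: measurable_cst. Qed.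

Lemma measurable_rho_xi phi kap p : smooth phi -> smooth kap ->
  measurable_fun setT (fun w : R * R * R =>
    rho_xi phi kap (fc w.2) (fc' w.2) w.1.1 w.1.2 p).
Proof.
move=> sphi skap; have mf := measurable_fc; have mf' := measurable_fc'.
have mphi := C1_measurable (smooth_C1 sphi); have mphi1 := C1_measurable' (smooth_C1 sphi).
have mk := C1_measurable (smooth_C1 skap); have mk1 := C1_measurable' (smooth_C1 skap).
by rewrite /rho_xi; meas.
Qed.

Lemma qslab_restrict (g : R * R * R -> R) (p q : R) : s <= p -> q <= t ->
  measurable_fun setT g ->
  \int[qslab]_w (\1_`[p, q] w.2 * g w) =
  \int[measure_add m n]_(w in [set: R * R] `*` `[p, q]%classic) g w.
Proof.
move=> sp qt mg.
have mI : measurable_fun setT (fun w : R * R * R => \1_`[p, q] w.2 * g w).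
  apply: measurable_funM => //; apply: measurableT_comp => //; exact: measurable_indic.
rewrite /qslab (Rint_mfrestr (mu := measure_add m n) _ _ mI).
rewrite Rintegral_mkcond [RHS]Rintegral_mkcond; apply: eq_Rint => w; rewrite !patchE.
have [wI|wI] := boolP (w \in [set: R * R] `*` `[p, q]%classic).
  have [_ /= wpq] := set_mem wI.
  rewrite mem_set ?indicE ?mem_set ?mul1r//; split => //=.
  move: wpq; rewrite !in_itv/= => /andP[h1 h2].
  by rewrite (le_trans sp h1) (le_trans h2 qt).
case: ifP => // _; rewrite indicE memNset ?mul0r// => h.
by move: wI; rewrite notin_setE; apply; split.
Qed.

(** The kinetic formulation tested with products [phi * kap]; the part of the
    kinetic function that does not depend on the solution is constant in time. *)
Lemma uc_increments phi kap eps del p : mollifier eps phi -> mollifier del kap ->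
  increments (window s t) s t qslab
    (fun w => 2 * rho_xi phi kap (fc w.2) (fc' w.2) w.1.1 w.1.2 p) snd
    (fun r => 2^-1 * Gc (fun xi => sigma xi ^+ 2) (derive1 (derive1 phi)) kap (fc r) (uc r) p.1 p.2)
    (fun r => Gc (fun=> 1) phi kap (fc r) (uc r) p.1 p.2).
Proof.
case: p => eta y mphi mkap r0 r sr0 r0r rt /=.
have [sphi _ vphi _] := mphi; have [skap _ vkap _] := mkap.
pose rho0 (q : R * R) := phi q.1 * kap q.2.
have r0_ge0 : 0 <= r0 by exact: le_trans sr0.
have rT : r <= T by exact: le_trans t_leT.
pose FF r' := \int[(leb \x leb)%E]_q (chi q.2 (u r' q.1) * test b gamma z rho0 q.2 r' q.1 eta y).
pose DD r' := \int[(leb \x leb)%E]_q (chi q.2 (u r' q.1) * sigma q.2 ^+ 2 *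
  test_xx b gamma z rho0 q.2 r' q.1 eta y).
have kf : - (FF r - FF r0) + 2^-1 * (\int[leb]_(r' in `[r0, r]%classic) DD r') =
  \int[measure_add m n]_(q in [set: R * R] `*` `[r0, r]%classic)
      test_xi b gamma z rho0 q.1.2 q.2 q.1.1 eta y.
  exact: (kin (tensor_Cc_infty sphi skap vphi vkap) eta y r0_ge0 r0r rT).
pose Sg := (\int[leb]_a phi a) * (\int[leb]_xi (Num.sg xi * 1 * kap (xi - eta))).
have mur r' : 0 <= r' <= T -> measurable_fun setT (u r').
  by move=> h; have := measurable_slice r' measurable_uc; rewrite /uc clamp_id.
have mf r' := C1_measurable (char_C1 z bC gammaC r').
have cphi := smooth_continuous sphi; have sphi2 := smooth_derive (smooth_derive sphi).
have vphi2 := vanishes_off_derive (smooth_C1 (smooth_derive sphi))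
  (vanishes_off_derive (smooth_C1 sphi) vphi).
have EF r' : 0 <= r' <= T -> FF r' =
    2^-1 * (Sg - Gc (fun=> 1) phi kap (fc r') (uc r') eta y).
  move=> hr'; have := chi_integral eta y mone one_bound cphi vphi
    (smooth_continuous skap) vkap (mf r') (mur r' hr').
  rewrite /fc /uc clamp_id// => <-; apply: eq_Rint => q.
  by rewrite test_rho mulr1.
have in01 r' : r0 <= r' <= r -> 0 <= r' <= T.
  by move=> /andP[h1 h2]; rewrite (le_trans r0_ge0 h1) (le_trans h2 rT).
have hr : 0 <= r <= T by apply: in01; rewrite r0r lexx.
have hr0 : 0 <= r0 <= T by apply: in01; rewrite r0r lexx.
pose h r' := Gc (fun xi => sigma xi ^+ 2) (derive1 (derive1 phi)) kap (fc r') (uc r') eta y.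
have msigma2 : measurable_fun setT (fun xi => sigma xi ^+ 2) by meas.
have A0 : 0 <= A by exact: le_trans (sigmaA 0).
have sigma2A xi : `|sigma xi ^+ 2| <= A ^+ 2 by rewrite normrX ler_pXn2r.
have ED r' : 0 <= r' <= T -> DD r' = - 2^-1 * h r'.
  move=> hr'; have := chi_integral eta y msigma2 sigma2A (smooth_continuous sphi2) vphi2
    (smooth_continuous skap) vkap (mf r') (mur r' hr').
  rewrite (Rint_derive_eq0 (smooth_C1 (smooth_derive sphi)) (vanishes_off_derive (smooth_C1 sphi) vphi)).
  rewrite mul0r sub0r /h /fc /uc clamp_id// mulrN -mulNr => <-; apply: eq_Rint => q.
  by rewrite test_xx_rho.
have mh : measurable_fun setT h.
  apply: (measurable_Gc (f := fc) (u := uc) (eta := fun=> eta) (y := fun=> y) msigma2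
    (C1_measurable (smooth_C1 sphi2)) (C1_measurable (smooth_C1 skap)) measurable_fc measurable_uc);
  exact: measurable_cst.
have mhI : measurable_fun setT (fun r' => \1_`[r0, r] r' * (2^-1 * h r')).
  by apply: measurable_funM; [exact: measurable_indic|meas].
have E2 : \int[leb]_(r' in `[r0, r]%classic) DD r' =
    - \int[window s t]_r' (\1_`[r0, r] r' * (2^-1 * h r')).
  rewrite -RintN//.
  have mNI : measurable_fun setT (fun r' => - (\1_`[r0, r] r' * (2^-1 * h r'))).
    exact: measurable_funN.
  rewrite (@Rint_window R s t _ mNI).
  rewrite Rintegral_mkcond [RHS]Rintegral_mkcond; apply: eq_Rint => r'; rewrite !patchE.
  have [rI|rI] := boolP (r' \in `[r0, r]%classic).
    have := set_mem rI; rewrite /= in_itv/= => hr'.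
    rewrite (ED r' (in01 r' hr')) mem_set ?indicE ?rI ?mul1r ?mulNr//=.
    move: hr' => /andP[h1 h2]; rewrite in_itv/=.
    by rewrite (le_trans sr0 h1) (le_trans h2 rt).
  by case: ifP => // _; rewrite indicE (negbTE rI) mul0r oppr0.
have mrx := measurable_rho_xi (eta, y) sphi skap.
have E3 : \int[measure_add m n]_(q in [set: R * R] `*` `[r0, r]%classic)
      test_xi b gamma z rho0 q.1.2 q.2 q.1.1 eta y =
    2^-1 * \int[qslab]_w (\1_`[r0, r] w.2 *
      (2 * rho_xi phi kap (fc w.2) (fc' w.2) w.1.1 w.1.2 (eta, y))).
  pose g (w : R * R * R) := rho_xi phi kap (fc w.2) (fc' w.2) w.1.1 w.1.2 (eta, y).
  have mg : measurable_fun setT (fun w => 2 * g w) by exact: measurable_funM (measurable_cst _) mrx.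
  have mIg : measurable_fun setT (fun w : R * R * R => \1_`[r0, r] w.2 * (2 * g w)).
    apply: measurable_funM => //; apply: measurableT_comp => //; exact: measurable_indic.
  rewrite -RintZl//.
  have eg w : 2^-1 * (\1_`[r0, r] w.2 * (2 * g w)) = \1_`[r0, r] w.2 * g w.
    by rewrite mulrCA (mulrA 2^-1) mulVf// mul1r.
  apply: (etrans _ (esym (eq_Rint _ eg))).
  rewrite (qslab_restrict sr0 rt mrx); apply: eq_Rintegral => w /set_mem[_ /=].
  rewrite in_itv/= => hw; rewrite test_xi_rho//.
  by rewrite /g /fc /fc' clamp_id//; exact: in01.
exact: (increment_algebra kf (EF r hr) (EF r0 hr0) E2 E3).
Qed.

Let msT : measurable (strip T) := measurable_strip T.

(** On the window, iterated integrals in (time, space) are integrals over the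
    strip. *)
Lemma window_strip (w : R -> R -> R) : measurable_fun setT (fun q : R * R => w q.1 q.2) ->
  (forall r x, 0 <= w r x) ->
  (\int[window s t]_r \int[leb]_x (w r x)%:E =
   \int[(leb \x leb)%E]_(q in strip T) (\1_`[s, t] q.1 * w q.1 q.2)%:E)%E.
Proof.
move=> mw w0; have mI : measurable_fun setT (\1_`[s, t] : R -> R) by exact: measurable_indic.
pose H (q : R * R) := \1_`[s, t] q.1 * w q.1 q.2.
have mH : measurable_fun setT H by rewrite /H; meas.
have H0 q : 0 <= H q by rewrite mulr_ge0.
have off q : q \notin strip T -> H q = 0.
  rewrite notin_setE /H indicE => nq; case: (boolP (q.1 \in _)) => [/set_mem/= h|]; last by rewrite mul0r.
  exfalso; apply: nq; split => //=; move: h; rewrite !in_itv/= => h; exact: window_sub.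
transitivity (\int[plane]_q (H q)%:E)%E; last first.
  rewrite [RHS]integral_mkcond; apply: eq_integral => q _; rewrite patchE.
  by case: ifPn => // /off ->.
rewrite (plane_integral mH H0) (ge0_integral_window s t); last 2 first.
- by apply: measurable_integral.
- by move=> r; apply: integral_ge0 => x _; rewrite lee_fin.
rewrite integral_mkcond; apply: eq_integral => r _; rewrite patchE /H/= indicE.
case: ifPn => rI; last by under eq_integral do rewrite mul0r; rewrite integral0.
by apply: eq_integral => x _; rewrite mul1r.
Qed.

Lemma vc_L2 : (\int[window s t]_r \int[leb]_x (vc r x ^+ 2)%:E < +oo)%E.
Proof.
have mv := measurable_vc.
rewrite (window_strip (w := fun r x => vc r x ^+ 2)); [|by meas|by move=> r x; exact: sqr_ge0].
have [_ N2] := v2; have two0 : (2 : R) != 0 by [].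
have := powR_Lnorm (mrestr (leb \x leb)%E msT) (fun q : R * R => (v q.1 q.2)%:E) two0.
move=> E; have := poweR_lty 2 N2; rewrite E; apply: le_lt_trans.
have mI : measurable_fun setT (\1_`[s, t] : R -> R) by exact: measurable_indic.
have mf : measurable_fun setT (fun q : R * R => (\1_`[s, t] q.1 * vc q.1 q.2 ^+ 2)%:E) by meas.
have f0 (q : R * R) : (0 <= (\1_`[s, t] q.1 * vc q.1 q.2 ^+ 2)%:E)%E.
  by rewrite lee_fin mulr_ge0 ?sqr_ge0.
rewrite -(ge0_integral_mrestr (leb \x leb)%E msT mf f0).
apply: le_integral_pointwise => // q.
rewrite abse_EFin poweR_EFin powR_mulrn// lee_fin real_normK ?num_real//.
rewrite indicE; case: (boolP (q.1 \in _)) => [/set_mem/= h|_]; last by rewrite mul0r sqr_ge0.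
rewrite mul1r /vc clamp_id//; apply: window_sub; move: h; by rewrite in_itv.
Qed.

(** [q] dominates [n], whose integrals are computed on the graph of [u]. *)
Lemma uc_dissipation (G : R * R * R -> R) : measurable_fun setT G -> (forall w, 0 <= G w) ->
  (\int[window s t]_r \int[leb]_x (2^-1 * vc r x ^+ 2 * G (x, uc r x, r))%:E
   <= \int[qslab]_w (G w)%:E)%E.
Proof.
have mv := measurable_vc; have mu' := measurable_uc.
have mw : measurable_fun setT (fun q : R * R => 2^-1 * vc q.1 q.2 ^+ 2) by meas.
have w0 (r x : R) : 0 <= 2^-1 * vc r x ^+ 2 by rewrite mulr_ge0 ?sqr_ge0 ?invr_ge0.
have mphi : measurable_fun setT (fun q : R * R => (q.2, uc q.1 q.2, q.1)).
  by do 2 apply: measurable_fun_pair => //; meas.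
apply: (density_integral_le (mu := qslab) (nu1 := window s t) (nu2 := leb)
  (w := fun r x => 2^-1 * vc r x ^+ 2) (phi := fun r x => (x, uc r x, r)) mw w0 mphi).
move=> B mB; have mBs : measurable (B `&` slab) by apply: measurableI => //; exact: measurable_slab.
have mK : measurable_fun setT (fun q : R * R => 2^-1 * vc q.1 q.2 ^+ 2 * \1_B (q.2, uc q.1 q.2, q.1)).
  by apply: measurable_funM mw _; apply: measurableT_comp mphi; exact: measurable_indic.
have K0 (r x : R) : 0 <= 2^-1 * vc r x ^+ 2 * \1_B (x, uc r x, r) by rewrite mulr_ge0.
rewrite (window_strip (w := fun r x => 2^-1 * vc r x ^+ 2 * \1_B (x, uc r x, r)) mK K0).
have E : qslab B = (m (B `&` slab) + n (B `&` slab))%E by rewrite -measure_addE.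
apply: (@le_trans _ _ (n (B `&` slab))); last first.
  by apply: (le_trans _ (eq_le_refl_e (esym E))); rewrite leeDr.
rewrite (par mBs); apply: eq_le_refl_e; apply: eq_integral => -[r x] /set_mem[/= hr _].
have r0T : 0 <= r <= T by move: hr; rewrite in_itv.
rewrite /vc /uc clamp_id// diracE mulrCA EFinM; congr (_ * _)%E; rewrite !indicE.
have -> : (u r x \in [set xi | (B `&` slab) (x, xi, r)]) =
    (r \in `[s, t]%classic) && ((x, u r x, r) \in B).
  apply/idP/andP => [/set_mem[h [_ h']]|[h h']].
    by split; exact: mem_set.
  by apply: mem_set; split; [exact: set_mem h'|split => //; exact: (set_mem h)].
by case: (r \in _); case: (_ \in B); rewrite /= ?mul1r ?mul0r.
Qed.

Hypothesis uBV : (LinftyBV_norm 0 T u < +oo)%E.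

Lemma BV_norm_fin : LinftyBV_norm s t u \is a fin_num /\
  {ae window s t, forall r, (TV (u r) <= LinftyBV_norm s t u)%E}.
Proof.
have pos (p q : R) : p < q -> (0 < mrestr leb (measurable_itv `[p, q]%R) setT)%E.
  by move=> pq; rewrite /mrestr setTI lebesgue_measure_itv/= lte_fin pq -EFinD lte_fin subr_gt0.
have T0 : 0 < T by apply: le_lt_trans s_ge0 _; exact: lt_le_trans lt_st t_leT.
pose absTV := abse \o (fun r => TV (u r)).
have EN p q : p < q -> LinftyBV_norm p q u = ess_sup (mrestr leb (measurable_itv `[p, q]%R)) absTV.
  by move=> pq; rewrite /LinftyBV_norm unlock; have := pos p q pq => ->.
have h0 : {ae mrestr leb (measurable_itv `[0, T]%R), forall r, (absTV r <= LinftyBV_norm 0 T u)%E}.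
  by rewrite (EN _ _ T0); exact: ess_sup_ge.
have hst : {ae mrestr leb (measurable_itv `[s, t]%R), forall r, (absTV r <= LinftyBV_norm 0 T u)%E}.
  have [N [mN N0 NP]] := h0; exists N; split => //.
  apply/eqP; rewrite -measure_le0 -N0 /mrestr; apply: le_measure; rewrite ?inE.
  - by apply: measurableI => //; exact: measurable_itv.
  - by apply: measurableI => //; exact: measurable_itv.
  apply: setIS => r /=; rewrite !in_itv/=; exact: window_sub.
have E := EN _ _ lt_st.
split.
  rewrite ge0_fin_numE; last exact: Lnorm_ge0.
  by apply: le_lt_trans uBV; rewrite E; apply/ess_supP.
have := ess_sup_ge (mrestr leb (measurable_itv `[s, t]%R)) absTV.
rewrite -E => -[N [mN N0 NP]]; exists N; split => // r h; apply: NP => /= h'; apply: h.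
by apply: le_trans h'; exact: lee_abs.
Qed.

(** The essential supremum bounds the total variation at almost every time. *)
Definition Kc : R := fine (LinftyBV_norm s t u) + 1.

Lemma uc_osc : {ae window s t, forall r, osc_bound (uc r) Kc}.
Proof.
have [fin aeTV] := BV_norm_fin.
apply: ae_imp (ae_and aeTV (ae_window_in s t)) => r [h rst].
have mur := measurable_slice r measurable_uc.
apply: (osc_bound_TV mur); rewrite fineK// /uc clamp_id//; exact: window_sub.
Qed.

(** The oscillation bound passes from almost every time to every time by
    continuity in [L^1]. *)
Lemma uc_osc_at r0 : s <= r0 <= t -> osc_bound (uc r0) Kc.
Proof.
move=> hr0; have mur0 := measurable_slice r0 measurable_uc.
have r00T := window_sub hr0.
apply: (osc_bound_closed mur0) => e e0.
have rin : r0 \in `[0, T]%R by rewrite in_itv.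
have lim := u_L1.2 r0 rin.
have {lim} [fin fcvg] := (fine_cvgP _ _).1 lim.
have near : \forall r \near within `[0, T]%classic (nbhs r0),
    (\int[leb]_x `|u r x - u r0 x|%:E <= e%:E)%E.
  near=> r.
  have fr : (\int[leb]_x `|u r x - u r0 x|%:E)%E \is a fin_num by near: r; exact: fin.
  rewrite -(fineK fr) lee_fin; apply: le_trans (ler_norm _) _; apply: ltW.
  rewrite -[X in `|X|]subr0 distrC; near: r.
  by move/cvgrPdist_lt : fcvg => /(_ e e0).
have {near} [d /= d0 near] := near.
have [p [q [sp pq qt pqd]]] : exists p q, [/\ s <= p, p < q, q <= t &
    forall r, p <= r <= q -> ball r0 d r].
  move: hr0 => /andP[sr0 r0t].
  have inball r : `|r0 - r| <= d / 2 -> ball r0 d r.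
    by move=> h; rewrite /ball/=; apply: le_lt_trans h _; rewrite ltr_pdivrMr// ltr_pMr// ltr1n.
  have d20 : 0 < d / 2 by rewrite divr_gt0.
  have [r0t'|r0t'] := ltP r0 t.
    exists r0, (Num.min t (r0 + d / 2)); split => //.
    - by rewrite lt_min r0t' ltrDl.
    - by rewrite ge_min lexx.
    move=> r /andP[h1]; rewrite le_min => /andP[_ h2]; apply: inball.
    by rewrite distrC ger0_norm ?subr_ge0// lerBlDl.
  have E : r0 = t by apply/eqP; rewrite eq_le r0t.
  exists (Num.max s (t - d / 2)), t; split => //.
  - by rewrite le_max lexx.
  - by rewrite gt_max lt_st ltrBlDr ltrDl.
  move=> r /andP[]; rewrite ge_max => /andP[_ h1] h2; apply: inball.
  by rewrite E ger0_norm ?subr_ge0// lerBlDl -lerBlDr.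
have [r hr osc] := ae_window_exists uc_osc sp pq qt.
exists (uc r); split => //; first exact: (measurable_slice r measurable_uc).
have r0T : 0 <= r <= T.
  move: hr => /andP[h1 h2]; apply: window_sub.
  by rewrite (le_trans sp h1) (le_trans h2 qt).
rewrite /uc !clamp_id//; under eq_integral do rewrite distrC.
apply: near; first exact: pqd.
by rewrite /= in_itv.
Unshelve. all: by end_near. Qed.

Let uc_osc_s : osc_bound (uc s) Kc.
Proof. by apply: uc_osc_at; rewrite lexx ltW. Qed.
Let uc_osc_t : osc_bound (uc t) Kc.
Proof. by apply: uc_osc_at; rewrite lexx ltW. Qed.

Definition solution_kinetic :
    kinetic (window s t) s t (Bb * T + Bg * Z) (Bb' * T + Bg' * Z) sigma :=
  Kinetic measurable_uc measurable_vc measurable_fc measurable_fc'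
    (fun r => char_C1 z bC gammaC (clamp r)) fc_bound fc'_bound qslab_time uc_osc
    uc_osc_s uc_osc_t uc_st vc_L2 uc_dissipation
    (fun phi kap eps del mphi mkap p => uc_chain p mphi mkap)
    (fun phi kap eps del mphi mkap p => uc_increments p mphi mkap).

End one_solution.
End solution.

(** * The total defect mass *)

Section mass.
Context {R : realType}.
Local Notation leb := (@lebesgue_measure R).

Lemma cvg_scaled (h : R -> R) (x : R) : continuous h ->
  h (n.+1%:R^-1 * x) @[n --> \oo] --> h 0.
Proof.
move=> ch.
have l : n.+1%:R^-1 * x @[n --> \oo] --> (0 : R).
  by rewrite -[X in _ --> X](mul0r x); apply: cvgM; [exact: cvg_harmonic|exact: cvg_cst].
exact: (cvg_comp _ _ l (ch 0)).
Qed.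

(** The primitive of a cutoff, tamed at infinity: the [xi]-derivative of the
    test functions below tends to a constant. *)
Definition ramp (x : R) : R := x * bump x.

Lemma ramp_smooth : smooth ramp.
Proof. by move=> k; apply: CnM; [exact: Cn_id|exact: bump_smooth]. Qed.

Lemma ramp_vanishes : vanishes_off 1 ramp.
Proof. by move=> x h; rewrite /ramp bump_vanishes// mulr0. Qed.

Lemma derive1_ramp0 : derive1 ramp 0 = bump 0.
Proof.
have idC : C1 (fun x : R => x) (fun=> 1) by split=> x; [exact: is_derive_id|exact: cvg_cst].
have /C1_derive1 := C1M idC (smooth_C1 (@bump_smooth R)).
by rewrite /ramp => ->; rewrite mul0r addr0 mul1r.
Qed.

Definition wide_bump n (x : R) : R := 1 * bump (n.+1%:R^-1 * x).
Definition wide_ramp n (x : R) : R := n.+1%:R * ramp (n.+1%:R^-1 * x).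

Lemma vanishes_off_scaled (h : R -> R) (c : R) n : vanishes_off 1 h ->
  vanishes_off n.+1%:R (fun x => c * h (n.+1%:R^-1 * x)).
Proof.
move=> vh x hx; rewrite vh ?mulr0// normrM ger0_norm ?invr_ge0//.
by rewrite mulrC ltr_pdivlMr// mul1r.
Qed.

Lemma derive1_scaled (h : R -> R) (c q : R) : smooth h ->
  derive1 (fun x => c * h (q * x)) = (fun x => c * q * derive1 h (q * x)).
Proof.
move=> sh; have cC : C1 (fun _ : R => c) (fun=> 0).
  by split=> x; [exact: is_derive_cst|exact: cvg_cst].
have /C1_derive1 := C1M cC (C1_scale q (smooth_C1 sh)) => ->.
by apply/funext => x; rewrite mul0r add0r mulrA.
Qed.

Lemma bounded_bump_ramp : exists2 B : R, 0 <= B & forall x : R,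
  [/\ `|bump x| <= B, `|derive1 bump x| <= B, `|ramp x| <= B & `|derive1 ramp x| <= B].
Proof.
have bnd (h : R -> R) : smooth h -> vanishes_off 1 h -> exists2 B : R, 0 <= B & forall x, `|h x| <= B.
  by move=> sh; apply: vanishes_off_bounded; exact: smooth_continuous.
have sb := @bump_smooth R; have sr := ramp_smooth.
have vb := @bump_vanishes R; have vr := ramp_vanishes.
have [B1 B10 h1] := bnd _ sb vb; have [B3 B30 h3] := bnd _ sr vr.
have [B2 B20 h2] := bnd _ (smooth_derive sb) (vanishes_off_derive (smooth_C1 sb) vb).
have [B4 B40 h4] := bnd _ (smooth_derive sr) (vanishes_off_derive (smooth_C1 sr) vr).
exists (B1 + B2 + B3 + B4) => [|x]; first by rewrite !addr_ge0.
by split; [have := h1 x|have := h2 x|have := h3 x|have := h4 x] => h; lra.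
Qed.

Let regroup (c i P j Q : R) : c * (i * P) * (j * Q) = c * (P * Q) * (i * j).
Proof. by ring. Qed.

Lemma rho_xi_wide n f f' (x xi : R) :
  rho_xi (wide_bump n) (wide_ramp n) f f' x xi (0, 0) =
  bump (n.+1%:R^-1 * (x - (0 + f xi))) * derive1 ramp (n.+1%:R^-1 * (xi - 0)) -
  f' xi * (derive1 bump (n.+1%:R^-1 * (x - (0 + f xi))) * ramp (n.+1%:R^-1 * (xi - 0))).
Proof.
rewrite /rho_xi /= /wide_bump /wide_ramp (derive1_scaled _ _ (@bump_smooth R)).
rewrite (derive1_scaled _ _ ramp_smooth) !mul1r divff ?pnatr_eq0// mul1r; congr (_ - _).
rewrite (regroup (f' xi)) mulVf ?pnatr_eq0// mulr1.
by rewrite mulrA.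
Qed.

Lemma smooth_wide n : smooth (@wide_bump n) /\ smooth (@wide_ramp n).
Proof. by split; apply: smooth_scale; [exact: bump_smooth|exact: ramp_smooth]. Qed.

End mass.

Section mass_unique.
Context {R : realType}.
Local Notation leb := (@lebesgue_measure R).
Variables (T : R) (b sigma gamma : R -> R) (s t : R).
Hypotheses (s_ge0 : 0 <= s) (lt_st : s < t) (t_leT : t <= T).
Variables (Bb' Bg' Z : R).
Hypotheses (bC : C1 b (derive1 b)) (gammaC : C1 gamma (derive1 gamma)).
Hypotheses (b'_le : forall xi, `|derive1 b xi| <= Bb') (g'_le : forall xi, `|derive1 gamma xi| <= Bg').
Variables (z : R -> R) (u : R -> R -> R).
Hypotheses (mz : measurable_fun `[0, T]%classic z) (z_le : forall r, 0 <= r <= T -> `|z r| <= Z).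

Let wide_test n (p : R * R) : R := wide_bump n p.1 * wide_ramp n p.2.

(** The [xi]-derivatives are bounded and converge to [bump 0 ^+ 2] on the whole
    space: in the transport term the factor [k.+1%:R] of the ramp is compensated by the
    derivative of the wide bump, and what is left vanishes since [ramp 0 = 0]. *)
Lemma total_mass_limit (m n : {finite_measure set (R * R * R)%type -> \bar R}) :
  \int[measure_add m n]_(q in [set: R * R] `*` `[s, t]%classic)
      test_xi b gamma z (wide_test k) q.1.2 q.2 q.1.1 0 0 @[k --> \oo] -->
  bump 0 ^+ 2 * fine (measure_add m n ([set: R * R] `*` `[s, t]%classic)).
Proof.
have [B B0 hB] := @bounded_bump_ramp R.
pose f := fc T b gamma z; pose f' := fc' T b gamma z.
pose g k (w : R * R * R) := rho_xi (wide_bump k) (wide_ramp k) (f w.2) (f' w.2) w.1.1 w.1.2 (0, 0).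
have mg k : measurable_fun setT (g k).
  have [sb sr] := @smooth_wide R k.
  exact: (measurable_rho_xi s_ge0 lt_st t_leT bC gammaC mz (0, 0) sb sr).
have E k : \int[measure_add m n]_(q in [set: R * R] `*` `[s, t]%classic)
      test_xi b gamma z (wide_test k) q.1.2 q.2 q.1.1 0 0 = \int[qslab s t m n]_w g k w.
  have [sb sr] := @smooth_wide R k.
  transitivity (\int[qslab s t m n]_w (\1_`[s, t] w.2 * g k w)).
    rewrite (qslab_restrict _ _ (lexx s) (lexx t) (mg k)); apply: eq_Rintegral => w /set_mem[_ /=].
    rewrite in_itv/= => hw.
    apply: etrans (test_xi_rho z bC gammaC sb sr w.1.2 w.2 w.1.1 0 0) _.
    by rewrite /g /f /f' /fc /fc' clamp_id//; exact: window_sub hw.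
  apply: ae_eq_Rint => //.
    by apply: measurable_funM => //; apply: measurableT_comp => //; exact: measurable_indic.
  apply: ae_imp (qslab_time s t m n) => w hw.
  by rewrite indicE mem_set ?mul1r//= in_itv.
rewrite (_ : (fun k => _) = (fun k => \int[qslab s t m n]_w g k w)); last exact/funext.
have -> : bump 0 ^+ 2 * fine (measure_add m n ([set: R * R] `*` `[s, t]%classic)) =
    \int[qslab s t m n]_w (bump (0 : R) ^+ 2).
  have := qslab_total s t m n; rewrite /slab => <-.
  exact: (esym (Rintegral_cst (qslab s t m n) measurableT _)).
set D := B * B + (Bb' * T + Bg' * Z) * (B * B).
apply: (ae_Rint_dominated (g := fun=> D)).
- exact: mg.
- exact: measurable_cst.
- apply: ae_all => w.
  have cb := smooth_continuous (@bump_smooth R); have cr := smooth_continuous (@ramp_smooth R).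
  have cb' := smooth_continuous (smooth_derive (@bump_smooth R)).
  have cr' := smooth_continuous (smooth_derive (@ramp_smooth R)).
  have ew : (fun k => g k w) = _ := funext (fun k =>
    rho_xi_wide k (f w.2) (f' w.2) w.1.1 w.1.2).
  rewrite ew {ew}.
  have -> : bump 0 ^+ 2 = bump 0 * derive1 ramp 0 -
      f' w.2 w.1.2 * (derive1 bump 0 * ramp 0) :> R.
    by rewrite derive1_ramp0 /ramp mul0r !mulr0 subr0 expr2.
  apply: cvgB; first by apply: cvgM; exact: cvg_scaled.
  by apply: cvgM; [exact: cvg_cst|apply: cvgM; exact: cvg_scaled].
- exact: (L1_finite (qslab s t m n) (f := fun=> D) (measurable_cst _) (fun=> lexx `|D|)).
apply: ae_all => w k; rewrite /g rho_xi_wide.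
apply: le_trans (ler_normB _ _) _.
have [h1 _ _ _] := hB (k.+1%:R^-1 * (w.1.1 - (0 + f w.2 w.1.2))).
have [_ h2 _ _] := hB (k.+1%:R^-1 * (w.1.1 - (0 + f w.2 w.1.2))).
have [_ _ h3 h4] := hB (k.+1%:R^-1 * (w.1.2 - 0)).
have nM (x y X Y : R) : `|x| <= X -> `|y| <= Y -> `|x * y| <= X * Y.
  by move=> h h'; rewrite normrM ler_pM.
apply: lerD; first exact: nM h1 h4.
apply: (nM _ _ _ _ _ (nM _ _ _ _ h2 h3)).
exact: (fc'_bound s_ge0 lt_st t_leT b'_le g'_le z_le).
Qed.

(** The kinetic formulation determines the total defect mass, though the
    splitting into entropy and parabolic parts may differ: test functions with
    [xi]-derivative close to a constant compute it from the solution alone. *)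
Lemma total_mass_unique (m n m' n' : {finite_measure set (R * R * R)%type -> \bar R}) :
  kinetic_formulation T b sigma gamma z u m n ->
  kinetic_formulation T b sigma gamma z u m' n' ->
  measure_add m n ([set: R * R] `*` `[s, t]%classic) =
  measure_add m' n' ([set: R * R] `*` `[s, t]%classic).
Proof.
move=> k1 k2.
have E k : \int[measure_add m n]_(q in [set: R * R] `*` `[s, t]%classic)
      test_xi b gamma z (wide_test k) q.1.2 q.2 q.1.1 0 0 =
    \int[measure_add m' n']_(q in [set: R * R] `*` `[s, t]%classic)
      test_xi b gamma z (wide_test k) q.1.2 q.2 q.1.1 0 0.
  have [sb sr] := @smooth_wide R k.
  have vb := @vanishes_off_scaled R _ 1 k (@bump_vanishes R).
  have vr := @vanishes_off_scaled R _ k.+1%:R k (@ramp_vanishes R).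
  have tC := tensor_Cc_infty sb sr vb vr.
  by rewrite -(k1 _ tC 0 0 s t s_ge0 (ltW lt_st) t_leT) -(k2 _ tC 0 0 s t s_ge0 (ltW lt_st) t_leT).
have l1 := @total_mass_limit m n; have l2 := @total_mass_limit m' n'.
have /funext e := E; rewrite e in l1.
have /(_ _ _)/= := cvg_unique _ l1 l2 => /(_ (@Rhausdorff R)).
have b0 : bump (0 : R) ^+ 2 != 0.
  by rewrite expf_neq0// gt_eqF// bump_gt0// normr0.
move=> /(mulfI b0) h.
have f1 := slab_fin s t m n; have f2 := slab_fin s t m' n'.
have g (a c : \bar R) : (0 <= a -> a < +oo -> 0 <= c -> c < +oo -> fine a = fine c -> a = c)%E.
  by move=> a0 a1 c0 c1 e'; rewrite -(fineK (x := a)) ?ge0_fin_numE// e' fineK// ge0_fin_numE.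
exact: (g _ _ (measure_ge0 _ _) f1 (measure_ge0 _ _) f2 h).
Qed.

End mass_unique.

(** * Choice of the scale *)

Section scale.
Context {R : realType}.

(** The error of the comparison at scale [eps] is of order
    [eps + dz + dz / eps], which is smallest for [eps] of order [sqrt dz]. *)
Lemma best_scale (A B B' K1 K2 q Ds Dt dz C : R) :
  0 <= A -> 0 <= B -> 0 <= B' -> 0 <= K1 -> 0 <= K2 -> 0 <= q -> 0 <= dz ->
  (forall eps, 0 < eps ->
     Dt <= Ds + 8 * (eps * K1 + (eps + B * dz) * K2) + A / eps * (B' * dz * q)) ->
  C = 8 * (1 + B) * (K1 + K2) + A * B' * q ->
  Dt <= Ds + C * Num.sqrt dz + C * dz.
Proof.
move=> A0 B0 B'0 K10 K20 q0; rewrite (le_eqVlt 0 dz) => /predU1P[<-|dz0] H ->.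
  rewrite sqrtr0 !mulr0 !addr0; apply/ler_addgt0Pr => e e0.
  pose K := 8 * (K1 + K2) + 1.
  have K0 : 0 < K by rewrite ltr_pwDr// mulr_ge0// addr_ge0.
  have := H (e / K) (divr_gt0 e0 K0); rewrite !mulr0 mul0r mulr0 !addr0 => h.
  apply: le_trans h _; rewrite lerD2l -mulrDr mulrCA mulrAC ler_pdivrMr//.
  by rewrite ler_wpM2l ?(ltW e0)// lerDl.
have r0 : 0 < Num.sqrt dz by rewrite sqrtr_gt0.
have E : dz = Num.sqrt dz * Num.sqrt dz by rewrite -expr2 sqr_sqrtr// ltW.
move: (Num.sqrt dz) E r0 (H _ r0) => r -> r0 {H dz0}.
have -> : A / r * (B' * (r * r) * q) = A * B' * q * r.
  have rr : r^-1 * r = 1 by rewrite mulVf// gt_eqF.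
  transitivity (A * B' * q * r * (r^-1 * r)); last by rewrite rr mulr1.
  by ring.
move=> h; apply: le_trans h _; rewrite -subr_ge0.
rewrite [X in 0 <= X](_ : _ = r * (8 * B * (K1 + K2)) +
  (r * r) * (8 * (K1 + K2) + 8 * B * K1 + A * B' * q)); last by ring.
have rge := ltW r0.
by rewrite addr_ge0// mulr_ge0// ?addr_ge0// !mulr_ge0// addr_ge0.
Qed.

End scale.

Section signals.
Context {R : realType}.
Implicit Types z : R -> R.

Lemma C0_bounded T z : 0 <= T -> C0 T z ->
  exists Z, forall r, 0 <= r <= T -> `|z r| <= Z.
Proof.
move=> T0 [_ cz].
have [c1 _ h1] := EVT_max T0 cz.
have cNz : {within `[0, T], continuous (fun r => - z r)}.
  by move=> x; apply: cvgN; exact: cz.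
have [c2 _ h2] := EVT_max T0 cNz.
exists (Num.max (z c1) (- z c2)) => r hr; have rin : r \in `[0, T]%R by rewrite in_itv.
rewrite ler_norml le_max h1// andbT lerNl le_max (h2 r rin) orbT//.
Qed.

Lemma C0_measurable T z : C0 T z -> measurable_fun `[0, T]%classic z.
Proof.
by move=> [_ cz]; apply: subspace_continuous_measurable_fun => //; exact: measurable_itv.
Qed.

Lemma sup_norm_on_ge s t z M r : (forall r', s <= r' <= t -> `|z r'| <= M) ->
  s <= r <= t -> `|z r| <= sup_norm_on s t z.
Proof.
move=> zM hr; apply: ub_le_sup; last by exists r => //=; rewrite in_itv.
by exists M => _ [r' /= hr' <-]; apply: zM; move: hr'; rewrite in_itv.
Qed.

Lemma bounded_fun_le (f : R -> R) : bounded_fun f -> exists2 B, 0 <= B & forall x, `|f x| <= B.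
Proof.
move=> [M [_ hM]]; have MM : M < `|M| + 1 by rewrite ltr_pwDr// ler_norm.
exists (`|M| + 1) => [|x]; first by rewrite addr_ge0.
exact: (hM _ MM x I).
Qed.

Lemma bounded_C1_C1 (f : R -> R) : bounded_C1 f -> C1 f (derive1 f).
Proof.
move=> [df cf _ _]; split => // x; rewrite derive1E; exact/derivableP.
Qed.

End signals.

Section conclusion.
Context {R : realType}.
Local Notation leb := (@lebesgue_measure R).

(** Two solutions at finite distance at time [s] remain at finite distance. *)
Lemma dist_lty (p q p' q' : R -> R) : measurable_fun setT p -> measurable_fun setT q ->
  measurable_fun setT p' -> measurable_fun setT q' ->
  (\int[leb]_x `|p x - q x|%:E < +oo)%E -> (\int[leb]_x `|p x - p' x|%:E < +oo)%E ->
  (\int[leb]_x `|q x - q' x|%:E < +oo)%E -> (\int[leb]_x `|p' x - q' x|%:E < +oo)%E.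
Proof.
move=> mp mq mp' mq' h1 h2 h3.
have i1 : L1 leb (fun x => p x - q x) by apply: L1P => //; meas.
have i2 : L1 leb (fun x => p x - p' x) by apply: L1P => //; meas.
have i3 : L1 leb (fun x => q x - q' x) by apply: L1P => //; meas.
have i4 := L1D (L1B i1 i2) i3.
have e : (fun x => p' x - q' x) = (fun x => p x - q x - (p x - p' x) + (q x - q' x)).
  by apply/funext => x; ring.
have : L1 leb (fun x => p' x - q' x) by rewrite e.
by move=> /integrableP[_].
Qed.

Section comparison.
Variables (T : R) (b sigma gamma : R -> R) (s t : R).
Hypotheses (s_ge0 : 0 <= s) (lt_st : s < t) (t_leT : t <= T).
Variables (S Bb Bb' Bg Bg' Z A dz : R).
Hypotheses (msigma : measurable_fun setT sigma) (sigmaS : forall xi, `|sigma xi| <= S).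
Hypotheses (bC : C1 b (derive1 b)) (gammaC : C1 gamma (derive1 gamma)).
Hypotheses (b_le : forall xi, `|b xi| <= Bb) (b'_le : forall xi, `|derive1 b xi| <= Bb').
Hypotheses (g_le : forall xi, `|gamma xi| <= Bg) (g'_le : forall xi, `|derive1 gamma xi| <= Bg').
Hypothesis A0 : 0 <= A.
Hypothesis mollA : forall e : R, 0 < e ->
  exists2 phi, mollifier e phi & \int[leb]_x `|derive1 phi x| <= A / e.
Variables (z1 z2 : R -> R) (u1 u2 v1 v2 : R -> R -> R).
Variables (m1 n1 m2 n2 : {finite_measure set (R * R * R)%type -> \bar R}).
Hypotheses (mz1 : measurable_fun `[0, T]%classic z1) (mz2 : measurable_fun `[0, T]%classic z2).
Hypotheses (z1_le : forall r, 0 <= r <= T -> `|z1 r| <= Z) (z2_le : forall r, 0 <= r <= T -> `|z2 r| <= Z).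
Hypothesis dzP : forall r, s <= r <= t -> `|z1 r - z2 r| <= dz.
Hypotheses (mu1 : measurable_fun (strip T) (fun q : R * R => u1 q.1 q.2))
  (mu2 : measurable_fun (strip T) (fun q : R * R => u2 q.1 q.2)).
Hypotheses (v1L2 : Lp_strip 2%:E T v1) (v2L2 : Lp_strip 2%:E T v2).
Hypotheses (u1L1 : L1_continuous T u1) (u2L1 : L1_continuous T u2).
Hypotheses (chain1 : chain_rule T b sigma gamma z1 u1 v1) (chain2 : chain_rule T b sigma gamma z2 u2 v2).
Hypotheses (par1 : parabolic_measure T u1 v1 n1) (par2 : parabolic_measure T u2 v2 n2).
Hypotheses (kin1 : kinetic_formulation T b sigma gamma z1 u1 m1 n1)
  (kin2 : kinetic_formulation T b sigma gamma z2 u2 m2 n2).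
Hypotheses (BV1 : (LinftyBV_norm 0 T u1 < +oo)%E) (BV2 : (LinftyBV_norm 0 T u2 < +oo)%E).

Let X := solution_kinetic s_ge0 lt_st t_leT msigma sigmaS bC gammaC b_le b'_le g_le g'_le
  mz1 z1_le mu1 v1L2 u1L1 chain1 par1 kin1 BV1.
Let Y := solution_kinetic s_ge0 lt_st t_leT msigma sigmaS bC gammaC b_le b'_le g_le g'_le
  mz2 z2_le mu2 v2L2 u2L1 chain2 par2 kin2 BV2.

Let mass (m n : {finite_measure set (R * R * R)%type -> \bar R}) := fine (measure_add m n ([set: R * R] `*` `[s, t]%classic)).

Let char_gap (h g : R) r G : `|g| <= G -> s <= r <= t ->
  `|h * clamp T r + g * z1 (clamp T r) - (h * clamp T r + g * z2 (clamp T r))| <= G * dz.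
Proof.
move=> gG hr; rewrite (clamp_id (window_sub s_ge0 t_leT hr)).
rewrite opprD addrACA subrr add0r -mulrBr normrM ler_pM//; exact: dzP.
Qed.

(** The two solutions are turned into kinetic solutions on the same window; their
    characteristics differ only through the signals. *)
Lemma comparison_of_solutions (C : R) :
  C = 8 * (1 + Bg) * (fine (LinftyBV_norm s t u1) + 1 + (fine (LinftyBV_norm s t u2) + 1)) +
      A * Bg' * (mass m1 n1 + mass m2 n2) ->
  (\int[leb]_x `|u1 t x - u2 t x|%:E
   <= \int[leb]_x `|u1 s x - u2 s x|%:E + (C * Num.sqrt dz)%:E + (C * dz)%:E)%E.
Proof.
move=> CE.
have T0 : 0 <= T by rewrite (le_trans s_ge0)// (le_trans (ltW lt_st)).
have ss : s <= s <= t by rewrite lexx ltW.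
have tt : s <= t <= t by rewrite lexx ltW.
have cs := clamp_id (window_sub s_ge0 t_leT ss).
have ct := clamp_id (window_sub s_ge0 t_leT tt).
have Bg0 : 0 <= Bg by exact: le_trans (g_le 0).
have Bg'0 : 0 <= Bg' by exact: le_trans (g'_le 0).
have Bb0 : 0 <= Bb by exact: le_trans (b_le 0).
have Z0 : 0 <= Z by exact: le_trans (z1_le (window_sub s_ge0 t_leT ss)).
have dz0 : 0 <= dz by exact: le_trans (dzP ss).
pose D r := (\int[leb]_x `|u1 r x - u2 r x|%:E)%E.
have D0 r : (0 <= D r)%E by apply: integral_ge0 => x _; rewrite lee_fin.
rewrite -/(D t) -/(D s).
have [Dsoo|Dsfin] := leP +oo%E (D s).
  have -> : D s = +oo%E by apply/eqP; rewrite -leye_eq.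
  by rewrite !addye// leey.
have mX r := measurable_slice r (ku_meas X).
have mY r := measurable_slice r (ku_meas Y).
have eX r : clamp T r = r -> ku X r = u1 r by rewrite /X /= /uc => ->.
have eY r : clamp T r = r -> ku Y r = u2 r by rewrite /Y /= /uc => ->.
have Dtfin : (D t < +oo)%E.
  have hX := ku_st X; have hY := ku_st Y.
  have := dist_lty (mX s) (mY s) (mX t) (mY t).
  move: hX hY; rewrite !eX ?eY// => hX hY; exact.
have hs : (\int[leb]_x `|ku X s x - ku Y s x|%:E = (fine (D s))%:E)%E.
  by rewrite eX// eY// fineK// ge0_fin_numE.
have ht : (\int[leb]_x `|ku X t x - ku Y t x|%:E = (fine (D t))%:E)%E.
  by rewrite eX// eY// fineK// ge0_fin_numE.
have F0 : 0 <= Bb * T + Bg * Z by rewrite addr_ge0// mulr_ge0.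
have hH r xi : s <= r <= t -> `|kf Y r xi - kf X r xi| <= Bg * dz.
  by rewrite distrC; exact: char_gap (g_le xi).
have hH' r xi : s <= r <= t -> `|kf' X r xi - kf' Y r xi| <= Bg' * dz.
  exact: char_gap (g'_le xi).
have K0 u : 0 <= fine (LinftyBV_norm s t u) + 1.
  by rewrite addr_ge0// fine_ge0// Lnorm_ge0.
have q0 m n : 0 <= mass m n by rewrite fine_ge0.
have eQ m n : \int[qslab s t m n]_w (Bg' * dz) = Bg' * dz * mass m n.
  apply: etrans (Rintegral_cst (qslab s t m n) measurableT _) _.
  by congr (_ * fine _); exact: qslab_total.
have main := @best_scale R A Bg Bg' _ _ _ (fine (D s)) (fine (D t)) dz C A0 Bg0 Bg'0
  (K0 u1) (K0 u2) (addr_ge0 (q0 m1 n1) (q0 m2 n2)) dz0.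
rewrite -(fineK (x := D s)) ?ge0_fin_numE// -(fineK (x := D t)) ?ge0_fin_numE//.
rewrite -!EFinD lee_fin; apply: main CE => eps eps0.
have := comparison_at_scale msigma sigmaS (ltW lt_st) (ae_window_in s t) F0 eps0 hH hH' hs ht
  (mollA eps0).
have -> : (\int[kq X]_w (Bg' * dz)) + \int[kq Y]_w (Bg' * dz) =
    Bg' * dz * (mass m1 n1 + mass m2 n2).
  by rewrite mulrDr; congr (_ + _); exact: eQ.
by [].
Qed.

End comparison.
End conclusion.

Theorem proposition1p8 (R : realType) (T : R) (b sigma gamma : R -> R)
    (T_gt0 : 0 < T)
    (sigma_meas : measurable_fun setT sigma)
    (sigma_gt0 : forall xi, 0 < sigma xi)
    (sigma_bounded : bounded_fun sigma)
    (b_C1 : bounded_C1 b)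
    (gamma_gt0 : forall xi, 0 < gamma xi)
    (gamma_C1 : bounded_C1 gamma)
    (s t : R) (s_ge0 : 0 <= s) (le_st : s <= t) (t_leT : t <= T) :
  exists C : \bar R -> \bar R -> \bar R -> \bar R -> R,
  forall (z1 z2 u01 u02 : R -> R) (u1 u2 v1 v2 : R -> R -> R)
    (m1 n1 m2 n2 : {finite_measure set (R * R * R)%type -> \bar R}),
    C0 T z1 -> C0 T z2 ->
    BV u01 -> BV u02 ->
    LinftyBV T u1 -> LinftyBV T u2 ->
    pathwise_entropy_solution T b sigma gamma z1 u01 u1 ->
    pathwise_entropy_solution T b sigma gamma z2 u02 u2 ->
    is_S_x T sigma u1 v1 -> is_S_x T sigma u2 v2 ->
    entropy_measures T b sigma gamma z1 u1 v1 m1 n1 ->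
    entropy_measures T b sigma gamma z2 u2 v2 m2 n2 ->
    let c := C (LinftyBV_norm s t u1) (LinftyBV_norm s t u2)
               (measure_add m1 n1 ([set: R * R] `*` `[s, t]))
               (measure_add m2 n2 ([set: R * R] `*` `[s, t])) in
    let dz := sup_norm_on s t (z1 \- z2) in
    (\int[lebesgue_measure]_x `|u1 t x - u2 t x|%:E
     <= \int[lebesgue_measure]_x `|u1 s x - u2 s x|%:E
        + (c * dz `^ 2^-1)%:E + (c * dz)%:E)%E.
Proof.
have [S _ sigmaS] := bounded_fun_le sigma_bounded.
have bC := bounded_C1_C1 b_C1; have gC := bounded_C1_C1 gamma_C1.
have [Bb Bb0 b_le] : exists2 B : R, 0 <= B & forall x, `|b x| <= B.
  by case: b_C1 => _ _ + _; exact: bounded_fun_le.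
have [Bb' _ b'_le] : exists2 B : R, 0 <= B & forall x, `|derive1 b x| <= B.
  by case: b_C1 => _ _ _; exact: bounded_fun_le.
have [Bg Bg0 g_le] : exists2 B : R, 0 <= B & forall x, `|gamma x| <= B.
  by case: gamma_C1 => _ _ + _; exact: bounded_fun_le.
have [Bg' Bg'0 g'_le] : exists2 B : R, 0 <= B & forall x, `|derive1 gamma x| <= B.
  by case: gamma_C1 => _ _ _; exact: bounded_fun_le.
have [A A0 moll] := @exists_mollifiers R.
have mollA e : 0 < e -> exists2 phi, mollifier e phi &
    \int[lebesgue_measure]_x `|derive1 phi x| <= A / e.
  by move=> e0; have [phi [h1 _ h2]] := moll e e0; exists phi.
exists (fun N1 N2 Q1 Q2 => 8 * (1 + Bg) * (fine N1 + 1 + (fine N2 + 1)) +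
  A * Bg' * (fine Q1 + fine Q2)).
move=> z1 z2 u01 u02 u1 u2 v1 v2 m1 n1 m2 n2 z1C z2C _ _ [[mu1 _] _ BV1] [[mu2 _] _ BV2].
move=> [_ _ u1L1 _ [w1 [[w1L2 _] chain1 [p1 [q1 [_ par1 kin1]]]]]].
move=> [_ _ u2L1 _ [w2 [[w2L2 _] chain2 [p2 [q2 [_ par2 kin2]]]]]] _ _.
move=> [_ _ kin1'] [_ _ kin2']; cbv zeta.
set dz := sup_norm_on s t _; set c := 8 * (1 + Bg) * _ + _.
have [Z1 z1_le] := C0_bounded (ltW T_gt0) z1C.
have [Z2 z2_le] := C0_bounded (ltW T_gt0) z2C.
have dzP r : s <= r <= t -> `|z1 r - z2 r| <= dz.
  apply: (@sup_norm_on_ge _ s t (z1 \- z2) (Z1 + Z2)) => r' hr'.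
  have := window_sub s_ge0 t_leT hr' => h.
  by apply: le_trans (ler_normB _ _) _; rewrite lerD ?z1_le ?z2_le.
have dz0 : 0 <= dz by apply: le_trans (dzP s _) => //; rewrite lexx le_st.
have c0 : 0 <= c.
  have K0 u : 0 <= fine (LinftyBV_norm s t u) + 1 by rewrite addr_ge0// fine_ge0// Lnorm_ge0.
  rewrite /c addr_ge0//; apply: mulr_ge0.
  - by rewrite mulr_ge0// addr_ge0.
  - by rewrite addr_ge0.
  - by rewrite mulr_ge0// ltW.
  - by rewrite addr_ge0// fine_ge0.
rewrite powR12_sqrt//.
have := le_st; rewrite le_eqVlt => /predU1P[st|lt_st].
  rewrite -st -addeA leeDl// -EFinD lee_fin addr_ge0// mulr_ge0//.
have mz1 := C0_measurable z1C; have mz2 := C0_measurable z2C.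
have z1_leZ r : 0 <= r <= T -> `|z1 r| <= Num.max Z1 Z2.
  by move=> h; rewrite le_max z1_le.
have z2_leZ r : 0 <= r <= T -> `|z2 r| <= Num.max Z1 Z2.
  by move=> h; rewrite le_max z2_le// orbT.
apply: (comparison_of_solutions s_ge0 lt_st t_leT sigma_meas sigmaS bC gC b_le b'_le
  g_le g'_le (ltW A0) mollA mz1 mz2 z1_leZ z2_leZ dzP mu1 mu2 w1L2 w2L2 u1L1 u2L1
  chain1 chain2 par1 par2 kin1 kin2 BV1 BV2).
rewrite /c; congr (_ + _ * (fine _ + fine _)).
- exact: (total_mass_unique s_ge0 lt_st t_leT bC gC b'_le g'_le mz1 z1_leZ kin1' kin1).
- exact: (total_mass_unique s_ge0 lt_st t_leT bC gC b'_le g'_le mz2 z2_leZ kin2' kin2).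
Qed.
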